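(* Let $\alpha\in[0,d)$ and let $f$ be an SGF on $\mathbb{R}^d$ or $\mathbb{Z}^d$ with spectral measure $\mu$. Suppose that (1) $\displaystyle\lim_{\delta\to0}\frac{\log\mu[B(\delta)]}{\log\delta}=\alpha$; (2) $\mu_{a.c.}\neq0$ and $\mu_{s.c.}=0$; (3) for every $\epsilon>0$, $\mathrm{Cap}_f(B(T+T^{1-\epsilon}))\sim\mathrm{Cap}_f(B(T))$ as $T\to\infty$; (4) there is $c>0$ such that $\mu[B(2\delta)]\le c\,\mu[B(\delta)]$ for all $\delta>0$; (5) there is $c>0$ such that $\sup_u\mu[u+B(\delta)]\le c\,\mu[B(\delta)]$ for all $\delta>0$. Let $m=\|\mu_{a.c.}\|$. Then for every $\delta\in(0,d-\alpha)$, as $T\to\infty$, $$\mathbb{P}\Big[\frac{1}{\mathrm{Vol}(B(T))}\int_{B(T)}f(x)\,dx\ge\sqrt{2m(d-\alpha-\delta)\log T}\ \Big|\ f(x)\ge0\text{ for all }x\in B(T)\Big]\to1.$$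
   Context: An SGF on $\mathbb{R}^d$ or $\mathbb{Z}^d$ is a continuous (in the case of $\mathbb{R}^d$), centred, non-degenerate, stationary Gaussian field $f$. Its covariance kernel is $K(x)=\mathbb{E}[f(0)f(x)]$; its spectral measure $\mu$ is the unique non-negative, finite, symmetric measure with $K=\mathcal{F}[\mu]$, where $\mathcal{F}[\mu](x)=\int e^{-2\pi i\langle\lambda,x\rangle}d\mu(\lambda)$. It lives on $\mathbb{R}^d$ for fields on $\mathbb{R}^d$, and on the torus $\mathbb{R}^d/\mathbb{Z}^d$ for fields on $\mathbb{Z}^d$. Write $\mu=\mu_{a.c.}+\mu_d+\mu_{s.c.}$ for the decomposition into absolutely continuous, discrete, and singular continuous parts, and $\|\cdot\|$ for total mass. $B(r)$ is the closed Euclidean ball of radius $r$ about the origin, and $\mathrm{Vol}$ is Lebesgue volume on $\mathbb{R}^d$; for fields on $\mathbb{Z}^d$, a spatial domain $B(T)$ is understood as $B(T)\cap\mathbb{Z}^d$ and the integral over $B(T)$ as a sum over $B(T)\cap\mathbb{Z}^d$. Capacity: for compact $D$, $$\mathrm{Cap}_f(D)=\Big(\min_{\nu\in\mathcal{P}(D)}\int_D\int_DK(x-y)\,d\nu(x)\,d\nu(y)\Big)^{-1}\in(0,\infty],$$ where $\mathcal{P}(D)$ is the set of Borel probability measures on $D$. $a(T)\sim b(T)$ means $a(T)/b(T)\to1$. *)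

(* Defs.v *)
From HB Require Import structures.
From mathcomp Require Import all_boot all_order all_algebra.
From mathcomp Require Import generic_quotient complex.
From mathcomp Require Import all_classical all_reals all_analysis.
From mathcomp Require Import measurable_realfun.

Set Implicit Arguments.
Unset Strict Implicit.
Unset Printing Implicit Defensive.

Import Order.TTheory GRing.Theory Num.Theory.
Import numFieldNormedType.Exports.

Local Open Scope classical_set_scope.
Local Open Scope ring_scope.

Definition borel (T : ptopologicalType) : measurableType _ :=
  g_sigma_algebraType (@open T).

Section lebesgue_tuple.
Variable R : realType.

Section step.
Variables (n : nat) (m : {sigma_finite_measure set (n.-tuple R) -> \bar R}).

Definition tuple_cons (p : R * n.-tuple R) : n.+1.-tuple R :=
  [tuple of p.1 :: p.2].

Let mtuple_cons : measurable_fun setT tuple_cons.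
Proof. exact: measurable_cons. Qed.

Definition lebesgue_cons : set (n.+1.-tuple R) -> \bar R :=
  pushforward (@lebesgue_measure R \x m)%E tuple_cons.

Let lebesgue_cons0 : lebesgue_cons set0 = 0%E.
Proof. by rewrite /lebesgue_cons /pushforward preimage_set0 measure0. Qed.

Let lebesgue_cons_ge0 A : (0 <= lebesgue_cons A)%E.
Proof. exact: measure_ge0. Qed.

Let lebesgue_cons_sigma_additive : semi_sigma_additive lebesgue_cons.
Proof.
move=> F mF tF mUF; rewrite /lebesgue_cons /pushforward preimage_bigcup.
apply: measure_semi_sigma_additive.
- by move=> n0; rewrite -[X in measurable X]setTI; exact: mtuple_cons.
- apply/trivIsetP => /= i j _ _ ij; rewrite -preimage_setI.
  by move/trivIsetP : tF => /(_ _ _ _ _ ij) ->//; rewrite preimage_set0.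
- by rewrite -preimage_bigcup -[X in measurable X]setTI; exact: mtuple_cons.
Qed.

HB.instance Definition _ := isMeasure.Build _ _ _ lebesgue_cons
  lebesgue_cons0 lebesgue_cons_ge0 lebesgue_cons_sigma_additive.

Let lebesgue_cons_sigma_finite : sigma_finite setT lebesgue_cons.
Proof.
have [F UF Foo] : sigma_finite setT (@lebesgue_measure R \x m)%E.
  have /sigma_finiteP[A [UA ndA Aoo]] := sigma_finiteT (@lebesgue_measure R).
  have /sigma_finiteP[B [UB ndB Boo]] := sigma_finiteT m.
  exists (fun k => A k `*` B k).
    rewrite -setXTT UA UB predeqE => -[x y]; split; last first.
      by move=> [k _ []/= ? ?]; split; exists k.
    move=> [/= [k _ Akx] [l _ Bly]]; exists (maxn k l) => //; split.
    - by move: x Akx; exact/subsetPset/ndA/leq_maxl.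
    - by move: y Bly; exact/subsetPset/ndB/leq_maxr.
  move=> k; have [? ?] := Aoo k; have [? ?] := Boo k.
  split; first exact: measurableX.
  by rewrite product_measure1E// lte_mul_pinfty// ge0_fin_numE.
pose g (t : n.+1.-tuple R) : R * n.-tuple R := (thead t, [tuple of behead t]).
have mg : measurable_fun setT g.
  apply: measurable_fun_pair; last exact: measurable_behead.
  exact: (measurable_tnth ord0).
exists (fun k => g @^-1` F k).
  by rewrite -preimage_bigcup -UF preimage_setT.
move=> k; have [mFk Fkoo] := Foo k; split.
  by rewrite -[X in measurable X]setTI; exact: mg.
rewrite /lebesgue_cons /pushforward -comp_preimage.
suff -> : g \o tuple_cons = id by [].
by apply/funext => -[x t] /=; rewrite /g /=; congr pair; exact/val_inj.
Qed.

HB.instance Definition _ := Measure_isSigmaFinite.Build _ _ _ lebesgue_cons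
  lebesgue_cons_sigma_finite.

End step.

(* the n-fold product of the one-dimensional Lebesgue measure *)
Fixpoint lebesgue_tuple n : {sigma_finite_measure set (n.-tuple R) -> \bar R} :=
  if n is n'.+1 then lebesgue_cons (lebesgue_tuple n') else \d_[tuple].

End lebesgue_tuple.

Section lebesgue.
Variables (R : realType) (d : nat).

Definition row_of_tuple (t : d.-tuple R) : borel 'rV[R]_d :=
  \row_i tnth t i.

Let mrow_of_tuple : measurable_fun setT row_of_tuple.
Proof.
refine (@measurability _ _ _ (borel 'rV[R]_d) setT row_of_tuple (@open 'rV[R]_d) erefl _).
move=> _ [U oU <-]; rewrite setTI.
pose box (p : 'rV[rat]_d * nat) : set 'rV[R]_d :=
  [set x | forall i, ball (ratr (p.1 ord0 i) : R) p.2.+1%:R^-1 (x ord0 i)].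
pose F p : set (d.-tuple R) :=
  [set t | box p `<=` U /\ box p (row_of_tuple t)].
suff -> : row_of_tuple @^-1` U = \bigcup_p F p.
  apply: countable_bigcupT_measurable; first exact: countableP.
  move=> p; have [pU|pU] := pselect (box p `<=` U); last first.
    by rewrite (_ : F p = set0)// -subset0 => t [].
  rewrite (_ : F p = \bigcap_(i in [set: 'I_d])
      ((fun t => tnth t i) @^-1` ball (ratr (p.1 ord0 i) : R) p.2.+1%:R^-1)).
    apply: fin_bigcap_measurable => // i _.
    rewrite -[X in measurable X]setTI; apply: measurable_tnth => //.
    exact: measurable_ball.
  apply/seteqP; split=> [t [_ pt] i _|t tp]; first by have := pt i; rewrite mxE.
  by split=> // i; rewrite mxE; exact: tp.
apply/seteqP; split=> [t Ut|t [p _ [pU]]]; last exact: pU.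
have /nbhs_ballP[e /= e0 eU] : nbhs (row_of_tuple t : 'rV[R]_d) U.
  exact: open_nbhs_nbhs.
have [k ke] : exists k, k.+1%:R^-1 < e / 2.
  have e2 : 0 < e / 2 by rewrite divr_gt0.
  exists (Num.truncn (e / 2)^-1); rewrite -[ltRHS]invrK ltf_pV2 ?posrE ?invr_gt0//.
  exact: truncnS_gt.
have k0 : 0 < k.+1%:R^-1 :> R by [].
have /choice[q qt] : forall i, exists r : rat,
    ball (tnth t i) k.+1%:R^-1 (ratr r : R).
  move=> i; have /rat_in_itvoo[r] : tnth t i - k.+1%:R^-1 < tnth t i + k.+1%:R^-1.
    by rewrite ltrBlDr -addrA ltrDl addr_gt0.
  rewrite in_itv/= => rt; exists r.
  by rewrite -ball_normE /= distrC ltr_distl.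
exists (\row_i q i, k) => //; split => [x xb|i]; last first.
  by rewrite !mxE; apply: ball_sym; exact: qt.
apply: eU; split=> // i j; rewrite (ord1 i) (splitr e).
apply: (le_ball (ltW _)); last first.
  apply: ball_triangle; last by apply: (xb j).
  by rewrite /= !mxE; exact: qt.
exact: ltrD.
Qed.

Definition lebesgue : set (borel 'rV[R]_d) -> \bar R :=
  pushforward (@lebesgue_tuple R d) row_of_tuple.

Let lebesgue0 : lebesgue set0 = 0%E.
Proof. by rewrite /lebesgue /pushforward preimage_set0 measure0. Qed.

Let lebesgue_ge0 A : (0 <= lebesgue A)%E.
Proof. exact: measure_ge0. Qed.

Let lebesgue_sigma_additive : semi_sigma_additive lebesgue.
Proof.
move=> F mF tF mUF; rewrite /lebesgue /pushforward preimage_bigcup.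
apply: measure_semi_sigma_additive.
- by move=> n0; rewrite -[X in measurable X]setTI; exact: mrow_of_tuple.
- apply/trivIsetP => /= i j _ _ ij; rewrite -preimage_setI.
  by move/trivIsetP : tF => /(_ _ _ _ _ ij) ->//; rewrite preimage_set0.
- by rewrite -preimage_bigcup -[X in measurable X]setTI; exact: mrow_of_tuple.
Qed.

HB.instance Definition _ := isMeasure.Build _ _ _ lebesgue
  lebesgue0 lebesgue_ge0 lebesgue_sigma_additive.

End lebesgue.

Section euclidean.
Variables (R : realType) (d : nat).
Implicit Types x y : 'rV[R]_d.

Definition dotp x y : R := \sum_(i < d) x ord0 i * y ord0 i.

Definition eball (r : R) : set 'rV[R]_d := [set x | Num.sqrt (dotp x x) <= r].

Definition of_int (n : 'rV[int]_d) : 'rV[R]_d := map_mx intr n.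

Definition lattice_ball (r : R) : set 'rV[int]_d := of_int @^-1` eball r.

End euclidean.

(* Z^d carries the discrete sigma-algebra; the point is only required by
   measurableType *)
HB.instance Definition _ := isPointed.Build int 0.

Definition discrete (T : pointedType) : measurableType _ :=
  g_sigma_algebraType [set: set T].

Definition translate (V : zmodType) (u : V) (A : set V) : set V :=
  [set u + v | v in A].

Section torus.
Variables (R : realType) (d : nat).

Definition int_lattice (x : 'rV[R]_d) : bool :=
  [forall i, x ord0 i \is a Num.int].

Fact int_lattice_zmod_closed : zmod_closed int_lattice.
Proof.
split=> [|x y /forallP Lx /forallP Ly]; apply/forallP => i.
  by rewrite !mxE rpred0.
by rewrite !mxE rpredB.
Qed.

HB.instance Definition _ :=
  GRing.isZmodClosed.Build 'rV[R]_d int_lattice int_lattice_zmod_closed.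

Definition torus : Type :=
  Quotient.quot (GRing.ZmodClosed.clone 'rV[R]_d int_lattice _).

HB.instance Definition _ := GRing.Zmodule.on torus.
HB.instance Definition _ := Quotient.on torus.
HB.instance Definition _ := isPointed.Build torus 0.

Definition to_torus (x : 'rV[R]_d) : torus := (\pi_torus)%qT x.

Let torus_open (U : set torus) : Prop := open (to_torus @^-1` U).

Let torus_openT : torus_open setT.
Proof. by rewrite /torus_open preimage_setT; exact: openT. Qed.

Let torus_openI : setI_closed torus_open.
Proof. by move=> A B; exact: openI. Qed.

Let torus_open_bigU (I : Type) (U : I -> set torus) :
  (forall i, torus_open (U i)) -> torus_open (\bigcup_i U i).
Proof.
by move=> oU; rewrite /torus_open preimage_bigcup; apply: bigcup_open => i _;
  exact: oU.
Qed.

(* the quotient topology; quotient_topology itself carries another choiceType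
   structure than the one underlying the zmodType torus *)
HB.instance Definition _ :=
  isOpenTopological.Build torus torus_openT torus_openI torus_open_bigU.

Definition torus_ball (r : R) : set torus := to_torus @` @eball R d r.

(* the image of Lebesgue measure on the fundamental domain [0, 1)^d *)
Definition lebesgue_torus (A : set (borel torus)) : \bar R :=
  lebesgue ([set x : 'rV[R]_d | forall i, 0 <= x ord0 i < 1] `&`
            to_torus @^-1` A).

(* defined modulo 1, because n is an integer vector *)
Definition torus_dotp (l : torus) (n : 'rV[int]_d) : R :=
  dotp (repr l) (of_int R n).

End torus.

Section gaussian_field.
Context {disp : measure_display} {Omega : measurableType disp} {R : realType}.
Variable P : probability Omega R.

(* the case s = 0 is separate because normal_prob m 0 is not the Dirac mass *)
Definition gaussian (X : Omega -> R) : Prop :=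
  exists m s : R, forall A : set R, measurable A ->
    P (X @^-1` A) = if s == 0 then \d_m A else normal_prob m s A.

Variable (I : zmodType).
Implicit Type f : I -> {RV P >-> R}.

(* Sample-path continuity, relevant on R^d only, is not part of the record.
   Non-degenerate means that f 0 is not almost surely zero. *)
Record stationary_gaussian_field f : Prop := {
  sgf_gaussian : forall n (x : 'I_n -> I) (a : 'I_n -> R),
    gaussian (fun w => \sum_(i < n) a i * f (x i) w) ;
  sgf_centred : forall x, ('E_P[f x] = 0)%E ;
  sgf_stationary : forall n (x : 'I_n -> I) (h : I) (A : set (n.-tuple R)),
    measurable A ->
    P [set w | A [tuple f (x i + h) w | i < n]] =
    P [set w | A [tuple f (x i) w | i < n]] ;
  sgf_nondegenerate : (0 < 'E_P[f 0%R \* f 0%R])%E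
}.

Definition covariance_kernel f (x : I) : R := fine ('E_P[f 0%R \* f x])%E.

Definition cond_prob (A B : set Omega) : R := fine (P (A `&` B)) / fine (P B).

End gaussian_field.

(* the case of a vanishing minimum is covered by 0^-1 = +oo in \bar R *)
Definition capacity {disp : measure_display} {T : measurableType disp}
    {R : realType} (k : T -> T -> R) (D : set T) : \bar R :=
  ((ereal_inf [set \int[nu]_(x in D) \int[nu]_(y in D) (k x y)%:E |
               nu in [set nu : probability T R | nu D = 1]])^-1)%E.

(* theta l is the pairing <l, x> at a fixed x *)
Definition fourier {disp : measure_display} {S : measurableType disp}
    {R : realType} (mu : {finite_measure set S -> \bar R}) (theta : S -> R)
    : R[i] :=
  Complex (\int[mu]_l cos (2 * pi * theta l))
          (- \int[mu]_l sin (2 * pi * theta l)).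

Section field_capacity.
Context {disp : measure_display} {Omega : measurableType disp} {R : realType}.
Variables (P : probability Omega R) (d : nat).

Definition field_capacity (f : 'rV[R]_d -> {RV P >-> R}) (D : set 'rV[R]_d) :
    \bar R :=
  @capacity _ (borel 'rV[R]_d) R
    (fun x y : 'rV[R]_d => covariance_kernel f (x - y)) D.

Definition lattice_field_capacity (f : 'rV[int]_d -> {RV P >-> R})
    (D : set 'rV[int]_d) : \bar R :=
  @capacity _ (discrete 'rV[int]_d) R
    (fun x y : 'rV[int]_d => covariance_kernel f (x - y)) D.

End field_capacity.

Section spectral_measure.
Context {disp : measure_display} {Omega : measurableType disp} {R : realType}.
Variables (P : probability Omega R) (d : nat).

Definition spectral_measure (f : 'rV[R]_d -> {RV P >-> R})
    (mu : {finite_measure set (borel 'rV[R]_d) -> \bar R}) : Prop :=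
  (forall A : set (borel 'rV[R]_d), measurable A ->
     mu ((fun l : 'rV[R]_d => - l) @` A) = mu A) /\
  (forall x, ((covariance_kernel f x)%:C)%C = fourier mu (fun l => dotp l x)).

Definition torus_spectral_measure (f : 'rV[int]_d -> {RV P >-> R})
    (mu : {finite_measure set (borel (torus R d)) -> \bar R}) : Prop :=
  (forall A : set (borel (torus R d)), measurable A ->
     mu ((fun l : torus R d => - l) @` A) = mu A) /\
  (forall n, ((covariance_kernel f n)%:C)%C =
             fourier mu (fun l => torus_dotp l n)).

End spectral_measure.

Definition spectral_decomposition {disp : measure_display}
    {S : measurableType disp} {R : realType} (leb : set S -> \bar R)
    (mu mu_ac mu_d mu_sc : {finite_measure set S -> \bar R}) : Prop :=
  [/\ forall A, measurable A -> mu A = (mu_ac A + mu_d A + mu_sc A)%E,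
      mu_ac `<< leb,
      exists C, [/\ measurable C, countable C & mu_d (~` C) = 0%E],
      forall x, mu_sc [set x] = 0%E &
      exists N, [/\ measurable N, leb N = 0%E & mu_sc (~` N) = 0%E]].

(* Main.v *)
(* Write B for B(T) and l for the level sqrt(2 m (d - alpha - delta) log T); it
   suffices that P(f >= 0 on B, mean < l) is negligible before P(f >= 0 on B).

   Lower bound on P(f >= 0 on B).  The restriction of mu to the frequencies of
   size at most c / T contributes a rank-one matrix u u^T, with all u_j of order
   at least mu(B(c / T))^(1/2), which the covariance matrix S of any finite
   family of points of B dominates.  So f is distributed as X' + Z u with Z
   standard normal independent of X' and |X'| at most T^eps with high
   probability (union bound, and Fernique's inequality on R^d); a value of Z of
   order T^(alpha / 2 + 2 eps) then makes f positive, whence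
   P(f >= 0 on B) >= exp(- T^(alpha + delta / 4)) for large T.

   Upper bound on P(f >= 0 on B, mean < l).  The density of mu_ac is close in
   L^1 to a step function on dyadic cubes of side 2^-n, and on each such cube
   the characters of 2^n Z^d are orthogonal.  Hence, on every translate of the
   grid 2^n Z^d, f plus an independent field of small variance dominates an
   i.i.d. Gaussian family of variance close to m.  For this family a Chernoff
   bound shows that being positive with empirical mean at most l costs
   exp(- c T^(alpha + delta / 2)), and by Markov's inequality a positive
   proportion of the translates of the grid has a mean not much larger than
   that of f over B. *)
Require Import Defs.
From HB Require Import structures.
From mathcomp Require Import all_boot all_order all_algebra.
From mathcomp Require Import all_classical all_reals all_analysis.
From mathcomp Require Import finmap measurable_realfun ring lra.
From mathcomp Require generic_quotient.

Set Implicit Arguments.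
Unset Strict Implicit.
Unset Printing Implicit Defensive.

Import Order.TTheory GRing.Theory Num.Theory.
Import numFieldNormedType.Exports.

Local Open Scope classical_set_scope.
Local Open Scope ring_scope.

Import HBNNSimple.

(** The values of the field are dependent, and both bounds get independence from an inequality
    between quadratic forms: when one covariance matrix dominates another, the Gaussian vector
    splits in law into two independent summands. The dominated matrix has rank one for the lower
    bound and is a multiple of the identity for the upper bound.

    The level [l] is the one at which a Gaussian density of variance [m] is about
    [T ^ -(d - alpha - delta)]. Among about [T ^ d] independent points of mean at most [l], about
    [T ^ (alpha + delta)] would fall below zero, and the absence of such points costs an exponential
    of that order. Between the exponents [alpha + delta / 4] and [alpha + delta / 2] of the two
    bounds there is room for every constant; the rest of [delta] pays for the losses in variance and
    level.

    Laws are compared only on intersections of half-spaces, starting from characteristic functions.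
    The spectral measure on the torus is carried over to [[0, 1) ^ d], so that both kinds of fields
    are handled through an index group with an additive map [iota] into [R ^ d]. *)

Section integration.
Context d (T : measurableType d) (R : realType).

(** A simple function is a finite sum of its values times the indicators of its level sets, and the
    induction runs over the list of values. Signs and measurability are handed to each step because
    [Q] will speak of integrals. *)
Lemma nnsfun_induction (Q : (T -> R) -> Prop) :
  Q (cst 0) -> (forall A, measurable A -> Q \1_A) ->
  (forall (c : R) (f : T -> R), 0 <= c -> (forall x, 0 <= f x) -> measurable_fun setT f ->
    Q f -> Q (fun x => c * f x)) ->
  (forall f g : T -> R, (forall x, 0 <= f x) -> (forall x, 0 <= g x) ->
    measurable_fun setT f -> measurable_fun setT g ->
    Q f -> Q g -> Q (fun x => f x + g x)) ->
  forall h : {nnsfun T >-> R}, Q h.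
Proof.
move=> Q0 Q1 QZ QD h.
have -> : (h : T -> R) = (fun x => \sum_(y <- finmap.enum_fset (fset_set (range h))) y * \1_(h @^-1` [set y]) x).
  by apply/funext => x; rewrite fimfunE fsbig_finite.
have : forall y, y \in finmap.enum_fset (fset_set (range h)) -> 0 <= y.
  by move=> y; rewrite -[y \in _]/(y \in fset_set (range h)) in_fset_set// => /set_mem[x _ <-].
elim: (finmap.enum_fset (fset_set (range h))) => [_|y s IH ys].
  by under eq_fun do rewrite big_nil.
have y0 : 0 <= y by apply: ys; rewrite inE eqxx.
have s0 : forall z, z \in s -> 0 <= z by move=> z zs; apply: ys; rewrite inE zs orbT.
have mi z : measurable_fun setT (\1_(h @^-1` [set z]) : T -> R).
  by apply: measurable_indic; exact: measurable_sfunP.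
under eq_fun do rewrite big_cons.
apply: QD.
- by move=> x; rewrite mulr_ge0.
- by move=> x; rewrite big_seq sumr_ge0// => z zs; rewrite mulr_ge0// s0.
- exact: measurable_funM.
- by apply: measurable_sum => z; exact: measurable_funM.
- by apply: QZ => //; apply: Q1; exact: measurable_sfunP.
- exact: IH.
Qed.

Lemma ge0_integral_density (mu nu : {measure set T -> \bar R}) (k : T -> R) :
  measurable_fun setT k -> (forall x, 0 <= k x) ->
  (forall A, measurable A -> nu A = \int[mu]_(x in A) (k x)%:E)%E ->
  forall f : T -> \bar R, measurable_fun setT f -> (forall x, 0 <= f x)%E ->
  (\int[nu]_x f x = \int[mu]_x (f x * (k x)%:E))%E.
Proof.
move=> mk k0 nuE f mf f0.
have simple (h : {nnsfun T >-> R}) : (\int[nu]_x (h x)%:E = \int[mu]_x ((h x)%:E * (k x)%:E))%E.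
  apply: (@nnsfun_induction (fun h => \int[nu]_x (h x)%:E = \int[mu]_x ((h x)%:E * (k x)%:E))%E).
  - by under [RHS]eq_integral do rewrite mul0e; rewrite !integral0.
  - move=> A mA; rewrite integral_indic// setIT nuE//.
    rewrite [LHS]integral_mkcond; apply: eq_integral => x _.
    by rewrite patchE indicE; case: (x \in A); rewrite ?mul1e ?mul0e.
  - move=> c g c0 g0 mg Qg.
    under eq_integral do rewrite EFinM.
    rewrite ge0_integralZl//; last 2 first.
    + exact/measurable_EFinP.
    + by move=> x _; rewrite lee_fin.
    rewrite Qg -ge0_integralZl//; last 2 first.
    + by under eq_fun do rewrite -EFinM; exact/measurable_EFinP/measurable_funM.
    + by move=> x _; rewrite mule_ge0 ?lee_fin.
    by apply: eq_integral => x _; rewrite EFinM muleA.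
  - move=> g1 g2 g10 g20 mg1 mg2 Qg1 Qg2.
    under eq_integral do rewrite EFinD.
    rewrite ge0_integralD//; last 4 first.
    + by move=> x _; rewrite lee_fin.
    + exact/measurable_EFinP.
    + by move=> x _; rewrite lee_fin.
    + exact/measurable_EFinP.
    rewrite Qg1 Qg2 -ge0_integralD//; last 4 first.
    + by move=> x _; rewrite mule_ge0 ?lee_fin.
    + by under eq_fun do rewrite -EFinM; exact/measurable_EFinP/measurable_funM.
    + by move=> x _; rewrite mule_ge0 ?lee_fin.
    + by under eq_fun do rewrite -EFinM; exact/measurable_EFinP/measurable_funM.
    by apply: eq_integral => x _; rewrite EFinD ge0_muleDl ?lee_fin.
pose h n := nnsfun_approx measurableT mf n.
have cf x : (EFin \o h ^~ x) @ \oo --> f x by exact: cvg_nnsfun_approx.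
have ndf x n m : (n <= m)%N -> h n x <= h m x.
  by move=> nm; exact/lefP/nd_nnsfun_approx.
transitivity (limn (fun n => \int[nu]_x (h n x)%:E))%E.
  rewrite -monotone_convergence//.
  - by apply: eq_integral => x _; apply/esym/cvg_lim => //; exact: cf.
  - by move=> n; apply/measurable_EFinP; exact: measurable_funPT.
  - by move=> n x _; rewrite lee_fin.
  - by move=> x _ n m nm; rewrite lee_fin ndf.
under eq_fun do rewrite simple.
rewrite -monotone_convergence//.
- apply: eq_integral => x _; apply/cvg_lim => //.
  by apply: cvgeZr => //; exact: cf.
- move=> n; apply: emeasurable_funM; apply/measurable_EFinP => //.
- by move=> n x _; rewrite mule_ge0 ?lee_fin.
- by move=> x _ n m nm; rewrite lee_wpmul2r ?lee_fin ?ndf.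
Qed.

Lemma bounded_integrable (mu : {finite_measure set T -> \bar R}) (f : T -> R) M :
  measurable_fun setT f -> (forall x, `|f x| <= M) ->
  mu.-integrable setT (EFin \o f).
Proof.
move=> mf fM; apply: measurable_bounded_integrable => //.
  exact: fin_num_fun_lty.
exists M; split; first exact: num_real.
by move=> x Mx y _ /=; rewrite (le_trans (fM y))// ltW.
Qed.

Lemma Rintegral_dominated (mu : {finite_measure set T -> \bar R})
    (f_ : nat -> T -> R) (f : T -> R) M :
  (forall n, measurable_fun setT (f_ n)) ->
  (forall n x, `|f_ n x| <= M) ->
  (forall x, f_ n x @[n --> \oo] --> f x) ->
  \int[mu]_x f_ n x @[n --> \oo] --> \int[mu]_x f x.
Proof.
move=> mf fM cf; apply: fine_cvg.
rewrite fineK; last first.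
  apply: integrable_fin_num => //; apply: (@bounded_integrable _ _ M).
    by apply: measurable_fun_cvg => // x _; exact: cf.
  move=> x; have /cvg_norm/cvg_lim <- := cf x => //.
  apply: limr_le; last by apply: nearW => n; exact: fM.
  by apply/cvg_ex; exists `|f x|; apply: cvg_norm; exact: cf.
apply: (@dominated_cvg _ _ _ _ _ _ _ _ (cst M%:E)) => //.
- by move=> n; exact/measurable_EFinP.
- by move=> x _; apply: cvg_EFin; [exact: nearW|exact: cf].
- by apply: (@bounded_integrable _ (cst M) `|M|).
- by move=> n x _; rewrite lee_fin.
Qed.

End integration.

(** * One-dimensional Gaussian integrals *)

Section normal.
Variable R : realType.
Implicit Types (m s t b x : R).
Notation mu := (@lebesgue_measure R).

Lemma integral_normal_prob m s (f : R -> R) : measurable_fun setT f ->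
  (forall x, 0 <= f x) ->
  (\int[normal_prob m s]_x (f x)%:E = \int[mu]_x (f x * normal_pdf m s x)%:E)%E.
Proof.
move=> mf f0; rewrite (@ge0_integral_density _ _ _ mu _ (normal_pdf m s))//.
- exact: measurable_normal_pdf.
- by move=> x; exact: normal_pdf_ge0.
- exact/measurable_EFinP.
Qed.

Lemma normal_pdf_neq0E m s x : s != 0 ->
  normal_pdf m s x = normal_peak s * expR (- (x - m) ^+ 2 / (s ^+ 2 *+ 2)).
Proof. by move=> s0; rewrite /normal_pdf (negPf s0). Qed.

Lemma is_derive_normal_pdf m s x : s != 0 ->
  is_derive x 1 (normal_pdf m s) (- (x - m) / s ^+ 2 * normal_pdf m s x).
Proof.
move=> s0; have -> : normal_pdf m s = (fun x => normal_peak s * expR (- (x - m) ^+ 2 / (s ^+ 2 *+ 2))).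
  by apply/funext => y; rewrite normal_pdf_neq0E.
apply: is_derive_eq.
by rewrite /GRing.scale/=; field.
Qed.

(** Completing the square in the exponent: an exponentially tilted Gaussian density is a translated
    one. *)
Lemma normal_pdf_shift m s t x : s != 0 ->
  expR (t * x) * normal_pdf m s x =
  expR (t * m + s ^+ 2 * t ^+ 2 / 2) * normal_pdf (m + s ^+ 2 * t) s x.
Proof.
move=> s0; rewrite !normal_pdf_neq0E// !mulrA.
rewrite ![_ * normal_peak s]mulrC -!mulrA; congr (_ * _).
rewrite -!expRD; congr expR; field.
by rewrite s0.
Qed.

Lemma normal_mgf s t : s != 0 ->
  (\int[normal_prob 0 s]_x (expR (t * x))%:E = (expR (s ^+ 2 * t ^+ 2 / 2))%:E)%E.
Proof.
move=> s0; rewrite -[X in expR X]add0r -[X in X + _](mulr0 t) integral_normal_prob//; last first.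
  by apply: measurableT_comp => //; exact: measurable_funM.
under eq_integral do rewrite normal_pdf_shift// EFinM.
rewrite ge0_integralZl//.
- by rewrite integral_normal_pdf mule1.
- by apply/measurable_EFinP; exact: measurable_normal_pdf.
- by move=> x _; rewrite lee_fin normal_pdf_ge0.
Qed.

(** The density decreases on [[u, u + 1]], an interval of length one, so its value at the right end
    bounds the integral from below. *)
Lemma normal_prob_gt s u : s != 0 -> 0 <= u ->
  ((normal_pdf 0 s (u + 1))%:E <= normal_prob 0 s `]u, +oo[)%E.
Proof.
move=> s0 u0.
rewrite (@le_trans _ _ (\int[mu]_(x in `]u, (u + 1)%R[) (normal_pdf 0 s x)%:E)%E)//; last first.
  apply: ge0_subset_integral => //.
  - by apply/measurable_EFinP; apply: measurable_funTS; exact: measurable_normal_pdf.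
  - by move=> x _; rewrite lee_fin normal_pdf_ge0.
  - by move=> x /=; rewrite !in_itv/= andbT => /andP[].
rewrite (@le_trans _ _ (\int[mu]_(x in `]u, (u + 1)%R[) (normal_pdf 0 s (u + 1))%:E)%E)//.
  by rewrite integral_cst//= lebesgue_measure_itv/= lte_fin ltrDl ltr01 -EFinD addrAC subrr add0r mule1 lexx.
apply: ge0_le_integral => //.
- by move=> x _; rewrite lee_fin normal_pdf_ge0.
- by apply/measurable_EFinP; apply: measurable_funTS; exact: measurable_normal_pdf.
- move=> x /=; rewrite in_itv/= => /andP[ux xu]; rewrite lee_fin.
  rewrite !normal_pdf_neq0E// ler_wpM2l ?normal_peak_ge0//.
  rewrite ler_expR !subr0 !mulNr lerN2 ler_wpM2r ?invr_ge0 ?mulrn_wge0 ?sqr_ge0//.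
  by rewrite lerXn2r ?nnegrE; lra.
Qed.

Lemma integrable_normal_prob m s (f : R -> R) : measurable_fun setT f ->
  mu.-integrable setT (fun x => (f x * normal_pdf m s x)%:E) ->
  (normal_prob m s).-integrable setT (EFin \o f).
Proof.
move=> mf /integrableP[_ fi]; apply/integrableP; split; first exact/measurable_EFinP.
rewrite [ltLHS](_ : _ = \int[normal_prob m s]_x (`|f x|)%:E)%E//.
rewrite integral_normal_prob//; last exact: measurableT_comp.
apply: le_lt_trans fi; rewrite le_eqVlt; apply/orP; left; apply/eqP.
by apply: eq_integral => x _ /=; rewrite normrM (ger0_norm (normal_pdf_ge0 _ _ _)).
Qed.

Lemma Rintegral_normal_prob m s (f : R -> R) : measurable_fun setT f ->
  mu.-integrable setT (fun x => (f x * normal_pdf m s x)%:E) ->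
  \int[normal_prob m s]_x f x = \int[mu]_x (f x * normal_pdf m s x).
Proof.
move=> mf fi; have fn := integrable_normal_prob mf fi.
rewrite /Rintegral; congr fine.
rewrite integralE [in RHS]integralE funerpos funerneg.
have mp : measurable_fun setT f^\+ by exact: measurable_funrpos.
have mn : measurable_fun setT f^\- by exact: measurable_funrneg.
rewrite !integral_normal_prob//; congr (_ - _)%E; apply: eq_integral => x _.
  by rewrite /= funeposE -EFin_max; congr EFin; rewrite /funrpos maxr_pMl ?normal_pdf_ge0// mul0r.
by rewrite /= funenegE -EFinN -EFin_max; congr EFin; rewrite /funrneg maxr_pMl ?normal_pdf_ge0// mul0r mulNr.
Qed.

(* Stein's identity: the integrand is the derivative of [- s^2 g phi]. *)
Lemma normal_stein m s (g g' : R -> R) : s != 0 ->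
  (forall x, is_derive x 1 g (g' x)) -> continuous g' ->
  mu.-integrable setT (fun x => (((x - m) * g x - s ^+ 2 * g' x) * normal_pdf m s x)%:E) ->
  g n%:R * normal_pdf m s n%:R @[n --> \oo] --> 0 ->
  g (- n%:R) * normal_pdf m s (- n%:R) @[n --> \oo] --> 0 ->
  \int[mu]_x (((x - m) * g x - s ^+ 2 * g' x) * normal_pdf m s x) = 0.
Proof.
move=> s0 dg cg' intg cy cNy.
pose h x := ((x - m) * g x - s ^+ 2 * g' x) * normal_pdf m s x.
pose H x := - s ^+ 2 * (g x * normal_pdf m s x).
have dH x : is_derive x 1 H (h x).
  have dp := is_derive_normal_pdf m x s0.
  apply: is_derive_eq.
  rewrite /h /GRing.scale/=; field.
  by rewrite s0.
have cg : continuous g by move=> x; apply/differentiable_continuous/derivable1_diffP; exact: ex_derive.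
have ch : continuous h.
  move=> x; apply: cvgM; last exact: continuous_normal_pdf.
  apply: cvgB; first by apply: cvgM; [apply: cvgB; [exact: cvg_id|exact: cvg_cst]|exact: cg].
  by apply: cvgM; [exact: cvg_cst|exact: cg'].
(* On a bounded interval the integral is a boundary term. The bound [n.+1] rather than [n] keeps the
   interval nondegenerate, as the fundamental theorem requires. *)
have ftc n : (\int[mu]_(x in `[(- n.+1%:R)%R, n.+1%:R%R]) (h x)%:E = (H n.+1%:R - H (- n.+1%:R))%:E)%E.
  rewrite (@continuous_FTC2 _ h H)//.
  - by have : (0:R) < n.+1%:R by []; lra.
  - by apply: continuous_subspaceT; exact: ch.
  - have cH : continuous H by move=> x; apply/differentiable_continuous/derivable1_diffP; exact: ex_derive.
    split; [|exact/cvg_at_right_filter/cH|exact/cvg_at_left_filter/cH].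
    by move=> x _; exact: ex_derive.
  - by move=> x _; rewrite derive1E; exact: derive_val.
have lim1 : (\int[mu]_(x in `[(- n.+1%:R)%R, n.+1%:R%R]) (h x)%:E)%E @[n --> \oo] --> (\int[mu]_x (h x)%:E)%E.
  under eq_fun do rewrite integral_mkcond.
  apply: (@dominated_cvg _ _ R mu setT measurableT _ _ (abse \o (EFin \o h))) => //.
  - move=> n; apply/(measurable_restrictT _ _).1 => //; apply: measurable_funTS.
    by apply/measurable_EFinP; exact: continuous_measurable_fun.
  - move=> x _; apply: cvg_near_cst; near=> n.
    rewrite patchE mem_set//= in_itv/= -ler_norml.
    near: n; exists (Num.truncn `|x|).+1 => // n /= nx.
    by rewrite ltW// (lt_le_trans (truncnS_gt _))// ler_nat (leq_trans nx).
  - exact: (integrable_abse intg).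
  - by move=> n x _; rewrite patchE; case: ifP => _ //=; rewrite normr0 lee_fin.
have lim2 : (H n.+1%:R - H (- n.+1%:R))%:E @[n --> \oo] --> 0%E.
  apply: cvg_EFin; first exact: nearW.
  rewrite -[0](subrr (- s ^+ 2 * 0)); apply: cvgB.
    by rewrite (cvg_shiftS (fun n => H n%:R)); apply: cvgMr.
  by rewrite (cvg_shiftS (fun n => H (- n%:R))); apply: cvgMr.
rewrite /Rintegral; have -> : (\int[mu]_x (h x)%:E = 0)%E; last by [].
apply: cvg_unique lim1 _ => //.
by apply: cvg_trans lim2; apply: near_eq_cvg; apply: nearW => n; rewrite ftc.
Unshelve. all: by end_near. Qed.

Lemma integrable_exp_normal m s t : s != 0 ->
  mu.-integrable setT (fun x => (expR (t * x) * normal_pdf m s x)%:E).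
Proof.
move=> s0; under eq_fun do rewrite normal_pdf_shift// EFinM.
by apply: integrableZl => //; exact: integrable_normal_pdf.
Qed.

(** For nonnegative [x], square [1 + x / 2 <= expR (x / 2)]. Quadratic growth is thereby dominated
    by exponentials, whose Gaussian integrability comes from tilting. *)
Lemma sqr_le_exp x : x ^+ 2 <= 4 * (expR x + expR (- x)).
Proof.
wlog x0 : x / 0 <= x => [H|].
  have [|x0] := leP 0 x; first exact: H.
  by have := H (- x); rewrite sqrrN opprK addrC; apply; lra.
have h := @expR_ge1Dx R (x / 2).
have : (1 + x / 2) ^+ 2 <= expR x.
  rewrite [X in _ <= expR X](_ : x = x / 2 + x / 2); last lra.
  by rewrite expRD -expr2 lerXn2r ?nnegrE ?expR_ge0//; lra.
have := expR_gt0 (- x); have -> : (1 + x / 2) ^+ 2 = 1 + x + x ^+ 2 / 4 by field.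
have : 0 <= x ^+ 2 by exact: sqr_ge0.
have := expR_gt0 x.
lra.
Qed.

Lemma integrable_poly_normal m s (f : R -> R) (C : R) : s != 0 -> measurable_fun setT f ->
  (forall x, `|f x| <= C * (1 + x ^+ 2)) ->
  mu.-integrable setT (fun x => (f x * normal_pdf m s x)%:E).
Proof.
move=> s0 mf fC.
have mp : measurable_fun setT (normal_pdf m s) by exact: measurable_normal_pdf.
have C0 : 0 <= C by have := fC 0; rewrite expr2 mulr0 addr0 mulr1; exact: le_trans.
pose k x := C * (expR (0 * x) * normal_pdf m s x +
   4 * (expR (1 * x) * normal_pdf m s x + expR (-1 * x) * normal_pdf m s x)).
have K : mu.-integrable setT (EFin \o k).
  have -> : EFin \o k = (fun x => (C%:E * ((expR (0 * x) * normal_pdf m s x)%:E +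
    (4%:E * ((expR (1 * x) * normal_pdf m s x)%:E + (expR (-1 * x) * normal_pdf m s x)%:E))))%E).
    by apply/funext => x; rewrite /= /k -!EFinD -!EFinM.
  apply: integrableZl => //; apply: integrableD => //; first exact: integrable_exp_normal.
  by apply: integrableZl => //; apply: integrableD => //; exact: integrable_exp_normal.
apply: le_integrable K => //.
  by apply/measurable_EFinP; exact: measurable_funM.
move=> x _; rewrite /= lee_fin /k.
rewrite mul0r expR0 mul1r mulN1r mul1r normrM (ger0_norm (normal_pdf_ge0 _ _ _)).
have -> : C * (normal_pdf m s x + 4 * (expR x * normal_pdf m s x + expR (- x) * normal_pdf m s x)) =
   C * (1 + 4 * (expR x + expR (- x))) * normal_pdf m s x by ring.
rewrite [leRHS]ger0_norm; last first.
  by rewrite !mulr_ge0// ?normal_pdf_ge0// addr_ge0// mulr_ge0// addr_ge0 ?expR_ge0.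
rewrite ler_wpM2r ?normal_pdf_ge0// (le_trans (fC x))// ler_wpM2l// lerD2l.
exact: sqr_le_exp.
Qed.

(** With [y = (x - m) ^ 2 / (2 s ^ 2)], one has [(1 + y) * expR (- y) <= 1], while [(1 + |x|) ^ 2]
    is at most affine in [y]. This makes the boundary terms of Stein's identity vanish for [g] of
    linear growth. *)
Lemma normal_pdf_decay m s : s != 0 ->
  exists2 C, 0 <= C & forall x, (1 + `|x|) * normal_pdf m s x <= C / (1 + `|x|).
Proof.
move=> s0; pose C := normal_peak s * (2 + 4 * m ^+ 2 + 4 * (s ^+ 2 *+ 2)).
have s20 : 0 < s ^+ 2 *+ 2 by rewrite pmulrn_lgt0// exprn_even_gt0.
have m20 : 0 <= m ^+ 2 by exact: sqr_ge0.
exists C; first by rewrite /C mulr_ge0 ?normal_peak_ge0//; lra.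
move=> x; rewrite ler_pdivlMr ?ltr_pwDl// normal_pdf_neq0E//.
set y := (x - m) ^+ 2 / (s ^+ 2 *+ 2).
have y0 : 0 <= y by rewrite divr_ge0 ?sqr_ge0// ltW.
have e : (1 + y) * expR (- y) <= 1.
  by rewrite expRN ler_pdivrMr ?expR_gt0// mul1r expR_ge1Dx.
have xy : (x - m) ^+ 2 = y * (s ^+ 2 *+ 2) by rewrite /y divfK// gt_eqF.
have x1 : (1 + `|x|) ^+ 2 <= 2 + 4 * m ^+ 2 + 4 * (s ^+ 2 *+ 2) * y.
  have h1 : (1 + `|x|) ^+ 2 <= 2 + 2 * x ^+ 2.
    by rewrite -[x ^+ 2]real_normK ?num_real//; have := sqr_ge0 (1 - `|x|); rewrite !expr2; nra.
  have h2 : x ^+ 2 <= 2 * (x - m) ^+ 2 + 2 * m ^+ 2 by have := sqr_ge0 (x - 2 * m); rewrite !expr2; nra.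
  by rewrite xy in h2; lra.
rewrite mulNr -/y.
have -> : (1 + `|x|) * (normal_peak s * expR (- y)) * (1 + `|x|) =
  normal_peak s * (expR (- y) * (1 + `|x|) ^+ 2) by ring.
rewrite /C ler_wpM2l ?normal_peak_ge0//.
rewrite (le_trans (ler_wpM2l (expR_ge0 _) x1))//.
have := expR_gt0 (- y); move: e; set E := expR (- y); set S := s ^+ 2 *+ 2 in s20 *.
set M := m ^+ 2 in m20 *. move=> e E0.
have e1 : E <= 1 by nra.
have e2 : y * E <= 1 by nra.
by nra.
Qed.

(** The sequence [u] stands for [n] and for [- n], the two boundary terms of Stein's identity. *)
Lemma cvg_normal_decay m s (g : R -> R) (C : R) (u : nat -> R) : s != 0 ->
  (forall x, `|g x| <= C * (1 + `|x|)) -> (forall n, `|u n| = n%:R) ->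
  g (u n) * normal_pdf m s (u n) @[n --> \oo] --> 0.
Proof.
move=> s0 gC un; have [D D0 pD] := normal_pdf_decay m s0.
have C0 : 0 <= C by have := gC 0; rewrite normr0 addr0 mulr1; exact: le_trans.
apply: norm_cvg0; apply: (@squeeze_cvgr _ _ _ _ (fun=> 0) (fun n => C * D * n.+1%:R^-1)).
- near=> n; rewrite normr_ge0/= normrM (ger0_norm (normal_pdf_ge0 _ _ _)).
  rewrite (le_trans (ler_wpM2r (normal_pdf_ge0 _ _ _) (gC _)))// -!mulrA ler_wpM2l//.
  by rewrite (le_trans (pD _))// un nat1r.
- exact: cvg_cst.
- by rewrite -[X in _ --> X](mulr0 (C * D)); apply: cvgMr; exact: cvg_harmonic.
Unshelve. all: by end_near. Qed.

Lemma normal_stein_bound m s (g g' : R -> R) C : s != 0 ->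
  (forall x, is_derive x 1 g (g' x)) -> continuous g' ->
  (forall x, `|g x| <= C * (1 + `|x|)) -> (forall x, `|g' x| <= C) ->
  \int[mu]_x (((x - m) * g x - s ^+ 2 * g' x) * normal_pdf m s x) = 0.
Proof.
move=> s0 dg cg' gC g'C.
have cg : continuous g by move=> x; apply/differentiable_continuous/derivable1_diffP; exact: ex_derive.
apply: normal_stein => //.
- have C0 : 0 <= C by rewrite (le_trans _ (g'C 0)).
  apply: (@integrable_poly_normal _ _ _ ((2 + 2 * `|m| + s ^+ 2) * C)) => //.
    apply: measurable_funB; apply: measurable_funM => //.
    + exact: measurable_funB.
    + exact: continuous_measurable_fun.
    + exact: continuous_measurable_fun.
  move=> x.
  have h1 : `|x - m| <= `|x| + `|m| by exact: ler_normB.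
  have h2 : `|x - m| * `|g x| <= (`|x| + `|m|) * (C * (1 + `|x|)) by apply: ler_pM.
  have h3 : `|s ^+ 2| * `|g' x| <= s ^+ 2 * C by rewrite ger0_norm ?sqr_ge0// ler_wpM2l ?sqr_ge0.
  rewrite (le_trans (ler_normB _ _))// [X in X + _ <= _]normrM [X in _ + X <= _]normrM.
  rewrite (le_trans (lerD h2 h3))//.
  have -> : (`|x| + `|m|) * (C * (1 + `|x|)) + s ^+ 2 * C = ((`|x| + `|m|) * (1 + `|x|) + s ^+ 2) * C by ring.
  rewrite [leRHS]mulrAC ler_wpM2r// -[x ^+ 2]real_normK ?num_real//.
  have := normr_ge0 x; have := normr_ge0 m; have := sqr_ge0 s.
  set a := `|x|; set b := `|m|; set c := s ^+ 2 => c0 b0 a0.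
  by have := sqr_ge0 (1 - a); rewrite !expr2; nra.
- by apply: (cvg_normal_decay _ s0 gC) => n; rewrite normr_nat.
- by apply: (cvg_normal_decay _ s0 gC) => n; rewrite normrN normr_nat.
Qed.

(** Stein's identity for [g = 1], whose integrand is [x - m] times the density. *)
Lemma normal_mean m s : s != 0 -> \int[normal_prob m s]_x x = m.
Proof.
move=> s0.
have intx : mu.-integrable setT (fun x => (x * normal_pdf m s x)%:E).
  apply: (@integrable_poly_normal _ _ id 1) => // x; rewrite mul1r.
  by rewrite -[x ^+ 2]real_normK ?num_real//; have := sqr_ge0 (1 - `|x|); rewrite !expr2; have := normr_ge0 x; nra.
have intp := integrable_normal_pdf m s.
rewrite (@Rintegral_normal_prob _ _ id)//.
have := @normal_stein_bound m s (cst 1) (cst 0) 1 s0.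
have -> : (fun x => ((x - m) * cst 1 x - s ^+ 2 * cst 0 x) * normal_pdf m s x) =
  (fun x => x * normal_pdf m s x - m * normal_pdf m s x).
  by apply/funext => x /=; ring.
rewrite RintegralB//; last first.
  exact: (integrableZl measurableT _ intp).
rewrite RintegralZl//.
have -> : \int[mu]_x normal_pdf m s x = 1 by rewrite /Rintegral integral_normal_pdf.
rewrite mulr1 => H; apply/eqP; rewrite -subr_eq0; apply/eqP; apply: H.
- by move=> x; exact: cvg_cst.
- by move=> x; rewrite normr1 mul1r lerDl.
- by move=> x; rewrite normr0.
Qed.

(** Stein's identity for [g = id], whose integrand is [x ^ 2 - s ^ 2] times the density. *)
Lemma normal_variance s : s != 0 -> \int[normal_prob 0 s]_x (x ^+ 2) = s ^+ 2.
Proof.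
move=> s0.
have intx : mu.-integrable setT (fun x => (x ^+ 2 * normal_pdf 0 s x)%:E).
  apply: (@integrable_poly_normal _ _ (fun x => x ^+ 2) 1) => //.
  by move=> x; rewrite mul1r ger0_norm ?sqr_ge0// lerDr.
have intp := integrable_normal_pdf 0 s.
rewrite (@Rintegral_normal_prob _ _ (fun x => x ^+ 2))//.
have := @normal_stein_bound 0 s id (cst 1) 1 s0.
have -> : (fun x => ((x - 0) * id x - s ^+ 2 * cst 1 x) * normal_pdf 0 s x) =
  (fun x => x ^+ 2 * normal_pdf 0 s x - s ^+ 2 * normal_pdf 0 s x).
  by apply/funext => x /=; ring.
rewrite RintegralB//; last first.
  exact: (integrableZl measurableT _ intp).
rewrite RintegralZl//.
have -> : \int[mu]_x normal_pdf 0 s x = 1 by rewrite /Rintegral integral_normal_pdf.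
rewrite mulr1 => H; apply/eqP; rewrite -subr_eq0; apply/eqP; apply: H.
- by move=> x; exact: cvg_cst.
- by move=> x; rewrite mul1r lerDr.
- by move=> x; rewrite normr1.
Qed.

Lemma measurable_cosM t b : measurable_fun setT (fun x => cos (t * x + b)).
Proof.
apply: continuous_measurable_fun => x; apply: continuous_comp; last exact: continuous_cos.
by apply: cvgD; [exact: mulrl_continuous|exact: cvg_cst].
Qed.

Lemma measurable_sinM t b : measurable_fun setT (fun x => sin (t * x + b)).
Proof.
apply: continuous_measurable_fun => x; apply: continuous_comp; last exact: continuous_sin.
by apply: cvgD; [exact: mulrl_continuous|exact: cvg_cst].
Qed.

(* The characteristic function [F] solves [F' = - s^2 t F] by Stein's identity. *)
Lemma normal_cos s t b : s != 0 ->
  \int[normal_prob 0 s]_x cos (t * x + b) = expR (- (s ^+ 2 * t ^+ 2) / 2) * cos b.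
Proof.
move=> s0.
have ic u : mu.-integrable setT (fun x => (cos (u * x + b) * normal_pdf 0 s x)%:E).
  apply: (@integrable_poly_normal _ _ _ 1) => //; first exact: measurable_cosM.
  by move=> x; rewrite mul1r (le_trans (cos_max _))// lerDl sqr_ge0.
rewrite (@Rintegral_normal_prob _ _ (fun x => cos (t * x + b)))//; last exact: measurable_cosM.
pose f u x := cos (u * x + b) * normal_pdf 0 s x.
pose F u := \int[mu]_x f u x.
have df (u x : R) : is_derive u (1 : R) (fun u : R => f u x) (- (x * sin (u * x + b)) * normal_pdf 0 s x).
  apply: is_derive_eq; rewrite /GRing.scale/=; ring.
have dF (u : R) : is_derive u (1 : R) F (- (s ^+ 2 * u) * F u).
  have d1f v x : partial1of2 f v x = - (x * sin (v * x + b)) * normal_pdf 0 s x.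
    by rewrite /partial1of2 derive1E; exact: derive_val.
  have I u' : `]u - 1, u + 1[%classic u' -> mu.-integrable setT (EFin \o f u') by move=> _; exact: ic.
  have Iu : `]u - 1, u + 1[%classic u by rewrite /= in_itv/=; apply/andP; split; lra.
  have der x y : `]u - 1, u + 1[%classic x -> setT y -> derivable (f ^~ y) x 1 by move=> _ _; exact: ex_derive.
  (* An integrable bound on the derivative in the parameter, uniform in the parameter. *)
  pose G x := `|x| * normal_pdf 0 s x.
  have G0 x : 0 <= G x by rewrite mulr_ge0 ?normal_pdf_ge0.
  have intG : mu.-integrable setT (EFin \o G).
    apply: (@integrable_poly_normal _ _ (fun x => `|x|) 1) => //.
    move=> x; rewrite mul1r normr_id -[x ^+ 2]real_normK ?num_real//.
    by have := sqr_ge0 (1 - `|x|); rewrite !expr2; have := normr_ge0 x; nra.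
  have Gub x y : `]u - 1, u + 1[%classic x -> setT y -> `|partial1of2 f x y| <= G y.
    move=> _ _; rewrite d1f /G normrM normrN normrM [X in _ * X <= _]ger0_norm ?normal_pdf_ge0//.
    by rewrite ler_wpM2r ?normal_pdf_ge0// ler_piMr// sin_max.
  apply: DeriveDef.
    exact: (derivable_under_integral measurableT Iu I der G0 intG Gub).
  rewrite -derive1E (differentiation_under_integral measurableT Iu I der G0 intG Gub).
  under eq_Rintegral do rewrite d1f.
  have st := @normal_stein_bound 0 s (fun x => sin (u * x + b)) (fun x => u * cos (u * x + b)) (1 + `|u|) s0.
  have is_ : mu.-integrable setT (fun x => (- (x * sin (u * x + b)) * normal_pdf 0 s x)%:E).
    apply: (@integrable_poly_normal _ _ _ 1) => //.
      by apply: measurable_funN; apply: measurable_funM => //; exact: measurable_sinM.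
    move=> x; rewrite normrN normrM mul1r -[x ^+ 2]real_normK ?num_real//.
    have := sin_max (u * x + b); have := normr_ge0 x; have := sqr_ge0 (1 - `|x|).
    by have := normr_ge0 (sin (u * x + b)); rewrite !expr2; nra.
  have : - (\int[mu]_x (((x - 0) * sin (u * x + b) - s ^+ 2 * (u * cos (u * x + b))) * normal_pdf 0 s x)) = 0.
    apply/eqP; rewrite oppr_eq0; apply/eqP; apply: st.
    - by move=> x; apply: is_derive_eq; rewrite /GRing.scale/=; ring.
    - move=> x; apply: cvgM; first exact: cvg_cst.
      apply: continuous_comp; last exact: continuous_cos.
      by apply: cvgD; [exact: mulrl_continuous|exact: cvg_cst].
    - move=> x; rewrite (le_trans (sin_max _))//; have := normr_ge0 u; have := normr_ge0 x; nra.
    - by move=> x; rewrite normrM; have := cos_max (u * x + b); have := normr_ge0 u; nra.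
  have -> : (fun x => ((x - 0) * sin (u * x + b) - s ^+ 2 * (u * cos (u * x + b))) * normal_pdf 0 s x) =
     (fun x => - (s ^+ 2 * u) * f u x - (- (x * sin (u * x + b)) * normal_pdf 0 s x)).
    by apply/funext => x; rewrite /f; ring.
  rewrite RintegralB//; last first.
    exact: (integrableZl measurableT _ (ic _)).
  rewrite RintegralZl//; last exact: ic.
  by rewrite -/(F u) => /eqP; rewrite oppr_eq0 subr_eq0 => /eqP.
(* The integrating factor of the equation [F' = - s ^ 2 u F]: the product has zero derivative. *)
pose H u := expR (s ^+ 2 * u ^+ 2 / 2) * F u.
have dH (u : R) : is_derive u (1 : R) H 0.
  apply: is_derive_eq; rewrite /GRing.scale/=; by field.
have := is_derive_0_is_cst t 0 dH.
have -> : H 0 = F 0 by rewrite /H expr0n/= mulr0 mul0r expR0 mul1r.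
have -> : F 0 = cos b.
  rewrite /F /f; under eq_Rintegral do rewrite mul0r add0r.
  by rewrite RintegralZl ?integrable_normal_pdf// /Rintegral integral_normal_pdf mulr1.
rewrite /H -[\int[mu]_x _]/(F t) => <-; rewrite mulrA -expRD mulNr addNr expR0 mul1r//.
Qed.

End normal.

Lemma measurable_lt_set d (T : measurableType d) (R : realType) (f g : T -> R) :
  measurable_fun setT f -> measurable_fun setT g -> measurable [set x | f x < g x].
Proof.
move=> mf mg; rewrite -[X in measurable X]setTI.
exact: (measurable_fun_ltr mf mg measurableT (Y := [set true])).
Qed.

(** * Gaussian laws of intersections of half-spaces *)

Section indicator_approximation.
Variable R : realType.
Implicit Types (x c y : R) (n N : nat).

Lemma ler_bernoulli y N : -1 <= y -> 1 + y *+ N <= (1 + y) ^+ N.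
Proof.
move=> y1; elim: N => [|N IH]; first by rewrite mulr0n addr0 expr0.
rewrite exprS mulrS; have h : 0 <= 1 + y by lra.
apply: (le_trans _ (ler_wpM2l h IH)).
have : 0 <= y *+ N * y by rewrite -mulr_natr mulrAC -expr2 mulr_ge0 ?sqr_ge0.
by set a := y *+ N => ay; rewrite [leRHS](_ : _ = 1 + (y + a) + a * y); [lra|ring].
Qed.

(** The polynomial [(1 - q ^ N) ^ (2 ^ N)] of the Brosowski-Deutsch proof of the Stone-Weierstrass
    theorem, at [q = 1/2 - x]. The size of [(2 q) ^ N] decides: as [N] grows the value tends to 1
    for [x > 0] and to 0 for [x < 0]. *)
Definition bump_approx N x : R := (1 - (2^-1 - x) ^+ N) ^+ (2 ^ N).

Lemma bump_approx_itv N x : - 2^-1 <= x <= 2^-1 -> 0 <= bump_approx N x <= 1.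
Proof.
move=> /andP[x0 x1].
have h0 : 0 <= (2^-1 - x) ^+ N by rewrite exprn_ge0//; lra.
have h1 : (2^-1 - x) ^+ N <= 1 by rewrite exprn_ile1//; lra.
by rewrite exprn_ge0 ?subr_ge0//= exprn_ile1 ?subr_ge0// lerBlDr lerDl.
Qed.

(** Bernoulli's inequality gives at least [1 - (1 - 2 x) ^ N]. Then [(1 - 2 x) (1 + 2 x) <= 1], and
    Bernoulli's inequality applies again to [(1 + 2 x) ^ N]. *)
Lemma bump_approx_gt N x : 0 <= x <= 2^-1 -> 1 - (1 + 2 * x *+ N)^-1 <= bump_approx N x.
Proof.
move=> /andP[x0 x1].
have h0 : 0 <= (2^-1 - x) ^+ N by rewrite exprn_ge0//; lra.
have h1 : (2^-1 - x) ^+ N <= 1 by rewrite exprn_ile1//; lra.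
have := @ler_bernoulli (- (2^-1 - x) ^+ N) (2 ^ N); rewrite lerN2 => /(_ h1).
apply: le_trans; rewrite lerD2l mulNrn lerN2 -[leLHS]mulr_natr natrX -exprMn.
have p0 : 0 < 1 + 2 * x *+ N by rewrite ltr_pwDl// mulrn_wge0// mulr_ge0.
rewrite -[leRHS]div1r ler_pdivlMr//.
have -> : (2^-1 - x) * 2 = 1 - 2 * x by rewrite mulrBl mulVf// mulrC.
apply: (@le_trans _ _ ((1 - 2 * x) ^+ N * (1 + 2 * x) ^+ N)).
  by rewrite ler_wpM2l ?exprn_ge0 ?subr_ge0//; [lra|apply: ler_bernoulli; lra].
rewrite -exprMn exprn_ile1//; first by rewrite mulr_ge0//; lra.
by rewrite -subr_sqr expr1n lerBlDr lerDl sqr_ge0.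
Qed.

(** Since [(1 - q) (1 + q) <= 1], it suffices to bound [(1 + q) ^ (2 ^ N)] from below. Bernoulli's
    inequality bounds it by [2 ^ N q], which is [(1 - 2 x) ^ N], and a second use makes this linear
    in [N]. *)
Lemma bump_approx_lt N x : - 2^-1 <= x <= 0 -> bump_approx N x <= (1 - 2 * x *+ N)^-1.
Proof.
move=> /andP[x0 x1].
set q := (2^-1 - x) ^+ N.
have h0 : 0 <= q by rewrite exprn_ge0//; lra.
have h1 : q <= 1 by rewrite exprn_ile1//; lra.
have p0 : 0 < 1 - 2 * x *+ N by rewrite -mulNrn -mulrN ltr_pwDl// mulrn_wge0// mulr_ge0//; lra.
rewrite -[leRHS]div1r ler_pdivlMr//.
apply: (@le_trans _ _ ((1 - q) ^+ (2 ^ N) * (1 + q) ^+ (2 ^ N))).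
  rewrite ler_wpM2l ?exprn_ge0 ?subr_ge0//.
  apply: (@le_trans _ _ (1 + q *+ (2 ^ N))); last by apply: ler_bernoulli; lra.
  rewrite -mulNrn -mulrN -[q *+ _]mulr_natr natrX -exprMn mulrBl mulVf//.
  have := @ler_bernoulli (- (x * 2)) N; rewrite (mulrC x) mulrN => H.
  rewrite (le_trans (H _)) ?lerDr//; lra.
rewrite -exprMn exprn_ile1//; first by rewrite mulr_ge0//; lra.
by rewrite -subr_sqr expr1n lerBlDr lerDl sqr_ge0.
Qed.

(* A trigonometric polynomial in [x]; it tends to the indicator of [x > c]. *)
Definition trig_step c n x : R :=
  bump_approx (n.+1 ^ 3) ((sin ((x - c) / n.+1%:R) - (n.+1 ^ 2)%:R^-1) / 4).

Lemma trig_step_itv c n x : 0 <= trig_step c n x <= 1.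
Proof.
apply: bump_approx_itv.
have := sin_max ((x - c) / n.+1%:R); rewrite ler_norml => /andP[h1 h2].
have h3 : (n.+1 ^ 2)%:R^-1 <= 1 :> R by rewrite invf_le1 ?ler1n ?ltr0n ?expn_gt0.
have h4 : 0 <= (n.+1 ^ 2)%:R^-1 :> R by rewrite invr_ge0.
by move: h1 h2 h3 h4; set r := (n.+1 ^ 2)%:R^-1; set q := sin _; lra.
Qed.

Lemma sin_ge_half : exists2 e : R, 0 < e & forall y, 0 <= y < e -> y / 2 <= sin y.
Proof.
have [e /= e0 H] : \forall y \near (0:R), 2^-1 <= cos y.
  have c0 : cos z @[z --> (0:R)] --> (cos 0 : R) by exact: continuous_cos.
  by apply: (cvgr_ge _ c0); rewrite cos0; lra.
exists e => // y /andP[y0 ye].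
have [->|yn0] := eqVneq y 0; first by rewrite sin0 mul0r.
have y0' : 0 < y by rewrite lt_neqAle eq_sym yn0.
have [z zy] := @MVT R sin cos 0 y y0' (fun x _ => is_derive_sin x)
  (continuous_subspaceT (@continuous_sin R)).
rewrite sin0 subr0 subr0 => ->; rewrite mulrC ler_wpM2r//.
by apply: H => /=; move: zy; rewrite in_itv/= => /andP[z0 zy]; rewrite sub0r normrN gtr0_norm// (lt_trans zy).
Qed.

(** For large [n] the argument of the sine is so small that the sine has its sign and at least half
    its size. The offset [(n + 1) ^ -2] is negligible before [(x - c) / (n + 1)] when [c < x], and
    makes the argument of the bump strictly negative when [x <= c], the case [x = c] included. The
    exponent [(n + 1) ^ 3] beats both orders of magnitude. *)
Lemma cvg_trig_step c x : trig_step c n x @[n --> \oo] --> ((c < x)%R%:R : R).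
Proof.
have inv0 (u : nat -> R) : (forall n, n.+1%:R <= u n) -> (u n)^-1 @[n --> \oo] --> 0.
  move=> hu; apply: (@squeeze_cvgr _ _ _ _ (fun=> 0) (fun n => n.+1%:R^-1)).
  - near=> n; have := hu n => hn; have n0 : 0 < n.+1%:R :> R by [].
    by rewrite invr_ge0 (le_trans (ltW n0))//= lef_pV2// posrE (lt_le_trans n0).
  - exact: cvg_cst.
  - exact: cvg_harmonic.
pose y n := (sin ((x - c) / n.+1%:R) - (n.+1 ^ 2)%:R^-1) / 4.
pose N n := (n.+1 ^ 3)%N.
have N0 n : 0 < n.+1%:R :> R by [].
have ylo n : - 2^-1 <= y n <= 2^-1.
  have := sin_max ((x - c) / n.+1%:R); rewrite ler_norml => /andP[h1 h2].
  have h3 : (n.+1 ^ 2)%:R^-1 <= 1 :> R by rewrite invf_le1 ?ler1n ?ltr0n ?expn_gt0.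
  have h4 : 0 <= (n.+1 ^ 2)%:R^-1 :> R by rewrite invr_ge0.
  by rewrite /y; move: h1 h2 h3 h4; set r := (n.+1 ^ 2)%:R^-1; set q := sin _; lra.
have [e e0 He] := sin_ge_half.
have small (a : R) : \forall n \near \oo, a <= n.+1%:R.
  exists (Num.truncn a).+1 => // n /= an.
  by rewrite ltW// (lt_le_trans (truncnS_gt _))// ler_nat (leq_trans an).
have [cx|xc] := ltP c x.
- pose b := x - c; have b0 : 0 < b by rewrite /b subr_gt0.
  have key : \forall n \near \oo, 1 - (1 + n.+1%:R)^-1 <= trig_step c n x.
    near=> n.
    have n1 : 1 <= n.+1%:R :> R by rewrite ler1n.
    have bn : 0 <= b / n.+1%:R < e.
      rewrite divr_ge0 ?(ltW b0)//= ltr_pdivrMr// -ltr_pdivrMl//.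
      by rewrite (@lt_le_trans _ _ (e^-1 * b + 1)) ?ltrDl//; near: n; exact: small.
    have /He sb := bn.
    have yge : b / n.+1%:R / 16 <= y n.
      have h1 : 4 / b <= n.+1%:R by near: n; exact: small.
      have h2 : (n.+1 ^ 2)%:R^-1 <= b / n.+1%:R / 4.
        have -> : b / n.+1%:R / 4 = n.+1%:R^-1 * (b / 4) by ring.
        rewrite natrX expr2 invfM ler_wpM2l ?invr_ge0//.
        by rewrite -[b / 4]invrK lef_pV2 ?posrE ?invr_gt0 ?divr_gt0// invf_div.
      have sb' : b / n.+1%:R / 2 <= sin (b / n.+1%:R) by [].
      rewrite /y -/b; move: h2 sb'; set r := (n.+1 ^ 2)%:R^-1; set q := sin _; set z := b / _; lra.
    have y0 : 0 <= y n <= 2^-1.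
      by rewrite (le_trans _ yge) ?(andP (ylo n)).2// !divr_ge0// ltW.
    apply: (le_trans _ (bump_approx_gt _ y0)).
    rewrite lerD2l lerN2 lef_pV2 ?posrE ?ltr_pwDl// ?mulrn_wge0 ?mulr_ge0 ?(andP y0).1//.
    rewrite lerD2l -[leRHS]mulr_natr /N natrX.
    have h3 : 8 / b <= n.+1%:R by near: n; exact: small.
    have h4 : 8 <= n.+1%:R * b by move: h3; rewrite ler_pdivrMr.
    have e1 : 2 * y n * n.+1%:R ^+ 3 = 2 * (y n * n.+1%:R) * n.+1%:R ^+ 2 by rewrite !exprS; ring.
    rewrite e1.
    have h5 : b / 16 <= y n * n.+1%:R.
      by move: yge; rewrite mulrAC ler_pdivrMr.
    move: h4 h5 n1; set K := n.+1%:R; set Y := y n * K => h4 h5 n1.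
    rewrite expr2; have : b / 8 * (K * K) <= 2 * Y * (K * K) by rewrite ler_wpM2r ?mulr_ge0//; lra.
    apply: le_trans; have -> : b / 8 * (K * K) = (K * b / 8) * K by field.
    by rewrite ler_peMl//; lra.
    by have := (andP y0).1; rewrite /y pmulr_lge0// invr_gt0.
  have cz : 1 - trig_step c n x @[n --> \oo] --> (0:R).
    apply: (@squeeze_cvgr _ _ _ _ (fun=> 0) (fun n => (1 + n.+1%:R)^-1)).
    + move: key; apply: filterS => k hk.
      by rewrite subr_ge0 (andP (trig_step_itv c k x)).2/= lerBlDr -lerBlDl.
    + exact: cvg_cst.
    + by apply: inv0 => n; rewrite lerDr.
  apply/cvgrPdist_le => r r0; move/cvgrPdist_le : cz => /(_ _ r0).
  by apply: filterS => k; rewrite sub0r normrN.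
- pose b := c - x; have b0 : 0 <= b by rewrite /b subr_ge0.
  have key : \forall n \near \oo, trig_step c n x <= (1 + n.+1%:R / 2)^-1.
    near=> n.
    have n1 : 1 <= n.+1%:R :> R by rewrite ler1n.
    have sb : sin ((x - c) / n.+1%:R) <= 0.
      have -> : (x - c) / n.+1%:R = - (b / n.+1%:R) by rewrite /b -mulNr opprB.
      rewrite sinN oppr_le0.
      have bn : 0 <= b / n.+1%:R < e.
        rewrite divr_ge0//= ltr_pdivrMr// -ltr_pdivrMl//.
        by rewrite (@lt_le_trans _ _ (e^-1 * b + 1)) ?ltrDl//; near: n; exact: small.
      by apply: (le_trans _ (He _ bn)); rewrite divr_ge0// (andP bn).1.
    have yle : y n <= - ((n.+1%:R ^+ 2)^-1 / 4).
      rewrite /y natrX; move: sb; set r := (_ ^+ 2)^-1; set q := sin _; lra.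
    have y0 : - 2^-1 <= y n <= 0.
      by rewrite (andP (ylo n)).1 (le_trans yle)// oppr_le0 divr_ge0// invr_ge0 sqr_ge0.
    apply: (le_trans (bump_approx_lt _ y0)).
    have h : n.+1%:R / 2 <= - (2 * y n *+ n.+1 ^ 3).
      rewrite -[X in _ <= - X]mulr_natr natrX.
      have : 2 * y n * n.+1%:R ^+ 3 <= 2 * - ((n.+1%:R ^+ 2)^-1 / 4) * n.+1%:R ^+ 3.
        by rewrite ler_wpM2r ?exprn_ge0// ler_wpM2l.
      rewrite -lerN2; apply: le_trans; rewrite mulrN mulNr opprK.
      rewrite le_eqVlt; apply/orP; left; apply/eqP; field.
      by rewrite nat1r pnatr_eq0.
    have p1 : 0 < 1 + n.+1%:R / 2 :> R by rewrite ltr_pwDl.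
    have p2 : 0 < 1 - 2 * y n *+ n.+1 ^ 3 by rewrite (lt_le_trans p1)// lerD2l.
    by rewrite lef_pV2 ?posrE// lerD2l.
  apply: (@squeeze_cvgr _ _ _ _ (fun=> 0) (fun n => (1 + n.+1%:R / 2)^-1)).
  + by near=> n; rewrite (andP (trig_step_itv c n x)).1/=; near: n.
  + exact: cvg_cst.
  + have : 2 * ((2 + n.+1%:R)^-1) @[n --> \oo] --> (2 * 0 : R).
      by apply: cvgMr; apply: inv0 => n; rewrite lerDr.
    rewrite mulr0; apply: cvg_trans; apply: near_eq_cvg; apply: nearW => n.
    have n0 : (0:R) < n.+1%:R by [].
    move: n0; rewrite /=; set K := n.+1%:R => K0; field; rewrite gt_eqF// nat1r -/K; lra.
Unshelve. all: by end_near. Qed.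

End indicator_approximation.

Section trig_class.
Context d (T : measurableType d) d' (T' : measurableType d') (R : realType).
Variables (P : probability T R) (P' : probability T' R) (J : finType).
Variables (X : J -> T -> R) (X' : J -> T' -> R).
Hypotheses (mX : forall j, measurable_fun setT (X j))
  (mX' : forall j, measurable_fun setT (X' j)).

Definition linc (a : J -> R) (x : J -> R) : R := \sum_j a j * x j.

Let U a b w := cos (linc a (X ^~ w) + b).
Let U' a b w := cos (linc a (X' ^~ w) + b).

Let mU a b : measurable_fun setT (U a b).
Proof.
apply: measurableT_comp; first exact: (continuous_measurable_fun (@continuous_cos R)).
by apply: measurable_funD => //; apply: measurable_sum => j; exact: measurable_funM.
Qed.

Let mU' a b : measurable_fun setT (U' a b).
Proof.
apply: measurableT_comp; first exact: (continuous_measurable_fun (@continuous_cos R)).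
by apply: measurable_funD => //; apply: measurable_sum => j; exact: measurable_funM.
Qed.

(** Two bounded functionals, one on each space, that no character tells apart. Testing against all
    characters, and not only against the constant 1, is what makes the relation stable under
    multiplication by a cosine. *)
Definition agree (F : T -> R) (F' : T' -> R) : Prop :=
  [/\ measurable_fun setT F, measurable_fun setT F',
    exists M, (forall x, `|F x| <= M) /\ (forall x, `|F' x| <= M) &
    forall (a : J -> R) (b : R),
      \int[P]_w (F w * U a b w) = \int[P']_w (F' w * U' a b w)].

Lemma agree_lin k1 k2 F F' G G' : agree F F' -> agree G G' ->
  agree (fun w => k1 * F w + k2 * G w) (fun w => k1 * F' w + k2 * G' w).
Proof.
move=> [mF mF' [M [FM FM']] FE] [mG mG' [N [GN GN']] GE]; split.
- by apply: measurable_funD; exact: measurable_funM.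
- by apply: measurable_funD; exact: measurable_funM.
- exists (`|k1| * M + `|k2| * N); split=> x; rewrite (le_trans (ler_normD _ _))// !normrM.
    by rewrite lerD// ler_wpM2l.
  by rewrite lerD// ler_wpM2l.
- have I d1 (S : measurableType d1) (Q : probability S R) (H V : S -> R) L :
      measurable_fun setT H -> measurable_fun setT V -> (forall x, `|H x| <= L) ->
      (forall x, `|V x| <= 1) -> Q.-integrable setT (EFin \o (fun w => H w * V w)).
    move=> mH mV HL V1; apply: (@bounded_integrable _ _ _ _ _ L); first exact: measurable_funM.
    by move=> x; rewrite normrM -[L]mulr1 ler_pM.
  have D d1 (S : measurableType d1) (Q : probability S R) (H K V : S -> R) L L' :
      measurable_fun setT H -> measurable_fun setT K -> measurable_fun setT V ->
      (forall x, `|H x| <= L) -> (forall x, `|K x| <= L') -> (forall x, `|V x| <= 1) ->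
      \int[Q]_w ((k1 * H w + k2 * K w) * V w) =
      k1 * (\int[Q]_w (H w * V w)) + k2 * (\int[Q]_w (K w * V w)).
    move=> mH mK mV HL KL V1.
    have i1 := I _ _ Q _ _ _ mH mV HL V1; have i2 := I _ _ Q _ _ _ mK mV KL V1.
    rewrite -!RintegralZl// -RintegralD//; last 2 first.
    + exact: (integrableZl measurableT k1 i1).
    + exact: (integrableZl measurableT k2 i2).
    by apply: eq_Rintegral => w _; rewrite mulrDl !mulrA.
  move=> a b; rewrite (D _ _ _ F G (U a b) M N)// ?(D _ _ _ F' G' (U' a b) M N)// ?FE ?GE//.
  + by move=> x; exact: cos_max.
  + by move=> x; exact: cos_max.
Qed.

Lemma agree_lim F F' (Fn : nat -> T -> R) (Fn' : nat -> T' -> R) M :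
  (forall n, agree (Fn n) (Fn' n)) ->
  (forall n x, `|Fn n x| <= M) -> (forall n x, `|Fn' n x| <= M) ->
  (forall x, Fn n x @[n --> \oo] --> F x) ->
  (forall x, Fn' n x @[n --> \oo] --> F' x) -> agree F F'.
Proof.
move=> ag FM FM' cF cF'.
have lb (S : Type) (u : nat -> S -> R) (v : S -> R) :
    (forall x, u n x @[n --> \oo] --> v x) -> (forall n x, `|u n x| <= M) -> forall x, `|v x| <= M.
  move=> cu uM x; have /cvg_norm/cvg_lim <- := cu x => //.
  apply: limr_le; last by apply: nearW => n; exact: uM.
  by apply/cvg_ex; exists `|v x|; apply: cvg_norm; exact: cu.
have mF : measurable_fun setT F.
  by apply: (measurable_fun_cvg (h := Fn)) => [n|x _]; [have [] := ag n|exact: cF].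
have mF' : measurable_fun setT F'.
  by apply: (measurable_fun_cvg (h := Fn')) => [n|x _]; [have [] := ag n|exact: cF'].
split => //; first by exists M; split; [exact: lb cF FM|exact: lb cF' FM'].
move=> a b.
have L d1 (S : measurableType d1) (Q : probability S R) (u : nat -> S -> R) (v V : S -> R) :
    (forall n, measurable_fun setT (u n)) -> measurable_fun setT V -> (forall x, `|V x| <= 1) ->
    (forall x, u n x @[n --> \oo] --> v x) -> (forall n x, `|u n x| <= M) ->
    \int[Q]_w (u n w * V w) @[n --> \oo] --> \int[Q]_w (v w * V w).
  move=> mu mV V1 cu uM; apply: (@Rintegral_dominated _ _ _ _ _ _ M).
  - by move=> n; exact: measurable_funM.
  - by move=> n x; rewrite normrM -[M]mulr1 ler_pM.
  - by move=> x; apply: cvgMl; exact: cu.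
have c1 := L _ _ P Fn F (U a b); have c2 := L _ _ P' Fn' F' (U' a b).
have {}c1 : \int[P]_w (Fn n w * U a b w) @[n --> \oo] --> \int[P]_w (F w * U a b w).
  by apply: c1 => // [n|x]; [have [] := ag n|exact: cos_max].
have {}c2 : \int[P']_w (Fn' n w * U' a b w) @[n --> \oo] --> \int[P']_w (F' w * U' a b w).
  by apply: c2 => // [n|x]; [have [] := ag n|exact: cos_max].
apply: (cvg_unique _ c1) => //; apply: cvg_trans c2; apply: near_eq_cvg.
by apply: nearW => n; have [_ _ _ ->] := ag n.
Qed.

(** Phrased as an action on [agree], the property is closed under products by mere composition. *)
Definition multiplier (g : T -> R) (g' : T' -> R) : Prop :=
  forall F F', agree F F' -> agree (fun w => F w * g w) (fun w => F' w * g' w).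

(** A product of two cosines is half the sum of two cosines, whose coefficients and phases are added
    and subtracted. *)
Lemma multiplier_cos a b : multiplier (U a b) (U' a b).
Proof.
move=> F F' [mF mF' [M [FM FM']] FE].
have cc (u v : R) : cos u * cos v = 2^-1 * cos (u + v) + 2^-1 * cos (u - v).
  by rewrite cosD cosB; field.
have M0 (S : Type) (H V : S -> R) : (forall x, `|H x| <= M) -> (forall x, `|V x| <= 1) ->
    forall x, `|H x * V x| <= M.
  by move=> HM V1 x; rewrite normrM -[M]mulr1 ler_pM.
split; [exact: measurable_funM|exact: measurable_funM| |].
  by exists M; split; apply: M0 => // x; exact: cos_max.
move=> a2 b2.
have D d1 (S : measurableType d1) (Q : probability S R) (Y : J -> S -> R) (H : S -> R) :
   (forall c e, measurable_fun setT (fun w => cos (linc c (Y ^~ w) + e))) ->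
   measurable_fun setT H -> (forall x, `|H x| <= M) ->
   \int[Q]_w (H w * cos (linc a (Y ^~ w) + b) * cos (linc a2 (Y ^~ w) + b2)) =
   2^-1 * (\int[Q]_w (H w * cos (linc (fun j => a j + a2 j) (Y ^~ w) + (b + b2)))) +
   2^-1 * (\int[Q]_w (H w * cos (linc (fun j => a j - a2 j) (Y ^~ w) + (b - b2)))).
  move=> mc mH HM.
  have i c e : Q.-integrable setT (EFin \o (fun w => H w * cos (linc c (Y ^~ w) + e))).
    apply: (@bounded_integrable _ _ _ _ _ M); first exact: measurable_funM.
    by apply: M0 => // x; exact: cos_max.
  rewrite -!RintegralZl// -RintegralD//; last 2 first.
  - exact: (integrableZl measurableT _ (i _ _)).
  - exact: (integrableZl measurableT _ (i _ _)).
  apply: eq_Rintegral => w _; rewrite -mulrA cc.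
  have -> : linc (fun j => a j + a2 j) (Y ^~ w) + (b + b2) =
      linc a (Y ^~ w) + b + (linc a2 (Y ^~ w) + b2).
    by rewrite /linc; under eq_bigr do rewrite mulrDl; rewrite big_split/=; ring.
  have -> : linc (fun j => a j - a2 j) (Y ^~ w) + (b - b2) =
      linc a (Y ^~ w) + b - (linc a2 (Y ^~ w) + b2).
    by rewrite /linc; under eq_bigr do rewrite mulrBl; rewrite sumrB; ring.
  ring.
rewrite (D _ _ P X F)// (D _ _ P' X' F')//.
by rewrite -!/(U _ _ _) !FE.
Qed.

Lemma multiplier_cst k : multiplier (cst k) (cst k).
Proof.
move=> F F' ag; have := agree_lin k 0 ag ag.
by congr agree; apply/funext => w; rewrite mul0r addr0 mulrC.
Qed.

Lemma multiplier_lin k1 k2 g g' h h' : multiplier g g' -> multiplier h h' ->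
  multiplier (fun w => k1 * g w + k2 * h w) (fun w => k1 * g' w + k2 * h' w).
Proof.
move=> mg mh F F' ag; have := agree_lin k1 k2 (mg _ _ ag) (mh _ _ ag).
by congr agree; apply/funext => w; ring.
Qed.

Lemma multiplierM g g' h h' : multiplier g g' -> multiplier h h' ->
  multiplier (fun w => g w * h w) (fun w => g' w * h' w).
Proof.
move=> mg mh F F' ag; have := mh _ _ (mg _ _ ag).
by congr agree; apply/funext => w; rewrite mulrA.
Qed.

Lemma multiplierX g g' n : multiplier g g' ->
  multiplier (fun w => g w ^+ n) (fun w => g' w ^+ n).
Proof.
move=> mg; elim: n => [|n IH]; first by have := multiplier_cst 1; congr multiplier; apply/funext => w; rewrite expr0.
have := multiplierM mg IH.
by congr multiplier; apply/funext => w; rewrite exprS.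
Qed.

Lemma multiplier_prod (K : Type) (s : seq K) (g : K -> T -> R) (g' : K -> T' -> R) :
  (forall k, multiplier (g k) (g' k)) ->
  multiplier (fun w => \prod_(k <- s) g k w) (fun w => \prod_(k <- s) g' k w).
Proof.
move=> mg; elim: s => [|k s IH].
  by have := multiplier_cst 1; congr multiplier; apply/funext => w; rewrite big_nil.
have := multiplierM (mg k) IH.
by congr multiplier; apply/funext => w; rewrite big_cons.
Qed.

(** [trig_step] is a polynomial in one sine, and this sine is a cosine with its phase moved by
    [pi / 2]; sums, products and powers of multipliers do the rest. *)
Lemma multiplier_trig_step a c n :
  multiplier (fun w => trig_step c n (linc a (X ^~ w)))
             (fun w => trig_step c n (linc a (X' ^~ w))).
Proof.
pose a' j := a j / n.+1%:R; pose b' := - (c / n.+1%:R) - pi / 2.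
have sE (x : J -> R) : sin ((linc a x - c) / n.+1%:R) = cos (linc a' x + b').
  have -> : linc a' x = linc a x / n.+1%:R.
    by rewrite /linc mulr_suml; apply: eq_bigr => j _; rewrite /a' mulrAC.
  by rewrite /b' addrA cosB cos_pihalf sin_pihalf mulr0 add0r mulr1 mulrBl.
have ms := multiplier_cos a' b'.
have mq := multiplier_lin 1 (- 4^-1) (multiplier_cst (2^-1 + (n.+1 ^ 2)%:R^-1 / 4)) ms.
have m1 := multiplier_lin 1 (-1) (multiplier_cst 1) (multiplierX (n.+1 ^ 3) mq).
have := multiplierX (2 ^ (n.+1 ^ 3)) m1.
by congr multiplier; apply/funext => w; rewrite /trig_step /bump_approx sE; congr (_ ^+ _);
  rewrite /= mulN1r mul1r; congr (_ - _ ^+ _); rewrite /U /U'; field; rewrite ?expn_eq0 ?pnatr_eq0.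
Qed.

Lemma multiplier_gt a c :
  multiplier (fun w => ((c < linc a (X ^~ w))%R)%:R) (fun w => ((c < linc a (X' ^~ w))%R)%:R).
Proof.
move=> F F' ag; have [mF mF' [M [FM FM']] FE] := ag.
have t1 n x : `|trig_step c n x| <= 1.
  by have /andP[t0 t1] := trig_step_itv c n x; rewrite ger0_norm.
apply: (@agree_lim _ _ (fun n w => F w * trig_step c n (linc a (X ^~ w)))
  (fun n w => F' w * trig_step c n (linc a (X' ^~ w))) M).
- by move=> n; exact: multiplier_trig_step.
- by move=> n x; rewrite normrM -[M]mulr1 ler_pM.
- by move=> n x; rewrite normrM -[M]mulr1 ler_pM.
- by move=> x; apply: cvgMr; exact: cvg_trig_step.
- by move=> x; apply: cvgMr; exact: cvg_trig_step.
Qed.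

Lemma measurable_halfspaces d1 (S : measurableType d1) (K : finType)
    (Y : J -> S -> R) (a : K -> J -> R) (c : K -> R) :
  (forall j, measurable_fun setT (Y j)) ->
  measurable [set w | forall k, c k < linc (a k) (Y ^~ w)].
Proof.
move=> mY; set A := [set w | _].
rewrite (_ : A = \bigcap_(k in [set: K]) [set w | c k < linc (a k) (Y ^~ w)]).
  apply: fin_bigcap_measurable => // k _.
  apply: (@measurable_lt_set _ _ _ (cst (c k)) (fun w => linc (a k) (Y ^~ w))) => //.
  by apply: measurable_sum => j; exact: measurable_funM.
by apply/seteqP; split=> w /=; [move=> h k _; exact: h|move=> h k; exact: h].
Qed.

(** Takes the place of Fourier inversion. The indicator of a half-space is a bounded limit of
    trigonometric polynomials, hence a multiplier, and the indicator of an intersection is a product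
    of such indicators. *)
Lemma prob_halfspaces_unique (K : finType) (a : K -> J -> R) (c : K -> R) :
  (forall a b, \int[P]_w U a b w = \int[P']_w U' a b w) ->
  P [set w | forall k, c k < linc (a k) (X ^~ w)] =
  P' [set w | forall k, c k < linc (a k) (X' ^~ w)].
Proof.
move=> UE.
have ag1 : agree (cst 1) (cst 1).
  split => //; first by exists 1; split=> x; rewrite normr1.
  move=> a0 b0; under eq_Rintegral do rewrite mul1r.
  by under [RHS]eq_Rintegral do rewrite mul1r.
(* With zero coefficients and zero phase the character is 1, so the integral is the probability of
   the intersection. *)
have [_ _ _ /(_ (fun=> 0) 0)] := multiplier_prod (enum K) (fun k => multiplier_gt (a k) (c k)) ag1.
have linc0 (x : J -> R) : linc (fun=> 0) x = 0 by rewrite /linc big1// => j _; rewrite mul0r.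
have E d1 (S : measurableType d1) (Q : probability S R) (Y : J -> S -> R) :
    (forall j, measurable_fun setT (Y j)) ->
    \int[Q]_w (cst 1 w * \prod_(k <- enum K) ((c k < linc (a k) (Y ^~ w))%R)%:R * cos (linc (fun=> 0) (Y ^~ w) + 0)) =
    fine (Q [set w | forall k, c k < linc (a k) (Y ^~ w)]).
  move=> mY; set A := [set w | _].
  have mA : measurable A by exact: measurable_halfspaces.
  rewrite /Rintegral -[Q A]/(Q (A)) -[in RHS](setIT A) -integral_indic//; congr fine.
  apply: eq_integral => w _; rewrite linc0 addr0 cos0 mulr1 mul1r indicE; congr EFin.
  have [wA|wA] := boolP (w \in A).
    by rewrite big1// => k _; move: wA => /set_mem/(_ k) ->.
  move: wA; rewrite notin_setE => /existsNP[k /negP kA].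
  by apply/eqP; rewrite prodf_seq_eq0; apply/hasP; exists k; rewrite ?mem_enum//= (negPf kA).
rewrite /U /U' (E _ _ P X)// (E _ _ P' X')// => h.
have m1 := measurable_halfspaces a c mX; have m2 := measurable_halfspaces a c mX'.
by rewrite -[LHS]fineK ?fin_num_measure// -[RHS]fineK ?fin_num_measure// h.
Qed.

End trig_class.

(** * Gaussian vectors *)

Section law.
Context d (T : measurableType d) (R : realType) (P : probability T R).

End law.

Section product.
Context d1 d2 (T1 : measurableType d1) (T2 : measurableType d2) (R : realType).
Variables (P1 : probability T1 R) (P2 : probability T2 R).

Lemma Rintegral_prod (F : T1 * T2 -> R) M :
  measurable_fun setT F -> (forall z, `|F z| <= M) ->
  \int[(P1 \x P2)%E]_z F z = \int[P1]_x \int[P2]_y F (x, y).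
Proof.
move=> mF FM; rewrite /Rintegral; congr fine.
have iF : (P1 \x P2)%E.-integrable setT (EFin \o F).
  exact: (@bounded_integrable _ _ _ ((P1 \x P2)%E : probability _ R) _ M).
rewrite -(integral12_prod_meas1 iF); apply: eq_integral => x _.
rewrite /fubini_F fineK// integrable_fin_num//.
apply: (@bounded_integrable _ _ _ _ (fun y => F (x, y)) M) => //.
exact: (measurableT_comp mF (measurable_pair1 x)).
Qed.
End product.

Section gaussian_vector.
Context {R : realType}.
Implicit Types (J K : finType).

Definition quad J (S : J -> J -> R) (a : J -> R) : R := \sum_i \sum_j a i * a j * S i j.

(* The law is prescribed by its characteristic function; [b] encodes both the
   real and the imaginary part. *)
Definition gauss_vec d (T : measurableType d) (P : probability T R) J (X : J -> T -> R)
    (S : J -> J -> R) : Prop :=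
  (forall j, measurable_fun setT (X j)) /\
  forall a b, \int[P]_w cos (linc a (X ^~ w) + b) = expR (- quad S a / 2) * cos b.

Lemma gauss_vec_unique d1 (T1 : measurableType d1) (P1 : probability T1 R)
    d2 (T2 : measurableType d2) (P2 : probability T2 R) J
    (X : J -> T1 -> R) (Y : J -> T2 -> R) S S' K (a : K -> J -> R) (c : K -> R) :
  gauss_vec P1 X S -> gauss_vec P2 Y S' -> (forall a, quad S a = quad S' a) ->
  P1 [set w | forall k, c k < linc (a k) (X ^~ w)] =
  P2 [set w | forall k, c k < linc (a k) (Y ^~ w)].
Proof.
move=> [mX XE] [mY YE] SE; apply: prob_halfspaces_unique => // a0 b0.
by rewrite XE YE SE.
Qed.

Lemma linc0 J (a : J -> R) : linc a (fun=> 0) = 0.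
Proof. by rewrite /linc big1// => j _; rewrite mulr0. Qed.

Lemma lincD J (a : J -> R) (x y : J -> R) : linc a (fun j => x j + y j) = linc a x + linc a y.
Proof. by rewrite /linc -big_split/=; apply: eq_bigr => j _; rewrite mulrDr. Qed.

Lemma quadD J (S S' : J -> J -> R) a : quad (fun i j => S i j + S' i j) a = quad S a + quad S' a.
Proof.
rewrite /quad -big_split/=; apply: eq_bigr => i _.
by rewrite -big_split/=; apply: eq_bigr => j _; rewrite mulrDr.
Qed.

Lemma quad_rank1 J (u : J -> R) k a : quad (fun i j => k * (u i * u j)) a = k * linc a u ^+ 2.
Proof.
rewrite /quad /linc expr2 mulr_suml mulr_sumr; apply: eq_bigr => i _.
by rewrite !mulr_sumr; apply: eq_bigr => j _; ring.
Qed.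

(** For a fixed point of the first space, the first vector only adds to the phase of the integral
    over the second. The arbitrary phase [b] thus replaces the factorisation of complex
    exponentials. *)
Lemma gauss_vecD d1 (T1 : measurableType d1) (P1 : probability T1 R)
    d2 (T2 : measurableType d2) (P2 : probability T2 R) J
    (X : J -> T1 -> R) (Y : J -> T2 -> R) S S' :
  gauss_vec P1 X S -> gauss_vec P2 Y S' ->
  gauss_vec (P1 \x P2)%E (fun j z => X j z.1 + Y j z.2) (fun i j => S i j + S' i j).
Proof.
move=> [mX XE] [mY YE]; split.
  move=> j; apply: measurable_funD.
    exact: measurableT_comp (mX j) measurable_fst.
  exact: measurableT_comp (mY j) measurable_snd.
have mlX a : measurable_fun setT (fun w => linc a (X ^~ w)).
  by apply: measurable_sum => j; exact: measurable_funM.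
have mlY a : measurable_fun setT (fun w => linc a (Y ^~ w)).
  by apply: measurable_sum => j; exact: measurable_funM.
have mcos : measurable_fun setT (@cos R) by exact: continuous_measurable_fun (@continuous_cos R).
move=> a b; rewrite (@Rintegral_prod _ _ _ _ _ _ _ _ 1); last 2 first.
- apply: measurableT_comp => //; apply: measurable_funD => //.
  under eq_fun do rewrite lincD; apply: measurable_funD.
    exact: measurableT_comp (mlX a) measurable_fst.
  exact: measurableT_comp (mlY a) measurable_snd.
- by move=> z; exact: cos_max.
have E x y : linc a (fun j => X j (x, y).1 + Y j (x, y).2) + b =
    linc a (Y ^~ y) + (linc a (X ^~ x) + b) by rewrite lincD; ring.
under eq_Rintegral => x _.
  under eq_Rintegral => y _ do rewrite E.
  rewrite YE; over.
rewrite RintegralZl//; last first.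
  apply: (@bounded_integrable _ _ _ _ _ 1); last by move=> x; exact: cos_max.
  by apply: measurableT_comp => //; exact: measurable_funD.
by rewrite XE mulrA -expRD quadD; congr (expR _ * _); rewrite -mulrDl -opprD addrC.
Qed.

Lemma quad_image J (S : J -> J -> R) K (B : K -> J -> R) (a : K -> R) :
  quad (fun k l => \sum_i \sum_j B k i * B l j * S i j) a =
  quad S (fun j => \sum_k a k * B k j).
Proof.
apply/esym; rewrite /quad.
under eq_bigr => i _ do under eq_bigr => j _ do rewrite mulr_suml mulr_suml.
under eq_bigr => i _ do (rewrite exchange_big/=).
rewrite exchange_big/=; apply: eq_bigr => k _.
under eq_bigr => i _ do under eq_bigr => j _ do rewrite mulr_sumr mulr_suml.
under eq_bigr => i _ do rewrite exchange_big/=.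
rewrite exchange_big/=; apply: eq_bigr => l _.
rewrite mulr_sumr; apply: eq_bigr => i _.
by rewrite mulr_sumr; apply: eq_bigr => j _; ring.
Qed.

Lemma gauss_vec_image d (T : measurableType d) (P : probability T R) J (X : J -> T -> R) S
    K (B : K -> J -> R) : gauss_vec P X S ->
  gauss_vec P (fun k w => linc (B k) (X ^~ w))
    (fun k l => \sum_i \sum_j B k i * B l j * S i j).
Proof.
move=> [mX XE]; split.
  by move=> k; apply: measurable_sum => j; exact: measurable_funM.
move=> a b.
have lE x : linc a (fun k => linc (B k) x) = linc (fun j => \sum_k a k * B k j) x.
  rewrite /linc; under eq_bigr do rewrite mulr_sumr.
  rewrite exchange_big/=; apply: eq_bigr => j _.
  by rewrite mulr_suml; apply: eq_bigr => k _; rewrite mulrA.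
by under eq_Rintegral do rewrite lE; rewrite XE quad_image.
Qed.

Lemma gauss_vec_rank1 J (s : R) (u : J -> R) : s != 0 ->
  gauss_vec (normal_prob 0 s) (fun j x => u j * x) (fun i j => s ^+ 2 * (u i * u j)).
Proof.
move=> s0; split; first by move=> j; exact: measurable_funM.
move=> a b; rewrite quad_rank1.
have E x : linc a (fun j => u j * x) = linc a u * x.
  by rewrite /linc mulr_suml; apply: eq_bigr => j _; rewrite mulrA.
by under eq_Rintegral do rewrite E; rewrite normal_cos.
Qed.

Definition psd J (S : J -> J -> R) := forall a, 0 <= quad S a.

Definition delta J (k : J) : J -> R := fun j => (j == k)%:R.

Lemma quadDdelta J (S : J -> J -> R) a k t : (forall i j, S i j = S j i) ->
  quad S (fun j => a j + t * delta k j) =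
  quad S a + 2 * t * (\sum_i a i * S i k) + t ^+ 2 * S k k.
Proof.
move=> symS; rewrite /quad.
have dE (F : J -> R) : \sum_j delta k j * F j = F k.
  rewrite (bigD1 k)//= /delta eqxx mul1r big1 ?addr0// => j /negPf ->.
  by rewrite mul0r.
transitivity (\sum_i \sum_j a i * a j * S i j + t * (\sum_i delta k i * \sum_j a j * S i j)
  + t * (\sum_i a i * \sum_j delta k j * S i j) + t ^+ 2 * (\sum_i delta k i * \sum_j delta k j * S i j)).
  rewrite !mulr_sumr -!big_split/=; apply: eq_bigr => i _.
  rewrite !mulr_sumr -!big_split/=; apply: eq_bigr => j _; ring.
rewrite !dE; under [X in _ + t * X + _]eq_bigr do rewrite dE.
by under [X in _ + t * X + _ + _]eq_bigr do rewrite symS; ring.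
Qed.

(** Along the direction [delta k] the quadratic form is affine when the diagonal entry vanishes, and
    it can stay nonnegative only if its slope is zero. *)
Lemma psd_diag0 J (S : J -> J -> R) k : (forall i j, S i j = S j i) -> psd S ->
  S k k = 0 -> forall a, \sum_i a i * S i k = 0.
Proof.
move=> symS pS Sk a; apply/eqP; apply/negPn/negP => s0.
set s := \sum_i _ in s0.
(* The multiple of [delta k] is chosen so that the form takes the value -1. *)
have := pS (fun j => a j + (- (quad S a + 1) / (2 * s)) * delta k j).
rewrite quadDdelta// Sk mulr0 addr0 -/s.
have -> : 2 * (- (quad S a + 1) / (2 * s)) * s = - (quad S a + 1) by field.
lra.
Qed.

(** Cholesky's elimination: the column of a nonzero diagonal entry carries a rank-one Gaussian
    vector, and the Schur complement [S'] is left for an independent one. The induction is on the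
    number of nonzero diagonal entries. *)
Lemma gauss_vec_exists J (S : J -> J -> R) : (forall i j, S i j = S j i) -> psd S ->
  exists d (T : measurableType d) (P : probability T R) (X : J -> T -> R), gauss_vec P X S.
Proof.
have [n] := ubnP #|[pred i | S i i != 0]|.
elim: n S => // n IH S; rewrite ltnS => Sn symS pS.
have [S0|] := posnP #|[pred i | S i i != 0]|.
  exists _, _, (normal_prob 0 1), (fun _ _ => 0); split; first by move=> j; exact: measurable_cst.
  move=> a b; have -> : quad S a = 0.
    rewrite /quad exchange_big/=; apply: big1 => j _.
    have Sj : S j j = 0.
      by have /negbFE/eqP := card0_eq S0 j.
    have := psd_diag0 symS pS Sj a; under eq_bigr do rewrite mulrAC.
    by rewrite -mulr_suml => ->; rewrite mul0r.
  rewrite oppr0 mul0r expR0 mul1r.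
  by rewrite linc0 add0r Rintegral_cst//= probability_setT mulr1.
move=> /card_gt0P[k]; rewrite inE => Skk.
have quad_delta t : quad S (fun j => 0 + t * delta k j) = t ^+ 2 * S k k.
  rewrite quadDdelta// (_ : quad S (fun=> 0) = 0).
    by rewrite big1 ?mulr0 ?add0r// => i _; rewrite mul0r.
  by rewrite /quad big1// => i _; rewrite big1// => j _; rewrite !mul0r.
have Skk0 : 0 < S k k.
  by rewrite lt_neqAle eq_sym Skk/=; have := pS (fun j => 0 + 1 * delta k j); rewrite quad_delta expr1n mul1r.
pose S' i j := S i j - (S k k)^-1 * (S i k * S j k).
have quadS' a : quad S' a = quad S a - (S k k)^-1 * (\sum_i a i * S i k) ^+ 2.
  rewrite -[\sum_i a i * S i k]/(linc a (S ^~ k)) -quad_rank1.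
  rewrite /quad -sumrB; apply: eq_bigr => i _; rewrite -sumrB; apply: eq_bigr => j _.
  by rewrite -mulrBr.
have [d [T [P [Y gY]]]] : exists d (T : measurableType d) (P : probability T R) (X : J -> T -> R), gauss_vec P X S'.
  apply: IH.
  (* A vanishing diagonal entry annihilates its row, so elimination leaves it at zero, while the
     entry [k] becomes zero. *)
  - apply: leq_trans Sn; apply: proper_card; apply/properP; split.
      apply/fintype.subsetP => i; rewrite !inE; apply: contraNneq => Si.
      have := psd_diag0 symS pS Si (delta k).
      rewrite (bigD1 k)//= /delta eqxx mul1r big1 ?addr0; last first.
        by move=> j /negPf ->; rewrite mul0r.
      by rewrite /S' Si symS => ->; rewrite mulr0 mulr0 subr0.
    by exists k; rewrite inE ?Skk// /S' mulrA mulVf// mul1r subrr eqxx.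
  - by move=> i j; rewrite /S' symS [S i k * _]mulrC.
  (* The Schur complement at [a] is the value of [S] at the point of the line [a + t * delta k]
     where [S] is smallest. *)
  - move=> a; rewrite quadS'; set s := \sum_i _.
    have := pS (fun j => a j + (- s / S k k) * delta k j); rewrite quadDdelta// -/s.
    suff -> : quad S a - (S k k)^-1 * s ^+ 2 =
      quad S a + 2 * (- s / S k k) * s + (- s / S k k) ^+ 2 * S k k by [].
    by field.
have n1 : (Num.sqrt (S k k))^-1 != 0 by rewrite invr_eq0 gt_eqF// sqrtr_gt0.
have := gauss_vecD gY (gauss_vec_rank1 (S ^~ k) n1) => gs.
eexists _, _, _, _; move: gs; congr gauss_vec.
apply/funext => i; apply/funext => j.
by rewrite /S' exprVn sqr_sqrtr ?(ltW Skk0)// subrK.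
Qed.

(** The second clause is the form in which independence will be used: a bound on one coordinate,
    uniform in its shift, multiplies up. The shifts [h] will be the values of an independent vector,
    held fixed. *)
Lemma iid_normal_exists J (s : R) : s != 0 ->
  exists d (T : measurableType d) (P : probability T R) (W : J -> T -> R),
    gauss_vec P W (fun i j => s ^+ 2 * (i == j)%:R) /\
    forall (psi : R -> R) (C : R), measurable_fun setT psi -> (forall x, 0 <= psi x) -> 0 <= C ->
      (forall b, \int[normal_prob 0 s]_x (psi (x + b))%:E <= C%:E)%E ->
      forall h : J -> R, (\int[P]_w (\prod_j psi (W j w + h j))%:E <= (C ^+ #|J|)%:E)%E.
Proof.
move=> s0.
(* Coordinates are switched on one at a time, each on a new factor of a product space. Those outside
   [l] are zero, which keeps the index type fixed along the induction. *)
suff : forall l : seq J, uniq l ->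
  exists d (T : measurableType d) (P : probability T R) (W : J -> T -> R),
    [/\ gauss_vec P W (fun i j => s ^+ 2 * ((i == j) && (i \in l))%:R),
    (forall j, j \notin l -> W j = cst 0) &
    forall (psi : R -> R) (C : R), measurable_fun setT psi -> (forall x, 0 <= psi x) -> 0 <= C ->
      (forall b, \int[normal_prob 0 s]_x (psi (x + b))%:E <= C%:E)%E ->
      forall h : J -> R, (\int[P]_w (\prod_(j <- l) psi (W j w + h j)%R)%:E <= (C ^+ size l)%:E)%E].
  move=> /(_ (enum J) (enum_uniq J))[d [T [P [W [gW _ HW]]]]].
  exists d, T, P, W; split.
    by move: gW; congr gauss_vec; apply/funext => i; apply/funext => j; rewrite mem_enum andbT.
  move=> psi C mpsi psi0 C0 HC h; have := HW psi C mpsi psi0 C0 HC h.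
  by rewrite cardE; under eq_integral do rewrite big_enum.
elim => [_|k l IH /= /andP[kl ul]].
  exists _, _, (normal_prob 0 1), (fun _ => cst 0); split => //.
    split; first by move=> j; exact: measurable_cst.
    move=> a b; have -> : quad (fun i j => s ^+ 2 * ((i == j) && (i \in [::]))%:R) a = 0.
      by rewrite /quad big1// => i _; rewrite big1// => j _; rewrite andbF !mulr0.
    rewrite oppr0 mul0r expR0 mul1r.
    by under eq_Rintegral do rewrite linc0 add0r; rewrite Rintegral_cst//= probability_setT mulr1.
  move=> psi C _ _ _ _ h; under eq_integral do rewrite big_nil.
  by rewrite integral_cst//= expr0 mul1e probability_setT.
have [d [T [P [W [gW W0 HW]]]]] := IH ul.
exists _, _, (normal_prob 0 s \x P)%E, (fun j z => delta k j * z.1 + W j z.2).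
have Wk : W k = cst 0 by exact: W0.
split.
- have := gauss_vecD (gauss_vec_rank1 (delta k) s0) gW; congr gauss_vec.
  apply/funext => i; apply/funext => j; rewrite -mulrDr inE /delta; congr (_ * _).
  have [->|ik] := eqVneq i k.
    by rewrite (negPf kl) andbF addr0 mul1r andbT eq_sym.
  by rewrite mul0r add0r.
- move=> j; rewrite inE negb_or => /andP[/negPf jk jl].
  by apply/funext => z; rewrite W0// /delta jk mul0r addr0.
- move=> psi C mpsi psi0 C0 HC h.
  have [mW _] := gW.
  have mp : measurable_fun setT (fun w => \prod_(j <- l) psi (W j w + h j)).
    by apply: measurable_prod => j _; apply: measurableT_comp => //; exact: measurable_funD.
  have mk : measurable_fun setT (fun x : R => psi (x + h k)).
    by apply: measurableT_comp => //; exact: measurable_funD.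
  have E z : \prod_(j <- k :: l) psi (delta k j * z.1 + W j z.2 + h j) =
     psi (z.1 + h k) * \prod_(j <- l) psi (W j z.2 + h j).
    rewrite big_cons Wk /delta eqxx mul1r addr0; congr (_ * _).
    rewrite !big_seq; apply: eq_bigr => j jl.
    by have [jk|] := eqVneq j k; [rewrite jk (negPf kl) in jl|rewrite mul0r add0r].
  under eq_integral do rewrite E.
  pose F z := (psi (z.1 + h k) * \prod_(j <- l) psi (W j z.2 + h j))%:E.
  have mF : measurable_fun setT F.
    apply/measurable_EFinP; apply: measurable_funM.
      exact: measurableT_comp mk measurable_fst.
    exact: measurableT_comp mp measurable_snd.
  have F0 z : (0 <= F z)%E by rewrite lee_fin mulr_ge0// prodr_ge0.
  rewrite [leLHS](_ : _ = \int[normal_prob 0 s]_x fubini_F P F x)%E; last exact: fubini_tonelli1.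
  have mFF := measurable_fun_fubini_tonelli_F (m2 := P) F mF F0.
  apply: (@le_trans _ _ (\int[normal_prob 0 s]_x ((psi (x + h k))%:E * (C ^+ size l)%:E))%E).
    apply: ge0_le_integral => //.
    + by move=> x _; apply: integral_ge0 => y _.
    + by apply: emeasurable_funM => //; exact/measurable_EFinP.
    + move=> x _; rewrite -[leLHS]/(\int[P]_y (psi (x + h k) * \prod_(j <- l) psi (W j y + h j))%:E)%E.
      under eq_integral do rewrite EFinM.
      rewrite ge0_integralZl//; last 3 first.
      * exact/measurable_EFinP.
      * by move=> y _; rewrite lee_fin prodr_ge0.
      * by rewrite lee_fin.
      by rewrite lee_wpmul2l ?lee_fin//; exact: HW.
  rewrite ge0_integralZr//; last 3 first.
  + exact/measurable_EFinP.
  + by move=> x _; rewrite lee_fin.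
  + by rewrite lee_fin exprn_ge0.
  by rewrite exprS EFinM lee_wpmul2r ?lee_fin ?exprn_ge0//; exact: HC.
Qed.

End gaussian_vector.

(** * Finite-dimensional laws of a stationary Gaussian field *)

Section stationary.
Context disp (Omega : measurableType disp) (R : realType) (P : probability Omega R).

Lemma gaussian_moments (U : Omega -> R) : measurable_fun setT U -> gaussian P U ->
  [/\ P.-integrable setT (EFin \o (fun w => U w ^+ 2)),
    P.-integrable setT (EFin \o U) &
    \int[P]_w U w = 0 -> forall b,
      \int[P]_w cos (U w + b) = expR (- (\int[P]_w U w ^+ 2) / 2) * cos b].
Proof.
move=> mU [m [s UE]].
have mcos b : measurable_fun setT (fun x : R => cos (x + b)).
  by have := @measurable_cosM R 1 b; under eq_fun do rewrite mul1r.
have mU' : measurable_fun setT (U : Omega -> measurableTypeR R) by move=> mT A mA; exact: mU.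
pose V : {mfun Omega >-> measurableTypeR R} :=
  HB.pack (U : Omega -> measurableTypeR R) (isMeasurableFun.Build _ _ _ _ _ mU').
(* Change of variables to the law of [U], stated for any measure so that it serves both the Dirac
   mass of the degenerate case and [normal_prob]. *)
have key (nu : {measure set (measurableTypeR R) -> \bar R}) :
    (forall A, measurable A -> P (U @^-1` A) = nu A) ->
    forall g : measurableTypeR R -> R, measurable_fun setT g -> nu.-integrable setT (EFin \o g) ->
    P.-integrable setT (EFin \o (g \o U)) /\ \int[P]_w g (U w) = \int[nu]_x g x.
  move=> nuE g mg /integrableP[_ ig].
  have nuE' A : measurable A -> A `<=` setT -> distribution P V A = nu A by move=> mA _; exact: nuE.
  have mEg : measurable_fun setT (EFin \o g) by exact/measurable_EFinP.
  have igU : P.-integrable setT (EFin \o (g \o U)).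
    apply/integrableP; split; first exact: (measurableT_comp mEg mU').
    rewrite [ltLHS](_ : _ = \int[P]_w ((abse \o (EFin \o g)) \o V) w)%E//.
    rewrite -ge0_integral_distribution; [|by apply: measurableT_comp|by move=> y; exact: abse_ge0].
    by rewrite (eq_measure_integral nu nuE').
  split => //; rewrite /Rintegral; congr fine.
  transitivity (\int[distribution P V]_x (g x)%:E)%E; last exact: eq_measure_integral.
  by rewrite integral_distribution.
have [s0|s0] := eqVneq s 0.
  have UE' A : measurable A -> P (U @^-1` A) = @dirac _ (measurableTypeR R) m R A.
    by move=> mA; rewrite UE// s0 eqxx.
  have I (g : R -> R) : measurable_fun setT g -> P.-integrable setT (EFin \o (g \o U)) /\ \int[P]_w g (U w) = g m.
    move=> mg; have mEg : measurable_fun setT (EFin \o g) by exact/measurable_EFinP.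
    have [|i1 ->] := key (@dirac _ (measurableTypeR R) m R) UE' g mg; last first.
      by split => //; rewrite /Rintegral integral_dirac// diracE mem_set// mul1e.
    apply/integrableP; split => //.
    rewrite integral_dirac//; last exact: measurableT_comp.
    by rewrite diracE mem_set// mul1e ltry.
  have [i2 E2] := I (fun x => x ^+ 2) (measurable_funX 2 (@measurable_id _ _ setT)).
  have [i1 E1] := I id (@measurable_id _ _ setT).
  split => // U0 b.
  have m0 : m = 0 by rewrite -U0 E1.
  rewrite (I (fun x => cos (x + b)) _).2// E2.
  by rewrite m0 expr0n/= oppr0 mul0r expR0 mul1r add0r.
have UE' A : measurable A -> P (U @^-1` A) = normal_prob m s A.
  by move=> mA; rewrite UE// (negPf s0).
have I (g : R -> R) C : measurable_fun setT g -> (forall x, `|g x| <= C * (1 + x ^+ 2)) ->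
    P.-integrable setT (EFin \o (g \o U)) /\ \int[P]_w g (U w) = \int[normal_prob m s]_x g x.
  move=> mg gC.
  have ig : (normal_prob m s).-integrable setT (EFin \o g).
    by apply: integrable_normal_prob => //; exact: integrable_poly_normal gC.
  exact: (key (normal_prob m s) UE' g mg ig).
have x1 (x : R) : `|x| <= 1 * (1 + x ^+ 2).
  rewrite mul1r -[x ^+ 2]real_normK ?num_real//.
  by have := sqr_ge0 (1 - `|x|); rewrite !expr2; have := normr_ge0 x; nra.
have [i1 j1] := I id 1 (@measurable_id _ _ setT) x1.
have x2 (x : R) : `|x ^+ 2| <= 1 * (1 + x ^+ 2).
  by rewrite mul1r ger0_norm ?sqr_ge0// lerDr.
have [i2 j2] := I (fun x => x ^+ 2) 1 (measurable_funX 2 (@measurable_id _ _ setT)) x2.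
split => // U0 b.
have m0 : m = 0 by rewrite -U0 j1 normal_mean.
have c1 (x : R) : `|cos (x + b)| <= 1 * (1 + x ^+ 2).
  by rewrite (le_trans (cos_max _))// mul1r lerDl sqr_ge0.
have j2' : \int[P]_w U w ^+ 2 = s ^+ 2 by apply: (etrans j2); rewrite m0 normal_variance.
have := (I (fun x => cos (x + b)) 1 (mcos b) c1).2 => jc; apply: (etrans jc).
rewrite j2' m0.
by have := normal_cos 1 b s0; under eq_Rintegral do rewrite mul1r; rewrite expr1n mulr1.
Qed.

Variables (I : zmodType) (f : I -> {RV P >-> R}).
Hypothesis sf : stationary_gaussian_field f.

Let mf x : measurable_fun setT (f x).
Proof. exact: measurable_funPT. Qed.

Lemma sgf_gaussian_sum (J : finType) (x : J -> I) (a : J -> R) :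
  gaussian P (fun w => linc a (fun j => f (x j) w)).
Proof.
have := sgf_gaussian sf (fun i : 'I_#|J| => x (enum_val i)) (fun i => a (enum_val i)).
congr gaussian; apply/funext => w.
by rewrite /linc (big_enum_val (A := J) (fun j => a j * f (x j) w)).
Qed.

Let sgf_gaussian1 x : gaussian P (f x).
Proof.
have := sgf_gaussian_sum (fun _ : 'I_1 => x) (fun=> 1).
by congr gaussian; apply/funext => w; rewrite /linc big_ord1 mul1r.
Qed.

Let intff x y : P.-integrable setT (EFin \o (fun w => f x w * f y w)).
Proof.
have [ix _ _] := gaussian_moments (mf x) (sgf_gaussian1 x).
have [iy _ _] := gaussian_moments (mf y) (sgf_gaussian1 y).
apply: le_integrable (integrableD measurableT ix iy) => //.
  by apply/measurable_EFinP; exact: measurable_funM.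
move=> w _ /=; rewrite lee_fin normrM [leRHS]ger0_norm ?addr_ge0 ?sqr_ge0//.
rewrite -[f x w ^+ 2]real_normK ?num_real// -[f y w ^+ 2]real_normK ?num_real//.
have := sqr_ge0 (`|f x w| - `|f y w|); have := normr_ge0 (f x w); have := normr_ge0 (f y w).
by rewrite !expr2; nra.
Qed.

(** Stationarity is applied to the pair of base points [0] and [y - x], shifted by [x]; the product
    of the two coordinates is then integrated against the common law of the pairs. *)
Lemma sgf_covariance x y : \int[P]_w (f x w * f y w) = covariance_kernel f (y - x).
Proof.
rewrite /covariance_kernel unlock /Rintegral; congr fine.
pose X (h : I) (w : Omega) : 2.-tuple R := [tuple f (tnth [tuple 0; y - x] i + h) w | i < 2].
have mX h : measurable_fun setT (X h).
  apply/measurable_fun_tnthP => i.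
  by rewrite (_ : _ \o _ = f (tnth [tuple 0; y - x] i + h))//; apply/funext => w; rewrite /= tnth_mktuple.
pose V h : {mfun Omega >-> 2.-tuple R} := HB.pack (X h) (isMeasurableFun.Build _ _ _ _ (X h) (mX h)).
pose g (t : 2.-tuple R) := tnth t ord0 * tnth t ord_max.
have mg : measurable_fun setT g by apply: measurable_funM; exact: measurable_tnth.
have gE h w : g (X h w) = f h w * f (y - x + h) w.
  by rewrite /g /X !tnth_mktuple/= add0r.
have D h : (\int[distribution P (V h)]_t (g t)%:E = \int[P]_w (f h w * f (y - x + h)%R w)%:E)%E.
  rewrite integral_distribution.
  - by apply: eq_integral => w _; rewrite /= gE.
  - exact/measurable_EFinP.
  - by rewrite (_ : _ \o _ = EFin \o (fun w => f h w * f (y - x + h) w))//; apply/funext => w /=; rewrite gE.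
transitivity (\int[P]_w (f x w * f (y - x + x)%R w)%:E)%E; first by rewrite subrK.
rewrite -D; transitivity (\int[distribution P (V (0 : I)%R)]_t (g t)%:E)%E; last first.
  by rewrite D addr0.
apply: eq_measure_integral => A mA _.
rewrite /distribution /pushforward /=.
have h1 h : [set w | A [tuple f (tnth [tuple 0; y - x] i + h) w | i < 2]] = X h @^-1` A by [].
have := @sgf_stationary _ _ _ _ _ _ sf 2 (tnth [tuple 0; y - x]) x A mA.
rewrite h1 => E; apply: (etrans E); rewrite -[RHS]/(P [set w | A (X (0 : I)%R w)]); congr (P _).
apply/seteqP; split => w /=; rewrite /X.
  by rewrite (_ : [tuple f (tnth [tuple 0; y - x] i) w | i < 2] = [tuple f (tnth [tuple 0; y - x] i + 0) w | i < 2])//; apply: eq_from_tnth => i; rewrite !tnth_mktuple addr0.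
by rewrite (_ : [tuple f (tnth [tuple 0; y - x] i) w | i < 2] = [tuple f (tnth [tuple 0; y - x] i + 0) w | i < 2])//; apply: eq_from_tnth => i; rewrite !tnth_mktuple addr0.
Qed.

Lemma sgf_gauss_vec (J : finType) (x : J -> I) :
  gauss_vec P (fun j w => f (x j) w) (fun i j => covariance_kernel f (x j - x i)).
Proof.
split=> [j|a b]; first exact: mf.
have mU : measurable_fun setT (fun w => linc a (fun j => f (x j) w)).
  by apply: measurable_sum => j; exact: measurable_funM.
have [i2 i1 H] := gaussian_moments mU (sgf_gaussian_sum x a).
rewrite H; last first.
  rewrite /linc /Rintegral; under eq_integral do rewrite -sumEFin.
  rewrite integral_sum//; last first.
    move=> j; have [_ ij _] := gaussian_moments (mf (x j)) (sgf_gaussian1 (x j)).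
    exact: (integrableZl measurableT (a j) ij).
  rewrite big1// => j _; under eq_integral do rewrite EFinM.
  have [_ ij _] := gaussian_moments (mf (x j)) (sgf_gaussian1 (x j)).
  rewrite integralZl//.
  by have := sgf_centred sf (x j); rewrite unlock => ->; rewrite mule0.
congr (expR (- _ / 2) * _).
have E w : linc a (fun j => f (x j) w) ^+ 2 = \sum_i \sum_j a i * a j * (f (x i) w * f (x j) w).
  rewrite expr2 /linc mulr_suml; apply: eq_bigr => i _.
  by rewrite mulr_sumr; apply: eq_bigr => j _; ring.
have K i j : P.-integrable setT (EFin \o (fun w => a i * a j * (f (x i) w * f (x j) w))).
  exact: (integrableZl measurableT (a i * a j) (intff _ _)).
have sumI (s : seq J) (F : J -> Omega -> R) : (forall j, P.-integrable setT (EFin \o F j)) ->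
    P.-integrable setT (EFin \o (fun w => \sum_(j <- s) F j w)) /\
    \int[P]_w (\sum_(j <- s) F j w) = \sum_(j <- s) \int[P]_w F j w.
  move=> iF; have i0 : P.-integrable setT (EFin \o (fun w => \sum_(j <- s) F j w)).
    rewrite (_ : _ \o _ = (fun w => \sum_(j <- s) (F j w)%:E))%E; last by apply/funext => w; rewrite /= sumEFin.
    by apply: (integrable_sum measurableT s (h := fun j w => (F j w)%:E)) => k _; exact: iF.
  split => //; elim: s {i0} => [|j s IH].
    by under eq_Rintegral do rewrite big_nil; rewrite Rintegral_cst//= mul0r big_nil.
  under eq_Rintegral do rewrite big_cons; rewrite big_cons -IH RintegralD//.
  rewrite (_ : _ \o _ = (fun w => \sum_(j <- s) (F j w)%:E))%E; last by apply/funext => w; rewrite /= sumEFin.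
  by apply: (integrable_sum measurableT s (h := fun j w => (F j w)%:E)) => k _; exact: iF.
under eq_Rintegral do rewrite E.
rewrite (sumI _ _ _).2; last by move=> i; exact: (sumI _ _ (K i)).1.
apply: eq_bigr => i _; rewrite (sumI _ _ (K i)).2; apply: eq_bigr => j _.
by rewrite RintegralZl// sgf_covariance.
Qed.

End stationary.

(** * Probability estimates for Gaussian vectors *)

Section real_probability.
Context d (T : measurableType d) (R : realType).
Implicit Type P : probability T R.

Definition Pr P (A : set T) : R := fine (P A).

Lemma PrT P : Pr P setT = 1.
Proof. by rewrite /Pr probability_setT. Qed.

Lemma PrK P A : measurable A -> (Pr P A)%:E = P A.
Proof. by move=> mA; rewrite fineK// fin_num_measure. Qed.

Lemma Pr_ge0 P A : 0 <= Pr P A.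
Proof. by rewrite fine_ge0. Qed.

Lemma Pr_le P A B : measurable A -> measurable B -> A `<=` B -> Pr P A <= Pr P B.
Proof.
move=> mA mB AB; rewrite -lee_fin !PrK//.
by apply: le_measure => //; apply/mem_set.
Qed.

Lemma Pr_le1 P A : measurable A -> Pr P A <= 1.
Proof. by move=> mA; rewrite -lee_fin PrK// probability_le1. Qed.

Lemma PrC P A : measurable A -> Pr P (~` A) = 1 - Pr P A.
Proof.
move=> mA; apply/EFin_inj; rewrite PrK; last exact: measurableC.
by rewrite probability_setC// EFinB PrK.
Qed.

Lemma PrID P A B : measurable A -> measurable B -> Pr P A = Pr P (A `&` B) + Pr P (A `\` B).
Proof.
move=> mA mB; apply/EFin_inj; rewrite EFinD !PrK//; [|exact: measurableD|exact: measurableI].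
by rewrite addeC -(measureDI P mA mB).
Qed.

Lemma PrU2 P A B : measurable A -> measurable B -> Pr P (A `|` B) <= Pr P A + Pr P B.
Proof.
move=> mA mB; rewrite -lee_fin EFinD !PrK//; last exact: measurableU.
exact: measureU2.
Qed.

Lemma Pr_union P (J : finType) (A : J -> set T) (B : set T) : (forall j, measurable (A j)) ->
  measurable B -> (forall w, B w -> exists j, A j w) -> Pr P B <= \sum_j Pr P (A j).
Proof.
move=> mA mB BA.
have mU (s : seq J) : measurable (\big[setU/set0]_(j <- s) A j) by exact: bigsetU_measurable.
have H (s : seq J) : Pr P (\big[setU/set0]_(j <- s) A j) <= \sum_(j <- s) Pr P (A j).
  elim: s => [|j s IH]; first by rewrite !big_nil /Pr measure0.
  by rewrite !big_cons (le_trans (PrU2 _ _ _))// lerD2l.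
apply: le_trans (H (index_enum J)); apply: Pr_le => // w /BA[j Ajw].
by rewrite -bigcup_seq; exists j => //=; exact: mem_index_enum.
Qed.

Lemma Pr_Rintegral P A : measurable A -> Pr P A = \int[P]_w \1_A w.
Proof. by move=> mA; rewrite /Rintegral integral_indic// setIT. Qed.

End real_probability.

Lemma Pr_prod d1 d2 (T1 : measurableType d1) (T2 : measurableType d2) (R : realType)
    (P1 : probability T1 R) (P2 : probability T2 R) A B : measurable A -> measurable B ->
  Pr (P1 \x P2)%E (A `*` B) = Pr P1 A * Pr P2 B.
Proof.
move=> mA mB; apply/EFin_inj; rewrite EFinM !PrK//; last exact: measurableX.
exact: product_measure1E.
Qed.

Section tails.
Context {R : realType}.
Implicit Types (s t u v b : R).

Lemma normal_prob_lt s u : s != 0 -> 0 <= u ->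
  ((normal_pdf 0 s (u + 1))%:E <= normal_prob 0 s `]-oo, (- u)%R[)%E.
Proof.
move=> s0 u0.
rewrite (@le_trans _ _ (\int[lebesgue_measure]_(x in `](- (u + 1))%R, (- u)%R[) (normal_pdf 0 s x)%:E)%E)//; last first.
  apply: ge0_subset_integral => //.
  - by apply/measurable_EFinP; apply: measurable_funTS; exact: measurable_normal_pdf.
  - by move=> x _; rewrite lee_fin normal_pdf_ge0.
  - by move=> x /=; rewrite !in_itv/= => /andP[].
rewrite (@le_trans _ _ (\int[lebesgue_measure]_(x in `](- (u + 1))%R, (- u)%R[) (normal_pdf 0 s (u + 1))%:E)%E)//.
  rewrite integral_cst//= lebesgue_measure_itv/= lte_fin ltrN2 ltrDl ltr01 -EFinD.
  by rewrite (_ : - u - - (u + 1) = 1) ?mule1 ?lexx//; ring.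
apply: ge0_le_integral => //.
- by move=> x _; rewrite lee_fin normal_pdf_ge0.
- by apply/measurable_EFinP; apply: measurable_funTS; exact: measurable_normal_pdf.
- move=> x /=; rewrite in_itv/= => /andP[ux xu]; rewrite lee_fin.
  rewrite !normal_pdf_neq0E// ler_wpM2l ?normal_peak_ge0//.
  rewrite ler_expR !subr0 !mulNr lerN2 ler_wpM2r ?invr_ge0 ?mulrn_wge0 ?sqr_ge0//.
  by rewrite -[x ^+ 2]sqrrN lerXn2r ?nnegrE; lra.
Qed.

(** Chernoff's bound with the optimal parameter: beyond [u] the weight [expR (u * x - u ^ 2)] is at
    least 1. *)
Lemma normal_tail u : 0 <= u -> (normal_prob 0 (1:R) `]u, +oo[ <= (expR (- (u ^+ 2) / 2))%:E)%E.
Proof.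
move=> u0; pose g x := expR (u * x) * expR (- u ^+ 2).
have mg : measurable_fun setT (fun x : R => expR (u * x)).
  by apply: measurableT_comp => //; exact: measurable_funM.
apply: (@le_trans _ _ (\int[normal_prob 0 (1:R)]_x (g x)%:E)%E); last first.
  under eq_integral do rewrite /g EFinM.
  rewrite ge0_integralZr//; try (by move=> x _; rewrite lee_fin expR_ge0);
    try (by rewrite lee_fin expR_ge0); try exact/measurable_EFinP.
  rewrite normal_mgf// -EFinM -expRD lee_fin ler_expR; lra.
rewrite -[X in (X <= _)%E]mul1e -integral_cst//= [leLHS]integral_mkcond.
apply: ge0_le_integral => //.
- by move=> x _; rewrite patchE; case: ifP.
- by apply/(measurable_restrictT _ _).1.
- by apply/measurable_EFinP; apply: measurable_funM.
- move=> x _; rewrite patchE; case: ifPn => [|_]; last by rewrite lee_fin mulr_ge0 ?expR_ge0.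
  move=> /set_mem /=; rewrite in_itv/= andbT => ux; rewrite lee_fin /g -expRD -[leLHS]expR0 ler_expR.
  by rewrite expr2; nra.
Qed.

Context d (T : measurableType d) (P : probability T R).

Definition above (J : finType) (X : J -> T -> R) (c : R) : set T := [set w | forall j, c < X j w].

Lemma linc_delta (J : finType) (k : J) (x : J -> R) : linc (delta k) x = x k.
Proof.
rewrite /linc (bigD1 k)//= /delta eqxx mul1r big1 ?addr0// => j /negPf ->.
by rewrite mul0r.
Qed.

Lemma quad_delta (J : finType) (S : J -> J -> R) k : quad S (delta k) = S k k.
Proof.
rewrite /quad (bigD1 k)//= [X in _ + X]big1 ?addr0; last first.
  by move=> i ik; rewrite big1// => j _; rewrite /delta (negPf ik) !mul0r.
rewrite (bigD1 k)//= big1 ?addr0 => [|i ik]; first by rewrite /delta eqxx !mul1r.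
by rewrite {2}/delta (negPf ik) mulr0 mul0r.
Qed.

Lemma gauss_vec_tail (J : finType) (X : J -> T -> R) S (j : J) (v u : R) :
  gauss_vec P X S -> S j j <= v -> 0 < v -> 0 <= u ->
  Pr P [set w | u < X j w] <= expR (- (u ^+ 2) / (2 * v)).
Proof.
move=> gX Sv v0 u0.
have mj : measurable [set w | u < X j w].
  by apply: (@measurable_lt_set _ _ _ (cst u)) => //; exact: gX.1.
(* The characteristic function of the coordinate at 1 is [expR (- S j j / 2)], and it is at most
   1. *)
have Sjj : 0 <= S j j.
  have := gX.2 (delta j) 0; rewrite quad_delta cos0 mulr1 => h.
  rewrite leNgt; apply/negP => S0.
  have : \int[P]_w cos (linc (delta j) (X^~ w) + 0) <= 1.
    rewrite -[leRHS](_ : \int[P]_w (cst 1 w) = 1); last by rewrite Rintegral_cst//= probability_setT mulr1.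
    apply: le_Rintegral => //.
    - apply: (@bounded_integrable _ _ _ _ _ 1); last by move=> x; exact: cos_max.
      apply: measurableT_comp; first exact: continuous_measurable_fun (@continuous_cos R).
      apply: measurable_funD => //; apply: measurable_sum => i.
      by apply: measurable_funM => //; exact: gX.1.
    - by apply: (@bounded_integrable _ _ _ _ _ 1) => // x; rewrite normr1.
    - by move=> x _; exact: cos_le1.
  by rewrite h leNgt expR_gt1 divr_gt0// oppr_gt0.
pose q := Num.sqrt (S j j).
have one0 : (1 : R) != 0 by rewrite oner_eq0.
have gZ := gauss_vec_rank1 (fun _ : 'I_1 => q) one0.
have gXj : gauss_vec P (fun (_ : 'I_1) w => X j w) (fun _ _ => S j j).
  have := gauss_vec_image (fun _ : 'I_1 => delta j) gX; congr gauss_vec.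
    by apply/funext => k; apply/funext => w; rewrite linc_delta.
  by apply/funext => k; apply/funext => l; rewrite -[RHS]quad_delta.
have qE a : quad (fun _ _ : 'I_1 => S j j) a = quad (fun i j : 'I_1 => 1 ^+ 2 * (q * q)) a.
  by congr quad; apply/funext => k; apply/funext => l; rewrite expr1n mul1r -expr2 sqr_sqrtr.
have := gauss_vec_unique (fun _ : 'I_1 => fun=> 1) (fun=> u) gXj gZ qE.
have l1 (x : R) : linc (fun _ : 'I_1 => 1) (fun=> x) = x by rewrite /linc big_ord1 mul1r.
rewrite (_ : [set w | _] = [set w | u < X j w]); last first.
  by apply/seteqP; split => w /=; [move=> /(_ ord0); rewrite l1|move=> h k; rewrite l1].
rewrite (_ : [set w | forall k, u < linc _ _] = [set x | u < q * x]); last first.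
  by apply/seteqP; split => w /=; [move=> /(_ ord0); rewrite l1|move=> h k; rewrite l1].
move=> E; rewrite -lee_fin PrK//; move: E => ->.
have [q0|qn0] := eqVneq q 0.
  rewrite (_ : [set x | _] = set0) ?measure0 ?lee_fin ?expR_ge0//.
  by rewrite -subset0 => x /=; rewrite q0 mul0r ltNge u0.
have q0 : 0 < q by rewrite lt_neqAle eq_sym qn0 sqrtr_ge0.
rewrite (_ : [set x | _] = `]u / q, +oo[%classic); last first.
  by apply/seteqP; split => x /=; rewrite in_itv/= andbT ltr_pdivrMr// mulrC.
apply: (le_trans (normal_tail _)); first by rewrite divr_ge0// ltW.
rewrite lee_fin ler_expR !mulNr lerN2.
have -> : (u / q) ^+ 2 / 2 = u ^+ 2 / (2 * q ^+ 2) by field; rewrite gt_eqF.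
rewrite ler_wpM2l ?sqr_ge0// lef_pV2 ?posrE ?mulr_gt0 ?exprn_gt0// ler_pM2l//.
by rewrite sqr_sqrtr.
Qed.

End tails.

(** * Repulsion for a Gaussian vector with an independent component *)

Section repulsion.
Context {R : realType}.

(* The exponential moment is the Chernoff weight that rules out both a high
   mean and, for a low mean, the absence of a point below zero. *)
Lemma chernoff_weight (v s l b : R) : 0 < v -> 0 < s -> s <= l -> v <= 2 * l * s ->
  let p := normal_pdf 0 (Num.sqrt v) (l + s + 1) in p <= 1 ->
  (\int[normal_prob 0 (Num.sqrt v)]_x
     (((0 < x + b)%R)%:R * expR (- (p / (2 * l)) * (x + b - l)))%:E
   <= (expR (- (p * s / (4 * l))))%:E)%E.
Proof.
move=> v0 s0 sl vls p p1; set sg := Num.sqrt v.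
have sg0 : sg != 0 by rewrite gt_eqF// sqrtr_gt0.
have l0 : 0 < l by exact: lt_le_trans sl.
have p0 : 0 <= p by exact: normal_pdf_ge0.
set t := p / (2 * l).
have t0 : 0 <= t by rewrite divr_ge0// mulr_ge0// ltW.
have mi : measurable_fun setT (fun x : R => (((0 < x + b)%R)%:R : R)).
  rewrite (_ : (fun x => _) = \1_[set x | 0 < x + b]); last first.
    by apply/funext => x; rewrite indicE mem_setE.
  by apply: measurable_indic; apply: (@measurable_lt_set _ _ _ (cst 0)) => //; exact: measurable_funD.
have me : measurable_fun setT (fun x : R => expR (- t * (x + b - l))).
  by apply: measurableT_comp => //; apply: measurable_funM => //; apply: measurable_funB => //; exact: measurable_funD.
have [bl|bl] := leP (l + s) b.
(* For a high shift the indicator is dropped. By [v <= 2 * l * s] and [p <= 1] one has [t * v <= s],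
   so the quadratic term of the exponential moment eats at most half of the linear gain [t * s]. *)
- apply: (@le_trans _ _ (\int[normal_prob 0 sg]_x (expR (- t * x) * expR (- t * (b - l)))%:E)%E).
    apply: ge0_le_integral => //.
    + by apply/measurable_EFinP; exact: measurable_funM.
    + apply/measurable_EFinP; apply: measurable_funM => //.
      by apply: measurableT_comp => //; exact: measurable_funM.
    + move=> x _; rewrite lee_fin -expRD -mulrDr addrA.
      by case: (0 < x + b); rewrite ?mul1r// mul0r expR_ge0.
  under eq_integral do rewrite EFinM.
  rewrite ge0_integralZr//; try (by move=> x _; rewrite lee_fin expR_ge0);
    try (by rewrite lee_fin expR_ge0);
    try (by apply/measurable_EFinP; apply: measurableT_comp => //; exact: measurable_funM).
  rewrite normal_mgf// -EFinM -expRD lee_fin ler_expR sqr_sqrtr ?(ltW v0)// sqrrN.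
  have tv : t * v <= s.
    rewrite /t mulrAC ler_pdivrMr ?mulr_gt0//.
    by rewrite (le_trans (_ : _ <= 1 * v)) ?ler_wpM2r ?(ltW v0)// mul1r mulrC.
  have -> : p * s / (4 * l) = t * s / 2 by rewrite /t; field; rewrite gt_eqF.
  have h : t * (b - l) >= t * s by rewrite ler_wpM2l//; lra.
  have h2 : t * (t * v) <= t * s by rewrite ler_wpM2l.
  by rewrite expr2 mulNr; lra.
(* For a low shift the variable is negative with probability at least [p]. On the remaining event
   the weight is at most [expR (t * l) = expR (p / 2)], against a factor [1 - p <= expR (- p)]. *)
- apply: (@le_trans _ _ (\int[normal_prob 0 sg]_x ((expR (t * l))%:E * (\1_(~` `]-oo, (- (l + s))%R[) x)%:E))%E).
    apply: ge0_le_integral => //; try (by move=> x _; rewrite lee_fin mulr_ge0 ?expR_ge0);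
      try (by apply/measurable_EFinP; exact: measurable_funM).
    + apply: emeasurable_funM => //; apply/measurable_EFinP; apply: measurable_indic.
      by apply: measurableC.
    + move=> x _; rewrite -EFinM lee_fin.
      have [xb|xb] := ltP 0 (x + b); last by rewrite mul0r mulr_ge0 ?expR_ge0.
      rewrite mul1r indicE mem_set ?mulr1; last first.
        by rewrite /= in_itv/=; apply/negP; rewrite -leNgt; lra.
      by rewrite ler_expR mulNr -mulrN ler_wpM2l//; lra.
  rewrite ge0_integralZl//; try (by move=> x _; rewrite lee_fin);
    try (by rewrite lee_fin expR_ge0);
    try (by apply/measurable_EFinP; apply: measurable_indic; exact: measurableC).
  rewrite integral_indic//; last exact: measurableC.
  rewrite setIT [X in (_ * X <= _)%E](_ : _ = (Pr (normal_prob 0 sg) (~` `]-oo, (- (l + s))%R[))%:E); last first.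
    by rewrite PrK//; exact: measurableC.
  rewrite PrC// -EFinM lee_fin.
  have q1 : Pr (normal_prob 0 sg) `]-oo, (- (l + s))%R[ >= p.
    by rewrite -lee_fin PrK// normal_prob_lt// addr_ge0// ltW.
  apply: (@le_trans _ _ (expR (t * l) * (1 - p))); first by rewrite ler_wpM2l ?expR_ge0// lerD2l lerN2.
  apply: (@le_trans _ _ (expR (t * l) * expR (- p))).
    by rewrite ler_wpM2l ?expR_ge0// expR_ge1Dx.
  rewrite -expRD ler_expR.
  have -> : t * l = p / 2 by rewrite /t; field; rewrite gt_eqF.
  have : p * s / (4 * l) <= p / 4.
    rewrite invfM mulrA ler_pdivrMr// mulrAC -mulrA -mulrA ler_wpM2l//.
    by rewrite mulrC ler_pdivlMl//; lra.
  lra.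
Qed.

(** An independent [Y] with covariance [Se] lifts the covariance of [X] above [v] times the
    identity, so [X + Y] has the law of [H + W] with [W] i.i.d. of variance [v]. All coordinates of
    [Y] are below [s] in absolute value with probability at least one half, which is the origin of
    the factor 2. The multiples of [s] added to [l] pay for [Y] and for the shift that restores
    positivity. *)
Lemma repulsion_upper d (T : measurableType d) (P : probability T R) (J : finType)
    (X : J -> T -> R) S Se (v eta s l : R) :
  gauss_vec P X S -> (forall i j, S i j = S j i) ->
  (forall i j, Se i j = Se j i) -> psd Se -> (forall j, Se j j <= eta) -> 0 < eta ->
  (forall a, v * \sum_j a j ^+ 2 <= quad S a + quad Se a) ->
  0 < v -> 0 < s -> 0 <= l -> v <= 2 * (l + 3 * s) * s ->
  2 * #|J|%:R * expR (- s ^+ 2 / (8 * eta)) <= 2^-1 ->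
  let p := normal_pdf 0 (Num.sqrt v) (l + 4 * s + 1) in p <= 1 ->
  Pr P [set w | (forall j, 0 <= X j w) /\ \sum_j X j w <= #|J|%:R * l] <=
  2 * expR (- (#|J|%:R * (p * s / (4 * (l + 3 * s))))).
Proof.
move=> gX symS symSe pSe Seta eta0 vS v0 s0 l0 vls Ns p p1.
have [dY [TY [PY [Y gY]]]] := gauss_vec_exists symSe pSe.
(* What is left of the covariance of [X + Y] once the i.i.d. part is removed. *)
pose Sh i j := S i j + Se i j + (- v) * (i == j)%:R.
have diagE (k : R) a : quad (fun i j : J => k * (i == j)%:R) a = k * \sum_j a j ^+ 2.
  rewrite /quad mulr_sumr; apply: eq_bigr => i _; rewrite (bigD1 i)//= eqxx mulr1 big1 ?addr0.
    by rewrite expr2 mulrC.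
  by move=> j ji; rewrite eq_sym (negPf ji) !mulr0.
have quadSh a : quad Sh a = quad S a + quad Se a - v * \sum_j a j ^+ 2.
  by rewrite /Sh !quadD diagE mulNr.
have [dH [TH [PH [H gH]]]] : exists d (T : measurableType d) (P : probability T R) (X : J -> T -> R), gauss_vec P X Sh.
  apply: gauss_vec_exists.
    by move=> i j; rewrite /Sh symS symSe eq_sym.
  by move=> a; rewrite quadSh subr_ge0.
have sg0 : Num.sqrt v != 0 by rewrite gt_eqF// sqrtr_gt0.
have [dW [TW [PW [W [gW HW]]]]] := iid_normal_exists J sg0.
have gXY := gauss_vecD gX gY.
have gHW := gauss_vecD gH gW.
have quadE a : quad (fun i j => S i j + Se i j) a =
    quad (fun i j => Sh i j + Num.sqrt v ^+ 2 * (i == j)%:R) a.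
  transitivity (quad S a + quad Se a); first by rewrite quadD.
  by rewrite (quadD Sh) quadSh diagE sqr_sqrtr ?(ltW v0)// subrK.
(* half-spaces: each coordinate is above [-s] and minus the sum is above [- N (l + 2 s)] *)
pose N : R := #|J|%:R.
pose A (k : option J) : J -> R := if k is Some j then delta j else (fun=> -1).
pose c (k : option J) : R := if k is Some j then - s else - (N * (l + 2 * s)).
have HE (x : J -> R) : (forall k, c k < linc (A k) x) <->
   ((forall j, - s < x j) /\ \sum_j x j < N * (l + 2 * s)).
  have lN : linc (fun=> -1) x = - \sum_j x j.
    by rewrite /linc -sumrN; apply: eq_bigr => j _; rewrite mulN1r.
  split=> [h|[h1 h2] [j|]].
  - by split=> [j|]; [have := h (Some j)|have := h None]; rewrite /= ?linc_delta// lN ltrN2.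
  - by rewrite /= linc_delta.
  - by rewrite /= lN ltrN2.
have U := gauss_vec_unique A c gXY gHW quadE.
set E := [set w | _ /\ _].
have mX := gX.1; have mY := gY.1; have mH := gH.1; have mW := gW.1.
have mE : measurable E.
  rewrite (_ : E = \bigcap_(j in [set: J]) ~` [set w | X j w < 0] `&` ~` [set w | N * l < \sum_j X j w]).
    apply: measurableI.
      apply: fin_bigcap_measurable => // j _; apply: measurableC.
      exact: (@measurable_lt_set _ _ _ (X j) (cst 0)).
    apply: measurableC; apply: (@measurable_lt_set _ _ _ (cst (N * l))) => //.
    exact: measurable_sum.
  apply/seteqP; split => w /=.
    by move=> [h1 h2]; split=> [j _|]; apply/negP; rewrite -leNgt.
  by move=> [h1 h2]; split=> [j|]; [have /negP := h1 j I|move/negP : h2]; rewrite -leNgt.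
have [J0|Jn0] := posnP #|J|.
  by rewrite (le_trans (Pr_le1 _ mE))// J0 mul0r oppr0 expR0; lra.
pose G := [set y | forall j, (Y j y < s)%R /\ (- s < Y j y)%R].
have mG : measurable G.
  rewrite (_ : G = \bigcap_(j in [set: J]) ([set w | Y j w < s] `&` [set w | - s < Y j w])).
    apply: fin_bigcap_measurable => // j _; apply: measurableI.
      exact: (@measurable_lt_set _ _ _ (Y j) (cst s)).
    exact: (@measurable_lt_set _ _ _ (cst (- s))).
  by apply/seteqP; split => w /=; [move=> h j _; exact: h|move=> h j; exact: h].
have G2 : 2^-1 <= Pr PY G.
  suff : Pr PY (~` G) <= 2^-1 by rewrite PrC//; lra.
  (* Tails are taken at [s / 2], which turns the weak inequalities of the complement into strict
     ones and is the origin of the 8 in the union bound. *)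
  have mB j : measurable ([set y | s / 2 < Y j y] `|` [set y | s / 2 < - Y j y]).
    apply: measurableU; apply: (@measurable_lt_set _ _ _ (cst (s / 2))) => //.
    exact: measurable_funN.
  have UB : Pr PY (~` G) <= \sum_j Pr PY ([set y | s / 2 < Y j y] `|` [set y | s / 2 < - Y j y]).
    apply: (Pr_union PY mB (measurableC mG)) => y; rewrite /G /= => /existsNP[j /not_andP h]; exists j.
    by case: h => /negP; rewrite -leNgt => h; [left|right] => /=; move: h s0; clear; lra.
  apply: (le_trans UB); apply: le_trans Ns; set ee := expR _.
  have -> : 2 * #|J|%:R * ee = \sum_(j : J) (2 * ee) by rewrite sumr_const -mulr_natr; ring.
  apply: ler_sum => j _; apply: (le_trans (PrU2 _ _ _)).
  - by apply: (@measurable_lt_set _ _ _ (cst (s / 2))).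
  - by apply: (@measurable_lt_set _ _ _ (cst (s / 2))) => //; exact: measurable_funN.
  have eE : - s ^+ 2 / (8 * eta) = - ((s / 2) ^+ 2) / (2 * eta).
    by field; rewrite gt_eqF.
  have s20 : 0 <= s / 2 by rewrite divr_ge0// ltW.
  rewrite /ee eE mulrDl mul1r; apply: lerD; first exact: gauss_vec_tail gY (Seta j) eta0 s20.
  have gNY := gauss_vec_image (fun k j => - delta k j) gY.
  have : (fun k l : J => \sum_i \sum_j (- delta k i) * (- delta l j) * Se i j) j j <= eta.
    rewrite -[leLHS]/(quad Se (fun i => - delta j i)).
    suff -> : quad Se (fun i => - delta j i) = Se j j by [].
    by rewrite -(quad_delta Se) /quad; apply: eq_bigr => i _; apply: eq_bigr => k _; rewrite mulrNN.
  move=> Sj; have := gauss_vec_tail gNY Sj eta0 s20; apply: le_trans.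
  rewrite le_eqVlt; apply/orP; left; apply/eqP; congr Pr.
  have E0 w : linc (fun k => - delta j k) (Y ^~ w) = - Y j w.
    by rewrite -[in RHS](linc_delta j (Y ^~ w)) /linc -sumrN; apply: eq_bigr => k _; rewrite mulNr.
  by apply/seteqP; split=> w /=; rewrite E0.
have mHS : measurable [set w | forall k, c k < linc (A k) (fun j => H j w.1 + W j w.2)].
  exact: (measurable_halfspaces A c gHW.1).
have mXS : measurable [set w | forall k, c k < linc (A k) (fun j => X j w.1 + Y j w.2)].
  exact: (measurable_halfspaces A c gXY.1).
have step1 : Pr P E * Pr PY G <=
    Pr (PH \x PW)%E [set w | forall k, c k < linc (A k) (fun j => H j w.1 + W j w.2)].
  rewrite -Pr_prod//.
  rewrite [leRHS](_ : _ = Pr (P \x PY)%E [set w | forall k, c k < linc (A k) (fun j => X j w.1 + Y j w.2)]); last by rewrite /Pr U.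
  apply: Pr_le => //; first exact: measurableX.
  move=> [x y] [/= [X0 Xl] Gy]; apply/HE; split.
    by move=> j; move: (X0 j) (Gy j).2; clear; lra.
  rewrite big_split/=; have h1 : \sum_j Y j y <= N * s.
    rewrite /N mulr_natl -sumr_const; apply: ler_sum => j _.
    by have [/ltW] := Gy j.
  have h2 : 0 < N * s by rewrite mulr_gt0// ltr0n.
  by move: Xl h1 h2; rewrite -/N; clear; lra.
(* The event only says that coordinates exceed [- s] and have mean below [l + 2 * s]. Raising them
   by [s] makes them positive and the mean less than [l']. *)
pose l' := l + 3 * s; pose C := expR (- (p * s / (4 * l'))).
have l'0 : 0 < l' by rewrite /l'; lra.
pose psi x := ((0 < x + s)%R)%:R * expR (- (p / (2 * l')) * (x + s - l')).
have psi0 x : 0 <= psi x by rewrite mulr_ge0 ?expR_ge0.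
have mpsi : measurable_fun setT psi.
  apply: measurable_funM.
    rewrite (_ : (fun x => _) = \1_[set x | 0 < x + s]); last first.
      by apply/funext => x; rewrite indicE mem_setE.
    by apply: measurable_indic; apply: (@measurable_lt_set _ _ _ (cst 0)) => //; exact: measurable_funD.
  apply: measurableT_comp => //; apply: measurable_funM => //; apply: measurable_funB => //.
  exact: measurable_funD.
have sl' : s <= l' by rewrite /l'; lra.
have pE : l' + s + 1 = l + 4 * s + 1 by rewrite /l'; ring.
have HC b : (\int[normal_prob 0 (Num.sqrt v)]_x (psi (x + b))%:E <= C%:E)%E.
  have := @chernoff_weight v s l' (b + s) v0 s0 sl' vls; rewrite pE => /(_ p1).
  apply: le_trans; rewrite le_eqVlt; apply/orP; left; apply/eqP.
  by apply: eq_integral => x _; rewrite /psi -/p !addrA.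
have C0 : 0 <= C by exact: expR_ge0.
have HWC := HW psi C mpsi psi0 C0 HC.
have step2 : Pr (PH \x PW)%E [set w | forall k, c k < linc (A k) (fun j => H j w.1 + W j w.2)] <= C ^+ #|J|.
  rewrite -lee_fin PrK//.
  (* On the event all indicators equal 1 and the exponents add up to a nonnegative number, so the
     product of the weights dominates the indicator of the event. With [H] held fixed, its integral
     factorises over [W]. *)
  pose F z := (\prod_j psi (W j z.2 + H j z.1))%:E.
  have mF : measurable_fun setT F.
    apply/measurable_EFinP; apply: measurable_prod => j _; apply: measurableT_comp => //.
    apply: measurable_funD.
      exact: measurableT_comp (mW j) measurable_snd.
    exact: measurableT_comp (mH j) measurable_fst.
  have F0 z : (0 <= F z)%E by rewrite lee_fin prodr_ge0.
  apply: (@le_trans _ _ (\int[(PH \x PW)%E]_z F z)%E).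
    set AS := [set w | _] in mHS *; rewrite [leLHS](_ : _ = \int[(PH \x PW)%E]_z (\1_AS z)%:E)%E; last by rewrite integral_indic// setIT.
    apply: ge0_le_integral => //.
      by apply/measurable_EFinP; exact: measurable_indic.
    move=> z _; rewrite lee_fin indicE.
    have [|_] := boolP (z \in _); last by rewrite prodr_ge0.
    move=> /set_mem/HE[h1 h2].
    rewrite big_split/= big1 ?mul1r; last first.
      by move=> j _; have -> : 0 < W j z.2 + H j z.1 + s by move: (h1 j); clear; lra.
    rewrite -expR_sum -[leLHS]expR0 ler_expR -mulr_sumr mulNr oppr_ge0 mulr_ge0_le0//.
      by rewrite divr_ge0 ?normal_pdf_ge0// mulr_ge0// ltW.
    have -> : \sum_j (W j z.2 + H j z.1 + s - l') = \sum_j (H j z.1 + W j z.2) + N * (s - l').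
      by rewrite /N mulr_natl -sumr_const -big_split/=; apply: eq_bigr => j _; ring.
    by move: h2; rewrite /l'; clear; lra.
  rewrite [leLHS](_ : _ = \int[PH]_x fubini_F PW F x)%E; last exact: fubini_tonelli1.
  have mFF := measurable_fun_fubini_tonelli_F (m2 := PW) F mF F0.
  apply: (@le_trans _ _ (\int[PH]_x (C ^+ #|J|)%:E)%E); last first.
    by rewrite integral_cst//= probability_setT mule1.
  apply: ge0_le_integral => //.
    by move=> x _; apply: integral_ge0 => y _.
  move=> y _; rewrite -[leLHS]/(\int[PW]_w (\prod_j psi (W j w + H j y))%:E)%E.
  exact: HWC.
have CE : C ^+ #|J| = expR (- (N * (p * s / (4 * l')))).
  by rewrite /C -expRM_natl mulrN.
rewrite -/N -/l' -CE.
have := le_trans step1 step2; have := Pr_ge0 P E.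
set x := Pr P E; set y := Pr PY G in G2 *; set z := C ^+ _ => x0 xyz.
have : x * 2^-1 <= x * y by rewrite ler_wpM2l.
by move: xyz; clear; lra.
Qed.

End repulsion.

(** * Persistence, Fernique's inequality and averaging over shifts *)

Section persistence.
Context {R : realType}.

Let half_compl (y : R) : 1 - y <= 2^-1 -> 2^-1 <= y.
Proof. lra. Qed.

Let double_compl (y : R) : 3 / 4 <= y -> 1 - y + (1 - y) <= 2^-1.
Proof. lra. Qed.

(* [X] is distributed as [X' + Z u] with [Z] standard normal, and is positive as
   soon as [X' > - s] and [Z > s / w0]. *)
Lemma persist_lower d (T : measurableType d) (P : probability T R) (J : finType)
    (X : J -> T -> R) S (u : J -> R) (w0 s : R) :
  gauss_vec P X S -> (forall i j, S i j = S j i) ->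
  (forall a, linc a u ^+ 2 <= quad S a) -> 0 < w0 -> (forall j, w0 <= u j) -> 0 < s ->
  3 / 4 <= Pr P (above X (- s)) ->
  2^-1 * normal_pdf 0 1 (s / w0 + 1) <= Pr P (above X 0).
Proof.
move=> gX symS uS w00 uw s0 PX.
pose S' i j := S i j + (-1) * (u i * u j).
have quadS' a : quad S' a = quad S a - linc a u ^+ 2 by rewrite /S' quadD quad_rank1 mulN1r.
have [dY [TY [PY [Y gY]]]] : exists d (T : measurableType d) (P : probability T R) (X : J -> T -> R), gauss_vec P X S'.
  apply: gauss_vec_exists => [i j|a]; first by rewrite /S' symS [u i * _]mulrC.
  by rewrite quadS' subr_ge0.
have one0 : (1 : R) != 0 by rewrite oner_eq0.
have gP := gauss_vecD gY (gauss_vec_rank1 u one0).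
have gM := gauss_vecD gY (gauss_vec_rank1 (fun j => - u j) one0).
pose Q := normal_prob 0 (1 : R).
have mab dd (TT : measurableType dd) (Z : J -> TT -> R) c : (forall j, measurable_fun setT (Z j)) -> measurable (above Z c).
  move=> mZ; rewrite (_ : above Z c = \bigcap_(j in [set: J]) [set w | c < Z j w]).
    apply: fin_bigcap_measurable => // j _; exact: (@measurable_lt_set _ _ _ (cst c)).
  by apply/seteqP; split => w /=; [move=> h j _; exact: h|move=> h j; exact: h].
have EQ dd (TT : measurableType dd) (PP : probability TT R) (Z : J -> TT -> R) SS c :
    gauss_vec PP Z SS -> (forall a, quad S a = quad SS a) -> Pr P (above X c) = Pr PP (above Z c).
  move=> gZ SE; have := gauss_vec_unique (@delta R J) (fun=> c) gX gZ SE.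
  have ab dd' (TT' : measurableType dd') (Z' : J -> TT' -> R) :
      [set w | forall k, c < linc (delta k) (Z' ^~ w)] = above Z' c.
    by apply/seteqP; split => w /= h k; have := h k; rewrite linc_delta.
  by rewrite !ab /Pr => ->.
have qP a : quad S a = quad (fun i j => S' i j + 1 ^+ 2 * (u i * u j)) a.
  by rewrite (quadD S') quadS' quad_rank1 expr1n mul1r subrK.
have qM a : quad S a = quad (fun i j => S' i j + 1 ^+ 2 * (- u i * - u j)) a.
  rewrite (quadD S') quadS' quad_rank1 expr1n mul1r.
  have -> : linc a (fun j => - u j) = - linc a u by rewrite /linc -sumrN; apply: eq_bigr => j _; rewrite mulrN.
  by rewrite sqrrN subrK.
have mY := mab _ _ Y (- s) gY.1.
(* [Y + Z u] and [Y - Z u] are both distributed as [X], and [Y] is their average. It exceeds [- s]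
   as soon as both do, which fails with probability at most [1/4 + 1/4]. *)
have Y2 : 2^-1 <= Pr PY (above Y (- s)).
  have mP := mab _ _ _ (- s) gP.1; have mM := mab _ _ _ (- s) gM.1.
  have eP := EQ _ _ _ _ _ (- s) gP qP; have eM := EQ _ _ _ _ _ (- s) gM qM.
  have := Pr_prod PY Q mY measurableT.
  rewrite PrT mulr1 => <-.
  suff : Pr (PY \x Q)%E (~` (above Y (- s) `*` setT)) <= 2^-1.
    rewrite PrC; last exact: measurableX.
    exact: half_compl.
  apply: (@le_trans _ _ (Pr (PY \x Q)%E (~` above (fun j z => Y j z.1 + u j * z.2) (- s))
     + Pr (PY \x Q)%E (~` above (fun j z => Y j z.1 + - u j * z.2) (- s)))); last first.
    rewrite (PrC _ mP) (PrC _ mM) -eP -eM.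
    exact: double_compl PX.
  apply: (le_trans (Pr_le _ _ _ _) (PrU2 _ _ _)); try exact: measurableC.
  - by apply: measurableC; exact: measurableX.
  - by apply: measurableU; exact: measurableC.
  - move=> [y z] /= h; apply/not_andP => -[h1 h2]; apply: h; split => // j.
    by move: (h1 j) (h2 j) => /=; clear; lra.
rewrite (EQ _ _ _ _ _ 0 gP qP).
have mz : measurable (`]s / w0, +oo[%classic : set (measurableTypeR R)) by exact: measurable_itv.
apply: (@le_trans _ _ (Pr (PY \x Q)%E (above Y (- s) `*` `]s / w0, +oo[%classic))).
  rewrite Pr_prod//; apply: ler_pM => //; first exact: normal_pdf_ge0.
  by rewrite -lee_fin PrK// normal_prob_gt// divr_ge0// ltW.
apply: Pr_le; [exact: measurableX|exact: (mab _ _ _ 0 gP.1)|].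
move=> [y z] [/= hy]; rewrite in_itv/= andbT ltr_pdivrMr// => hz j /=.
have z0 : 0 < z by rewrite -(pmulr_lgt0 _ w00) (lt_trans s0).
have : z * w0 <= u j * z by rewrite mulrC ler_wpM2r// ltW.
by move: (hy j) hz => /=; clear; lra.
Qed.

Definition within d (T : measurableType d) (J : finType) (X : J -> T -> R) (t : R) : set T :=
  [set w | forall j, - t < X j w < t].

Lemma measurable_within d (T : measurableType d) (J : finType) (X : J -> T -> R) t :
  (forall j, measurable_fun setT (X j)) -> measurable (within X t).
Proof.
move=> mX; rewrite (_ : within X t = \bigcap_(j in [set: J]) ([set w | X j w < t] `&` [set w | - t < X j w])).
  apply: fin_bigcap_measurable => // j _; apply: measurableI.
    exact: (@measurable_lt_set _ _ _ (X j) (cst t)).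
  exact: (@measurable_lt_set _ _ _ (cst (- t))).
apply/seteqP; split => w /=; first by move=> h j _; have /andP[] := h j.
by move=> h j; have [h1 h2] := h j I; apply/andP.
Qed.

(** A two-sided constraint is a pair of half-spaces. Fernique's step imposes two different levels
    and sometimes constrains only half of the coordinates, whence a level [t j] for each coordinate
    and the selection [D]. *)
Lemma gauss_vec_within_unique (J : finType) d1 (T1 : measurableType d1) (P1 : probability T1 R)
    d2 (T2 : measurableType d2) (P2 : probability T2 R) (X : J -> T1 -> R) (Y : J -> T2 -> R) S S'
    (t : J -> R) (D : pred J) :
  gauss_vec P1 X S -> gauss_vec P2 Y S' -> (forall a, quad S a = quad S' a) ->
  Pr P1 [set w | forall j, D j -> - t j < X j w < t j] =
  Pr P2 [set w | forall j, D j -> - t j < Y j w < t j].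
Proof.
move=> gX gY SE.
pose A (k : {j | D j} * bool) : J -> R := fun j => (if k.2 then 1 else -1) * delta (sval k.1) j.
pose c (k : {j | D j} * bool) : R := - t (sval k.1).
have := gauss_vec_unique A c gX gY SE.
have E d (T : measurableType d) (Z : J -> T -> R) :
   [set w | forall k, c k < linc (A k) (Z ^~ w)] = [set w | forall j, D j -> - t j < Z j w < t j].
  have lA k x : linc (A k) x = (if k.2 then 1 else -1) * x (sval k.1).
    by rewrite -[in RHS]linc_delta /linc mulr_sumr; apply: eq_bigr => j _; rewrite mulrA.
  apply/seteqP; split => w /= h.
    move=> j Dj; have := h (exist _ j Dj, true); have := h (exist _ j Dj, false).
    by rewrite !lA /c /= mul1r mulN1r ltrN2 => -> ->.
  move=> [[j Dj] b]; rewrite lA /c /=; have /andP[h1 h2] := h j Dj.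
  by case: b; rewrite ?mul1r// mulN1r ltrN2.
by rewrite !E /Pr => ->.
Qed.

(* [(X + X') / sqrt 2] and [(X - X') / sqrt 2] are independent copies of [X]: if
   one is large and the other small, then both [X] and [X'] are large. *)
Lemma fernique_step d (T : measurableType d) (P : probability T R) (J : finType)
    (X : J -> T -> R) S (s0 t : R) : gauss_vec P X S -> 0 < s0 -> 2 * s0 <= t ->
  4 / 5 <= Pr P (within X s0) ->
  5 / 4 * Pr P (~` within X (2 * t)) <= (5 / 4 * Pr P (~` within X t)) ^+ 2.
Proof.
move=> gX s00 st PX.
have mX := gX.1; have mw r := measurable_within r mX.
pose r := Num.sqrt (2 : R).
have r2 : r ^+ 2 = 2 by rewrite sqr_sqrtr.
have r0 : 0 < r by rewrite sqrtr_gt0.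
have r15 : r <= 3 / 2 by rewrite -[leRHS]ger0_norm// -sqrtr_sqr ler_sqrt ?sqr_ge0//; lra.
pose K := (J + J)%type.
(* [B1], [B2] read off the pair of independent copies; [C1], [C2] read off its rotation by 45
   degrees, the difference in the left summand and the sum in the right one. By the parallelogram
   identity [qE] the two families have the same covariance. *)
pose B1 (k : K) : J -> R := match k with inl j => delta j | inr _ => fun=> 0 end.
pose B2 (k : K) : J -> R := match k with inl _ => fun=> 0 | inr j => delta j end.
pose C1 (k : K) : J -> R := match k with inl j => fun i => r^-1 * delta j i | inr j => fun i => r^-1 * delta j i end.
pose C2 (k : K) : J -> R := match k with inl j => fun i => - r^-1 * delta j i | inr j => fun i => r^-1 * delta j i end.
have gB := gauss_vecD (gauss_vec_image B1 gX) (gauss_vec_image B2 gX).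
have gC := gauss_vecD (gauss_vec_image C1 gX) (gauss_vec_image C2 gX).
have lz c j (x : J -> R) : linc (fun i => c * delta j i) x = c * x j.
  by rewrite -[in RHS](linc_delta j x) /linc mulr_sumr; apply: eq_bigr => i _; rewrite mulrA.
have l00 (x : J -> R) : linc (fun=> 0) x = 0 by rewrite /linc big1// => j _; rewrite mul0r.
have qE a : quad (fun k l => (\sum_i \sum_j B1 k i * B1 l j * S i j) + (\sum_i \sum_j B2 k i * B2 l j * S i j)) a =
    quad (fun k l => (\sum_i \sum_j C1 k i * C1 l j * S i j) + (\sum_i \sum_j C2 k i * C2 l j * S i j)) a.
  rewrite !quadD !quad_image.
  pose x j := a (inl j); pose y j := a (inr j).
  have sd (b : J -> R) j : \sum_k b k * delta k j = b j.
    rewrite (bigD1 j)//= /delta eqxx mulr1 big1 ?addr0// => i /negPf ij.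
    by rewrite eq_sym ij mulr0.
  have sS (F : K -> R) : \sum_k F k = \sum_j F (inl j) + \sum_j F (inr j) by rewrite big_sumType.
  have e1 : (fun j => \sum_k a k * B1 k j) = x.
    apply/funext => j; rewrite sS /= sd [X in _ + X]big1 ?addr0// => i _.
    by rewrite mulr0.
  have e2 : (fun j => \sum_k a k * B2 k j) = y.
    apply/funext => j; rewrite sS /= sd [X in X + _]big1 ?add0r// => i _.
    by rewrite mulr0.
  have e3 : (fun j => \sum_k a k * C1 k j) = (fun j => r^-1 * (x j + y j)).
    apply/funext => j; rewrite sS /=.
    under eq_bigr do rewrite mulrCA. under [X in _ + X]eq_bigr do rewrite mulrCA.
    by rewrite -!mulr_sumr !sd mulrDr.
  have e4 : (fun j => \sum_k a k * C2 k j) = (fun j => r^-1 * (y j - x j)).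
    apply/funext => j; rewrite sS /=.
    under eq_bigr do rewrite mulrCA. under [X in _ + X]eq_bigr do rewrite mulrCA.
    by rewrite -!mulr_sumr !sd mulNr addrC -mulrBr.
  rewrite e1 e2 e3 e4 /quad -!big_split/=; apply: eq_bigr => i _; rewrite -!big_split/=; apply: eq_bigr => j _.
  have : r^-1 * r^-1 = 2^-1 by rewrite -invfM -expr2 r2.
  set q := r^-1 => qq.
  have -> : q * (x i + y i) * (q * (x j + y j)) * S i j + q * (y i - x i) * (q * (y j - x j)) * S i j =
    q * q * 2 * (x i * x j * S i j + y i * y j * S i j) by ring.
  by rewrite qq mulVf// mul1r.
pose W (c : bool) (Z : K -> T * T -> R) := [set z | (forall j, - s0 < Z (inl j) z < s0) /\ (forall j, c -> - (2 * t) < Z (inr j) z < 2 * t)].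
have WE (c : bool) : Pr (P \x P)%E (W c (fun k z => linc (B1 k) (X ^~ z.1) + linc (B2 k) (X ^~ z.2))) =
   Pr (P \x P)%E (W c (fun k z => linc (C1 k) (X ^~ z.1) + linc (C2 k) (X ^~ z.2))).
  pose D (k : K) := match k with inl _ => true | inr _ => c end.
  pose tt (k : K) := match k with inl _ => s0 | inr _ => 2 * t end.
  have E (Z : K -> T * T -> R) : W c Z = [set z | forall k, D k -> - tt k < Z k z < tt k].
    apply/seteqP; split => z /=; first by move=> [h1 h2] [j|j] /= cc; [exact: h1|exact: h2].
    by move=> h; split => j; [exact: (h (inl j))|exact: (h (inr j))].
  by rewrite !E (gauss_vec_within_unique tt D gB gC qE).
have WB c : W c (fun k z => linc (B1 k) (X ^~ z.1) + linc (B2 k) (X ^~ z.2)) =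
    within X s0 `*` (if c then within X (2 * t) else setT).
  apply/seteqP; split => -[x y] /=.
    move=> [h1 h2]; split=> [j|]; first by have := h1 j; rewrite linc_delta l00 addr0.
    by case: c h2 => //= h2 j; have := h2 j isT; rewrite linc_delta l00 add0r.
  move=> [h1 h2]; split => j; first by rewrite linc_delta l00 addr0; exact: h1.
  by case: c h2 => //= h2 _; rewrite linc_delta l00 add0r; exact: h2.
pose V c := W c (fun k z => linc (C1 k) (X ^~ z.1) + linc (C2 k) (X ^~ z.2)).
have mV c : measurable (V c).
  rewrite (_ : V c = [set z | forall j, - s0 < linc (C1 (inl j)) (X ^~ z.1) + linc (C2 (inl j)) (X ^~ z.2) < s0] `&`
     (if c then [set z | forall j, - (2 * t) < linc (C1 (inr j)) (X ^~ z.1) + linc (C2 (inr j)) (X ^~ z.2) < 2 * t] else setT)).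
    apply: measurableI; first exact: (measurable_within s0 (fun j => gC.1 (inl j))).
    by case: c => //; exact: (measurable_within (2 * t) (fun j => gC.1 (inr j))).
  apply/seteqP; split => z /= -[h1 h2]; split => //; first by case: c h2 => //= h2 j; exact: h2.
  by move=> j; case: c h2 => //= h2 _; exact: h2.
have VT : V true `<=` V false by move=> z [h1 h2]; split.
have VD : V false `\` V true `<=` (~` within X t) `*` (~` within X t).
  move=> [x y] [[h1 _] h2].
  have [j hj] : exists j, ~ (- (2 * t) < linc (C1 (inr j)) (X ^~ x) + linc (C2 (inr j)) (X ^~ y) < 2 * t).
    by apply/existsNP => h; apply: h2; split => // j _; exact: h.
  have := h1 j; move: hj; rewrite /= !lz.
  set a := X j x; set b := X j y => hj /andP[g1 g2].
  have rr : r^-1 * r = 1 by rewrite mulVf// gt_eqF.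
  have ea : r^-1 * (r * a) = a by rewrite mulrA rr mul1r.
  have [ha hb] : (a <= - t \/ t <= a) /\ (b <= - t \/ t <= b).
    have ra : a = r^-1 * a * r by rewrite mulrAC rr mul1r.
    have rb : b = r^-1 * b * r by rewrite mulrAC rr mul1r.
    move: hj g1 g2; rewrite mulNr; set p := r^-1 * a in ra *; set q := r^-1 * b in rb *.
    move=> hj g1 g2; have {hj} : p + q <= - (2 * t) \/ 2 * t <= p + q.
      by have [|h3] := leP (p + q) (- (2 * t)); [left|right; rewrite leNgt; apply/negP => h4; apply: hj; rewrite h3].
    (* From [s0 <= t / 2] and [4 / 3 <= sqrt 2]: indeed [(3 / 4) t] times [4 / 3] is [t]. *)
    have rt : t <= (2 * t - s0) / 2 * r.
      have h5 : 4 / 3 <= r by rewrite -[leLHS]ger0_norm// -sqrtr_sqr ler_sqrt//; lra.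
      have : (2 * t - s0) / 2 * (4 / 3) <= (2 * t - s0) / 2 * r by rewrite ler_wpM2l//; lra.
      by apply: le_trans; lra.
    have K1 z : z <= - ((2 * t - s0) / 2) -> z * r <= - t.
      move=> hz; rewrite -[leRHS]opprK lerNr opprK.
      have : z * r <= - ((2 * t - s0) / 2) * r by rewrite ler_wpM2r// ltW.
      by rewrite mulNr; move: rt; set qq := _ / 2 * r; clear; lra.
    have K2 z : (2 * t - s0) / 2 <= z -> t <= z * r.
      by move=> hz; apply: (le_trans rt); rewrite ler_wpM2r// ltW.
    by rewrite ra rb; case=> h6; split; [left; apply: K1|left; apply: K1|right; apply: K2|right; apply: K2]; lra.
  split => /= h; have /andP := h j; rewrite -/a -/b => -[] k1 k2.
    by case: ha; [rewrite leNgt k1|rewrite leNgt k2].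
  by case: hb; [rewrite leNgt k1|rewrite leNgt k2].
have key : Pr P (within X s0) * Pr P (~` within X (2 * t)) <= Pr P (~` within X t) ^+ 2.
  have mC : measurable (~` within X t) by apply: measurableC; exact: mw.
  have -> : Pr P (~` within X t) ^+ 2 = Pr (P \x P)%E ((~` within X t) `*` (~` within X t)).
    by rewrite Pr_prod// expr2.
  apply: le_trans (Pr_le _ _ _ VD); last 2 first.
  - exact: measurableD.
  - by apply: measurableX; exact: measurableC.
  have := PrID (P \x P)%E (mV false) (mV true).
  rewrite (_ : V false `&` V true = V true); last first.
    by apply/seteqP; split => z; [case|move=> h; split => //; exact: VT].
  rewrite /V -!WE !WB Pr_prod// Pr_prod// PrT mulr1.
  by rewrite PrC//; clear; set p := Pr _ _; set q := Pr _ _; set r' := Pr _ _; lra.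
have := Pr_ge0 P (~` within X (2 * t)).
set x := Pr P (~` within X (2 * t)) in key *; set y := Pr P (~` within X t) in key *.
set q := Pr P (within X s0) in key PX * => x0.
have : 4 / 5 * x <= q * x by rewrite ler_wpM2r.
by rewrite !expr2 in key *; move: key; clear; lra.
Qed.

(** Each doubling of the level squares [5 / 4] times the tail, which starts from at most
    [5 / 4 * 1 / 5 = 1 / 4]. The bound does not involve the number of points, so it survives an
    arbitrary refinement of a grid. *)
Lemma fernique d (T : measurableType d) (P : probability T R) (J : finType)
    (X : J -> T -> R) S (s0 : R) k : gauss_vec P X S -> 0 < s0 ->
  4 / 5 <= Pr P (within X s0) ->
  Pr P (~` within X (2 ^+ k.+1 * s0)) <= 4^-1 ^+ (2 ^ k).
Proof.
move=> gX s00 PX.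
suff H : 5 / 4 * Pr P (~` within X (2 ^+ k.+1 * s0)) <= 4^-1 ^+ (2 ^ k).
  by apply: le_trans H; rewrite ler_peMl ?Pr_ge0//; lra.
have mw t : measurable (within X t) by exact: (measurable_within t gX.1).
elim: k => [|k IH].
  rewrite expr1 expn0 expr1.
  have : Pr P (~` within X (2 * s0)) <= Pr P (~` within X s0).
    apply: Pr_le; [exact: measurableC|exact: measurableC|].
    apply: subsetC => w h j; have /andP[h1 h2] := h j; apply/andP; split; lra.
  by rewrite (PrC P (mw s0)); lra.
have -> : 2 ^+ k.+2 * s0 = 2 * (2 ^+ k.+1 * s0) by rewrite exprS mulrA.
have st : 2 * s0 <= 2 ^+ k.+1 * s0.
  by rewrite ler_wpM2r ?(ltW s00)// exprS ler_peMr// exprn_ege1//; lra.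
apply: (le_trans (fernique_step gX s00 st PX)).
rewrite expnS mulnC exprM lerXn2r// nnegrE ?exprn_ge0//.
by rewrite mulr_ge0// Pr_ge0.
Qed.

(* Markov's inequality over the shifts [y]: a positive proportion of them has a
   low average. *)
Lemma shift_average d (T : measurableType d) (P : probability T R) (J Y : finType)
    (X : Y -> J -> T -> R) (l k B : R) :
  (forall y j, measurable_fun setT (X y j)) -> 0 < l -> 0 < k -> (0 < #|Y|)%N -> (0 < #|J|)%N ->
  (forall y, Pr P [set w | (forall j, 0 <= X y j w) /\ \sum_j X y j w <= #|J|%:R * ((1 + k) * l)] <= B) ->
  Pr P [set w | (forall y j, 0 <= X y j w) /\ \sum_y \sum_j X y j w <= (#|Y| * #|J|)%:R * l] <=
    (1 + k) / k * B.
Proof.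
move=> mX l0 k0 Y0 J0 HB; set E := [set w | _ /\ _].
pose F y := [set w | (forall j, 0 <= X y j w) /\ \sum_j X y j w <= #|J|%:R * ((1 + k) * l)].
have mle (f : T -> R) c : measurable_fun setT f -> measurable [set w | f w <= c].
  move=> mf; rewrite (_ : [set w | _] = ~` [set w | c < f w]); last first.
    by apply/seteqP; split => w /=; [move=> h; apply/negP; rewrite -leNgt|move=> /negP; rewrite -leNgt].
  by apply: measurableC; exact: (@measurable_lt_set _ _ _ (cst c)).
have mpos y : measurable [set w | forall j, 0 <= X y j w].
  rewrite (_ : [set w | _] = \bigcap_(j in [set: J]) [set w | - X y j w <= 0]).
    by apply: fin_bigcap_measurable => // j _; apply: mle; exact: measurable_funN.
  by apply/seteqP; split => w /=; [move=> h j _ /=; rewrite oppr_le0|move=> h j; have := h j I; rewrite /= oppr_le0].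
have mF y : measurable (F y).
  by apply: measurableI; [exact: mpos|apply: (mle (fun w => \sum_j X y j w)); exact: measurable_sum].
have mE : measurable E.
  apply: measurableI.
    rewrite (_ : (fun w => _) = \bigcap_(y in [set: Y]) [set w | forall j, 0 <= X y j w]).
      by apply: fin_bigcap_measurable.
    by apply/seteqP; split => w /=; [move=> h y _ j; exact: h|move=> h y; exact: h].
  by apply: (mle (fun w => \sum_y \sum_j X y j w)); apply: measurable_sum => y; exact: measurable_sum.
(* On [E], where all values are nonnegative, at most a fraction [1 / (1 + k)] of the shifts can
   exceed [1 + k] times the average. *)
have pt w : \1_E w * (k / (1 + k) * #|Y|%:R) <= \sum_y \1_(F y) w :> R.
  rewrite [\1_E w]indicE; have [/set_mem[h1 h2]|_] := boolP (w \in E); last by rewrite mul0r sumr_ge0.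
  rewrite mul1r; pose c := #|J|%:R * ((1 + k) * l).
  have c0 : 0 < c by rewrite !mulr_gt0 ?ltr0n//; lra.
  have : \sum_y (c * (1 - \1_(F y) w)) <= \sum_y \sum_j X y j w.
    apply: ler_sum => y _; rewrite indicE; have [_|nF] := boolP (w \in F y).
      by rewrite subrr mulr0 sumr_ge0.
    rewrite subr0 mulr1 leNgt; apply/negP => h3; move: nF; rewrite notin_setE; apply.
    by split => //; exact: ltW.
  rewrite -mulr_sumr sumrB sumr_const -[1 *+ _]/(#|Y|%:R) => h3.
  have {}h3 := le_trans h3 h2.
  move: h3; rewrite /c natrM; set s := \sum_(i in Y) _; set y := #|Y|%:R; set j := #|J|%:R => h3.
  have j0 : 0 < j by rewrite ltr0n.
  have e : j * ((1 + k) * l) * (y - s) <= y * j * l by [].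
  have : (1 + k) * (y - s) <= y.
    rewrite -(ler_pM2l (mulr_gt0 j0 l0)); move: e; congr (_ <= _); ring.
  move=> h4; rewrite mulrAC ler_pdivrMr; [|lra].
  by rewrite [s * _]mulrC; nra.
have ki : 0 < k / (1 + k) * #|Y|%:R by rewrite !mulr_gt0 ?ltr0n ?invr_gt0//; lra.
have indic_int A : measurable A -> P.-integrable setT (EFin \o (\1_A : T -> R)).
  by move=> mA; apply: (@bounded_integrable _ _ _ _ _ 1) => // w; rewrite indicE; case: (_ \in _); rewrite ?normr1 ?normr0.
have ints (s : seq Y) : P.-integrable setT (EFin \o (fun w => \sum_(y <- s) \1_(F y) w)).
  apply: (@bounded_integrable _ _ _ _ _ (size s)%:R); first by apply: measurable_sum => y; exact: measurable_indic.
  move=> w; rewrite ger0_norm ?sumr_ge0//.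
  elim: s => [|y s IH]; first by rewrite big_nil.
  by rewrite big_cons -nat1r lerD// indicE; case: (_ \in _).
have sumE (s : seq Y) : \int[P]_w (\sum_(y <- s) \1_(F y) w) = \sum_(y <- s) Pr P (F y).
  elim: s => [|y s IH]; first by under eq_Rintegral do rewrite big_nil; rewrite Rintegral_cst//= mul0r big_nil.
  under eq_Rintegral do rewrite big_cons; rewrite (RintegralD measurableT (indic_int _ (mF y)) (ints s)).
  by rewrite IH big_cons Pr_Rintegral.
have : \int[P]_w (\1_E w * (k / (1 + k) * #|Y|%:R)) <= \int[P]_w (\sum_y \1_(F y) w).
  apply: (@le_Rintegral _ _ _ _ _ (fun w => \1_E w * (k / (1 + k) * #|Y|%:R)) (fun w => \sum_y \1_(F y) w)) => //.
  - by have := integrableZr measurableT (k / (1 + k) * #|Y|%:R) (indic_int _ mE); apply.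
rewrite RintegralZr//; last exact: (indic_int _ mE).
rewrite -Pr_Rintegral// sumE -ler_pdivlMr// => /le_trans; apply.
rewrite ler_pdivrMr//; apply: (@le_trans _ _ (\sum_(y : Y) B)); first by apply: ler_sum => y _; exact: HB.
rewrite sumr_const -mulr_natl le_eqVlt; apply/orP; left; apply/eqP; field.
by rewrite !gt_eqF//; lra.
Qed.

End persistence.

(** * Lebesgue measure and dyadic cubes *)

Section boxes.
Context {R : realType} (d : nat).
Implicit Types a b : 'I_d -> R.

Definition box a b : set (borel 'rV[R]_d) := [set x | forall i, a i <= x ord0 i < b i].

Lemma borel_open (U : set 'rV[R]_d) : open U -> measurable (U : set (borel 'rV[R]_d)).
Proof. by move=> oU; exact: sub_sigma_algebra. Qed.

Lemma borel_continuous (f : 'rV[R]_d -> R) : continuous f ->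
  measurable_fun setT (f : borel 'rV[R]_d -> R).
Proof.
move=> cf; apply: (measurability _ (RGenOpens.measurableE R)).
move=> _ [_ [x [y ->]] <-]; rewrite setTI; apply: borel_open.
by move/continuousP : cf; apply; exact: interval_open.
Qed.

Lemma borel_coord i : measurable_fun setT (fun x : borel 'rV[R]_d => (x : 'rV[R]_d) ord0 i).
Proof. by apply: borel_continuous; exact: coord_continuous. Qed.

Lemma measurable_box a b : measurable (box a b).
Proof.
rewrite (_ : box a b = \bigcap_(i in [set: 'I_d]) (fun x : borel 'rV[R]_d => (x : 'rV[R]_d) ord0 i) @^-1` `[a i, b i[%classic).
  by apply: fin_bigcap_measurable => // i _; rewrite -[X in measurable X]setTI; exact: borel_coord.
by apply/seteqP; split => x /= h i; [move=> _ /=; rewrite in_itv; exact: h|have := h i I; rewrite /= in_itv].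
Qed.

Lemma lebesgue_measure_ico (x y : R) : @lebesgue_measure R `[x, y[%classic = (Num.max 0 (y - x))%:E.
Proof.
rewrite lebesgue_measure_itv/= lte_fin.
have [h|h] := ltP x y; first by rewrite max_r ?subr_ge0 ?ltW.
by rewrite max_l// subr_le0.
Qed.

End boxes.

Lemma lebesgue_tuple_box {R : realType} n (a b : 'I_n -> R) :
  lebesgue_tuple R n [set t | forall i, a i <= tnth t i < b i] = (\prod_i Num.max 0 (b i - a i))%:E.
Proof.
elim: n a b => [|n IH] a b.
  rewrite big_ord0 /= diracE mem_set// => i; by case: i.
have mb m (a' b' : 'I_m -> R) : measurable [set t : m.-tuple R | forall i, a' i <= tnth t i < b' i].
  rewrite (_ : [set _ | _] = \bigcap_(i in [set: 'I_m]) (fun t : m.-tuple R => tnth t i) @^-1` `[a' i, b' i[%classic).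
    by apply: fin_bigcap_measurable => // i _; rewrite -[X in measurable X]setTI; exact: measurable_tnth.
  by apply/seteqP; split => x /= h i; [move=> _ /=; rewrite in_itv; exact: h|have := h i I; rewrite /= in_itv].
rewrite /= /lebesgue_cons /pushforward big_ord_recl EFinM -lebesgue_measure_ico -IH -product_measure1E//; last exact: mb.
congr (product_measure1 _ _ _); apply/seteqP; split => [[x t] /= h|[x t] /= [h1 h2] i].
  split; first by have := h ord0; rewrite /= in_itv.
  by move=> i; have := h (lift ord0 i); rewrite tnthS.
have [->|[j ->]] : i = ord0 \/ exists j, i = lift ord0 j.
    by case: (unliftP ord0 i) => [j ->|->]; [right; exists j|left].
  by move: h1; rewrite in_itv.
by rewrite tnthS; exact: h2.
Qed.

Lemma lt_norm_window {R : realFieldType} (q x y e : R) :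
  q <= y -> y < q + e -> x - e < q -> q <= x -> - e < x - y < e.
Proof. by move=> *; apply/andP; split; lra. Qed.

Section lebesgue_boxes.
Context {R : realType} (d : nat).
Implicit Types a b : 'I_d -> R.

Lemma lebesgue_box a b : lebesgue (box a b) = (\prod_i Num.max 0 (b i - a i))%:E.
Proof.
rewrite -lebesgue_tuple_box /lebesgue /pushforward; congr (lebesgue_tuple R d _).
by apply/seteqP; split => t /= h i; have := h i; rewrite mxE.
Qed.

Lemma nbhs_box (x : 'rV[R]_d) (U : set 'rV[R]_d) : open U -> U x ->
  exists n : nat, forall y : 'rV[R]_d, (forall i, `|x ord0 i - y ord0 i| < n.+1%:R^-1) -> U y.
Proof.
move=> oU Ux; have /nbhs_ballP[e /= e0 eU] : nbhs x U by exact: open_nbhs_nbhs.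
have [k ke] : exists k, k.+1%:R^-1 < e.
  exists (Num.truncn e^-1); rewrite -[ltRHS]invrK ltf_pV2 ?posrE ?invr_gt0//.
  exact: truncnS_gt.
exists k => y h; apply: eU; split => // i j; rewrite (ord1 i) -ball_normE /=.
exact: lt_trans (h j) ke.
Qed.

Definition gbox := [set A : set (borel 'rV[R]_d) | exists a b, A = box a b].

(** An open set is the countable union of the boxes it contains among those with rational lower
    corner and side [1 / (n + 1)]. Half-open boxes are moreover stable under intersection, so they
    determine the measure. *)
Lemma measurable_gbox : (@measurable _ (borel 'rV[R]_d)) = <<s gbox >>.
Proof.
apply/seteqP; split; last first.
  apply: smallest_sub; first exact: sigma_algebra_measurable.
  by move=> _ [a [b ->]]; exact: measurable_box.
apply: smallest_sub; first exact: smallest_sigma_algebra.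
move=> U oU.
pose bx (p : 'rV[rat]_d * nat) : set (borel 'rV[R]_d) :=
  box (fun i => ratr (p.1 ord0 i)) (fun i => ratr (p.1 ord0 i) + p.2.+1%:R^-1).
pose F p : set (borel 'rV[R]_d) := if `[< bx p `<=` U >] then bx p else set0.
suff -> : U = \bigcup_p F p.
  change ((@measurable _ (g_sigma_algebraType gbox)) (\bigcup_p F p)).
  apply: countable_bigcupT_measurable; first exact: countableP.
  move=> p.
  rewrite /F; case: ifP => _ //; apply: sub_sigma_algebra; by eexists; eexists.
apply/seteqP; split=> [x Ux|x [p _]]; last by rewrite /F; case: ifPn => // /asboolP; apply.
have [k hk] := nbhs_box oU Ux.
have k0 : 0 < k.+1%:R^-1 :> R by [].
have /choice[q qt] : forall i, exists r : rat, x ord0 i - k.+1%:R^-1 < ratr r <= x ord0 i.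
  move=> i; have /rat_in_itvoo[r] : x ord0 i - k.+1%:R^-1 < x ord0 i by rewrite ltrBlDr ltrDl.
  by rewrite in_itv/= => /andP[h1 h2]; exists r; rewrite h1 ltW.
have bE : bx (\row_i q i, k) `<=` U.
  move=> y /= h; apply: hk => i; have := h i; rewrite !mxE /= => /andP[h1 h2].
  have /andP[h3 h4] := qt i; rewrite ltr_norml; exact: (lt_norm_window h1 h2 h3 h4).
exists (\row_i q i, k) => //; rewrite /F asboolT// => i; rewrite !mxE/=.
by have /andP[h3 h4] := qt i; rewrite h4 -ltrBlDr.
Qed.

Lemma gbox_setI : setI_closed gbox.
Proof.
move=> _ _ [a [b ->]] [a' [b' ->]].
exists (fun i => Num.max (a i) (a' i)), (fun i => Num.min (b i) (b' i)).
apply/seteqP; split => x /=; rewrite /box /=.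
  move=> [h1 h2] i; rewrite ge_max lt_min.
  by have /andP[-> ->] := h1 i; have /andP[-> ->] := h2 i.
move=> h; split => i; have := h i; rewrite ge_max lt_min.
  by move=> /andP[/andP[-> _] /andP[-> _]].
by move=> /andP[/andP[_ ->] /andP[_ ->]].
Qed.

Lemma box_cover : \bigcup_n box (fun=> - n%:R) (fun=> n%:R) = [set: borel 'rV[R]_d].
Proof.
apply/seteqP; split => // x _.
exists (Num.truncn (\sum_i `|(x : 'rV[R]_d) ord0 i|)).+1 => // i.
have h : `|(x : 'rV[R]_d) ord0 i| < (Num.truncn (\sum_i `|(x : 'rV[R]_d) ord0 i|)).+1%:R.
  apply: le_lt_trans (truncnS_gt _).
  by rewrite (bigD1 i)//= lerDl sumr_ge0.
by move: h; rewrite ltr_norml => /andP[h1 h2]; rewrite h2 (ltW h1).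
Qed.

Lemma lebesgue_unique (m : {measure set (borel 'rV[R]_d) -> \bar R}) :
  (forall a b, m (box a b) = lebesgue (box a b)) ->
  forall A, measurable A -> m A = lebesgue A.
Proof.
move=> h A mA.
apply: (measure_unique gbox (fun n => box (fun=> - n%:R) (fun=> n%:R)) measurable_gbox gbox_setI) => //.
- by move=> i; eexists; eexists.
- exact: box_cover.
- by move=> _ [a [b ->]]; exact: h.
- by move=> k; rewrite h lebesgue_box ltry.
Qed.

Lemma lebesgue_sigma_finite : sigma_finite setT (@lebesgue R d).
Proof.
exists (fun n => box (fun=> - n%:R) (fun=> n%:R)); first by rewrite box_cover.
by move=> k; split; [exact: measurable_box|rewrite lebesgue_box ltry].
Qed.

HB.instance Definition _ := Measure_isSigmaFinite.Build _ _ _ (@lebesgue R d) lebesgue_sigma_finite.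

Definition affine (c : R) (t : 'rV[R]_d) (x : borel 'rV[R]_d) : borel 'rV[R]_d :=
  c *: (x : 'rV[R]_d) + t.

Lemma measurable_rV d' (T : measurableType d') (f : T -> borel 'rV[R]_d) :
  (forall i, measurable_fun setT (fun x => (f x : 'rV[R]_d) ord0 i)) -> measurable_fun setT f.
Proof.
move=> mf; apply: (measurability _ measurable_gbox).
move=> _ [_ [a [b ->]] <-]; rewrite setTI.
rewrite (_ : _ @^-1` _ = \bigcap_(i in [set: 'I_d]) (fun x => (f x : 'rV[R]_d) ord0 i) @^-1` `[a i, b i[%classic).
  by apply: fin_bigcap_measurable => // i _; rewrite -[X in measurable X]setTI; exact: mf.
by apply/seteqP; split => x /= h i; [move=> _ /=; rewrite in_itv; exact: h|have := h i I; rewrite /= in_itv].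
Qed.

Lemma measurable_affine c t : measurable_fun setT (affine c t).
Proof.
apply: measurable_rV => i; rewrite /affine.
under eq_fun do rewrite !mxE.
by apply: measurable_funD => //; apply: measurable_funM => //; exact: borel_coord.
Qed.

(** The preimage measure rescaled by [c ^+ d] agrees with [lebesgue] on boxes, hence everywhere by
    uniqueness. *)
Lemma lebesgue_affine c t A : 0 < c -> measurable A ->
  (lebesgue (affine c t @^-1` A) = ((c ^+ d)^-1)%:E * lebesgue A)%E.
Proof.
move=> c0 mA.
have cd0 : 0 <= c ^+ d by rewrite exprn_ge0// ltW.
pose m0 : {measure set (borel 'rV[R]_d) -> \bar R} := measure_function_pushforward__canonical__measure_function_Measure (@lebesgue R d) (measurable_affine c t).
pose m1 : {measure set (borel 'rV[R]_d) -> \bar R} := mscale (NngNum cd0) m0.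
have H : m1 A = lebesgue A.
  apply: lebesgue_unique => // a b.
  rewrite /m1 /= /mscale /m0 /= /pushforward.
  rewrite (_ : affine c t @^-1` _ = box (fun i => c^-1 * (a i - t ord0 i)) (fun i => c^-1 * (b i - t ord0 i))); last first.
    apply/seteqP; split => x /= h i; have := h i; rewrite /= ?mxE.
      by rewrite ler_pdivrMl// ltr_pdivlMl// lerBlDr ltrBrDr.
    by rewrite ler_pdivrMl// ltr_pdivlMl// lerBlDr ltrBrDr.
  rewrite !lebesgue_box -EFinM -[X in X * _](_ : \prod_(i < d) c = _); last by rewrite prodr_const card_ord.
  rewrite -big_split/=; congr _%:E; apply: eq_bigr => i _.
  rewrite maxr_pMr ?ltW// mulr0; congr (Num.max 0 _).
  by rewrite -mulrBr mulrA mulfV ?gt_eqF// mul1r; lra.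
rewrite -H /m1 /= /mscale /m0 /= /pushforward muleA -EFinM mulVf ?mul1e//.
by rewrite expf_neq0// gt_eqF.
Qed.

End lebesgue_boxes.

(** * Dyadic sets and the approximation of Borel sets *)

Section dyadic.
Context {R : realType} (d : nat).
Local Notation E := (borel 'rV[R]_d).

Definition dfloor n (x : 'rV[R]_d) : 'rV[int]_d := \row_i Num.floor (2 ^+ n * x ord0 i).

(* [D] is a union of dyadic cubes of side [2 ^- n]. *)
Definition dyadic n (D : set E) := forall x y : 'rV[R]_d, dfloor n x = dfloor n y -> D x -> D y.

Definition cell n (k : 'rV[int]_d) : set E := [set x | dfloor n x = k].

Lemma cellE n k : cell n k =
  box (fun i => (2 ^+ n)^-1 * (k ord0 i)%:~R) (fun i => (2 ^+ n)^-1 * (k ord0 i + 1)%:~R).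
Proof.
have p0 : 0 < 2 ^+ n :> R by rewrite exprn_gt0.
apply/seteqP; split => [x <- i|x h].
  by rewrite mxE ler_pdivrMl// ltr_pdivlMl// floor_itv.
apply/rowP => i; rewrite mxE; apply: floor_def; have := h i.
by rewrite ler_pdivrMl// ltr_pdivlMl.
Qed.

Lemma measurable_cell n k : measurable (cell n k).
Proof. by rewrite cellE; exact: measurable_box. Qed.

Lemma dyadic_measurable n D : dyadic n D -> measurable D.
Proof.
move=> dD; pose F k : set E := if `[< cell n k `<=` D >] then cell n k else set0.
have -> : D = \bigcup_k F k.
  apply/seteqP; split => [x Dx|x [k _]]; last by rewrite /F; case: ifPn => // /asboolP; apply.
  by exists (dfloor n x) => //; rewrite /F asboolT// => y hy; apply: dD Dx.
apply: countable_bigcupT_measurable; first exact: countableP.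
by move=> k; rewrite /F; case: ifP => _ //; exact: measurable_cell.
Qed.

Lemma dfloor_le n m (x y : 'rV[R]_d) : (n <= m)%N -> dfloor m x = dfloor m y -> dfloor n x = dfloor n y.
Proof.
move=> nm; wlog suff H : x y / forall i, dfloor m x = dfloor m y -> dfloor n x ord0 i <= dfloor n y ord0 i.
  move=> h; apply/rowP => i; apply/le_anti/andP; split; first exact: H.
  by apply: H.
move=> i h; rewrite !mxE floor_ge_int.
have p0 k : 0 < 2 ^+ k :> R by rewrite exprn_gt0.
have E1 : 2 ^+ m = 2 ^+ n * 2 ^+ (m - n) :> R by rewrite -exprD subnKC.
rewrite -(ler_pM2r (p0 (m - n)%N)) mulrAC -E1 -[X in _ * X]/(2 ^+ (m - n)).
have -> : (Num.floor (2 ^+ n * x ord0 i))%:~R * 2 ^+ (m - n) =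
    (Num.floor (2 ^+ n * x ord0 i) * 2 ^+ (m - n))%:~R :> R by rewrite intrM rmorphXn.
rewrite -floor_ge_int; have /rowP/(_ i) := h; rewrite !mxE => <-.
rewrite floor_ge_int intrM rmorphXn /= E1 mulrAC ler_pM2r//.
exact: floor_le_tmp.
Qed.

Lemma dyadic_le n m D : (n <= m)%N -> dyadic n D -> dyadic m D.
Proof. by move=> nm dD x y xy; apply: dD; exact: dfloor_le xy. Qed.

Lemma dyadicC n D : dyadic n D -> dyadic n (~` D).
Proof. by move=> dD x y xy Dx Dy; apply: Dx; exact: dD Dy. Qed.

Lemma dyadicU n D D' : dyadic n D -> dyadic n D' -> dyadic n (D `|` D').
Proof. by move=> h h' x y xy [?|?]; [left; exact: h xy _|right; exact: h' xy _]. Qed.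

Lemma dyadicI n D D' : dyadic n D -> dyadic n D' -> dyadic n (D `&` D').
Proof. by move=> h h' x y xy [? ?]; split; [exact: h xy _|exact: h' xy _]. Qed.

Section approximation.
Variable nu : {finite_measure set E -> \bar R}.

Definition differ (A D : set E) := (A `\` D) `|` (D `\` A).

Definition approximable A := forall eta : R, 0 < eta ->
  exists n D, dyadic n D /\ (nu (differ A D) <= eta%:E)%E.

Lemma measurable_differ A D : measurable A -> measurable D -> measurable (differ A D).
Proof. by move=> mA mD; apply: measurableU; exact: measurableD. Qed.

Lemma finite_measure_le A B : measurable A -> measurable B -> A `<=` B -> (nu A <= nu B)%E.
Proof. by move=> mA mB; exact: (le_measure nu (mem_set mA) (mem_set mB)). Qed.

Lemma approximableC A : approximable A -> approximable (~` A).
Proof.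
move=> h eta /h[n [D [dD hD]]]; exists n, (~` D); split; first exact: dyadicC.
rewrite (_ : differ _ _ = differ A D)//.
by apply/seteqP; split => x; rewrite /differ/=; case: (pselect (A x)); case: (pselect (D x)); tauto.
Qed.

Lemma approximableU A B : measurable A -> measurable B ->
  approximable A -> approximable B -> approximable (A `|` B).
Proof.
move=> mA mB hA hB eta eta0.
have e2 : 0 < eta / 2 by rewrite divr_gt0.
have [n [D [dD hD]]] := hA _ e2; have [m [D' [dD' hD']]] := hB _ e2.
have mD := dyadic_measurable dD; have mD' := dyadic_measurable dD'.
exists (maxn n m), (D `|` D'); split.
  by apply: dyadicU; [exact: dyadic_le (leq_maxl _ _) dD|exact: dyadic_le (leq_maxr _ _) dD'].
apply: (@le_trans _ _ (nu (differ A D `|` differ B D'))).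
  apply: finite_measure_le.
  - by apply: measurable_differ; exact: measurableU.
  - by apply: measurableU; exact: measurable_differ.
  - by move=> x; rewrite /differ/=; tauto.
apply: (le_trans (measureU2 _ _ _)); [exact: measurable_differ|exact: measurable_differ|].
by rewrite [eta]splitr EFinD; exact: leeD.
Qed.

Lemma approximable_lim (F : (set E)^nat) : (forall n, measurable (F n)) ->
  {homo F : n m / (n <= m)%N >-> (n <= m)%O} -> (forall n, approximable (F n)) ->
  approximable (\bigcup_n F n).
Proof.
move=> mF ndF aF eta eta0.
have e2 : 0 < eta / 2 by rewrite divr_gt0.
set A := \bigcup_n F n.
have mA : measurable A by exact: bigcupT_measurable.
have fA B : measurable B -> nu B \is a fin_num by move=> mB; exact: fin_num_measure.
have cv := @nondecreasing_cvg_mu _ _ _ nu F mF mA ndF.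
have [k hk] : exists k, (nu (A `\` F k) <= (eta / 2)%:E)%E.
  have [k _ hk] : \forall k \near \oo, (nu A - (eta / 2)%:E < nu (F k))%E.
    have cv' : fine (nu (F k)) @[k --> \oo] --> fine (nu A).
      by apply: fine_cvg; rewrite fineK ?fA.
    have h : fine (nu A) - eta / 2 < fine (nu A) by rewrite ltrBlDr ltrDl.
    apply: filterS (cvgr_gt _ cv' _ h) => n hn.
    by rewrite /= -(fineK (fA _ mA)) -(fineK (fA _ (mF n))) -EFinB lte_fin.
  exists k; have FA : F k `<=` A by exact: bigcup_sup.
  have h : (nu A < nu (F k) + (eta / 2)%:E)%E by rewrite -lteBlDr//; exact: hk k (leqnn k).
  have e : nu A = (nu (A `\` F k) + nu (F k))%E.
    rewrite addeC [LHS](measureDI nu (A := A) (B := F k))// addeC; congr (nu _ + _)%E.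
    by rewrite setIidr.
  move: h; rewrite e addeC lteD2lE ?fA// => h; exact: ltW.
have [n [D [dD hD]]] := aF k _ e2; have mD := dyadic_measurable dD.
exists n, D; split => //.
apply: (@le_trans _ _ (nu (differ (F k) D `|` (A `\` F k)))).
  apply: finite_measure_le.
  - exact: measurable_differ.
  - by apply: measurableU; [exact: measurable_differ|exact: measurableD].
  - move=> x [[Ax Dx]|[Dx Ax]].
      by have [Fx|Fx] := pselect (F k x); [left; left|right].
    by left; right; split => // Fx; apply: Ax; exists k.
apply: (le_trans (measureU2 _ _ _)); [exact: measurable_differ|exact: measurableD|].
by rewrite [eta]splitr EFinD; exact: leeD.
Qed.

(** An open set is the increasing union of the dyadic sets [F n] made of the cells of side [2 ^- n]
    that it contains. *)
Lemma approximable_open (U : set 'rV[R]_d) : open U -> approximable U.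
Proof.
move=> oU; pose F n : set E := [set x | cell n (dfloor n x) `<=` U].
have dF n : dyadic n (F n) by move=> x y xy; rewrite /F /= xy.
have -> : U = \bigcup_n F n.
  apply/seteqP; split => [x Ux|x [n _]]; last by apply.
  have [n hn] := nbhs_box oU Ux.
  have nn : (n.+1%:R <= 2 ^+ n :> R) by rewrite -natrX ler_nat ltn_expl.
  exists n => // y yx; apply: hn => i.
  have p0 : 0 < 2 ^+ n :> R by rewrite exprn_gt0.
  apply: (@lt_le_trans _ _ (2 ^+ n)^-1); last by rewrite lef_pV2// posrE.
  rewrite -(ltr_pM2l p0) mulfV ?gt_eqF// -[X in X * _]ger0_norm ?ltW// -normrM mulrBr.
  have /rowP/(_ i) := yx; rewrite !mxE => e.
  have := floor_itv (2 ^+ n * y ord0 i); have := floor_itv (2 ^+ n * x ord0 i).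
  rewrite e intrD; set f := (Num.floor _)%:~R; move=> /andP[h1 h2] /andP[h3 h4].
  by rewrite ltr_norml; apply/andP; split; move: h1 h2 h3 h4; clear; lra.
apply: approximable_lim.
- by move=> n; exact: dyadic_measurable (dF n).
- move=> n m nm; apply/subsetPset => x /= h y hy; apply: h; exact: dfloor_le nm hy.
- move=> n eta eta0; exists n, (F n); split => //.
  rewrite (_ : differ _ _ = set0) ?measure0 ?lee_fin ?ltW//.
  by rewrite -subset0 /differ => x /=; tauto.
Qed.

(** Dynkin's induction from the open sets: the approximable sets are stable under complement, and
    finite unions followed by continuity from below give countable unions. *)
Lemma borel_approximable A : measurable A -> approximable A.
Proof.
move=> mA.
apply: (@dynkin_induction _ E (@open 'rV[R]_d) approximable) => //.
- by move=> U V; exact: openI.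
- by apply: approximable_open; exact: openT.
- by move=> U; exact: approximable_open.
- by move=> S _; exact: approximableC.
- move=> F mF tF aF.
  have -> : \bigcup_k F k = \bigcup_k \big[setU/set0]_(i < k.+1) F i.
    apply/seteqP; split => x; last first.
      by move=> [k _]; rewrite -bigcup_mkord => -[i _ Fi]; exists i.
    by move=> [k _ Fk]; exists k => //; rewrite -bigcup_mkord; exists k => /=.
  apply: approximable_lim.
  + by move=> n; exact: bigsetU_measurable.
  + by move=> n m nm; apply/subsetPset; rewrite -!bigcup_mkord; apply: bigcup_sub => i /= ik;
      apply: bigcup_sup => /=; exact: leq_trans ik _.
  + elim => [|n IH]; first by rewrite big_ord_recr big_ord0 /= set0U.
    by rewrite big_ord_recr/=; apply: approximableU => //; exact: bigsetU_measurable.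
Qed.

End approximation.
End dyadic.

(** * Covariance matrices and the absolutely continuous spectrum *)

Section fourier_matrix.
Context d (T : measurableType d) (R : realType) (m : {measure set T -> \bar R}).
Implicit Types (J : finType).

Lemma integrable_bounded_mul (f e : T -> R) M : measurable_fun setT f -> (forall x, `|f x| <= M) ->
  m.-integrable setT (EFin \o e) -> m.-integrable setT (fun x => (f x * e x)%:E).
Proof.
move=> mf fM ie.
have me : measurable_fun setT e by apply/measurable_EFinP; exact: measurable_int ie.
apply: (@le_integrable _ _ _ _ _ measurableT _ (fun x => (M * e x)%:E)).
- by apply/measurable_EFinP; exact: measurable_funM.
- move=> x _; rewrite /= lee_fin !normrM; apply: ler_pM => //.
  exact: le_trans (fM x) (ler_norm _).
- by under eq_fun do rewrite EFinM; exact: integrableZl.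
Qed.

Lemma Rintegral_sum_fin (I : finType) (F : I -> T -> R) :
  (forall i, m.-integrable setT (EFin \o F i)) ->
  m.-integrable setT (EFin \o (fun x => \sum_i F i x)) /\
  \int[m]_x (\sum_i F i x) = \sum_i \int[m]_x F i x.
Proof.
move=> iF.
have H (s : seq I) : m.-integrable setT (EFin \o (fun x => \sum_(i <- s) F i x)) /\
    \int[m]_x (\sum_(i <- s) F i x) = \sum_(i <- s) \int[m]_x F i x.
  elim: s => [|i s [IH1 IH2]].
    split; last by under eq_Rintegral do rewrite big_nil; rewrite /Rintegral integral0 big_nil.
    by under eq_fun do rewrite big_nil; exact: integrable0.
  split.
    have := integrableD measurableT (iF i) IH1; apply: eq_integrable => // x _.
    by rewrite /= big_cons EFinD.
  under eq_Rintegral do rewrite big_cons.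
  by rewrite (RintegralD measurableT (iF i) IH1) IH2 big_cons.
exact: H.
Qed.

(** The squared modulus of the sum of the [a j * exp (i th j)], written with real functions. *)
Definition trig J (th : J -> T -> R) (a : J -> R) (l : T) : R :=
  (\sum_j a j * cos (th j l)) ^+ 2 + (\sum_j a j * sin (th j l)) ^+ 2.

Lemma trig_ge0 J (th : J -> T -> R) a l : 0 <= trig th a l.
Proof. by rewrite addr_ge0 ?sqr_ge0. Qed.

Lemma trigE J (th : J -> T -> R) a l :
  trig th a l = \sum_i \sum_j a i * a j * cos (th j l - th i l).
Proof.
rewrite /trig !expr2 !big_distrlr -big_split; apply: eq_bigr => i _.
by rewrite -big_split; apply: eq_bigr => j _ /=; rewrite cosB; ring.
Qed.

(** The covariance matrix of points of phases [th] for the spectral measure of density [e] with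
    respect to [m]. *)
Definition fmat J (e : T -> R) (th : J -> T -> R) (i j : J) : R :=
  \int[m]_l (cos (th j l - th i l) * e l).

Section weight.
Variables (J : finType) (e : T -> R) (th : J -> T -> R).
Hypothesis ie : m.-integrable setT (EFin \o e).
Hypothesis mth : forall j, measurable_fun setT (th j).

Let mcos i j : measurable_fun setT (fun l => cos (th j l - th i l)).
Proof.
apply: measurableT_comp; last exact: measurable_funB.
by apply: continuous_measurable_fun; exact: continuous_cos.
Qed.

Let icos i j : m.-integrable setT (EFin \o (fun l => cos (th j l - th i l) * e l)).
Proof.
apply: (@integrable_bounded_mul (fun l => cos (th j l - th i l)) e 1) => // x.
by rewrite ler_norml cos_geN1 cos_le1.
Qed.

Lemma fmat_sym i j : fmat e th i j = fmat e th j i.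
Proof. by apply: eq_Rintegral => l _; rewrite -cosN opprB. Qed.

Lemma fmat_quad a : m.-integrable setT (EFin \o (fun l => trig th a l * e l)) /\
  quad (fmat e th) a = \int[m]_l (trig th a l * e l).
Proof.
have E l : trig th a l * e l = \sum_i \sum_j a i * a j * (cos (th j l - th i l) * e l).
  rewrite trigE mulr_suml; apply: eq_bigr => i _; rewrite mulr_suml.
  by apply: eq_bigr => j _; rewrite mulrA.
have i1 i j : m.-integrable setT (EFin \o (fun l => a i * a j * (cos (th j l - th i l) * e l))).
  have := integrableZl measurableT (a i * a j) (icos i j).
  by apply: eq_integrable.
have i2 i := Rintegral_sum_fin (i1 i).
have [i3 i4] := Rintegral_sum_fin (fun i => (i2 i).1).
split; first by under eq_fun do rewrite E.
under [RHS]eq_Rintegral do rewrite E.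
rewrite i4; apply: eq_bigr => i _; rewrite (i2 i).2; apply: eq_bigr => j _.
by rewrite RintegralZl//; exact: icos.
Qed.

Lemma fmat_psd : (forall l, 0 <= e l) -> psd (fmat e th).
Proof.
move=> e0 a; rewrite (fmat_quad a).2; apply: Rintegral_ge0 => l _.
by rewrite mulr_ge0// trig_ge0.
Qed.

Lemma fmat_diag i : fmat e th i i = \int[m]_l e l.
Proof. by apply: eq_Rintegral => l _; rewrite subrr cos0 mul1r. Qed.

End weight.
End fourier_matrix.

(* Cauchy-Schwarz on [G] dominates the rank-one matrix of the [u j]. *)
Lemma fmat_rank1 d (T : measurableType d) (R : realType) (m : {finite_measure set T -> \bar R})
    (J : finType) (th : J -> T -> R) (G : set T) : (forall j, measurable_fun setT (th j)) ->
  measurable G -> 0 < fine (m G) -> (forall j l, G l -> 2^-1 <= cos (th j l)) ->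
  exists u : J -> R, (forall j, Num.sqrt (fine (m G)) / 2 <= u j) /\
    forall a, linc a u ^+ 2 <= quad (fmat m (cst 1) th) a.
Proof.
move=> mth mG g0 hG; set g := fine (m G).
have ib (f : T -> R) M : measurable_fun setT f -> (forall x, `|f x| <= M) ->
    m.-integrable setT (EFin \o f) by exact: bounded_integrable.
have mc j : measurable_fun setT (fun l => cos (th j l)).
  by apply: measurableT_comp => //; apply: continuous_measurable_fun; exact: continuous_cos.
have i1 : m.-integrable setT (EFin \o (cst 1 : T -> R)).
  by apply: (ib _ 1) => // x; rewrite normr1.
have mI : measurable_fun setT (\1_G : T -> R) by exact: measurable_indic.
have I1 l : `|\1_G l : R| <= 1 by rewrite indicE; case: (_ \in _); rewrite ?normr1 ?normr0.
have c1 j l : `|cos (th j l)| <= 1 by rewrite ler_norml cos_geN1 cos_le1.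
have ic j : m.-integrable setT (EFin \o (fun l => cos (th j l) * \1_G l)).
  by apply: (ib _ 1); [exact: measurable_funM|move=> x; rewrite normrM mulr_ile1].
have iI : m.-integrable setT (EFin \o (\1_G : T -> R)) by exact: (ib _ 1).
have EI : \int[m]_l (\1_G l : R) = g.
  by rewrite /Rintegral integral_indic// setIT.
pose u j := (\int[m]_l (cos (th j l) * \1_G l)) / Num.sqrt g.
have sg : 0 < Num.sqrt g by rewrite sqrtr_gt0.
have sgE : Num.sqrt g ^+ 2 = g by rewrite sqr_sqrtr// ltW.
exists u; split => [j|a].
  rewrite /u ler_pdivlMr// mulrAC -expr2 sgE.
  have : \int[m]_l (2^-1 * \1_G l) <= \int[m]_l (cos (th j l) * \1_G l).
    apply: le_Rintegral => // [|l _].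
      by have := integrableZl measurableT 2^-1 iI; apply: eq_integrable => // x _; rewrite /= EFinM.
    rewrite indicE; have [/set_mem Gl|_] := boolP (l \in G); last by rewrite !mulr0.
    by rewrite !mulr1 hG.
  by rewrite RintegralZl// EI mulrC.
pose h l := \sum_j a j * (cos (th j l) * \1_G l).
have ij j : m.-integrable setT (EFin \o (fun l => a j * (cos (th j l) * \1_G l))).
  by have := integrableZl measurableT (a j) (ic j); apply: eq_integrable => // x _; rewrite /= EFinM.
have [ih Eh] := Rintegral_sum_fin ij.
have luE : linc a u = (\int[m]_l h l) / Num.sqrt g.
  rewrite Eh /linc mulr_suml; apply: eq_bigr => j _.
  by rewrite (RintegralZl _ measurableT (ic j)) mulrA.
rewrite luE expr_div_n sgE.
have [iq ->] := fmat_quad i1 mth a.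
(* The mean of [h] over [G]. With this constant, Cauchy-Schwarz becomes the pointwise inequality
   [2 c x - c ^ 2 <= x ^ 2]. *)
set c := (\int[m]_l h l) / g.
have gn : g != 0 by rewrite gt_eqF.
have -> : (\int[m]_l h l) ^+ 2 / g = \int[m]_l (2 * c * h l - c ^+ 2 * \1_G l).
  have i2 : m.-integrable setT (EFin \o (fun l => 2 * c * h l)).
    by have := integrableZl measurableT (2 * c) ih; apply: eq_integrable => // x _; rewrite /= EFinM.
  have i3 : m.-integrable setT (EFin \o (fun l => c ^+ 2 * \1_G l)).
    by have := integrableZl measurableT (c ^+ 2) iI; apply: eq_integrable => // x _; rewrite /= EFinM.
  rewrite RintegralB// RintegralZl// RintegralZl// EI.
  have -> : \int[m]_l h l = c * g by rewrite mulfVK.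
  by field.
apply: le_Rintegral => // [|l _].
  have i2 : m.-integrable setT (EFin \o (fun l => 2 * c * h l)).
    by have := integrableZl measurableT (2 * c) ih; apply: eq_integrable => // x _; rewrite /= EFinM.
  have i3 : m.-integrable setT (EFin \o (fun l => c ^+ 2 * \1_G l)).
    by have := integrableZl measurableT (c ^+ 2) iI; apply: eq_integrable => // x _; rewrite /= EFinM.
  by have := integrableB measurableT i2 i3; apply: eq_integrable => // x _; rewrite /= EFinB.
rewrite mulr1 /h indicE; have [_|_] := boolP (l \in G); last first.
  by under eq_bigr do rewrite !mulr0; rewrite big1// !mulr0 subrr trig_ge0.
under eq_bigr do rewrite mulr1.
rewrite /trig mulr1; set x := \sum_j _; set y := \sum_j _.
have := sqr_ge0 (x - c); have := sqr_ge0 y.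
have -> : (x - c) ^+ 2 = x ^+ 2 - 2 * c * x + c ^+ 2 by ring.
by clear; lra.
Qed.

(** * Orthogonality of the grid characters on dyadic cubes *)

Section spectral.
Context {R : realType} (d : nat).
Local Notation E := (borel 'rV[R]_d).
Local Notation leb := (@lebesgue R d).

Lemma lebesgue_translate t A : measurable A -> leb (affine 1 t @^-1` A) = leb A.
Proof. by move=> mA; rewrite lebesgue_affine// expr1n invr1 mul1e. Qed.

Lemma Rintegral_translate (t : 'rV[R]_d) (f : E -> R) : leb.-integrable setT (EFin \o f) ->
  \int[leb]_x f (affine 1 t x) = \int[leb]_x f x.
Proof.
move=> intf.
have mt := measurable_affine 1 t.
have mf := measurable_int _ intf.
have EM (g : E -> \bar R) : (\int[pushforward leb (affine 1 t)]_x g x)%E = (\int[leb]_x g x)%E.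
  by apply: eq_measure_integral => A mA _; exact: lebesgue_translate.
have i2 : leb.-integrable (affine 1 t @^-1` setT) ((EFin \o f) \o affine 1 t).
  rewrite preimage_setT; have /integrableP[_ h] := intf; apply/integrableP; split.
    exact: measurableT_comp.
  have := EM (fun x => `|(f x)%:E|)%E; rewrite ge0_integral_pushforward//; last exact: measurableT_comp.
  by rewrite preimage_setT => ->.
have e := integral_pushforward mt mf i2 measurableT.
by rewrite preimage_setT EM in e; rewrite /Rintegral e.
Qed.

(** The shift moves [M y] by one half, so it exchanges the lower and upper halves of the unit
    interval for the fractional part of [M y]. From the lower half it crosses no integer multiple of
    [1 / M], hence no integer. *)
Lemma half_shift (M : nat) (y : R) : (0 < M)%N ->
  let fr z := z - (Num.floor z)%:~R in
  (fr (M%:R * y) < 2^-1 -> Num.floor (y + (2 * M%:R)^-1) = Num.floor y) /\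
  (fr (M%:R * y + 2^-1) < 2^-1) = ~~ (fr (M%:R * y) < 2^-1).
Proof.
move=> M0 fr; have M0' : 0 < M%:R :> R by rewrite ltr0n.
have /andP[h1 h2] := floor_itv y; have /andP[h3 h4] := floor_itv (M%:R * y).
have MV : M%:R * (2 * M%:R)^-1 = 2^-1 :> R by field; rewrite gt_eqF.
split.
  rewrite /fr ltrBlDl => h5; apply: floor_def.
  apply/andP; split; first by apply: le_trans h1 _; rewrite lerDl invr_ge0 mulr_ge0// ltW.
  rewrite -(ltr_pM2l M0') mulrDr MV.
  have : Num.floor (M%:R * y) < M%:Z * (Num.floor y + 1).
    by rewrite floor_lt_int intrM ltr_pM2l.
  rewrite -lezD1 -(ler_int R) => h6.
  have : (M%:Z * (Num.floor y + 1))%:~R = M%:R * (Num.floor y + 1)%:~R :> R by rewrite intrM.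
  move=> e; rewrite e intrD in h6.
  by apply: lt_le_trans h6; rewrite -[X in _ < _ + X](_ : 2^-1 + 2^-1 = _)//; lra.
have [h5|h5] := ltP (fr (M%:R * y)) 2^-1 => /=.
  have -> : fr (M%:R * y + 2^-1) = fr (M%:R * y) + 2^-1.
    rewrite /fr; have -> : Num.floor (M%:R * y + 2^-1) = Num.floor (M%:R * y).
      apply: floor_def; move: h5 h3 h4; rewrite /fr intrD => h5 h3 h4.
      by apply/andP; split; lra.
    by rewrite addrAC.
  by apply/negbTE; rewrite -leNgt lerDr; rewrite /fr subr_ge0.
have -> : fr (M%:R * y + 2^-1) = fr (M%:R * y) - 2^-1.
  rewrite /fr; have -> : Num.floor (M%:R * y + 2^-1) = Num.floor (M%:R * y) + 1.
    apply: floor_def; move: h5 h3 h4; rewrite /fr !intrD => h5 h3 h4.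
    by apply/andP; split; lra.
  by rewrite intrD; lra.
by move: h4; rewrite /fr intrD => h4; lra.
Qed.

Definition phase n (j : 'rV[int]_d) (l : E) : R := 2 * pi * (2 ^+ n * dotp l (of_int R j)).

Lemma measurable_dotp (x : 'rV[R]_d) : measurable_fun setT (fun l : E => dotp l x).
Proof.
by apply: measurable_sum => i; apply: measurable_funM => //; exact: borel_coord.
Qed.

Lemma measurable_phase n j : measurable_fun setT (phase n j).
Proof. by do 2! apply: measurable_funM => //; exact: measurable_dotp. Qed.

Lemma measurable_cos_comp d' (T : measurableType d') (f : T -> R) : measurable_fun setT f ->
  measurable_fun setT (fun x => cos (f x)).
Proof.
by move=> mf; apply: measurableT_comp => //; apply: continuous_measurable_fun; exact: continuous_cos.
Qed.

Lemma phaseB n j j' l : phase n j l - phase n j' l = phase n (j - j') l.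
Proof.
rewrite /phase /dotp -!mulrBr -sumrB; congr (_ * (_ * _)); apply: eq_bigr => i _.
by rewrite !mxE intrB mulrBr.
Qed.

(* Translating by a half period changes the sign of the cosine and maps the part
   of [D] where [frac (|j c| * 2^n * l c) < 1/2] onto the rest of [D]. *)
Lemma dyadic_cos0 n (D : set E) j : dyadic n D -> (leb D < +oo)%E -> j != 0 ->
  \int[leb]_l (cos (phase n j l) * \1_D l) = 0.
Proof.
move=> dD Doo jn0; have mD := dyadic_measurable dD.
have [c jc] : exists c, j ord0 c != 0.
  apply/existsP; apply: contraR jn0 => /existsPn h; apply/eqP/rowP => i.
  by rewrite mxE; apply/eqP; have := h i; rewrite negbK.
set M := `|j ord0 c|%N; have M0 : (0 < M)%N by rewrite absz_gt0.
have M0' : 0 < M%:R :> R by rewrite ltr0n.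
have p0 : 0 < 2 ^+ n :> R by rewrite exprn_gt0.
pose fr (z : R) := z - (Num.floor z)%:~R.
pose t : 'rV[R]_d := \row_i if i == c then (2 ^+ n)^-1 * (2 * M%:R)^-1 else 0.
pose low (l : E) : bool := fr (M%:R * (2 ^+ n * (l : 'rV[R]_d) ord0 c)) < 2^-1.
have tE (l : E) i : (affine 1 t l : 'rV[R]_d) ord0 i =
   (l : 'rV[R]_d) ord0 i + (if i == c then (2 ^+ n)^-1 * (2 * M%:R)^-1 else 0).
  by rewrite /affine !mxE mul1r.
have tcE (l : E) : 2 ^+ n * (affine 1 t l : 'rV[R]_d) ord0 c = 2 ^+ n * (l : 'rV[R]_d) ord0 c + (2 * M%:R)^-1.
  by rewrite tE eqxx mulrDr mulrA mulfV ?gt_eqF// mul1r.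
have lowT l : low (affine 1 t l) = ~~ low l.
  rewrite /low tcE mulrDr; have -> : M%:R * (2 * M%:R)^-1 = 2^-1 :> R by field; rewrite gt_eqF.
  exact: (half_shift _ M0).2.
have DT (l : E) : low l -> D (affine 1 t l) = D l.
  move=> hl; have e : dfloor n (affine 1 t l) = dfloor n l.
    apply/rowP => i; rewrite !mxE; have [->|ic] := eqVneq i c.
      rewrite /= mul1r mulrDr mulrA mulfV ?gt_eqF// mul1r.
      exact: (half_shift _ M0).1 hl.
    by rewrite /= addr0 mul1r.
  by apply/propext; split; apply: dD.
have mlow : measurable [set l | low l].
  pose F (k : int) : set E := [set l | 2 ^+ n * M%:R * (l : 'rV[R]_d) ord0 c - k%:~R < 2^-1] `&`
      [set l | k%:~R <= 2 ^+ n * M%:R * (l : 'rV[R]_d) ord0 c].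
  have mc : measurable_fun setT (fun l : E => 2 ^+ n * M%:R * (l : 'rV[R]_d) ord0 c).
    by apply: measurable_funM => //; exact: borel_coord.
  have -> : [set l | low l] = \bigcup_k F k.
    apply/seteqP; split => [l /= h|l [k _ [/= h1 h2]]].
      exists (Num.floor (2 ^+ n * M%:R * (l : 'rV[R]_d) ord0 c)) => //; split => /=.
        by move: h; rewrite /low /fr mulrCA mulrA.
      by have /andP[] := floor_itv (2 ^+ n * M%:R * (l : 'rV[R]_d) ord0 c).
    rewrite /low /fr mulrCA mulrA (_ : Num.floor _ = k)//.
    by apply: floor_def; rewrite h2 intrD; lra.
  apply: countable_bigcupT_measurable; first exact: countableP.
  move=> k; apply: measurableI.
    apply: (@measurable_lt_set _ _ _ _ (cst 2^-1)) => //; exact: measurable_funB.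
  rewrite (_ : [set l | _] = ~` [set l : E | 2 ^+ n * M%:R * (l : 'rV[R]_d) ord0 c < k%:~R]).
    by apply: measurableC; exact: (@measurable_lt_set _ _ _ _ (cst k%:~R)).
  by apply/seteqP; split => l /=; [move=> h; apply/negP; rewrite -leNgt|move=> /negP; rewrite -leNgt].
pose g l := cos (phase n j l).
have mg : measurable_fun setT g by apply: measurable_cos_comp; exact: measurable_phase.
have gT l : g (affine 1 t l) = - g l.
  rewrite /g /phase.
  have -> : dotp (affine 1 t l) (of_int R j) = dotp l (of_int R j) + (2 ^+ n)^-1 * (2 * M%:R)^-1 * (j ord0 c)%:~R.
    rewrite /dotp (bigD1 c)// [in RHS](bigD1 c)//= tE eqxx mulrDl [in LHS]mxE [in RHS]mxE addrAC; congr (_ + _ + _).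
      apply: eq_bigr => i /negPf ic; by rewrite tE ic addr0.
  rewrite [X in cos (_ * X)](_ : _ = 2 ^+ n * dotp l (of_int R j) + (2 * M%:R)^-1 * (j ord0 c)%:~R); last first.
    by rewrite mulrDr !mulrA mulfV ?gt_eqF// mul1r.
  rewrite mulrDr.
  have [jE|jE] : j ord0 c = M%:Z \/ j ord0 c = - M%:Z.
    by rewrite /M; case: (j ord0 c) => k; [left|right].
    rewrite jE; have -> : 2 * pi * ((2 * M%:R)^-1 * M%:~R) = pi :> R by field; rewrite gt_eqF.
    by rewrite cosDpi.
  rewrite jE; have -> : 2 * pi * ((2 * M%:R)^-1 * (- M%:Z)%:~R) = - pi :> R.
    by rewrite mulrNz; field; rewrite gt_eqF.
  by rewrite -cosN opprD opprK cosDpi cosN.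
pose D0 := D `&` [set l | low l]; pose D1 := D `&` ~` [set l | low l].
have mD0 : measurable D0 by exact: measurableI.
have mD1 : measurable D1 by apply: measurableI => //; exact: measurableC.
have iI (A : set E) : measurable A -> A `<=` D -> leb.-integrable setT (EFin \o (\1_A : E -> R)).
  move=> mA AD; apply/integrableP; split; first by apply/measurable_EFinP; exact: measurable_indic.
  under eq_integral => x _ do rewrite /= ger0_norm//.
  rewrite integral_indic// setIT; apply: le_lt_trans Doo.
  exact: (le_measure leb (mem_set mA) (mem_set mD)).
have ig (A : set E) : measurable A -> A `<=` D -> leb.-integrable setT (EFin \o (fun l => g l * \1_A l)).
  move=> mA AD; apply: (@integrable_bounded_mul _ _ _ _ g (\1_A) 1) => //; last exact: iI.
  by move=> x; rewrite ler_norml cos_geN1 cos_le1.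
have i0 := ig _ mD0 (@subIsetl _ _ _); have i1 := ig _ mD1 (@subIsetl _ _ _).
transitivity (\int[leb]_l (g l * \1_D0 l + g l * \1_D1 l)).
  apply: eq_Rintegral => l _; rewrite /g -mulrDr; congr (_ * _).
  rewrite !indicE /D0 /D1 !in_setI in_setC.
  by case: (l \in D); case: (l \in [set l | low l]); rewrite /= ?addr0 ?add0r.
rewrite RintegralD// -(Rintegral_translate t i1).
under [X in _ + X]eq_Rintegral => l _.
  rewrite gT (_ : \1_D1 (affine 1 t l) = \1_D0 l :> R); last first.
    rewrite !indicE; congr (_%:R); congr nat_of_bool.
    have h1 : D1 (affine 1 t l) = D0 l.
      rewrite /D1 /D0; apply/propext; split => -[/= a b].
        by have hl : low l; [move: b; rewrite lowT => /negP; rewrite negbK|rewrite -(DT _ hl)].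
      by split; [rewrite (DT _ b)|rewrite lowT b].
    by apply/idP/idP => /set_mem h; apply/mem_set; rewrite ?h1// -h1.
  rewrite mulNr -mulN1r.
  over.
by rewrite (RintegralZl _ measurableT i0) mulN1r subrr.
Qed.

End spectral.

Section spectral_key.
Context {R : realType} (d : nat).
Local Notation E := (borel 'rV[R]_d).
Local Notation leb := (@lebesgue R d).
Import HBNNSimple.

Definition ftrig n (J : finType) (j : J -> 'rV[int]_d) (a : J -> R) : E -> R :=
  trig (fun k l => phase n (j k) l) a.

Lemma ftrig_integrable n (J : finType) (j : J -> 'rV[int]_d) a (m : {measure set E -> \bar R}) (e : E -> R) :
  m.-integrable setT (EFin \o e) -> m.-integrable setT (EFin \o (fun l => ftrig n j a l * e l)).
Proof. by move=> ie; apply: (fmat_quad ie _ a).1 => k; exact: measurable_phase. Qed.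

Lemma ftrig_ge0 n (J : finType) (j : J -> 'rV[int]_d) a l : 0 <= ftrig n j a l.
Proof. exact: trig_ge0. Qed.

Lemma integrable_indic (A : set E) : measurable A -> (leb A < +oo)%E ->
  leb.-integrable setT (EFin \o (\1_A : E -> R)).
Proof.
move=> mA Aoo; apply/integrableP; split; first by apply/measurable_EFinP; exact: measurable_indic.
by under eq_integral => x _ do rewrite /= ger0_norm//; rewrite integral_indic// setIT.
Qed.

Lemma Rintegral_indic (A : set E) : measurable A -> \int[leb]_l (\1_A l) = fine (leb A) :> R.
Proof. by move=> mA; rewrite /Rintegral integral_indic// setIT. Qed.

(** Off-diagonal entries vanish by [dyadic_cos0] at the nonzero differences of indices, which is
    where injectivity enters. *)
Lemma dyadic_parseval n (D : set E) (J : finType) (j : J -> 'rV[int]_d) a :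
  dyadic n D -> (leb D < +oo)%E -> injective j ->
  \int[leb]_l (ftrig n j a l * \1_D l) = fine (leb D) * \sum_k a k ^+ 2.
Proof.
move=> dD Doo ij; have mD := dyadic_measurable dD.
have iD := integrable_indic mD Doo.
have mp k : measurable_fun setT (phase n (j k) : E -> R) by exact: measurable_phase.
rewrite /ftrig -(fmat_quad iD mp a).2 mulr_sumr; apply: eq_bigr => k _.
rewrite (bigD1 k)//= fmat_diag Rintegral_indic// -expr2 mulrC big1 ?addr0// => k' kk'.
rewrite /fmat; under eq_Rintegral do rewrite phaseB.
by rewrite dyadic_cos0 ?mulr0// subr_eq0; apply: contraNN kk' => /eqP/ij ->.
Qed.

(** The grid [2 ^ m Z ^ d] lies in [2 ^ n Z ^ d]. Bounds at level [n] therefore persist at finer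
    frequency scales, and approximations of different levels can be combined. *)
Lemma ftrig_le n m (J : finType) (j : J -> 'rV[int]_d) a : (n <= m)%N ->
  ftrig m j a = ftrig n (fun k => j k *+ (2 ^ (m - n))) a.
Proof.
move=> nm; have E1 k (l : E) : phase m (j k) l = phase n (j k *+ (2 ^ (m - n))) l.
  have e : 2 ^+ m = 2 ^+ n * 2 ^+ (m - n) :> R by rewrite -exprD subnKC.
  rewrite /phase /dotp; congr (_ * _); rewrite e -mulrA; congr (_ * _).
  rewrite mulr_sumr; apply: eq_bigr => i _; rewrite !mxE mulrCA; congr (_ * _).
  by rewrite mulmxnE rmorphMn /= -[RHS]mulr_natl natrX.
by apply/funext => l; rewrite /ftrig /trig; under eq_bigr do rewrite E1; under [X in _ + X ^+ 2]eq_bigr do rewrite E1.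
Qed.

Lemma mulrn_injective (J : finType) (j : J -> 'rV[int]_d) k : (0 < k)%N -> injective j ->
  injective (fun i => j i *+ k).
Proof.
move=> k0 ij x y /rowP h; apply: ij; apply/rowP => i; have := h i.
by rewrite !mulmxnE => /eqP; rewrite eqr_pMn2r// => /eqP.
Qed.

(* Up to a small additional density, trigonometric polynomials with frequencies
   in [2 ^ n Z ^ d] see [g] as a constant density. *)
Definition flat (g : E -> R) := forall eta : R, 0 < eta -> exists n (e : E -> R),
  [/\ forall l, 0 <= e l, leb.-integrable setT (EFin \o e), \int[leb]_l e l <= eta &
  forall (J : finType) (j : J -> 'rV[int]_d) a, injective j ->
    (\int[leb]_l g l - eta) * \sum_k a k ^+ 2 <= \int[leb]_l (ftrig n j a l * (g l + e l))].

Lemma flat_mono n m g (e : E -> R) eta : (n <= m)%N ->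
  (forall (J : finType) (j : J -> 'rV[int]_d) a, injective j ->
    eta * \sum_k a k ^+ 2 <= \int[leb]_l (ftrig n j a l * (g l + e l))) ->
  (forall (J : finType) (j : J -> 'rV[int]_d) a, injective j ->
    eta * \sum_k a k ^+ 2 <= \int[leb]_l (ftrig m j a l * (g l + e l))).
Proof.
move=> nm H J j a ij; rewrite (ftrig_le _ _ nm); apply: H.
by apply: mulrn_injective => //; rewrite expn_gt0.
Qed.

Lemma integrableDR (f g : E -> R) : leb.-integrable setT (EFin \o f) -> leb.-integrable setT (EFin \o g) ->
  leb.-integrable setT (EFin \o (fun x => f x + g x)).
Proof. by move=> hf hg; have := integrableD measurableT hf hg; apply: eq_integrable. Qed.

Lemma integrableZR c (f : E -> R) : leb.-integrable setT (EFin \o f) ->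
  leb.-integrable setT (EFin \o (fun x => c * f x)).
Proof. by move=> hf; have := integrableZl measurableT c hf; apply: eq_integrable. Qed.

Lemma flatD f g : leb.-integrable setT (EFin \o f) -> leb.-integrable setT (EFin \o g) ->
  flat f -> flat g -> flat (fun x => f x + g x).
Proof.
move=> intf intg hf hg eta eta0; have e2 : 0 < eta / 2 by rewrite divr_gt0.
have [n [e [e0 ie ee He]]] := hf _ e2; have [m [e' [e0' ie' ee' He']]] := hg _ e2.
exists (maxn n m), (fun x => e x + e' x); split.
- by move=> l; rewrite addr_ge0.
- exact: integrableDR.
- by rewrite (RintegralD measurableT ie ie') [eta]splitr lerD.
move=> J j a ij.
have h1 := flat_mono (leq_maxl n m) He a ij.
have h2 := flat_mono (leq_maxr n m) He' a ij.
under [leRHS]eq_Rintegral do rewrite /= addrACA mulrDr.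
rewrite (RintegralD measurableT (ftrig_integrable _ j a (integrableDR intf ie))
  (ftrig_integrable _ j a (integrableDR intg ie'))).
rewrite (RintegralD measurableT intf intg); apply: le_trans (lerD h1 h2).
by rewrite -mulrDl; apply: ler_wpM2r; [apply: sumr_ge0 => k _; exact: sqr_ge0|lra].
Qed.

Lemma flatZ c f : 0 < c -> leb.-integrable setT (EFin \o f) -> flat f -> flat (fun x => c * f x).
Proof.
move=> c0 intf hf eta eta0; have e2 : 0 < eta / c by rewrite divr_gt0.
have [n [e [e0 ie ee He]]] := hf _ e2.
exists n, (fun x => c * e x); split.
- by move=> l; rewrite mulr_ge0// ltW.
- exact: integrableZR.
- by rewrite RintegralZl// mulrC -ler_pdivlMr.
move=> J j a ij; under [leRHS]eq_Rintegral do rewrite /= -mulrDr mulrCA.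
rewrite (RintegralZl c measurableT (ftrig_integrable n j a (integrableDR intf ie))).
apply: le_trans (ler_wpM2l (ltW c0) (He J j a ij)).
by rewrite RintegralZl// mulrA mulrBr [c * (eta / c)]mulrC divfK// gt_eqF.
Qed.

(** [A] is cut to a large cube and replaced there by a dyadic set [D'], on which Parseval's identity
    is exact. The part of [D'] outside [A] becomes the additional density; the part of [A] outside
    [D'] is the loss of mass. *)
Lemma flat_indic (A : set E) : measurable A -> (leb A < +oo)%E -> flat (\1_A).
Proof.
move=> mA Aoo eta eta0; have e2 : 0 < eta / 2 by rewrite divr_gt0.
have fA B : measurable B -> B `<=` A -> leb B \is a fin_num.
  move=> mB BA; rewrite ge0_fin_numE//; apply: le_lt_trans Aoo.
  exact: (le_measure leb (mem_set mB) (mem_set mA)).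
pose W k : set E := box (fun=> - k%:R) (fun=> k%:R).
have mW k : measurable (W k) by exact: measurable_box.
have dW k : dyadic 0 (W k).
  move=> x y /rowP xy Wx i; have := xy i; rewrite !mxE expr0 !mul1r => e.
  have /andP[h1 h2] := Wx i; have := floor_ge_int (y ord0 i) (- k%:Z); have := floor_lt_int (y ord0 i) k%:Z.
  by rewrite -e floor_lt_int floor_ge_int mulrNz h2 h1 => <- <-.
have [k hk] : exists k, (leb (A `\` W k) <= (eta / 2)%:E)%E.
  have mAW k : measurable (A `&` W k) by exact: measurableI.
  have cv : fine (leb (A `&` W k)) @[k --> \oo] --> fine (leb A).
    apply: fine_cvg; rewrite fineK; last exact: fA.
    have AE : A = \bigcup_k (A `&` W k) by rewrite -setI_bigcupr box_cover setIT.
    have nd : {homo (fun k => A `&` W k) : n m / (n <= m)%N >-> (n <= m)%O}.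
      move=> n m nm; apply/subsetPset => x [Ax Wx]; split => // i.
      have /andP[h1 h2] := Wx i; apply/andP; split.
        by apply: le_trans h1; rewrite lerN2 ler_nat.
      by apply: lt_le_trans h2 _; rewrite ler_nat.
    have mU : measurable (\bigcup_k (A `&` W k)) by rewrite -AE.
    by have := @nondecreasing_cvg_mu _ _ _ leb _ mAW mU nd; rewrite -AE.
  have h : fine (leb A) - eta / 2 < fine (leb A) by rewrite ltrBlDr ltrDl.
  have [k _ hk] := cvgr_gt _ cv _ h.
  exists k; have := hk k (leqnn k); rewrite /= ltrBlDr => h3.
  have e : leb A = (leb (A `\` W k) + leb (A `&` W k))%E.
    exact: measureDI.
  have f1 : leb (A `\` W k) \is a fin_num by apply: fA; [exact: measurableD|exact: subDsetl].
  have f2 : leb (A `&` W k) \is a fin_num by apply: fA; [exact: mAW|exact: subIsetl].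
  move: h3; rewrite e fineD// addrC ltrD2l => h3; rewrite -[leLHS]fineK// lee_fin; exact: ltW.
have Woo : (leb (W k) < +oo)%E by rewrite lebesgue_box ltry.
pose nu : {finite_measure set E -> \bar R} := mfrestr (mW k) Woo.
have [n [D [dD hD]]] := @borel_approximable R d nu A mA _ e2.
have dD' : dyadic n (D `&` W k) by apply: dyadicI => //; exact: dyadic_le (dW k).
have mD := dyadic_measurable dD; have mD' := dyadic_measurable dD'.
set D' := D `&` W k in dD' mD' *.
have D'oo : (leb D' < +oo)%E.
  apply: (@le_lt_trans _ _ (leb (W k)) _ _ _ Woo).
  by apply: (le_measure leb (mem_set mD') (mem_set (mW k))); exact: subIsetr.
have hD' : (leb (differ A D `&` W k) <= (eta / 2)%:E)%E by [].
have mdf : measurable (differ A D `&` W k) by apply: measurableI => //; exact: measurable_differ.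
have AD : (leb (A `\` D') <= eta%:E)%E.
  apply: (@le_trans _ _ (leb ((A `\` W k) `|` (differ A D `&` W k)))).
    have m1 : measurable (A `\` D') by exact: measurableD.
    have m2 : measurable ((A `\` W k) `|` (differ A D `&` W k)) by apply: measurableU => //; exact: measurableD.
    apply: (le_measure leb (mem_set m1) (mem_set m2)).
    move=> x [Ax Dx]; have [Wx|Wx] := pselect (W k x); [right; split => //; left; split => // Dx'|by left].
    by apply: Dx.
  apply: (le_trans (measureU2 _ _ _)) => //; first exact: measurableD.
  by rewrite [eta]splitr EFinD; exact: leeD.
have DA : (leb (D' `\` A) <= eta%:E)%E.
  apply: (@le_trans _ _ (leb (differ A D `&` W k))).
    have m1 : measurable (D' `\` A) by exact: measurableD.
    apply: (le_measure leb (mem_set m1) (mem_set mdf)).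
    by move=> x [[Dx Wx] Ax]; split => //; right.
  by apply: (le_trans hD'); rewrite lee_fin; lra.
have mDA : measurable (D' `\` A) by exact: measurableD.
have DAoo : (leb (D' `\` A) < +oo)%E by apply: (le_lt_trans DA); rewrite ltry.
exists n, (\1_(D' `\` A)); split => //.
- exact: integrable_indic.
- by rewrite Rintegral_indic// -lee_fin fineK// ge0_fin_numE.
move=> J j a ij; rewrite Rintegral_indic//.
apply: (@le_trans _ _ (\int[leb]_l (ftrig n j a l * \1_D' l))).
  rewrite dyadic_parseval//; apply: ler_wpM2r; first by apply: sumr_ge0 => i _; exact: sqr_ge0.
  rewrite lerBlDr; have : (leb A <= leb D' + eta%:E)%E.
    apply: (@le_trans _ _ (leb (D' `|` (A `\` D')))).
      have m2 : measurable (D' `|` (A `\` D')) by apply: measurableU => //; exact: measurableD.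
      apply: (le_measure leb (mem_set mA) (mem_set m2)).
      by move=> x Ax; have [?|?] := pselect (D' x); [left|right].
    apply: (le_trans (measureU2 _ _ _)) => //; first exact: measurableD.
    by apply: leeD.
  have fD : leb D' \is a fin_num by rewrite ge0_fin_numE.
  have fA' : leb A \is a fin_num by exact: fA.
  by rewrite -[in X in X -> _](fineK fD) -[in X in X -> _](fineK fA') -EFinD lee_fin.
apply: le_Rintegral => // [||l _].
- by apply: ftrig_integrable; exact: integrable_indic.
- by apply: ftrig_integrable; apply: integrableDR; exact: integrable_indic.
apply: ler_wpM2l; first exact: ftrig_ge0.
rewrite !indicE in_setD; case: (l \in A); case: (l \in D') => //=; rewrite ?addr0 ?add0r//.
Qed.

Lemma flat_nnsfun (h : {nnsfun E >-> R}) : leb.-integrable setT (EFin \o h) -> flat h.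
Proof.
have le_int (f g : E -> R) : measurable_fun setT f -> (forall x, 0 <= f x <= g x) ->
    leb.-integrable setT (EFin \o g) -> leb.-integrable setT (EFin \o f).
  move=> mf fg; apply: le_integrable => //; first exact/measurable_EFinP.
  move=> x _ /=; have /andP[h1 h2] := fg x.
  by rewrite lee_fin !ger0_norm//; exact: le_trans h2.
have flat0 : flat (cst 0).
  move=> eta eta0; exists 0%N, (cst 0); split => //; first exact: integrable0.
    by rewrite Rintegral_cst//= mul0r ltW.
  move=> J j a ij; rewrite Rintegral_cst// mul0r sub0r.
  apply: (@le_trans _ _ 0).
    rewrite mulNr oppr_le0; apply: mulr_ge0; [exact: ltW|apply: sumr_ge0 => i _; exact: sqr_ge0].
  by apply: Rintegral_ge0 => l _; rewrite mulr_ge0// ?ftrig_ge0// addr0.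
apply: (@nnsfun_induction _ _ _ (fun f => leb.-integrable setT (EFin \o f) -> flat f)).
- by [].
- move=> A mA /integrableP[_]; under eq_integral => x _ do rewrite /= ger0_norm//.
  by rewrite integral_indic// setIT; exact: flat_indic.
- move=> c f c0 f0 mf hf icf; have [c00|cn0] := eqVneq c 0.
    by rewrite c00 (_ : (fun x => 0 * f x) = cst 0)//; apply/funext => x; rewrite mul0r.
  have cp : 0 < c by rewrite lt_neqAle eq_sym cn0.
  have intf : leb.-integrable setT (EFin \o f).
    have := integrableZR c^-1 icf; apply: eq_integrable => // x _ /=.
    by rewrite mulKf.
  by apply: flatZ => //; exact: hf.
- move=> f g f0 g0 mf mg hf hg ifg.
  have intf : leb.-integrable setT (EFin \o f).
    by apply: le_int ifg => // x; rewrite f0 lerDl g0.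
  have intg : leb.-integrable setT (EFin \o g).
    by apply: le_int ifg => // x; rewrite g0 lerDr f0.
  by apply: flatD => //; [exact: hf|exact: hg].
Qed.

(** As only a lower bound is claimed, the Radon-Nikodym density may be replaced by a smaller simple
    function. Half of [eta] pays for the mass lost in this way, the other half for the flatness of
    the simple function. *)
Lemma spectral_key (nu : {finite_measure set E -> \bar R}) : nu `<< leb ->
  forall eta : R, 0 < eta -> exists n (e : E -> R),
  [/\ forall l, 0 <= e l, leb.-integrable setT (EFin \o e), \int[leb]_l e l <= eta &
  forall (J : finType) (j : J -> 'rV[int]_d) a, injective j ->
    (fine (nu setT) - eta) * \sum_k a k ^+ 2 <=
    \int[nu]_l (ftrig n j a l) + \int[leb]_l (ftrig n j a l * e l)].
Proof.
move=> nuleb eta eta0; have e2 : 0 < eta / 2 by rewrite divr_gt0.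
pose rho := Radon_Nikodym_SigmaFinite.f nu leb.
have rho0 x : (0 <= rho x)%E by exact: Radon_Nikodym_SigmaFinite.f_ge0.
have rhof x : rho x \is a fin_num by exact: Radon_Nikodym_SigmaFinite.f_fin_num.
have irho : leb.-integrable setT rho by exact: Radon_Nikodym_SigmaFinite.f_integrable.
have mrho := measurable_int _ irho.
have nuT : nu setT = (\int[leb]_x rho x)%E by exact: Radon_Nikodym_SigmaFinite.f_integral.
pose h := nnsfun_approx measurableT mrho.
have hrho n x : ((h n x)%:E <= rho x)%E.
  have cv := cvg_nnsfun_approx measurableT mrho (fun x _ => rho0 x) (I : setT x).
  apply: (cvge_to_ge cv); exists n => // k nk /=.
  by rewrite lee_fin; have /lefP := nd_nnsfun_approx measurableT mrho nk; apply.
have ih n : leb.-integrable setT (EFin \o h n).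
  apply: le_integrable irho => //; first by apply/measurable_EFinP.
  move=> x _ /=; rewrite gee0_abs// ?lee_fin//; rewrite ger0_norm//; exact: hrho.
have [n hn] : exists n, fine (nu setT) - eta / 2 <= \int[leb]_x h n x.
  have cv : \int[leb]_x h n x @[n --> \oo] --> fine (nu setT).
    apply: fine_cvg; rewrite nuT fineK; last by rewrite -nuT fin_num_measure.
    have E1 : (\int[leb]_x rho x = \int[leb]_x (limn (fun n => (h n x)%:E)))%E.
      apply: eq_integral => x _; apply/esym; apply: cvg_lim => //.
      exact: (cvg_nnsfun_approx measurableT mrho (fun x _ => rho0 x) (I : setT x)).
    rewrite E1; apply: cvg_monotone_convergence => //.
    - by move=> k; apply/measurable_EFinP.
    - by move=> k x _; rewrite lee_fin.
    - by move=> x _ a b ab; rewrite lee_fin; have /lefP := nd_nnsfun_approx measurableT mrho ab; apply.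
  have hlt : fine (nu setT) - eta / 2 < fine (nu setT) by rewrite ltrBlDr ltrDl.
  have [k _ hk] := cvgr_gt _ cv _ hlt.
  by exists k; apply: ltW; exact: hk k (leqnn k).
have [m [e [e0 ie ee He]]] := flat_nnsfun (ih n) e2.
exists m, e; split => //; first by apply: (le_trans ee); lra.
move=> J j a ij.
have ift : nu.-integrable setT (EFin \o (ftrig m j a)).
  have i1 : nu.-integrable setT (EFin \o (cst 1 : E -> R)).
    by apply: (@bounded_integrable _ _ _ _ _ 1) => // x; rewrite normr1.
  by have := ftrig_integrable m j a i1; under eq_fun do rewrite mulr1.
have mft : measurable_fun setT (EFin \o ftrig m j a) by exact: measurable_int ift.
have E2 : \int[nu]_l ftrig m j a l = fine (\int[leb]_l ((ftrig m j a l)%:E * rho l))%E.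
  rewrite /Rintegral; congr fine; apply/esym.
  apply: (Radon_Nikodym_SigmaFinite.change_of_variables nuleb) => // l.
  by rewrite lee_fin ftrig_ge0.
have h1 : \int[leb]_l (ftrig m j a l * h n l) <= \int[nu]_l ftrig m j a l.
  rewrite E2 /Rintegral; apply: fine_le.
  - by apply: integrable_fin_num => //; exact: ftrig_integrable.
  - rewrite (Radon_Nikodym_SigmaFinite.change_of_variables nuleb)//; last first.
      by move=> l; rewrite lee_fin ftrig_ge0.
    exact: integrable_fin_num.
  apply: ge0_le_integral => //.
  - by move=> x _; rewrite lee_fin mulr_ge0// ftrig_ge0.
  - by have := ftrig_integrable m j a (ih n); exact: measurable_int.
  - exact: emeasurable_funM.
  - by move=> x _; rewrite EFinM lee_wpmul2l// ?lee_fin ?ftrig_ge0//; exact: hrho.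
have := He J j a ij; under [X in (_ <= X) -> _]eq_Rintegral do rewrite mulrDr.
rewrite RintegralD//; [|exact: ftrig_integrable|exact: ftrig_integrable].
move=> h2; apply: (@le_trans _ _ ((\int[leb]_l h n l - eta / 2) * \sum_k a k ^+ 2)).
  apply: ler_wpM2r; first by apply: sumr_ge0 => i _; exact: sqr_ge0.
  by move: hn; clear; set p := fine _; set q := Rintegral _ _ _; lra.
by apply: (le_trans h2); rewrite lerD2r.
Qed.

End spectral_key.

(** * Persistence and repulsion for a field indexed through an additive map *)

Section spectral_field.
Context {R : realType} (d : nat) {disp : measure_display} {Omega : measurableType disp}.
Variables (P : probability Omega R) (I : zmodType) (f : I -> {RV P >-> R}).
Variables (iota : I -> 'rV[R]_d) (mu : {finite_measure set (borel 'rV[R]_d) -> \bar R}).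
Hypothesis sf : stationary_gaussian_field f.
Hypothesis iotaB : forall x y, iota (x - y) = iota x - iota y.
Hypothesis covE : forall x, covariance_kernel f x = \int[mu]_l cos (2 * pi * dotp l (iota x)).
Local Notation E := (borel 'rV[R]_d).
Local Notation leb := (@lebesgue R d).

Let angle (J : finType) (x : J -> I) (j : J) (l : E) : R := 2 * pi * dotp l (iota (x j)).

Let mangle J x j : measurable_fun setT (@angle J x j).
Proof. by apply: measurable_funM => //; exact: measurable_dotp. Qed.

Lemma integrable_cst1 (m : {finite_measure set E -> \bar R}) : m.-integrable setT (EFin \o (cst 1 : E -> R)).
Proof. by apply: (@bounded_integrable _ _ _ _ _ 1) => // x; rewrite normr1. Qed.

Lemma dotpBr (l x y : 'rV[R]_d) : dotp l (x - y) = dotp l x - dotp l y.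
Proof. by rewrite /dotp -sumrB; apply: eq_bigr => i _; rewrite !mxE mulrBr. Qed.

Lemma covariance_fmat (J : finType) (x : J -> I) i j :
  covariance_kernel f (x j - x i) = fmat mu (cst 1) (angle x) i j.
Proof.
rewrite covE; apply: eq_Rintegral => l _.
by rewrite mulr1 /angle -mulrBr iotaB dotpBr.
Qed.

Lemma field_gauss_vec (J : finType) (x : J -> I) :
  gauss_vec P (fun j w => f (x j) w) (fmat mu (cst 1) (angle x)).
Proof.
have [h1 h2] := sgf_gauss_vec sf x; split => // a b; rewrite h2; congr (expR (- _ / 2) * _).
by apply: eq_bigr => i _; apply: eq_bigr => j _; rewrite covariance_fmat.
Qed.

Lemma field_persistence (J : finType) (x : J -> I) (g s : R) : 0 < g -> 0 < s ->
  (g%:E <= mu [set l | forall j, (2^-1 <= cos (2 * pi * dotp l (iota (x j))))%R])%E ->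
  3 / 4 <= Pr P (above (fun j w => f (x j) w) (- s)) ->
  2^-1 * normal_pdf 0 1 (s / (Num.sqrt g / 2) + 1) <= Pr P (above (fun j w => f (x j) w) 0).
Proof.
move=> g0 s0; set G := [set l | _] => gG Ps.
have mG : measurable (G : set E).
  rewrite (_ : G = \bigcap_(j in [set: J]) ~` [set l : E | cos (angle x j l) < 2^-1]).
    apply: fin_bigcap_measurable => // j _; apply: measurableC.
    by apply: (@measurable_lt_set _ _ _ _ (cst 2^-1)) => //; exact: measurable_cos_comp.
  apply/seteqP; split => l /= h j; first by move=> _; apply/negP; rewrite -leNgt; exact: h.
  by rewrite leNgt; apply/negP; exact: h.
have fG : mu G \is a fin_num by exact: fin_num_measure.
have gG' : g <= fine (mu G) by rewrite -lee_fin fineK.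
have G0 : 0 < fine (mu G) by exact: lt_le_trans gG'.
have [u [u1 u2]] := fmat_rank1 (mangle x) mG G0 (fun j l h => h j).
apply: (persist_lower (field_gauss_vec x) _ u2) => //.
- by move=> i j; exact: fmat_sym.
- by rewrite divr_gt0// sqrtr_gt0.
- by move=> j; apply: le_trans (u1 j); rewrite ler_pM2r ?invr_gt0// ler_sqrt// ltW.
Qed.

Variable nu : {finite_measure set E -> \bar R}.
Hypothesis nuleb : nu `<< leb.
Hypothesis numu : forall A : set E, measurable A -> (nu A <= mu A)%E.

(** The density [e] of [spectral_key] is the spectral density of the auxiliary field of
    [repulsion_upper], whose variance is its integral, at most [eta]. The offset [y] drops out of
    all differences of points, so [n] serves all translates of the grid. *)
Lemma grid_repulsion eta : 0 < eta -> eta < fine (nu setT) ->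
  let v := fine (nu setT) - eta in
  exists n : nat, forall (J : finType) (x : J -> I) (j : J -> 'rV[int]_d) y,
    injective j -> (forall k, iota (x k) = y + (2 ^+ n) *: of_int R (j k)) ->
    forall s l, 0 < s -> 0 <= l -> v <= 2 * (l + 3 * s) * s ->
    2 * #|J|%:R * expR (- s ^+ 2 / (8 * eta)) <= 2^-1 ->
    let p := normal_pdf 0 (Num.sqrt v) (l + 4 * s + 1) in p <= 1 ->
    Pr P [set w | (forall k, 0 <= f (x k) w) /\ \sum_k f (x k) w <= #|J|%:R * l] <=
    2 * expR (- (#|J|%:R * (p * s / (4 * (l + 3 * s))))).
Proof.
move=> eta0 etanu v; have v0 : 0 < v by rewrite subr_gt0.
have [n [e [e0 ie ee He]]] := spectral_key nuleb eta0.
exists n => J x j y ij xE s l s0 l0 vls Ns p p1.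
have mp k : measurable_fun setT (phase n (j k) : E -> R) by exact: measurable_phase.
have trE a : trig (angle x) a = ftrig n j a.
  apply/funext => z; rewrite /ftrig !trigE; apply: eq_bigr => i _; apply: eq_bigr => k _.
  congr (_ * cos _); rewrite /angle /phase -!mulrBr !xE -!dotpBr; congr (_ * _).
  rewrite opprD addrACA subrr add0r -scalerBr /dotp mulr_sumr.
  by apply: eq_bigr => q _; rewrite !mxE mulrCA.
apply: (repulsion_upper (field_gauss_vec x) (Se := fmat leb e (fun k => phase n (j k))) _ _ _ _ eta0) => //.
- by move=> i k; exact: fmat_sym.
- by move=> i k; exact: fmat_sym.
- exact: fmat_psd.
- by move=> k; rewrite fmat_diag.
move=> a; apply: (le_trans (He J j a ij)).
rewrite (fmat_quad ie mp a).2 lerD2r (fmat_quad (integrable_cst1 mu) (mangle x) a).2.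
have it (m' : {finite_measure set E -> \bar R}) := (fmat_quad (integrable_cst1 m') (mangle x) a).1.
under [leRHS]eq_Rintegral do rewrite mulr1.
rewrite -trE; have fi (m' : {finite_measure set E -> \bar R}) : (\int[m']_l (trig (angle x) a l)%:E)%E \is a fin_num.
  have := it m'; under eq_fun do rewrite mulr1.
  by move=> /(integrable_fin_num measurableT).
rewrite /Rintegral; apply: fine_le; [exact: fi|exact: fi|].
apply: ge0_le_measure_integral => //.
- by move=> l'; rewrite lee_fin trig_ge0.
- by have := it mu; under eq_fun do rewrite mulr1; exact: measurable_int.
Qed.

End spectral_field.

(** * Asymptotic bounds *)

Section growth.
Context {R : realType}.
Implicit Types (a b c C L : R).

(** Powers of [T] are written [expR (a * ln T)], and orders of growth are compared in the variable
    [L = ln T]. *)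
Lemma near_ln (Q : R -> Prop) : (\forall L \near +oo, Q L) -> \forall T \near +oo, Q (ln T).
Proof.
move=> [M [Mr HM]]; exists (expR M); split; first exact: num_real.
move=> T MT; apply: HM; rewrite -[M]expRK ltr_ln ?posrE ?expR_gt0//.
by apply: (lt_trans _ MT); exact: expR_gt0.
Qed.

Lemma near_ge c : \forall L \near (+oo : set_system R), c <= L.
Proof. by apply: nbhs_pinfty_ge; exact: num_real. Qed.

Lemma exp_beats a C : 0 < a -> \forall L \near +oo, C <= expR (a * L).
Proof.
move=> a0; apply: filterS (near_ge (C / a)) => L; rewrite ler_pdivrMr// mulrC => h.
by apply: le_trans h _; apply: le_trans (expR_ge1Dx _); lra.
Qed.

Lemma exp_beats_lin a C : 0 < a -> 0 <= C -> \forall L \near +oo, C * L <= expR (a * L).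
Proof.
move=> a0 C0; have a2 : 0 < a / 2 by rewrite divr_gt0.
have h1 := exp_beats (C / (a / 2)) a2.
apply: filterS2 h1 (near_ge 0) => L; rewrite ler_pdivrMr// => h L0.
have -> : a * L = a / 2 * L + a / 2 * L by lra.
rewrite expRD; set e := expR _ in h *.
have e0 : 0 < e by exact: expR_gt0.
have : 1 + a / 2 * L <= e by exact: expR_ge1Dx.
move=> h2; apply: (@le_trans _ _ (e * (a / 2) * L)); first by rewrite ler_wpM2r.
by rewrite -mulrA ler_pM2l//; lra.
Qed.

Lemma sqrt_expR (x : R) : Num.sqrt (expR x) = expR (x / 2).
Proof.
have -> : expR x = expR (x / 2) ^+ 2 by rewrite expr2 -expRD; congr expR; lra.
by rewrite sqrtr_sqr ger0_norm// expR_ge0.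
Qed.

(** A loss [eta] in the variance is paid with a quarter of [de] in the exponent. *)
Lemma shrink_ineq (m D de eta : R) : eta * (D - de / 2) <= m * (de / 4) ->
  m * (D - 3 / 4 * de) <= (m - eta) * (D - de / 2).
Proof. by lra. Qed.

End growth.

Section field_growth.
Context {R : realType} (d : nat) {disp : measure_display} {Omega : measurableType disp}.
Variables (P : probability Omega R) (I : zmodType) (f : I -> {RV P >-> R}).
Variables (iota : I -> 'rV[R]_d) (mu : {finite_measure set (borel 'rV[R]_d) -> \bar R}).
Hypothesis sf : stationary_gaussian_field f.
Hypothesis iotaB : forall x y, iota (x - y) = iota x - iota y.
Hypothesis covE : forall x, covariance_kernel f x = \int[mu]_l cos (2 * pi * dotp l (iota x)).

Section lower.
(* [low r] stands for the spectral mass of the ball of radius [r], in [R ^ d] or in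
   the torus. *)
Variables (low : R -> \bar R) (alpha : R).
Hypothesis alpha0 : 0 <= alpha.
Hypothesis low_alpha : (lne (low r) * ((ln r)^-1)%:E)%E @[r --> 0^'+] --> alpha%:E.
Hypothesis lowE : forall r (J : finType) (x : J -> I), 0 < r ->
  (forall j, (\sum_i `|iota (x j) ord0 i|) * r <= 8^-1) ->
  (low r <= mu [set l | forall j, (2^-1 <= cos (2 * pi * dotp l (iota (x j))))%R])%E.

(** Multiplying by [ln r], negative for [r < 1], reverses the inequality. A vanishing mass is
    excluded because its logarithm [-oo] would make the quotient [+oo]. *)
Lemma low_ge a : alpha < a -> exists2 rho : R, 0 < rho &
  forall r, 0 < r < rho -> ((expR (a * ln r))%:E <= low r)%E.
Proof.
move=> aa; have oU : open [set x : \bar R | (x < a%:E)%E] by exact: open_ereal_lt_ereal.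
have nU : nbhs alpha%:E [set x : \bar R | (x < a%:E)%E] by apply: open_nbhs_nbhs; split => //; rewrite /= lte_fin.
have /nbhs_ballP[rho /= rho0 H] := low_alpha nU.
exists (Num.min rho 1); first by rewrite lt_min rho0 ltr01.
move=> r /andP[r0]; rewrite lt_min => /andP[r1 r2].
have lr : ln r < 0 by rewrite ln_lt0// r0.
have : (lne (low r) * ((ln r)^-1)%:E < a%:E)%E.
  by apply: H => //; rewrite -ball_normE /= sub0r normrN gtr0_norm.
have li : (ln r)^-1 < 0 by rewrite invr_lt0.
case: (low r) => [y| |] /=; [|by rewrite leey|].
  case: ifPn => y0; first by rewrite lt0_mulNye ?lte_fin// => /lt_geF; rewrite leey.
  rewrite -ltNge in y0; rewrite -EFinM lte_fin ltr_ndivrMr// => h.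
  by rewrite lee_fin -[leRHS]lnK ?posrE// ler_expR ltW.
by rewrite lt0_mulNye ?lte_fin// => /lt_geF; rewrite leey.
Qed.

(** At radius [r = 1 / (c' T)] the spectral mass is at least [r ^ a]. The value required of the
    normal variable then has a square of order [T ^ (a + 2 eps)], and [a + 2 eps = alpha + 3 eps]
    stays below [b], which leaves a positive power of [T] for the constants. *)
Lemma field_lower b c : alpha < b -> 0 < c -> exists2 eps : R, 0 < eps &
  \forall T \near +oo, forall (J : finType) (x : J -> I),
    (forall j i, `|iota (x j) ord0 i| <= c * T) ->
    3 / 4 <= Pr P (above (fun j w => f (x j) w) (- expR (eps * ln T))) ->
    expR (- expR (b * ln T)) <= Pr P (above (fun j w => f (x j) w) 0).
Proof.
move=> ab c0; pose eps := (b - alpha) / 8; have eps0 : 0 < eps by rewrite divr_gt0// subr_gt0.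
exists eps => //; pose a := alpha + eps.
have aa : alpha < a by rewrite ltrDl.
have [rho rho0 Hrho] := low_ge aa.
(* The 8 is that of [lowE]; [d.+1] bounds the number of coordinates and remains positive in
   dimension 0. *)
pose c' := 8 * (d.+1%:R * c); have c'0 : 0 < c' by rewrite !mulr_gt0.
pose K := ln c'; pose q := ln (2^-1 * normal_peak 1 : R).
have pk : 0 < normal_peak 1 :> R by apply: normal_peak_gt0; exact: oner_neq0.
have h1 : \forall T \near +oo, (c' * rho)^-1 < T :> R by apply: nbhs_pinfty_gt; exact: num_real.
have h2 : \forall T \near (+oo : set_system R), 0 < T by exact: nbhs_pinfty_gt.
have ge0 : 0 < b - a - 2 * eps by rewrite /a /eps; lra.
have h3 := near_ln (exp_beats (9 / 2 * expR (a * K) + `|q|) ge0).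
have ge1 : 0 < eps + a / 2 by rewrite addr_gt0// divr_gt0// ltr_wpDl.
have h4 := near_ln (near_ge ((- (a * K)) / 2 / (eps + a / 2))).
have h5 := near_ln (near_ge (0 : R)).
near=> T => J x xT PT.
have T0 : 0 < T by near: T.
have h3' : 9 / 2 * expR (a * K) + `|q| <= expR ((b - a - 2 * eps) * ln T) by near: T.
have h4' : - (a * K) / 2 / (eps + a / 2) <= ln T by near: T.
have L0 : 0 <= ln T by near: T.
have Trho : (c' * rho)^-1 < T by near: T.
set L := ln T in PT h3' h4' L0 *.
pose r := (c' * T)^-1.
have r0 : 0 < r by rewrite invr_gt0 mulr_gt0.
have r1 : r < rho.
  by rewrite /r -[ltRHS]invrK ltf_pV2 ?posrE ?invr_gt0 ?mulr_gt0// -ltr_pdivrMl// -invfM.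
have lr : ln r = - (K + L) by rewrite /r lnV ?posrE ?mulr_gt0// lnM ?posrE.
have := Hrho r; rewrite r0 r1 lr => /(_ isT) gr.
have xr j : (\sum_i `|iota (x j) ord0 i|) * r <= 8^-1.
  rewrite /r ler_pdivrMr ?mulr_gt0//.
  apply: (@le_trans _ _ (\sum_(i < d) c * T)); first by apply: ler_sum => i _; exact: xT.
  rewrite sumr_const card_ord -[leLHS]mulr_natl.
  have -> : 8^-1 * (c' * T) = d.+1%:R * (c * T) by rewrite /c'; field.
  by rewrite ler_wpM2r ?ler_nat// ltW// mulr_gt0.
have s0 : 0 < expR (eps * L) :> R by exact: expR_gt0.
have := field_persistence sf iotaB covE (expR_gt0 _) s0 (le_trans gr (lowE r0 xr)) PT.
apply: le_trans; rewrite sqrt_expR.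
set z := _ + 1.
have zE : z = 2 * expR (eps * L + a * (K + L) / 2) + 1.
  rewrite /z invf_div mulrA mulrC mulrA -expRN -expRD mulrC; congr (_ * expR _ + _).
  by rewrite mulrN mulNr opprK addrC.
have z3 : 0 <= z <= 3 * expR (eps * L + a * (K + L) / 2).
  have : 1 <= expR (eps * L + a * (K + L) / 2).
    rewrite -[leLHS]expR0 ler_expR; move: h4'; rewrite ler_pdivrMr// => h.
    rewrite [leRHS](_ : _ = L * (eps + a / 2) - (- (a * K) / 2)); [by rewrite subr_ge0|by field].
  rewrite zE; set w := expR _ => w1; apply/andP; split; lra.
have zz : z ^+ 2 <= 9 * (expR (a * K) * expR ((a + 2 * eps) * L)).
  rewrite -expRD; have -> : a * K + (a + 2 * eps) * L = (eps * L + a * (K + L) / 2) + (eps * L + a * (K + L) / 2) by lra.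
  rewrite expRD -expr2; have /andP[z0 z1] := z3.
  have -> : 9 = 3 ^+ 2 :> R by rewrite -natrX.
  by rewrite -exprMn lerXn2r// nnegrE// (le_trans z0).
rewrite normal_pdf_neq0E ?oner_neq0// mulrA -[X in X * expR _]lnK ?posrE ?mulr_gt0//.
rewrite -/q -expRD ler_expR subr0 expr1n.
have q1 : - `|q| <= q by rewrite lerNl -normrN ler_norm.
have e1 : 1 <= expR ((a + 2 * eps) * L).
  have a0 : 0 <= a by exact: addr_ge0 alpha0 (ltW eps0).
  by rewrite -[leLHS]expR0 ler_expR mulr_ge0// (addr_ge0 a0 (mulr_ge0 (ler0n _ _) (ltW eps0))).
have -> : b * L = (b - a - 2 * eps) * L + (a + 2 * eps) * L by lra.
rewrite expRD; move: h3' zz e1 q1; set E1 := expR (a * K); set E2 := expR ((a + 2 * eps) * L).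
set E3 := expR _; set Q := `|q| => h3' zz e1 q1.
have Q0 : 0 <= Q by exact: normr_ge0.
have E20 : 0 <= E2 by lra.
have h6 : (9 / 2 * E1 + Q) * E2 <= E3 * E2 by rewrite ler_wpM2r.
have h7 : Q * 1 <= Q * E2 by rewrite ler_wpM2l.
by move: h6 h7 zz q1; clear; rewrite mulrDl; set A := E3 * E2; set B := Q * E2; set F := z ^+ 2; rewrite -mulrA; set G := E1 * E2; lra.
Unshelve. all: end_near.
Qed.

End lower.

Section upper.
Variable nu : {finite_measure set (borel 'rV[R]_d) -> \bar R}.
Hypothesis nuleb : nu `<< @lebesgue R d.
Hypothesis numu : forall A, measurable A -> (nu A <= mu A)%E.
Let m := fine (nu setT).
Hypothesis m0 : 0 < m.

(** In units of [sqrt L], [A] is the level of exponent [D - delta] and [B] that of exponent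
    [D - 3/4 delta]. The slack [k] keeps the level below [B] after all additions, and [eta] is so
    small that a density of variance [m - eta] at [B] is still of order [T ^ -(D - delta / 2)]. The
    constants [c1] and [C] are quantified after [n] and [k], because the count of the blocks depends
    on these. *)
Lemma field_upper (D delta dd : R) : 0 < delta -> delta < D -> 0 <= dd ->
  exists n (k : R), 0 < k /\ forall c1 C, 0 < c1 -> 0 < C -> exists2 c : R, 0 < c &
  \forall T \near +oo, forall (J : finType) (x : J -> I) (j : J -> 'rV[int]_d) y,
    injective j -> (forall i, iota (x i) = y + (2 ^+ n) *: of_int R (j i)) ->
    c1 * expR (dd * ln T) <= #|J|%:R <= C * expR (dd * ln T) ->
    Pr P [set w | (forall i, 0 <= f (x i) w) /\
      \sum_i f (x i) w <= #|J|%:R * ((1 + k) ^+ 2 * Num.sqrt (2 * m * (D - delta) * ln T))] <=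
    2 * expR (- (c * expR ((dd - D + delta / 2) * ln T))).
Proof.
move=> de0 deD dd0.
pose A := Num.sqrt (2 * m * (D - delta)); pose B := Num.sqrt (2 * m * (D - 3 / 4 * delta)).
have A0 : 0 < A by rewrite sqrtr_gt0 !mulr_gt0// subr_gt0.
have B2 : B ^+ 2 = 2 * m * (D - 3 / 4 * delta) by rewrite sqr_sqrtr// !mulr_ge0 ?ltW//; lra.
have AB : A < B.
  rewrite ltr_sqrt; first by rewrite ltr_pM2l ?mulr_gt0//; lra.
  by rewrite !mulr_gt0//; lra.
(* By [k <= 1], [(1 + k) ^ 2 <= 1 + 3 k], whence [3 A]; the 5 pays for [4 * s + 1 <= 5 * s]. *)
pose k := Num.min 1 ((B - A) / (3 * A + 5)).
have A5 : 0 < 3 * A + 5 by rewrite addr_gt0// mulr_gt0.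
have k0 : 0 < k by rewrite lt_min ltr01 divr_gt0// subr_gt0.
have k1 : k <= 1 by rewrite ge_min lexx.
have kAB : k * (3 * A + 5) <= B - A by rewrite -ler_pdivlMr// ge_min lexx orbT.
have Dd : 0 < D - delta / 2 by lra.
(* In turn: the variance [m - eta] stays positive, the loss is the one allowed by [shrink_ineq], and
   the tail of the auxiliary field at [s = k sqrt L] beats a union over about [T ^ dd] points. *)
pose eta := Num.min (m / 2) (Num.min (m * (delta / 4) / (D - delta / 2)) (k ^+ 2 / (8 * (dd + 1)))).
have k20 : 0 < k ^+ 2 by rewrite exprn_gt0.
have d10 : 0 < 8 * (dd + 1) by lra.
have eta0 : 0 < eta by rewrite !lt_min !divr_gt0// mulr_gt0//; lra.
have etam : eta < m by rewrite (@le_lt_trans _ _ (m / 2)) ?ge_min ?lexx// ltr_pdivrMr// ltr_pMr// ltr1n.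
have eta1 : eta * (D - delta / 2) <= m * (delta / 4) by rewrite -ler_pdivlMr// !ge_min lexx orbT.
have eta2 : dd + 1 <= k ^+ 2 / (8 * eta).
  rewrite ler_pdivlMr ?mulr_gt0//.
  have : eta <= k ^+ 2 / (8 * (dd + 1)) by rewrite !ge_min lexx !orbT.
  by rewrite ler_pdivlMr// mulrCA [eta * _]mulrC mulrCA.
have [n Hn] := grid_repulsion sf iotaB covE nuleb numu eta0 etam.
exists n, k; split => // c1 C c10 C0.
set v := fine (nu setT) - eta in Hn; have v0 : 0 < v by rewrite subr_gt0.
have sv : Num.sqrt v != 0 by rewrite gt_eqF// sqrtr_gt0.
pose pk := normal_peak (Num.sqrt v); have pk0 : 0 < pk by exact: normal_peak_gt0.
pose W := (1 + k) ^+ 2 * A + 3 * k.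
have W0 : 0 < W by rewrite addr_gt0// mulr_gt0// exprn_gt0//; lra.
exists (c1 * (pk * (k / (4 * W)))); first by rewrite !mulr_gt0// invr_gt0 mulr_gt0.
have h1 := near_ln (near_ge (k ^- 2)).
have h2 := near_ln (near_ge (v / (6 * k ^+ 2))).
have g3 : 0 < 8 * k ^+ 2 / v by rewrite divr_gt0// mulr_gt0.
have h3 := near_ln (exp_beats pk g3).
have h4 := near_ln (exp_beats (4 * C) (ltr01 : 0 < 1 :> R)).
have h5 := near_ln (near_ge (1 : R)).
near=> T => J x j y ij xE /andP[N1 N2].
have h1' : k ^- 2 <= ln T by near: T.
have h2' : v / (6 * k ^+ 2) <= ln T by near: T.
have h3' : pk <= expR (8 * k ^+ 2 / v * ln T) by near: T.
have h4' : 4 * C <= expR (1 * ln T) by near: T.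
have L1 : 1 <= ln T by near: T.
set L := ln T in N1 N2 h1' h2' h3' h4' L1 *.
have L0 : 0 <= L by exact: le_trans L1.
pose t := Num.sqrt L; have t2 : t ^+ 2 = L by rewrite sqr_sqrtr.
have t0 : 0 < t by rewrite sqrtr_gt0; exact: lt_le_trans L1.
pose s := k * t; have s0 : 0 < s by rewrite mulr_gt0.
have s2 : s ^+ 2 = k ^+ 2 * L by rewrite exprMn t2.
have s1 : 1 <= s.
  have h : 1 ^+ 2 <= s ^+ 2 by rewrite s2 expr1n -ler_pdivrMl// mulr1.
  by rewrite -ler_sqr ?nnegrE// ltW.
have -> : Num.sqrt (2 * m * (D - delta) * L) = A * t.
  by rewrite sqrtrM// !mulr_ge0// ?ltW//; lra.
pose l := (1 + k) ^+ 2 * (A * t).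
have l0 : 0 < l by apply: mulr_gt0; [apply: exprn_gt0; lra|exact: mulr_gt0].
have lW : l + 3 * s = W * t by rewrite /l /s /W; ring.
have e0 x' : 0 < expR x' :> R by exact: expR_gt0.
set z := l + 4 * s + 1 in Hn.
pose z' := l + 4 * s + 1.
have z0 : 0 <= z'.
  exact: addr_ge0 (addr_ge0 (ltW l0) (mulr_ge0 (ler0n _ _) (ltW s0))) ler01.
have zB : z' <= B * t.
  have hk : (1 + k) ^+ 2 <= 1 + 3 * k by rewrite expr2; nra.
  have h6 : (1 + k) ^+ 2 * (A * t) <= (1 + 3 * k) * (A * t) by rewrite ler_wpM2r// mulr_ge0// ltW.
  have h7 : (k * (3 * A + 5)) * t <= (B - A) * t by rewrite ler_wpM2r// ltW.
  rewrite /z' /l; apply: (@le_trans _ _ ((1 + 3 * k) * (A * t) + 4 * s + s)); first by lra.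
  by move: h7; rewrite /s; lra.
have zz : z' ^+ 2 / (2 * v) <= (D - delta / 2) * L.
  rewrite ler_pdivrMr ?mulr_gt0//.
  have h6 : z' ^+ 2 <= B ^+ 2 * L.
    by rewrite -t2 -exprMn lerXn2r// nnegrE// (le_trans z0).
  apply: (le_trans h6); rewrite B2.
  have h8 : m * (D - 3 / 4 * delta) <= v * (D - delta / 2).
    exact: shrink_ineq eta1.
  rewrite [leRHS](_ : _ = 2 * (v * (D - delta / 2)) * L); last by ring.
  by rewrite ler_wpM2r// -mulrA ler_pM2l.
have z16 : 16 * s ^+ 2 <= z' ^+ 2.
  have -> : 16 = 4 ^+ 2 :> R by rewrite -natrX.
  rewrite -exprMn lerXn2r ?nnegrE ?mulr_ge0// ?ltW// /z'; lra.
have pE : normal_pdf 0 (Num.sqrt v) z' = pk * expR (- (z' ^+ 2 / (2 * v))).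
  rewrite normal_pdf_neq0E// subr0 sqr_sqrtr ?ltW//; congr (_ * expR _).
  by rewrite mulNr -[v *+ 2]mulr_natl.
have p1 : normal_pdf 0 (Num.sqrt v) z' <= 1.
  rewrite pE expRN ler_pdivrMr// mul1r; apply: (le_trans h3'); rewrite ler_expR.
  rewrite ler_pdivlMr ?mulr_gt0//; apply: le_trans z16; rewrite s2.
  by rewrite le_eqVlt; apply/orP; left; apply/eqP; field; rewrite gt_eqF.
have pp : pk * expR (- ((D - delta / 2) * L)) <= normal_pdf 0 (Num.sqrt v) z'.
  by rewrite pE ler_pM2l// ler_expR lerN2.
have vls : v <= 2 * (l + 3 * s) * s.
  apply: (@le_trans _ _ (6 * s ^+ 2)).
    by rewrite s2 mulrA -ler_pdivrMl ?mulr_gt0// mulrC.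
  have : 0 <= l * s by rewrite mulr_ge0// ltW.
  move=> h; have -> : 2 * (l + 3 * s) * s = 2 * (l * s) + 6 * s ^+ 2 by ring.
  by rewrite lerDr mulr_ge0.
have Ns : 2 * #|J|%:R * expR (- s ^+ 2 / (8 * eta)) <= 2^-1.
  have h6 : expR (- s ^+ 2 / (8 * eta)) <= expR (- ((dd + 1) * L)).
    rewrite ler_expR mulNr lerN2 s2 mulrAC; exact: ler_wpM2r.
  have h7 : 2 * #|J|%:R * expR (- s ^+ 2 / (8 * eta)) <= 2 * (C * expR (dd * L)) * expR (- ((dd + 1) * L)).
    by apply: ler_pM => //; rewrite ?mulr_ge0// ?ler_pM2l// expR_ge0.
  apply: (le_trans h7).
  have -> : 2 * (C * expR (dd * L)) * expR (- ((dd + 1) * L)) = 2 * C * (expR (1 * L))^-1.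
    by rewrite -expRN mulrA -[LHS]mulrA -expRD; congr (_ * expR _); lra.
  by rewrite ler_pdivrMr//; lra.
apply: (le_trans (Hn J x j y ij xE s l s0 (ltW l0) vls Ns p1)).
rewrite ler_pM2l// ler_expR lerN2 lW.
rewrite [(dd - D + delta / 2) * L](_ : _ = dd * L + - ((D - delta / 2) * L)); last by lra.
rewrite expRD.
have -> : normal_pdf 0 (Num.sqrt v) z' * s / (4 * (W * t)) = normal_pdf 0 (Num.sqrt v) z' * (k / (4 * W)).
  by rewrite /s; field; rewrite !gt_eqF.
have kW : 0 < k / (4 * W) by rewrite divr_gt0// mulr_gt0.
apply: (@le_trans _ _ ((c1 * expR (dd * L)) * ((pk * expR (- ((D - delta / 2) * L))) * (k / (4 * W))))).
  by rewrite le_eqVlt; apply/orP; left; apply/eqP; ring.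
apply: ler_pM => //; first by rewrite mulr_ge0// ltW.
  exact: mulr_ge0 (mulr_ge0 (ltW pk0) (expR_ge0 _)) (ltW kW).
by rewrite ler_pM2r.
Unshelve. all: end_near.
Qed.

End upper.
End field_growth.

(** * Balls and blocks *)

Section balls.
Context {R : realType} (d : nat).
Local Notation E := (borel 'rV[R]_d).
Local Notation leb := (@lebesgue R d).

Lemma eballE (r : R) (x : 'rV[R]_d) : 0 <= r -> eball r x <-> dotp x x <= r ^+ 2.
Proof.
move=> r0; have xx : 0 <= dotp x x by apply: sumr_ge0 => i _; rewrite -expr2 sqr_ge0.
by rewrite /eball /= -[X in _ <-> is_true (X <= _)](sqr_sqrtr xx) ler_sqr ?nnegrE.
Qed.

Lemma eball_coord (r : R) (x : 'rV[R]_d) i : 0 <= r -> eball r x -> `|x ord0 i| <= r.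
Proof.
move=> r0 /(eballE _ r0) h; rewrite -ler_sqr ?nnegrE// real_normK ?num_real//.
apply: le_trans h; rewrite /dotp (bigD1 i)//= -expr2 lerDl.
by apply: sumr_ge0 => j _; rewrite -expr2 sqr_ge0.
Qed.

Lemma measurable_eball (r : R) : 0 <= r -> measurable (eball r : set E).
Proof.
move=> r0; rewrite (_ : eball r = ~` [set x : E | r ^+ 2 < dotp x x]).
  apply: measurableC; apply: (@measurable_lt_set _ _ _ (cst (r ^+ 2))) => //.
  by apply: measurable_sum => i; apply: measurable_funM; exact: borel_coord.
apply/seteqP; split => x.
  by move/(eballE _ r0) => h /=; rewrite ltNge => /negP; apply.
by move=> /= /negP; rewrite -leNgt => h; apply/eballE.
Qed.

Lemma lebesgue_eballM (c r : R) : 0 < c -> 0 <= r ->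
  leb (eball (c * r)) = ((c ^+ d)%:E * leb (eball r))%E.
Proof.
move=> c0 r0; have cr : 0 <= c * r by rewrite mulr_ge0// ltW.
have cd : 0 < c ^+ d by rewrite exprn_gt0.
have e : (affine c 0 @^-1` eball (c * r) : set E) = (eball r : set E).
  have dE (x : 'rV[R]_d) : dotp (affine c 0 x) (affine c 0 x) = c ^+ 2 * dotp x x.
    rewrite /dotp mulr_sumr; apply: eq_bigr => i _; rewrite /affine !mxE addr0.
    by rewrite mulrACA -expr2.
  apply/seteqP; split => x.
    by move/(eballE _ cr); rewrite dE exprMn ler_pM2l ?exprn_gt0// => h; apply/eballE.
  by move/(eballE _ r0) => h; apply/eballE => //; rewrite dE exprMn ler_pM2l ?exprn_gt0.
rewrite -[in RHS]e lebesgue_affine//; last exact: measurable_eball.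
by rewrite muleA -EFinM mulfV ?gt_eqF// mul1e.
Qed.

Lemma lebesgue_eball1 : (0 < leb (eball 1) < +oo)%E.
Proof.
apply/andP; split.
  pose c : R := d.+1%:R^-1; have c0 : 0 < c by rewrite invr_gt0.
  have s : (box (fun=> - c) (fun=> c) : set E) `<=` eball 1.
    move=> x h.
    apply: (eballE x ler01).2.
    apply: (@le_trans _ _ (\sum_(i < d) c ^+ 2)).
      apply: ler_sum => i _; rewrite -expr2 -real_normK ?num_real// ler_sqr ?nnegrE// ?(ltW c0)//.
      by rewrite ler_norml; have /andP[-> /ltW ->] := h i.
    rewrite sumr_const card_ord expr1n -mulr_natl /c -[leRHS](@mulfV _ (d.+1%:R ^+ 2 : R)) ?expf_neq0//.
    by rewrite exprVn ler_wpM2r ?invr_ge0 ?exprn_ge0// -natrX ler_nat (leq_trans (leqnSn d))// leq_pmulr.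
  apply: (@lt_le_trans _ _ (leb (box (fun=> - c) (fun=> c)))); last first.
    exact: (le_measure leb (mem_set (measurable_box _ _)) (mem_set (measurable_eball ler01)) s).
  by rewrite lebesgue_box lte_fin prodr_gt0// => i _; rewrite opprK lt_max addr_gt0 ?orbT.
have s : (eball 1 : set E) `<=` box (fun=> - 1) (fun=> 2 : R).
  move=> x h i; have := eball_coord i ler01 h; rewrite ler_norml => /andP[-> h1].
  by apply: (le_lt_trans h1); rewrite ltr1n.
apply: (@le_lt_trans _ _ (leb (box (fun=> - 1) (fun=> 2)))).
  exact: (le_measure leb (mem_set (measurable_eball ler01)) (mem_set (measurable_box _ _)) s).
by rewrite lebesgue_box ltry.
Qed.

Definition vol1 : R := fine (leb (eball 1)).

Lemma vol1_gt0 : 0 < vol1.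
Proof. by have /andP[h1 h2] := lebesgue_eball1; rewrite fine_gt0// h1 h2. Qed.

Lemma lebesgue_eball (r : R) : 0 < r -> leb (eball r) = (r ^+ d * vol1)%:E.
Proof.
move=> r0; rewrite -[in LHS](mulr1 r) lebesgue_eballM// EFinM fineK//.
by have /andP[h1 h2] := lebesgue_eball1; rewrite ge0_fin_numE// ltW.
Qed.

Definition block (L : R) (k : 'rV[int]_d) : set E :=
  box (fun i => L * (k ord0 i)%:~R) (fun i => L * ((k ord0 i)%:~R + 1)).

Lemma lebesgue_block L k : 0 < L -> leb (block L k) = (L ^+ d)%:E.
Proof.
move=> L0; rewrite lebesgue_box; congr _%:E; rewrite -[in RHS](card_ord d) -prodr_const.
by apply: eq_bigr => i _; rewrite mulrDr mulr1 addrAC subrr add0r max_r// ltW.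
Qed.

Lemma block_floor L k (x : 'rV[R]_d) : 0 < L -> block L k x -> k = \row_i Num.floor (L^-1 * x ord0 i).
Proof.
move=> L0 h; apply/rowP => i; rewrite mxE; apply/esym/floor_def; have /andP[h1 h2] := h i.
by rewrite intrD ler_pdivlMl// ltr_pdivrMl// h1 h2.
Qed.

Lemma floor_block L (x : 'rV[R]_d) : 0 < L -> block L (\row_i Num.floor (L^-1 * x ord0 i)) x.
Proof.
move=> L0 i; rewrite !mxE -ler_pdivlMl// -ltr_pdivrMl//.
by have := floor_itv (L^-1 * x ord0 i); rewrite intrD.
Qed.

(** Coordinates of two points of a block differ by at most [L], so that [|y| ^ 2 <= r ^ 2 + 2 d r L
    + d L ^ 2 <= (r + d L) ^ 2]. The generous margin [d L] avoids the square root in the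
    diameter. *)
Lemma block_near L k T (x y : 'rV[R]_d) : 0 < L -> 0 <= T - d%:R * L ->
  eball (T - d%:R * L) x -> block L k x -> block L k y -> eball T y.
Proof.
move=> L0 T0 hx bx byy; set r := T - d%:R * L in hx T0.
have TE : T = r + d%:R * L by rewrite /r subrK.
have T0' : 0 <= T by rewrite TE addr_ge0// mulr_ge0// ltW.
apply/eballE => //; rewrite /dotp.
apply: (@le_trans _ _ (\sum_i (x ord0 i * x ord0 i + (2 * r * L + L ^+ 2)))).
  apply: ler_sum => i _; have := eball_coord i T0 hx.
  rewrite ler_norml => /andP[h5 h6].
  have /andP[h1 h2] := bx i; have /andP[h3 h4] := byy i.
  set a := x ord0 i in h1 h2 h5 h6 *; set b := y ord0 i in h3 h4 *.
  set q := L * _ in h1 h3; rewrite mulrDr mulr1 -/q in h2 h4.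
  have hab : - L <= b - a <= L by apply/andP; split; move: h1 h2 h3 h4; clear; lra.
  have e : b * b = a * a + 2 * a * (b - a) + (b - a) ^+ 2 by ring.
  rewrite e -addrA lerD2l; apply: lerD.
    have : a * (b - a) <= r * L.
      apply: le_trans (ler_norm _) _; rewrite normrM ler_pM//.
        by rewrite ler_norml h5 h6.
      by rewrite ler_norml.
    by rewrite -!mulrA ler_pM2l.
  by rewrite -[leLHS]real_normK ?num_real// ler_sqr ?nnegrE ?(ltW L0)// ler_norml.
rewrite big_split /= sumr_const card_ord -[X in _ + X]mulr_natl.
move/(eballE _ T0) : hx; rewrite /dotp; set D := \sum_i _ => hD.
have -> : T ^+ 2 = r ^+ 2 + d%:R * (2 * r * L) + (d%:R * L) ^+ 2 by rewrite TE; ring.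
have -> : D + d%:R * (2 * r * L + L ^+ 2) = D + d%:R * (2 * r * L) + d%:R * L ^+ 2 by ring.
apply: lerD; first by rewrite lerD2r.
rewrite exprMn ler_wpM2r ?sqr_ge0// -natrX ler_nat; case: (d) => // n; exact: leq_pmulr.
Qed.

(** Parametrises the integer points of the cube [[-N, N) ^ d] by a finite type. *)
Definition shifted (N : nat) (k : {ffun 'I_d -> 'I_(N + N)}) : 'rV[int]_d :=
  \row_i ((k i)%:Z - N%:Z).

Lemma shifted_inj N : injective (@shifted N).
Proof.
move=> k k' /rowP h; apply/ffunP => i; have := h i; rewrite !mxE => /addIr [e].
exact: val_inj.
Qed.

Lemma shifted_surj N (z : 'rV[int]_d) : (forall i, - N%:Z <= z ord0 i < N%:Z) -> exists k, z = @shifted N k.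
Proof.
move=> h; have hb i : (`|(z ord0 i + N%:Z)%R|%N < N + N)%N.
  have /andP[h1 h2] := h i; have h3 : 0 <= z ord0 i + N%:Z by rewrite -lerBlDr sub0r.
  by rewrite -ltz_nat gez0_abs// PoszD ltrD2r.
exists [ffun i => Ordinal (hb i)]; apply/rowP => i; rewrite mxE ffunE /=.
have /andP[h1 h2] := h i; have h3 : 0 <= z ord0 i + N%:Z by rewrite -lerBlDr sub0r.
by rewrite gez0_abs// addrK.
Qed.

(** The blocks inside the ball are disjoint and cover the ball of radius [T - d L]. Integrating
    these two facts, written as inequalities between indicators, bounds the number of blocks on both
    sides by volumes. *)
Lemma blocks_exist (L k : R) : 0 < L -> 0 < k -> exists c1 C : R, [/\ 0 < c1, 0 < C &
  \forall T \near +oo, exists (J : finType) (j : J -> 'rV[int]_d),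
  [/\ injective j, (forall i x, block L (j i) x -> eball T x),
      (forall x : E, \sum_i \1_(block L (j i)) x <= \1_(eball T) x :> R),
      fine (leb (eball T)) <= (1 + k) * (#|J|%:R * L ^+ d) &
      c1 * T ^+ d <= #|J|%:R <= C * T ^+ d]].
Proof.
move=> L0 k0; have V0 := vol1_gt0; have Ld : 0 < L ^+ d by rewrite exprn_gt0.
exists (vol1 / ((1 + k) * L ^+ d)), (vol1 / L ^+ d).
split; [by rewrite divr_gt0// mulr_gt0//; lra|by rewrite divr_gt0|].
have h1 : \forall T \near +oo, d%:R * L < T :> R by apply: nbhs_pinfty_gt; exact: num_real.
have h2 : \forall T \near +oo, (d%:R * (d%:R * L)) / (k / (1 + k)) <= T :> R by apply: nbhs_pinfty_ge; exact: num_real.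
near=> T.
have T1 : d%:R * L < T by near: T.
have T2 : (d%:R * (d%:R * L)) / (k / (1 + k)) <= T by near: T.
have dL : 0 <= d%:R * L by rewrite mulr_ge0// ltW.
have T0 : 0 < T by exact: le_lt_trans T1.
pose N := (Num.truncn (T / L)).+2.
pose J : finType := {k : {ffun 'I_d -> 'I_(N + N)} | `[< block L (shifted k) `<=` eball T >]}.
pose j (i : J) := shifted (val i).
have ij : injective j by move=> x y /shifted_inj/val_inj.
have jB i x : block L (j i) x -> eball T x.
  by have /asboolP := valP i; apply.
have single (x : E) i i' : block L (j i) x -> block L (j i') x -> i = i'.
  by move=> /(block_floor L0) h /(block_floor L0) h'; apply: ij; rewrite h h'.
have sum_le (x : E) : \sum_i \1_(block L (j i)) x <= \1_(eball T) x :> R.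
  have [[i hi]|no] := pselect (exists i, block L (j i) x).
    rewrite (bigD1 i)//= big1; last first.
      move=> i' ii'; rewrite indicE memNset// => hi'; move/eqP : ii'; apply; exact: single hi' hi.
    by rewrite addr0 !indicE !mem_set//; exact: jB hi.
  rewrite big1 ?indicE// => i _; rewrite indicE memNset// => hi; apply: no; by exists i.
have sum_ge (x : E) : \1_(eball (T - d%:R * L)) x <= \sum_i \1_(block L (j i)) x :> R.
  rewrite indicE; have [/set_mem hx|_] := boolP (x \in _); last by apply: sumr_ge0 => i _.
  have TdL : 0 <= T - d%:R * L by rewrite subr_ge0 ltW.
  have bx := floor_block x L0; set z := \row_i _ in bx.
  have [q qE] : exists q, z = @shifted N q.
    apply: shifted_surj => i; rewrite mxE.
    have : eball T x by apply: (block_near L0 TdL hx bx bx).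
    move/(eball_coord i (ltW T0)); rewrite ler_norml => /andP[a1 a2].
    have tN : T / L < (Num.truncn (T / L)).+1%:R by exact: truncnS_gt.
    rewrite floor_ge_int floor_lt_int mulrNz.
    have b2 : L^-1 * x ord0 i <= T / L by rewrite mulrC ler_pM2r ?invr_gt0.
    have b1 : - (T / L) <= L^-1 * x ord0 i by rewrite -mulNr mulrC ler_pM2l ?invr_gt0.
    have NN : (Num.truncn (T / L)).+1%:R <= N%:R :> R by rewrite ler_nat.
    by move: b1 b2 tN NN; rewrite -!pmulrn; clear; lra.
  have zB : `[< block L (shifted q) `<=` eball T >].
    by apply/asboolP => y hy; apply: (block_near L0 TdL hx bx); rewrite qE.
  rewrite (bigD1 (exist _ q zB : J))//= indicE mem_set; last by rewrite /j /= -qE.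
  by rewrite lerDl; apply: sumr_ge0.
have mblock i : measurable (block L (j i)) by exact: measurable_box.
have iblock i : leb.-integrable setT (EFin \o (\1_(block L (j i)) : E -> R)).
  by apply: integrable_indic => //; rewrite lebesgue_block// ltry.
have [isum Esum] := Rintegral_sum_fin iblock.
have EN : \int[leb]_x (\sum_i \1_(block L (j i)) x) = #|J|%:R * L ^+ d :> R.
  rewrite Esum; under eq_bigr do rewrite Rintegral_indic// lebesgue_block//=.
  by rewrite sumr_const mulr_natl.
have iball r : 0 < r -> leb.-integrable setT (EFin \o (\1_(eball r) : E -> R)).
  by move=> r0; apply: integrable_indic; [exact: measurable_eball (ltW r0)|rewrite lebesgue_eball// ltry].
have Eball r : 0 < r -> \int[leb]_x (\1_(eball r) x : R) = r ^+ d * vol1.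
  by move=> r0; rewrite Rintegral_indic ?lebesgue_eball//; exact: measurable_eball (ltW r0).
have TdL : 0 < T - d%:R * L by rewrite subr_gt0.
have up : #|J|%:R * L ^+ d <= T ^+ d * vol1.
  by rewrite -EN -Eball//; apply: le_Rintegral => //; exact: iball.
have lo : (T - d%:R * L) ^+ d * vol1 <= #|J|%:R * L ^+ d.
  by rewrite -EN -Eball//; apply: le_Rintegral => //; exact: iball.
(* Bernoulli's inequality for [(1 - d L / T) ^ d]; the threshold [T2] makes the loss at most
   [k / (1 + k)]. *)
have ratio : T ^+ d <= (1 + k) * (T - d%:R * L) ^+ d.
  have -> : T - d%:R * L = T * (1 + - (d%:R * L / T)) by field; rewrite gt_eqF.
  rewrite exprMn mulrCA -[leLHS]mulr1 ler_pM2l ?exprn_gt0//.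
  have bern : -1 <= - (d%:R * L / T) by rewrite lerN2 ler_pdivrMr// mul1r ltW.
  have := ler_bernoulli d bern; rewrite -[X in 1 + X]mulr_natl => h.
  have k1 : 0 < 1 + k by lra.
  rewrite -ler_pdivrMl// mulr1; apply: le_trans h.
  move: T2; rewrite ler_pdivrMr ?divr_gt0// => h3.
  have : d%:R * (d%:R * L / T) <= k / (1 + k).
    by rewrite mulrA ler_pdivrMr// [leRHS]mulrC.
  move=> h4; have -> : (1 + k)^-1 = 1 - k / (1 + k) by field; rewrite gt_eqF.
  by rewrite mulrN; apply: lerB.

have V : T ^+ d * vol1 <= (1 + k) * (#|J|%:R * L ^+ d).
  apply: (@le_trans _ _ ((1 + k) * ((T - d%:R * L) ^+ d * vol1))).
    by rewrite mulrA ler_pM2r.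
  by rewrite ler_pM2l//; lra.
exists J, j; split => //; first by rewrite lebesgue_eball.
apply/andP; split.
  rewrite mulrAC ler_pdivrMr; last by rewrite mulr_gt0//; lra.
  by rewrite [leRHS]mulrCA [leLHS]mulrC.
by rewrite mulrAC ler_pdivlMr// [leRHS]mulrC.
Unshelve. all: end_near.
Qed.

End balls.

(** The conditional probability of the complement is at most the quotient of the two exponential
    bounds, and a larger power of [T] in the exponent outweighs every constant. *)
Lemma cond_prob_cvg1 {R : realType} d (T : measurableType d) (P : probability T R)
    (A B : R -> set T) (b b' c C : R) : 0 <= b -> b < b' -> 0 < c ->
  (forall r, 0 < r -> measurable (A r)) -> (forall r, 0 < r -> measurable (B r)) ->
  (\forall r \near +oo, expR (- expR (b * ln r)) <= Pr P (B r)) ->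
  (\forall r \near +oo, Pr P (B r `\` A r) <= C * expR (- (c * expR (b' * ln r)))) ->
  cond_prob P (A r) (B r) @[r --> +oo] --> (1 : R).
Proof.
move=> b0 bb c0 mA mB lo up; apply/cvgrPdist_le => e e0.
(* Covers the factor [C] and the target [e]: for large [r] one has
   [c T ^ b' >= (1 + K) T ^ b >= T ^ b + K]. *)
pose K := `|ln (e / (`|C| + 1))|.
have bb' : 0 < b' - b by rewrite subr_gt0.
have h1 := near_ln (exp_beats ((1 + K) / c) bb').
have h2 : \forall T \near (+oo : set_system R), 0 < T by exact: nbhs_pinfty_gt.
have h3 := near_ln (near_ge (0 : R)).
near=> r.
have r0 : 0 < r by near: r.
have L0 : 0 <= ln r by near: r.
have H1 : (1 + K) / c <= expR ((b' - b) * ln r) by near: r.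
have lo' : expR (- expR (b * ln r)) <= Pr P (B r) by near: r.
have up' : Pr P (B r `\` A r) <= C * expR (- (c * expR (b' * ln r))) by near: r.
have B0 : 0 < Pr P (B r) by apply: lt_le_trans lo'; exact: expR_gt0.
rewrite /cond_prob -[fine (P (A r `&` B r))]/(Pr P (A r `&` B r)) -[fine (P (B r))]/(Pr P (B r)).
have E := PrID P (mB _ r0) (mA _ r0); rewrite setIC in E.
have -> : 1 - Pr P (A r `&` B r) / Pr P (B r) = Pr P (B r `\` A r) / Pr P (B r).
  apply: (mulIf (lt0r_neq0 B0)); rewrite mulrBl mul1r !divfK ?gt_eqF//.
  by rewrite [in LHS]E addrC addKr.
rewrite ger0_norm; last by rewrite divr_ge0// ?Pr_ge0// ltW.
rewrite ler_pdivrMr//; apply: (le_trans up').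
apply: (@le_trans _ _ (e * expR (- expR (b * ln r)))); last by rewrite ler_pM2l.
have C0 : 0 < `|C| + 1 by rewrite ltr_wpDl.
apply: (@le_trans _ _ ((`|C| + 1) * expR (- (c * expR (b' * ln r))))).
  by rewrite ler_pM2r ?expR_gt0//; apply: (le_trans (ler_norm _)); lra.
pose w := ln (e / (`|C| + 1)).
have eE : e = (`|C| + 1) * expR w by rewrite lnK ?posrE ?divr_gt0// mulrC divfK ?gt_eqF.
rewrite [X in _ <= X * _]eE -mulrA ler_pM2l// -expRD ler_expR.
have K1 : - K <= w by rewrite /K -/w lerNl -normrN ler_norm.
have e1 : 1 <= expR (b * ln r) by rewrite -[leLHS]expR0 ler_expR mulr_ge0.
have -> : b' * ln r = (b' - b) * ln r + b * ln r by lra.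
rewrite expRD mulrA; move: H1; rewrite ler_pdivrMr// [_ * c]mulrC => H1.
have K0 : 0 <= K by exact: normr_ge0.
have : (1 + K) * expR (b * ln r) <= c * expR ((b' - b) * ln r) * expR (b * ln r).
  by rewrite ler_wpM2r// expR_ge0.
have : K * 1 <= K * expR (b * ln r) by rewrite ler_wpM2l.
move: K1 e1; set u := expR (b * ln r); set v := c * _ * u; set w' := w; set K' := K; move=> K1 e1.
rewrite mulrDl mul1r; set ku := K' * u; move: K1 e1; clear; lra.
Unshelve. all: end_near.
Qed.

Section sets_and_sums.
Context {R : realType}.

Lemma measurable_ge_set d (T : measurableType d) (f : T -> R) c : measurable_fun setT f ->
  measurable [set w | c <= f w].
Proof.
move=> mf; rewrite (_ : [set w | _] = ~` [set w | f w < c]); last first.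
  by apply/seteqP; split => w /=; [move=> h; apply/negP; rewrite -leNgt|move=> /negP; rewrite -leNgt].
by apply: measurableC; exact: (@measurable_lt_set _ _ _ _ (cst c)).
Qed.

Lemma measurable_forall d (T : measurableType d) (I : countType) (Q : I -> set T) :
  (forall i, measurable (Q i)) -> measurable [set w | forall i, Q i w].
Proof.
move=> mQ; rewrite (_ : [set w | _] = ~` \bigcup_i ~` Q i).
  apply: measurableC; apply: countable_bigcupT_measurable; first exact: countableP.
  by move=> i; exact: measurableC.
apply/seteqP; split => w /=; first by move=> h [i _]; apply.
by move=> h i; apply: contrapT => hi; apply: h; exists i.
Qed.

Lemma ler_sum_uniq (I : eqType) (s t : seq I) (F : I -> R) : uniq s -> uniq t ->
  {subset t <= s} -> (forall i, i \in s -> 0 <= F i) -> \sum_(i <- t) F i <= \sum_(i <- s) F i.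
Proof.
move=> us ut ts F0.
have <- : \sum_(i <- s | i \in t) F i = \sum_(i <- t) F i.
  rewrite -big_filter; apply: perm_big; apply: uniq_perm => //; first exact: filter_uniq.
  by move=> i; rewrite mem_filter; have [/ts ->|] := boolP (i \in t).
rewrite [leRHS](bigID (fun i => i \in t)) lerDl big_seq_cond; apply: sumr_ge0 => i /andP[si _]; exact: F0.
Qed.

Lemma linc_opp (J : finType) (a x : J -> R) : linc a (fun j => - x j) = linc (fun j => - a j) x.
Proof. by apply: eq_bigr => j _; rewrite mulrN mulNr. Qed.

Lemma gauss_vec_opp d (T : measurableType d) (P : probability T R) (J : finType) (X : J -> T -> R) S :
  gauss_vec P X S -> gauss_vec P (fun j w => - X j w) S.
Proof.
move=> [mX gX]; split=> [j|a b]; first exact: measurable_funN.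
under eq_Rintegral do rewrite linc_opp.
rewrite gX; congr (expR (- _ / 2) * _).
by apply: eq_bigr => i _; apply: eq_bigr => j _; rewrite mulrNN.
Qed.

Lemma above_tail d (T : measurableType d) (P : probability T R) (J : finType) (X : J -> T -> R) S (v s : R) :
  gauss_vec P X S -> (forall j, S j j <= v) -> 0 < v -> 0 < s ->
  1 - #|J|%:R * expR (- s ^+ 2 / (8 * v)) <= Pr P (above X (- s)).
Proof.
move=> gX Sv v0 s0; have s2 : 0 <= s / 2 by rewrite divr_ge0// ltW.
have gN := gauss_vec_opp gX.
have ma : measurable (above X (- s)).
  rewrite (_ : above X (- s) = \bigcap_(j in [set: J]) [set w | - s < X j w]).
    apply: fin_bigcap_measurable => // j _.
    by apply: (@measurable_lt_set _ _ _ (cst (- s))) => //; exact: gX.1.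
  by apply/seteqP; split => w /= h j; [move=> _|]; exact: h.
rewrite lerBlDr -lerBlDl -PrC//.
have mt j : measurable [set w | s / 2 < - X j w].
  by apply: (@measurable_lt_set _ _ _ (cst (s / 2))) => //; exact: gN.1.
apply: (@le_trans _ _ (\sum_j Pr P [set w | s / 2 < - X j w])); last first.
  rewrite mulr_natl -[leRHS]sumr_const; apply: ler_sum => j _.
  apply: (le_trans (gauss_vec_tail gN (Sv j) v0 s2)).
  rewrite ler_expR le_eqVlt; apply/orP; left; apply/eqP; field; rewrite gt_eqF//.
apply: Pr_union => //; first exact: measurableC.
move=> w /existsNP[j hj]; exists j => //=; rewrite ltrNr; apply: (@le_lt_trans _ _ (- s)).
  by rewrite leNgt; apply/negP.
by rewrite ltrN2; lra.
Qed.

End sets_and_sums.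

(** * Fields on the lattice *)

Section lattice.
Context {R : realType} (d : nat) {disp : measure_display} {Omega : measurableType disp}.
Variables (P : probability Omega R) (f : 'rV[int]_d -> {RV P >-> R}).
Variables (mu nu : {finite_measure set (borel 'rV[R]_d) -> \bar R}) (low : R -> \bar R) (alpha : R).
Hypothesis sf : stationary_gaussian_field f.
Hypothesis covE : forall x, covariance_kernel f x = \int[mu]_l cos (2 * pi * dotp l (of_int R x)).
Hypothesis alpha0 : 0 <= alpha.
Hypothesis low_alpha : (lne (low r) * ((ln r)^-1)%:E)%E @[r --> 0^'+] --> alpha%:E.
Hypothesis lowE : forall r (J : finType) (x : J -> 'rV[int]_d), 0 < r ->
  (forall j, (\sum_i `|(of_int R (x j)) ord0 i|) * r <= 8^-1) ->
  (low r <= mu [set l | forall j, (2^-1 <= cos (2 * pi * dotp l (of_int R (x j))))%R])%E.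
Hypothesis nuleb : nu `<< @lebesgue R d.
Hypothesis numu : forall A, measurable A -> (nu A <= mu A)%E.
Hypothesis nu0 : 0 < fine (nu setT).
Variable delta : R.
Hypothesis delta0 : 0 < delta < d%:R - alpha.

Let m := fine (nu setT).
Let ball (T : R) : set 'rV[int]_d := lattice_ball (R := R) T.
Let pos T : set Omega := [set w | forall x, ball T x -> 0 <= f x w].
Let high T : set Omega :=
  [set w | Num.sqrt (2 * m * (d%:R - alpha - delta) * ln T) <=
    (fine (lebesgue (@eball R d T)))^-1 * \sum_(x \in ball T) f x w].

Let iotaB x y : of_int R (x - y) = of_int R x - of_int R y :> 'rV[R]_d.
Proof. by apply/rowP => i; rewrite !mxE intrB. Qed.

Lemma shifted_cover T (x : 'rV[int]_d) : 0 < T -> ball T x ->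
  exists k, x = shifted (N := (Num.truncn T).+1) k.
Proof.
move=> T0 bx; apply: shifted_surj => i.
have := eball_coord i (ltW T0) bx; rewrite mxE ler_norml => /andP[h1 h2].
have tN : T < (Num.truncn T).+1%:R by exact: truncnS_gt.
rewrite -(ler_int R) -(ltr_int R) mulrNz -!pmulrn.
by rewrite (le_lt_trans h2 tN) (le_trans _ h1)// lerN2 ltW.
Qed.

Lemma finite_ball T : 0 < T -> finite_set (ball T).
Proof.
move=> T0; apply: (@sub_finite_set _ _ (@shifted d (Num.truncn T).+1 @` setT)).
  by move=> x /(shifted_cover T0)[k ->]; exists k.
by apply: finite_image; exact: finite_finset.
Qed.

Lemma measurable_pos T : measurable (pos T).
Proof.
rewrite (_ : pos T = [set w | forall x, (if `[< ball T x >] then [set w | 0 <= f x w] else setT) w]).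
  by apply: measurable_forall => x; case: ifP => _ //; exact: measurable_ge_set.
apply/seteqP; split => w /= h x; have := h x.
  by case: ifPn => // /asboolP bx; apply.
by case: ifPn => [/asboolP|/asboolP].
Qed.

Lemma measurable_high T : 0 < T -> measurable (high T).
Proof.
move=> T0; apply: measurable_ge_set; apply: measurable_funM => //.
under eq_fun do rewrite (fsbig_finite _ _ (finite_ball T0)).
by apply: measurable_sum.
Qed.

(** The field is made positive on a whole cube [[-N, N) ^ d] containing the ball. It has at most
    [(4 T) ^ d] points, and a union bound over them is beaten by the Gaussian tail at [T ^ eps]. *)
Lemma lattice_lower b : alpha < b -> \forall T \near +oo, expR (- expR (b * ln T)) <= Pr P (pos T).
Proof.
move=> ab; have c0 : 0 < 2 :> R by [].
have [eps eps0 H] := field_lower sf iotaB covE alpha0 low_alpha lowE ab c0.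
pose v := `|covariance_kernel f 0| + 1; have v0 : 0 < v by rewrite ltr_wpDl.
have e2 : 0 < 2 * eps by rewrite mulr_gt0.
have dd0 : 0 <= 16 * v * d%:R by rewrite !mulr_ge0// ltW.
have h1 := near_ln (exp_beats_lin e2 dd0).
have h2 := near_ln (exp_beats (16 * v * (d%:R * ln 4 + ln 4)) e2).
have h3 : \forall T \near +oo, 1 <= T :> R by exact: nbhs_pinfty_ge.
near=> T.
have T1 : 1 <= T by near: T.
have T0 : 0 < T by exact: lt_le_trans T1.
have H1 : 16 * v * d%:R * ln T <= expR (2 * eps * ln T) by near: T.
have H2 : 16 * v * (d%:R * ln 4 + ln 4) <= expR (2 * eps * ln T) by near: T.
set N := (Num.truncn T).+1; have NT : N%:R <= 2 * T.
  have : (Num.truncn T)%:R <= T by rewrite truncn_le// ltW.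
  by rewrite /N -natr1; lra.
pose x := @shifted d N.
have xT j i : `|(of_int R (x j)) ord0 i| <= 2 * T.
  rewrite !mxE; apply: le_trans NT; have := ltn_ord (j i) => h.
  rewrite intrB -!pmulrn ler_norml lerBlDr lerBrDr addNr ler0n/= -natrD ler_nat; exact: ltnW.
have : 3 / 4 <= Pr P (above (fun j w => f (x j) w) (- expR (eps * ln T))).
  have Sv (j : {ffun 'I_d -> 'I_(N + N)}) : covariance_kernel f (x j - x j) <= v.
    by rewrite subrr /v; apply: (le_trans (ler_norm _)); rewrite lerDl.
  apply: le_trans (above_tail (sgf_gauss_vec sf x) Sv v0 (expR_gt0 _)).
  suff : #|{ffun 'I_d -> 'I_(N + N)}|%:R * expR (- expR (eps * ln T) ^+ 2 / (8 * v)) <= 4^-1 by lra.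
  have cJ : #|{ffun 'I_d -> 'I_(N + N)}|%:R <= expR (d%:R * (ln 4 + ln T)).
    rewrite card_ffun !card_ord natrX mulrC expRM_natr expRD !lnK ?posrE//.
    by rewrite lerXn2r ?nnegrE ?mulr_ge0 ?(ltW T0)// natrD; lra.
  apply: (@le_trans _ _ (expR (d%:R * (ln 4 + ln T)) * expR (- expR (eps * ln T) ^+ 2 / (8 * v)))).
    by rewrite ler_wpM2r// expR_ge0.
  have <- : expR (- ln 4) = 4^-1 :> R by rewrite expRN lnK ?posrE.
  rewrite -expRD ler_expR expr2 -expRD.
  have -> : eps * ln T + eps * ln T = 2 * eps * ln T by lra.
  have h : d%:R * (ln 4 + ln T) + ln 4 <= expR (2 * eps * ln T) / (8 * v).
    by rewrite ler_pdivlMr ?mulr_gt0//; move: H1 H2; set e := expR _; set u := ln T; set q := ln 4; lra.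
  by move: h; rewrite mulNr; set e := _ / _; lra.
move=> tail.
have HH : forall (J : finType) (x : J -> 'rV[int]_d), (forall j i, `|(of_int R (x j)) ord0 i| <= 2 * T) ->
  3 / 4 <= Pr P (above (fun j w => f (x j) w) (- expR (eps * ln T))) ->
  expR (- expR (b * ln T)) <= Pr P (above (fun j w => f (x j) w) 0) by near: T.
apply: (le_trans (HH _ x xT tail)).
apply: Pr_le; last first.
- by move=> w h z /(shifted_cover T0)[k ->]; apply: ltW; exact: h.
- exact: measurable_pos.
rewrite (_ : above _ 0 = [set w | forall j, [set w | 0 < f (x j) w] w])//.
apply: measurable_forall => j; exact: (@measurable_lt_set _ _ _ (cst 0)).
Unshelve. all: end_near.
Qed.

(** A block of side [2 ^ n] contains one point of each residue class modulo [2 ^ n], so the points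
    in blocks form [2 ^ (n d)] translates of a grid. Positivity bounds their sum by the sum over the
    ball. One factor [1 + k] in the level pays for the volume outside the blocks, the other for
    Markov's inequality over the translates. *)
Lemma lattice_upper : exists c C : R, 0 < c /\
  \forall T \near +oo, Pr P (pos T `\` high T) <= C * expR (- (c * expR ((alpha + delta / 2) * ln T))).
Proof.
have /andP[de0 deD] := delta0; have dd0 : 0 <= d%:R :> R by [].
have [n [k [k0 Hk]]] := field_upper sf iotaB covE nuleb numu nu0 de0 deD dd0.
have k1 : 0 < 1 + k by rewrite addr_gt0.
pose L : R := 2 ^+ n; have L0 : 0 < L by rewrite exprn_gt0.
have [c1 [C [c10 C0 Hb]]] := @blocks_exist R d L k L0 k0.
have [c c0 Hc] := Hk c1 C c10 C0.
exists c, ((1 + k) / k * 2); split => //.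
have h3 : \forall T \near +oo, 1 < T :> R by exact: nbhs_pinfty_gt.
near=> T.
have T1 : 1 < T by near: T.
have T0 : 0 < T by exact: lt_trans T1.
have lT : 0 < ln T by rewrite ln_gt0.
have [J [j [ij jB sB VT /andP[J1 J2]]]] : exists (J : finType) (j : J -> 'rV[int]_d),
  [/\ injective j, (forall i x, block L (j i) x -> eball T x),
      (forall x : borel 'rV[R]_d, \sum_i \1_(block L (j i)) x <= \1_(eball T) x :> R),
      fine (lebesgue (@eball R d T)) <= (1 + k) * (#|J|%:R * L ^+ d) &
      c1 * T ^+ d <= #|J|%:R <= C * T ^+ d] by near: T.
have TdE : T ^+ d = expR (d%:R * ln T) by rewrite mulrC expRM_natr lnK ?posrE.
rewrite TdE in J1 J2.
pose l := Num.sqrt (2 * m * (d%:R - alpha - delta) * ln T).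
have l0 : 0 < l by rewrite sqrtr_gt0 !mulr_gt0// subr_gt0.
pose Y := {ffun 'I_d -> 'I_(2 ^ n)}.
(* The point of residue [y] in the block of index [j i]. *)
pose x (y : Y) (i : J) : 'rV[int]_d := (\row_q (y q)%:Z) + j i *+ 2 ^ n.
have xB y i : ball T (x y i).
  apply: (jB i) => q; rewrite !mxE mulmxnE intrD rmorphMn /= -mulr_natl natrX -/L mulrDr mulr1 addrC.
  rewrite lerDl ltrD2l ler0n/= /L -natrX -pmulrn ltr_nat; exact: ltn_ord.
(* Euclidean division by [2 ^ n] recovers the block from the quotient and the residue from the
   remainder. *)
have xinj : injective (fun p : Y * J => x p.1 p.2).
  move=> [y i] [y' i'] /rowP /= e.
  have eq q : ((y q)%:Z + j i ord0 q * (2 ^ n)%:Z) = ((y' q)%:Z + j i' ord0 q * (2 ^ n)%:Z).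
    have := e q; rewrite !mxE !mulmxnE.
    by rewrite -[j i ord0 q *+ _]mulr_natr -[j i' ord0 q *+ _]mulr_natr natz.
  have p2 : (2 ^ n)%:Z != 0 by rewrite -lt0n expn_gt0.
  have ji : j i = j i'.
    apply/rowP => q; have /(congr1 (fun z => (z %/ (2 ^ n)%:Z)%Z)) := eq q.
    rewrite ![_%:Z + _]addrC !divzMDl//.
    by rewrite !divz_small ?addr0//= ltz_nat ltn_ord.
  have yy : y = y'.
    by apply/ffunP => q; have := eq q; rewrite ji => /addIr[]; exact: val_inj.
  by rewrite (ij _ _ ji) yy.
have Vgt : 0 < fine (lebesgue (@eball R d T)).
  by rewrite lebesgue_eball//= mulr_gt0 ?exprn_gt0 ?vol1_gt0.
have NJ : (0 < #|J|)%N.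
  by rewrite -(ltr0n R); apply: lt_le_trans J1; rewrite mulr_gt0// expR_gt0.
have NY : (0 < #|Y|)%N by rewrite card_ffun !card_ord !expn_gt0.
have YE : #|Y|%:R = L ^+ d by rewrite card_ffun !card_ord !natrX.
have sub : pos T `\` high T `<=`
    [set w | (forall y i, 0 <= f (x y i) w) /\ \sum_y \sum_i f (x y i) w <= (#|Y| * #|J|)%:R * ((1 + k) * l)].
  move=> w [pw]; rewrite /high /= => /negP; rewrite -ltNge ltr_pdivrMl// => hw; split.
    by move=> y i; apply: pw; exact: xB.
  have -> : (#|Y| * #|J|)%:R * ((1 + k) * l) = (1 + k) * (#|J|%:R * L ^+ d) * l by rewrite natrM YE; ring.
  apply: (@le_trans _ _ (fine (lebesgue (@eball R d T)) * l)); last by rewrite ler_pM2r.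
  apply: le_trans (ltW hw); rewrite fsbig_finite/=; last exact: finite_ball.
  rewrite pair_big /= -[leLHS](big_map (fun p : Y * J => x p.1 p.2) xpredT (fun z => f z w)).
  apply: ler_sum_uniq.
  - exact: fset_uniq.
  - by rewrite map_inj_uniq// index_enum_uniq.
  - move=> z /mapP[p _ ->]; rewrite in_fset_set; last exact: finite_ball.
    by apply/mem_set; exact: xB.
  - by move=> z; rewrite in_fset_set; [move/set_mem; exact: pw|exact: finite_ball].
have mP : measurable (pos T `\` high T) by apply: measurableD; [exact: measurable_pos|exact: measurable_high].
set S := [set w | _] in sub.
have mS : measurable S.
  apply: measurableI.
    apply: measurable_forall => y; apply: measurable_forall => i; exact: measurable_ge_set.
  rewrite (_ : (fun w => _) = [set w | - ((#|Y| * #|J|)%:R * ((1 + k) * l)) <= - \sum_y \sum_i f (x y i) w]).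
    apply: measurable_ge_set; apply: measurable_funN; apply: measurable_sum => y; exact: measurable_sum.
  by apply/seteqP; split => w /=; rewrite lerN2.
apply: (@le_trans _ _ (Pr P S)); first exact: Pr_le.
rewrite -mulrA; apply: shift_average => //; first by rewrite mulr_gt0.
move=> y.
have e1 : (1 + k) * ((1 + k) * l) = (1 + k) ^+ 2 * Num.sqrt (2 * fine (nu setT) * (d%:R - alpha - delta) * ln T).
  by rewrite mulrA -expr2.
rewrite e1; have -> : alpha + delta / 2 = d%:R - (d%:R - alpha) + delta / 2 by lra.
have Hcc : forall (J : finType) (x : J -> 'rV[int]_d) (j : J -> 'rV[int]_d) y,
    injective j -> (forall i, of_int R (x i) = y + (2 ^+ n) *: of_int R (j i)) ->
    c1 * expR (d%:R * ln T) <= #|J|%:R <= C * expR (d%:R * ln T) ->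
    Pr P [set w | (forall i, 0 <= f (x i) w) /\
      \sum_i f (x i) w <= #|J|%:R * ((1 + k) ^+ 2 * Num.sqrt (2 * fine (nu setT) * (d%:R - alpha - delta) * ln T))] <=
    2 * expR (- (c * expR ((d%:R - (d%:R - alpha) + delta / 2) * ln T))) by near: T.
apply: (Hcc J (x y) j (of_int R (\row_q (y q)%:Z))) => //; last by rewrite J1 J2.
move=> i; apply/rowP => q; rewrite /x !mxE mulmxnE intrD rmorphMn /=; congr (_ + _).
by rewrite -mulr_natl natrX.
Unshelve. all: end_near.
Qed.

Lemma lattice_repulsion : cond_prob P (high T) (pos T) @[T --> +oo] --> (1 : R).
Proof.
have /andP[de0 deD] := delta0.
have ab : alpha < alpha + delta / 4 by rewrite ltrDl divr_gt0.
have [c [C [c0 up]]] := lattice_upper.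
apply: (@cond_prob_cvg1 _ _ _ _ _ _ (alpha + delta / 4) (alpha + delta / 2) c C) => //.
- by rewrite addr_ge0// divr_ge0// ltW.
- by lra.
- exact: measurable_high.
- by move=> r _; exact: measurable_pos.
- exact: lattice_lower.
Qed.

End lattice.

(** * Fields on the Euclidean space *)

Section shift_integral.
Context {R : realType} dY (Y : measurableType dY) d (T : measurableType d).
Variables (m : {sigma_finite_measure set Y -> \bar R}) (P : probability T R) (J : finType).

(** The argument of [shift_average] with a set [D] of finite measure in place of a finite set of
    shifts. Tonelli's theorem computes the expected measure of the shifts of low average in both
    orders. *)
Lemma shift_average_int (D : set Y) (X : Y -> J -> T -> R) (E : set T) (l k B : R) :
  measurable D -> (0 < m D < +oo)%E ->
  (forall j, measurable_fun setT (fun z : Y * T => X z.1 j z.2)) -> measurable E ->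
  0 < l -> 0 < k -> (0 < #|J|)%N ->
  (forall w, E w -> (forall y j, D y -> 0 <= X y j w) /\
    (\int[m]_(y in D) (\sum_j X y j w)%:E <= (fine (m D) * (#|J|%:R * l))%:E)%E) ->
  (forall y, D y -> Pr P [set w | (forall j, 0 <= X y j w) /\ \sum_j X y j w <= #|J|%:R * ((1 + k) * l)] <= B) ->
  Pr P E <= (1 + k) / k * B.
Proof.
move=> mD /andP[D0 Doo] mX mE l0 k0 J0 HE HB.
have fD : m D \is a fin_num by rewrite ge0_fin_numE// ltW.
set mu := fine (m D); have mu0 : 0 < mu by rewrite fine_gt0// D0 Doo.
pose c := #|J|%:R * ((1 + k) * l).
have k1 : 0 < 1 + k by rewrite addr_gt0.
have c0 : 0 < c by rewrite !mulr_gt0 ?ltr0n.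
pose F : set (Y * T) := [set z | D z.1 /\ (forall j, 0 <= X z.1 j z.2) /\ \sum_j X z.1 j z.2 <= c].
have mF : measurable F.
  apply: measurableI.
    rewrite (_ : (fun z => _) = D `*` setT); last by apply/seteqP; split => -[y w] //= [].
    exact: measurableX.
  apply: measurableI; first by apply: measurable_forall => j; exact: measurable_ge_set.
  rewrite (_ : (fun z => _) = [set z : Y * T | - c <= - \sum_j X z.1 j z.2]).
    by apply: measurable_ge_set; apply: measurable_funN; exact: measurable_sum.
  by apply/seteqP; split => z /=; rewrite lerN2.
have mf : measurable_fun setT (EFin \o (\1_F : Y * T -> R)).
  by apply/measurable_EFinP; exact: measurable_indic.
have f0 z : (0 <= (EFin \o (\1_F : Y * T -> R)) z)%E by rewrite lee_fin.
have secY y : measurable [set w | F (y, w)].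
  by have := measurable_xsection y mF; rewrite (_ : xsection F y = [set w | F (y, w)])//;
    apply/seteqP; split => w; rewrite /xsection /= => h; [exact/set_mem|exact/mem_set].
have secT w : measurable [set y | F (y, w)].
  by have := measurable_ysection w mF; rewrite (_ : ysection F w = [set y | F (y, w)])//;
    apply/seteqP; split => y; rewrite /ysection /= => h; [exact/set_mem|exact/mem_set].
have EF y : (fubini_F P (EFin \o (\1_F : Y * T -> R)) y = P [set w | F (y, w)])%E.
  rewrite /fubini_F -[X in _ = P X](setIT) -(integral_indic _ measurableT (secY y)).
  by apply: eq_integral => w _ /=; rewrite !indicE; congr (_%:R)%:E; apply/idP/idP => /set_mem h; apply/mem_set.
have EG w : (fubini_G m (EFin \o (\1_F : Y * T -> R)) w = m [set y | F (y, w)])%E.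
  rewrite /fubini_G -[X in _ = m X](setIT) -(integral_indic _ measurableT (secT w)).
  by apply: eq_integral => y _ /=; rewrite !indicE; congr (_%:R)%:E; apply/idP/idP => /set_mem h; apply/mem_set.
have fub : (\int[m]_y fubini_F P (EFin \o (\1_F : Y * T -> R)) y =
    \int[P]_w fubini_G m (EFin \o (\1_F : Y * T -> R)) w)%E by exact: (@fubini_tonelli _ _ _ _ _ m P _ mf f0).
have up : (\int[m]_y fubini_F P (EFin \o (\1_F : Y * T -> R)) y <= (B * mu)%:E)%E.
  apply: (@le_trans _ _ (\int[m]_y ((\1_D y)%:E * B%:E))%E).
    apply: ge0_le_integral => //.
    - by move=> y _; apply: integral_ge0.
    - exact: measurable_fun_fubini_tonelli_F.
    - by apply: emeasurable_funM => //; apply/measurable_EFinP; exact: measurable_indic.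
    - move=> y _; rewrite EF indicE; have [/set_mem Dy|nDy] := boolP (y \in D); last first.
        rewrite mul0e (_ : [set w | _] = set0) ?measure0//.
        by rewrite -subset0 => w [] /=; move: nDy; rewrite notin_setE.
      rewrite mul1e -(PrK P (secY y)) lee_fin; apply: le_trans (HB y Dy).
      apply: Pr_le => //; last by move=> w [_].
      apply: measurableI; first by apply: measurable_forall => j; apply: measurable_ge_set;
        exact: (measurableT_comp (mX j) (measurable_pair1 y)).
      rewrite (_ : (fun w => _) = [set w : T | - c <= - \sum_j X y j w]).
        apply: measurable_ge_set; apply: measurable_funN; apply: measurable_sum => j.
        exact: (measurableT_comp (mX j) (measurable_pair1 y)).
      by apply/seteqP; split => w /=; rewrite lerN2.
  rewrite integralZr//; last first.
    apply/integrableP; split; first by apply/measurable_EFinP; exact: measurable_indic.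
    by under eq_integral => x _ do rewrite /= ger0_norm//; rewrite integral_indic// setIT.
  by rewrite integral_indic// setIT EFinM /mu fineK// muleC.
(* On [E] the shifts of low average have measure at least [k / (1 + k)] times that of [D]; otherwise
   the remaining ones alone would exceed the integral. *)
have lo : ((Pr P E * (mu * (k / (1 + k))))%:E <= \int[P]_w fubini_G m (EFin \o (\1_F : Y * T -> R)) w)%E.
  apply: (@le_trans _ _ (\int[P]_w ((\1_E w)%:E * (mu * (k / (1 + k)))%:E))%E).
    rewrite integralZr//; last first.
      apply/integrableP; split; first by apply/measurable_EFinP; exact: measurable_indic.
      by under eq_integral => x _ do rewrite /= ger0_norm//; rewrite integral_indic// setIT; apply: le_lt_trans (probability_le1 P mE) _; rewrite ltry.
    by rewrite integral_indic// setIT EFinM PrK.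
  apply: ge0_le_integral => //.
  - by move=> w _; rewrite lee_fin mulr_ge0// mulr_ge0 ?ltW// divr_gt0.
  - by apply: emeasurable_funM => //; apply/measurable_EFinP; exact: measurable_indic.
  - exact: measurable_fun_fubini_tonelli_G.
  move=> w _; rewrite EG indicE; have [/set_mem Ew|_] := boolP (w \in E); last first.
    by rewrite mul0e.
  rewrite mul1e; have [h1 h2] := HE w Ew.
  set Fw := [set y | F (y, w)] in EG *; have mFw : measurable Fw by exact: secT.
  have FD : Fw `<=` D by move=> y [].
  have fF : m Fw \is a fin_num.
    by rewrite ge0_fin_numE//; apply: le_lt_trans Doo; exact: (le_measure m (mem_set mFw) (mem_set mD)).
  have mDF : measurable (D `\` Fw) by exact: measurableD.
  have fDF : m (D `\` Fw) \is a fin_num.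
    by rewrite ge0_fin_numE//; apply: le_lt_trans Doo; apply: (le_measure m (mem_set mDF) (mem_set mD)); exact: subDsetl.
  have h3 : ((c * fine (m (D `\` Fw)))%:E <= (mu * (#|J|%:R * l))%:E)%E.
    apply: le_trans h2; rewrite EFinM fineK//.
    rewrite -[X in (_ * m X)%E]setIT -(integral_indic _ measurableT mDF).
    have -> : (c%:E * \int[m]_x (\1_(D `\` Fw) x)%:E = \int[m]_x (c%:E * (\1_(D `\` Fw) x)%:E))%E.
      apply/esym/ge0_integralZl => //; try by rewrite lee_fin ltW.
      by apply/measurable_EFinP; exact: measurable_indic.
    rewrite [leRHS]integral_mkcond; apply: ge0_le_integral => //.
    - by move=> y _; rewrite lee_fin mulr_ge0// ltW.
    - by apply: emeasurable_funM => //; apply/measurable_EFinP; exact: measurable_indic.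
    - apply/(measurable_restrictT _ mD); apply: measurable_funTS; apply/measurable_EFinP; apply: measurable_sum => j.
      exact: (measurableT_comp (mX j) (measurable_pair2 w)).
    - move=> y _; rewrite /patch indicE; have [/set_mem[Dy nF]|_] := boolP (y \in D `\` Fw); last first.
        by rewrite mule0; case: ifPn => // /set_mem Dy; rewrite lee_fin; apply: sumr_ge0 => j _; exact: h1.
      rewrite mem_set// mule1 lee_fin leNgt; apply/negP => h; apply: nF; split => //; split.
        by move=> j; exact: h1.
      exact: ltW.
  have e : mu = fine (m (D `\` Fw)) + fine (m Fw).
    rewrite -fineD// /mu; congr fine; rewrite addeC.
    by rewrite [LHS](measureDI m (A := D) (B := Fw))// addeC setIidr.
  rewrite -(fineK fF) lee_fin; move: h3 e; rewrite lee_fin /c.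
  set x := fine (m (D `\` _)); set y := fine (m Fw).
  have jl : 0 < #|J|%:R * l by rewrite mulr_gt0 ?ltr0n.
  rewrite (_ : #|J|%:R * ((1 + k) * l) * x = #|J|%:R * l * ((1 + k) * x)); last by ring.
  rewrite [mu * _]mulrC ler_pM2l// => h3 e.
  rewrite mulrA ler_pdivrMr//; move: h3; rewrite e; clear; lra.
have : ((Pr P E * (mu * (k / (1 + k))))%:E <= (B * mu)%:E)%E.
  by apply: (le_trans lo); rewrite -fub.
rewrite lee_fin mulrCA [leRHS]mulrC ler_pM2l// -ler_pdivlMr ?divr_gt0// => h.
by apply: (le_trans h); rewrite le_eqVlt; apply/orP; left; apply/eqP; field; rewrite !gt_eqF.
Qed.

End shift_integral.

(** * Measurability for fields with continuous paths *)

Section continuous_field.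
Context {R : realType} (d : nat) {disp : measure_display} {Omega : measurableType disp}.
Variables (f : 'rV[R]_d -> {mfun Omega >-> R}).
Hypothesis cf : forall w, continuous (fun x => f x w).
Local Notation E := (borel 'rV[R]_d).
Local Notation leb := (@lebesgue R d).

Lemma continuous_bounded_cube (g : 'rV[R]_d -> R) (r : R) : continuous g ->
  exists2 M : R, 0 < M & forall x : 'rV[R]_d, (forall i, `|x ord0 i| <= r) -> `|g x| <= M.
Proof.
move=> cg; have cK : compact [set v : 'rV[R]_d | forall i, `[- r, r]%classic (v ord0 i)].
  exact: (@rV_compact _ _ (fun=> `[- r, r]%classic) (fun=> @segment_compact R _ _)).
have /compact_bounded[M [_ HM]] := continuous_compact (continuous_subspaceT cg) cK.
exists (`|M| + 1); first by rewrite ltr_wpDl.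
move=> x hx; apply: HM; first by apply: (le_lt_trans (ler_norm M)); rewrite ltrDl.
by exists x => // i; rewrite /= in_itv /= -ler_norml; exact: hx.
Qed.

Definition node n (k : 'rV[int]_d) : 'rV[R]_d := \row_i ((2 ^+ n)^-1 * (k ord0 i)%:~R).

Lemma dfloor_node n k : dfloor n (node n k) = k.
Proof.
apply/rowP => i; rewrite !mxE mulrA mulfV ?mul1r ?intrKfloor// expf_neq0.
Qed.

Lemma same_cell_cvg (x : 'rV[R]_d) (u : nat -> 'rV[R]_d) : (forall n, dfloor n (u n) = dfloor n x) ->
  u n @[n --> \oo] --> x.
Proof.
move=> h; apply/cvg_ballP => e e0; exists (Num.truncn e^-1) => // n /= hn.
split => // i j; rewrite (ord1 i) -ball_normE /=.
have p0 : 0 < 2 ^+ n :> R by rewrite exprn_gt0.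
have en : e^-1 < 2 ^+ n.
  apply: (lt_le_trans (truncnS_gt _)); rewrite -natrX ler_nat.
  by apply: leq_ltn_trans hn (ltn_expl _ _).
apply: (@lt_trans _ _ (2 ^+ n)^-1); last by rewrite -[ltRHS]invrK ltf_pV2 ?posrE ?invr_gt0.
rewrite -(ltr_pM2l p0) mulfV ?gt_eqF// -[X in X * _]ger0_norm ?(ltW p0)// -normrM mulrBr.
have /rowP/(_ j) := h n; rewrite !mxE => e1.
have := floor_itv (2 ^+ n * u n ord0 j); have := floor_itv (2 ^+ n * x ord0 j).
rewrite e1 intrD; set f' := (Num.floor _)%:~R; move=> /andP[h1 h2] /andP[h3 h4].
by rewrite ltr_norml; apply/andP; split; move: h1 h2 h3 h4; clear; lra.
Qed.

Lemma node_cvg (x : 'rV[R]_d) : node n (dfloor n x) @[n --> \oo] --> x.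
Proof. by apply: same_cell_cvg => n; rewrite dfloor_node. Qed.

Lemma path_cvg w (u : nat -> 'rV[R]_d) x :
  u n @[n --> \oo] --> x -> f (u n) w @[n --> \oo] --> f x w.
Proof. by move=> ux; exact: (cvg_comp _ _ ux (@cf w x)). Qed.

(** The field is the limit of its values at the corners of the dyadic cells, and each approximation
    is measurable because the cells are countably many. *)
Lemma joint_measurable : measurable_fun setT (fun z : E * Omega => f z.1 z.2).
Proof.
apply: (@measurable_fun_cvg _ _ _ _ (fun n (z : E * Omega) => f (node n (dfloor n z.1)) z.2)); last first.
  move=> [x w] _ /=.
  exact: (@path_cvg w _ x (@node_cvg x)).
move=> n _ Y mY; rewrite setTI.
rewrite (_ : _ @^-1` _ = \bigcup_k (cell n k `*` (f (node n k) @^-1` Y))).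
  apply: countable_bigcupT_measurable; first exact: countableP.
  move=> k; apply: measurableX; first exact: measurable_cell.
  by rewrite -[X in measurable X]setTI; exact: measurable_funP.
apply/seteqP; split => [[x w] /= h|[x w] [k _ [/= <-]]]//.
by exists (dfloor n x).
Qed.

(** By continuity it suffices to test one point of [B] in each dyadic cell that meets [B]. As [B] is
    arbitrary these points must be chosen; the corners of the cells could miss [B]. *)
Lemma measurable_all_ge0 (B : set 'rV[R]_d) : measurable [set w | forall x, B x -> 0 <= f x w].
Proof.
have /choice[pt hpt] : forall p : nat * 'rV[int]_d, exists x, (exists y, B y /\ dfloor p.1 y = p.2) -> B x /\ dfloor p.1 x = p.2.
  move=> p; have [[y hy]|no] := pselect (exists y, B y /\ dfloor p.1 y = p.2); first by exists y.
  (* A default for the cells that miss [B]; the test [B (pt p)] in the events keeps it harmless. *)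
  by exists 0 => /no.
rewrite (_ : [set w | _] = [set w | forall p : nat * 'rV[int]_d,
    (if `[< B (pt p) >] then [set w | 0 <= f (pt p) w] else setT) w]).
  by apply: measurable_forall => p; case: ifP => _ //; exact: measurable_ge_set.
apply/seteqP; split => w /= h.
  by move=> p; case: ifPn => // /asboolP; exact: h.
move=> x Bx; have hx n : B (pt (n, dfloor n x)) /\ dfloor n (pt (n, dfloor n x)) = dfloor n x.
  by apply: hpt; exists x.
have cv : f (pt (n, dfloor n x)) w @[n --> \oo] --> f x w.
  by apply: path_cvg; apply: same_cell_cvg => n; exact: (hx n).2.
apply: (cvgr_to_ge cv); exists 0%N => // n _.
by have := h (n, dfloor n x); case: ifPn => [_ //|/asboolP]; have [] := hx n.
Qed.

Lemma measurable_ball_integral (B : set E) : measurable B ->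
  measurable_fun setT (fun w => \int[leb]_(x in B) f x w).
Proof.
move=> mB; pose g (z : E * Omega) : \bar R := (f z.1 z.2 * \1_B z.1)%:E.
have mg : measurable_fun setT g.
  apply/measurable_EFinP; apply: measurable_funM; first exact: joint_measurable.
  apply: (@measurableT_comp _ _ _ _ _ _ (\1_B : E -> R) _ (fun z : E * Omega => z.1)); [exact: measurable_indic|exact: measurable_fst].
have -> : (fun w => \int[leb]_(x in B) f x w) =
    fine \o (fun w => fubini_G leb (g^\+)%E w - fubini_G leb (g^\-)%E w)%E.
  apply/funext => w; rewrite /Rintegral /=; congr fine; rewrite integral_mkcond integralE /fubini_G.
  congr (_ - _)%E; apply: eq_integral => x _; rewrite ?funeposE ?funenegE /g /= patchE indicE;
    by case: (x \in B); rewrite ?mulr1 ?mulr0.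
apply: measurableT_comp; first exact: fine_measurable.
apply: emeasurable_funB.
- by apply: measurable_fun_fubini_tonelli_G => //; exact: measurable_funepos.
- by apply: measurable_fun_fubini_tonelli_G => //; exact: measurable_funeneg.
Qed.

End continuous_field.

Section continuous_upper.
Context {R : realType} (d : nat) {disp : measure_display} {Omega : measurableType disp}.
Variables (P : probability Omega R) (f : 'rV[R]_d -> {RV P >-> R}).
Variables (mu nu : {finite_measure set (borel 'rV[R]_d) -> \bar R}) (low : R -> \bar R) (alpha : R).
Hypothesis sf : stationary_gaussian_field f.
Hypothesis cf : forall w, continuous (fun x => f x w).
Hypothesis covE : forall x, covariance_kernel f x = \int[mu]_l cos (2 * pi * dotp l x).
Hypothesis alpha0 : 0 <= alpha.
Hypothesis low_alpha : (lne (low r) * ((ln r)^-1)%:E)%E @[r --> 0^'+] --> alpha%:E.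
Hypothesis lowE : forall r (J : finType) (x : J -> 'rV[R]_d), 0 < r ->
  (forall j, (\sum_i `|x j ord0 i|) * r <= 8^-1) ->
  (low r <= mu [set l | forall j, (2^-1 <= cos (2 * pi * dotp l (x j)))%R])%E.
Hypothesis nuleb : nu `<< @lebesgue R d.
Hypothesis numu : forall A, measurable A -> (nu A <= mu A)%E.
Hypothesis nu0 : 0 < fine (nu setT).
Variable delta : R.
Hypothesis delta0 : 0 < delta < d%:R - alpha.
Local Notation E := (borel 'rV[R]_d).
Local Notation leb := (@lebesgue R d).

Let m := fine (nu setT).
Let pos T : set Omega := [set w | forall x, eball T x -> 0 <= f x w].
Let high T : set Omega :=
  [set w | Num.sqrt (2 * m * (d%:R - alpha - delta) * ln T) <=
    (fine (leb (@eball R d T)))^-1 * \int[leb]_(x in eball T) f x w].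

Lemma measurable_pos_ball T : measurable (pos T).
Proof. exact: measurable_all_ge0. Qed.

Lemma measurable_high_ball T : 0 < T -> measurable (high T).
Proof.
move=> T0; apply: measurable_ge_set; apply: measurable_funM => //.
by apply: measurable_ball_integral => //; exact: measurable_eball (ltW T0).
Qed.

Lemma ge0_integral_translate (t : 'rV[R]_d) (g : E -> \bar R) : measurable_fun setT g ->
  (forall x, 0 <= g x)%E -> (\int[leb]_x g (affine 1 t x) = \int[leb]_x g x)%E.
Proof.
move=> mg g0; have mt := measurable_affine 1 t.
have <- : (\int[pushforward leb (affine 1 t)]_x g x)%E = (\int[leb]_x g x)%E.
  by apply: eq_measure_integral => A mA _; exact: lebesgue_translate.
by rewrite [RHS]ge0_integral_pushforward// ?preimage_setT.
Qed.

(** The translates of the grid are now indexed by the points of one block. The integral over this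
    block of the sum over a translate is the integral of the field over all blocks, which positivity
    bounds by that over the ball. *)
Lemma continuous_upper : exists c C : R, 0 < c /\
  \forall T \near +oo, Pr P (pos T `\` high T) <= C * expR (- (c * expR ((alpha + delta / 2) * ln T))).
Proof.
have /andP[de0 deD] := delta0; have dd0 : 0 <= d%:R :> R by [].
have iB (x y : 'rV[R]_d) : (id (x - y)) = id x - id y by [].
have [n [k [k0 Hk]]] := field_upper (iota := id) sf iB covE nuleb numu nu0 de0 deD dd0.
have k1 : 0 < 1 + k by rewrite addr_gt0.
pose L : R := 2 ^+ n; have L0 : 0 < L by rewrite exprn_gt0.
have [c1 [C [c10 C0 Hb]]] := @blocks_exist R d L k L0 k0.
have [c c0 Hc] := Hk c1 C c10 C0.
exists c, ((1 + k) / k * 2); split => //.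
have h3 : \forall T \near +oo, 1 < T :> R by exact: nbhs_pinfty_gt.
near=> T.
have T1 : 1 < T by near: T.
have T0 : 0 < T by exact: lt_trans T1.
have lT : 0 < ln T by rewrite ln_gt0.
have [J [j [ij jB sB VT /andP[J1 J2]]]] : exists (J : finType) (j : J -> 'rV[int]_d),
  [/\ injective j, (forall i x, block L (j i) x -> eball T x),
      (forall x : borel 'rV[R]_d, \sum_i \1_(block L (j i)) x <= \1_(eball T) x :> R),
      fine (leb (@eball R d T)) <= (1 + k) * (#|J|%:R * L ^+ d) &
      c1 * T ^+ d <= #|J|%:R <= C * T ^+ d] by near: T.
have TdE : T ^+ d = expR (d%:R * ln T) by rewrite mulrC expRM_natr lnK ?posrE.
rewrite TdE in J1 J2.
pose l := Num.sqrt (2 * m * (d%:R - alpha - delta) * ln T).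
have l0 : 0 < l by rewrite sqrtr_gt0 !mulr_gt0// subr_gt0.
pose D : set E := block L 0.
have mD : measurable D by exact: measurable_box.
have DE : leb D = (L ^+ d)%:E by exact: lebesgue_block.
have DL : (0 < leb D < +oo)%E by rewrite DE lte_fin exprn_gt0// ltry.
pose t (i : J) : 'rV[R]_d := L *: of_int R (j i).
pose X (y : E) (i : J) w := f (affine 1 (t i) y) w.
have tD y i : D y <-> block L (j i) (affine 1 (t i) y).
  have zE q : ((0 : 'rV[int]_d) ord0 q)%:~R = 0 :> R by rewrite mxE.
  have aE q : (affine 1 (t i) y : 'rV[R]_d) ord0 q = L * (j i ord0 q)%:~R + (y : 'rV[R]_d) ord0 q.
    by rewrite /affine /t !mxE mul1r addrC.
  split => h q; have := h q; rewrite aE zE mulr0 add0r mulr1 mulrDr mulr1 lerDl ltrD2l//.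
have mX i : measurable_fun setT (fun z : E * Omega => X z.1 i z.2).
  apply: (@measurableT_comp _ _ _ _ _ _ (fun z : E * Omega => f z.1 z.2) _
    (fun z : E * Omega => (affine 1 (t i) z.1, z.2))); first exact: joint_measurable.
  apply: measurable_fun_pair; last exact: measurable_snd.
  by apply: measurableT_comp; [exact: measurable_affine|exact: measurable_fst].
have NJ : (0 < #|J|)%N.
  by rewrite -(ltr0n R); apply: lt_le_trans J1; rewrite mulr_gt0// expR_gt0.
have mS : measurable (pos T `\` high T).
  by apply: measurableD; [exact: measurable_pos_ball|exact: measurable_high_ball].
have mB : measurable (eball T : set E) by exact: measurable_eball (ltW T0).
have BE := @lebesgue_eball R d T T0.
have Vgt : 0 < fine (leb (@eball R d T)) by rewrite BE/= mulr_gt0 ?exprn_gt0 ?vol1_gt0.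
have Hcc : forall (J : finType) (x : J -> 'rV[R]_d) (j : J -> 'rV[int]_d) y,
    injective j -> (forall i, id (x i) = y + (2 ^+ n) *: of_int R (j i)) ->
    c1 * expR (d%:R * ln T) <= #|J|%:R <= C * expR (d%:R * ln T) ->
    Pr P [set w | (forall i, 0 <= f (x i) w) /\
      \sum_i f (x i) w <= #|J|%:R * ((1 + k) ^+ 2 * Num.sqrt (2 * fine (nu setT) * (d%:R - alpha - delta) * ln T))] <=
    2 * expR (- (c * expR ((d%:R - (d%:R - alpha) + delta / 2) * ln T))) by near: T.
rewrite -mulrA.
apply: (@shift_average_int R _ E _ Omega leb P J D X _ ((1 + k) * l) k) => //; first by rewrite mulr_gt0.
  move=> w [pw]; rewrite /high /= => /negP; rewrite -ltNge ltr_pdivrMl// => hw; split.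
    by move=> y i Dy; apply: pw; apply: (jB i); exact/tD.
  pose h (x : E) : R := f x w * \1_(eball T) x.
  have mh : measurable_fun setT h.
    apply: measurable_funM; last exact: measurable_indic.
    exact: borel_continuous.
  have h0 x : 0 <= h x.
    rewrite /h indicE; have [/set_mem Bx|_] := boolP (x \in _); last by rewrite mulr0.
    by rewrite mulr1; exact: pw.
  pose hb i (x : E) : \bar R := (h x * \1_(block L (j i)) x)%:E.
  have mblock i : measurable (block L (j i)) by exact: measurable_box.
  have mhb i : measurable_fun setT (hb i).
    by apply/measurable_EFinP; apply: measurable_funM => //; exact: measurable_indic.
  have hb0 i x : (0 <= hb i x)%E by rewrite lee_fin mulr_ge0.
  have E1 : (\int[leb]_(y in D) (\sum_i X y i w)%:E = \int[leb]_y (\sum_i hb i (affine 1 (t i) y)))%E.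
    rewrite integral_mkcond; apply: eq_integral => y _; rewrite patchE.
    rewrite -sumEFin; case: ifPn => [/set_mem Dy|].
      apply: eq_bigr => i _; have bi := (tD y i).1 Dy; have ei := jB _ _ bi.
      by rewrite /hb /h !indicE (mem_set bi) (mem_set ei) !mulr1.
    rewrite notin_setE => nD; rewrite big1// => i _; rewrite /hb indicE memNset ?mulr0//.
    by move=> /(tD y i).2.
  have E2 : (\int[leb]_y (\sum_i hb i (affine 1 (t i) y)) = \sum_i \int[leb]_x hb i x)%E.
    rewrite ge0_integral_sum//; last first.
      by move=> i; apply: measurableT_comp; [exact: mhb|exact: measurable_affine].
    by apply: eq_bigr => i _; exact: ge0_integral_translate.
  have E3 : (\sum_i \int[leb]_x hb i x <= \int[leb]_x (h x)%:E)%E.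
    rewrite -ge0_integral_sum//; apply: ge0_le_integral => //.
    - by move=> x _; apply: sume_ge0.
    - exact: emeasurable_sum.
    - by apply/measurable_EFinP.
    - move=> x _; rewrite /hb sumEFin lee_fin -mulr_sumr -[leRHS]mulr1.
      apply: ler_wpM2l => //; apply: (le_trans (sB x)); rewrite indicE; by case: (_ \in _).
  (* A continuous path is bounded on the ball, so the integral is finite and [fine] does not alter
     it. *)
  have hfin : (\int[leb]_x (h x)%:E < +oo)%E.
    have [M M0 HM] := continuous_bounded_cube T (@cf w).
    apply: (@le_lt_trans _ _ (\int[leb]_x (M%:E * (\1_(eball T) x)%:E))%E).
      apply: ge0_le_integral => //.
      - by move=> x _; rewrite lee_fin.
      - by apply/measurable_EFinP.
      - by apply/measurable_EFinP; apply: measurable_funM => //; exact: measurable_indic.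
      - move=> x _; rewrite -EFinM lee_fin /h indicE.
        have [/set_mem Bx|_] := boolP (x \in _); last by rewrite !mulr0.
        rewrite !mulr1; apply: (le_trans (ler_norm _)); apply: HM => i.
        exact: eball_coord (ltW T0) Bx.
    have -> : (\int[leb]_x (M%:E * (\1_(eball T) x)%:E) = M%:E * \int[leb]_x (\1_(eball T) x)%:E)%E.
      apply: ge0_integralZl => //; try by rewrite lee_fin ltW.
      by apply/measurable_EFinP; exact: measurable_indic.
    by rewrite integral_indic// setIT -[X in (_ * X)%E]/(leb (eball T)) BE -EFinM ltry.
  have hE : \int[leb]_(x in eball T) f x w = fine (\int[leb]_x (h x)%:E)%E.
    rewrite /Rintegral integral_mkcond; congr fine; apply: eq_integral => x _.
    by rewrite patchE /h indicE; case: (x \in _); rewrite ?mulr1 ?mulr0.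
  rewrite hE in hw.
  apply: (@le_trans _ _ (\int[leb]_x (h x)%:E)%E); first by rewrite E1 E2; exact: E3.
  rewrite -[leLHS]fineK; last first.
    by rewrite ge0_fin_numE//; apply: integral_ge0 => x _; rewrite lee_fin.
  rewrite lee_fin; apply: (le_trans (ltW hw)).
  have -> : fine (leb D) * (#|J|%:R * ((1 + k) * l)) = (1 + k) * (#|J|%:R * L ^+ d) * l.
    by rewrite DE /=; ring.
  by rewrite ler_pM2r.
move=> y Dy.
have e1 : (1 + k) * ((1 + k) * l) = (1 + k) ^+ 2 * Num.sqrt (2 * fine (nu setT) * (d%:R - alpha - delta) * ln T).
  by rewrite mulrA -expr2.
rewrite e1; have -> : alpha + delta / 2 = d%:R - (d%:R - alpha) + delta / 2 by lra.
apply: (Hcc J (fun i => affine 1 (t i) y) j y) => //; last by rewrite J1 J2.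
by move=> i; rewrite /affine scale1r.
Unshelve. all: end_near.
Qed.

End continuous_upper.

Lemma pow2_bracket {R : realType} (y : R) : 1 <= y -> exists k : nat, 2 ^+ k <= y < 2 ^+ k.+1.
Proof.
move=> y1; have y0 : 0 <= y by exact: le_trans y1.
have n0 : (0 < Num.truncn y)%N by rewrite truncn_gt_nat.
have /andP[h1 h2] := trunc_log_bounds (isT : 1 < 2)%N n0.
exists (trunc_log 2 (Num.truncn y)); apply/andP; split.
  by apply: (@le_trans _ _ (Num.truncn y)%:R); rewrite ?truncn_le// -natrX ler_nat.
by apply: (lt_le_trans (truncnS_gt y)); rewrite -natrX ler_nat.
Qed.

(** * Positivity of a continuous field on a ball *)

Section continuous_lower.
Context {R : realType} (d : nat) {disp : measure_display} {Omega : measurableType disp}.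
Variables (P : probability Omega R) (f : 'rV[R]_d -> {RV P >-> R}).
Hypothesis sf : stationary_gaussian_field f.
Hypothesis cf : forall w, continuous (fun x => f x w).
Let pos T : set Omega := [set w | forall x, eball T x -> 0 <= f x w].

Definition unit_node p (b : {ffun 'I_d -> 'I_(2 ^ p)}) : 'rV[R]_d :=
  \row_q ((2 ^+ p)^-1 * (b q)%:R).

(** The integer part is kept apart so that the nodes over one unit cube are a translate of the
    [unit_node] family and have the same law by stationarity. *)
Definition cube_node N p (ab : {ffun 'I_d -> 'I_(N + N)} * {ffun 'I_d -> 'I_(2 ^ p)}) : 'rV[R]_d :=
  of_int R (shifted ab.1) + unit_node ab.2.

Lemma unit_node_itv p (b : {ffun 'I_d -> 'I_(2 ^ p)}) q : 0 <= unit_node b ord0 q < 1.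
Proof.
have p0 : 0 < 2 ^+ p :> R by rewrite exprn_gt0.
rewrite mxE mulr_ge0 ?invr_ge0 ?(ltW p0)//= ltr_pdivrMl// mulr1 -natrX ltr_nat.
exact: ltn_ord.
Qed.

(** Continuous paths are bounded on the closed unit cube, so one level holds for its dyadic points
    of all orders at once with probability close to 1. The value [4 / 5] is what [fernique] starts
    from. *)
Lemma unit_sup_bound : exists2 s0 : R, 0 < s0 & forall p,
  4 / 5 <= Pr P (within (fun (b : {ffun 'I_d -> 'I_(2 ^ p)}) w => f (unit_node b) w) s0).
Proof.
pose ok (pz : nat * 'rV[int]_d) := [forall q, (0 <= pz.2 ord0 q) && (pz.2 ord0 q < (2 ^ pz.1)%:Z)].
pose W n : set Omega := [set w | forall pz : nat * 'rV[int]_d,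
  (if ok pz then [set w | `|f (node pz.1 pz.2) w| < n.+1%:R] else setT) w].
have mW n : measurable (W n).
  apply: measurable_forall => pz; case: ifP => _ //.
  apply: (@measurable_lt_set _ _ _ _ (cst n.+1%:R)) => //.
  by apply: measurableT_comp.
have ndW : {homo W : n m / (n <= m)%N >-> (n <= m)%O}.
  move=> n m' nm; apply/subsetPset => w h pz; have := h pz; case: ifP => // _ /= h1.
  by apply: (lt_le_trans h1); rewrite ler_nat.
have UW : \bigcup_n W n = setT.
  apply/seteqP; split => // w _; have [M M0 HM] := continuous_bounded_cube 1 (@cf w).
  exists (Num.truncn M) => // -[p z]; case: ifPn => // /forallP hz /=.
  apply: le_lt_trans (truncnS_gt M); apply: HM => q; have /andP[h1 h2] := hz q.
  have p0 : 0 < 2 ^+ p :> R by rewrite exprn_gt0.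
  rewrite mxE normrM ger0_norm ?invr_ge0 ?(ltW p0)// ler_pdivrMl// mulr1 ger0_norm ?ler0z//.
  by rewrite -natrX pmulrn ler_int ltW.
have cv : fine (P (W n)) @[n --> \oo] --> (1 : R).
  rewrite -[1]/(fine 1%E) -(@probability_setT _ _ _ P); apply: fine_cvg.
  rewrite fineK ?probability_setT// -(@probability_setT _ _ _ P) -UW.
  by apply: nondecreasing_cvg_mu => //; rewrite UW.
have h45 : 4 / 5 < 1 :> R by lra.
have [n _ hn] := cvgr_gt _ cv _ h45.
exists n.+1%:R => // p; apply: (@le_trans _ _ (Pr P (W n))).
  apply: ltW; apply: hn => /=; exact: leqnn.
apply: Pr_le => //.
  by apply: measurable_within => b; exact: measurable_funP.
move=> w h b; have := h (p, \row_q (b q)%:Z); rewrite ifT.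
  move=> /=; rewrite -ltr_norml; suff -> : node p (\row_q (b q)%:Z) = unit_node b by [].
  by apply/rowP => q; rewrite !mxE pmulrn.
by apply/forallP => q /=; rewrite !mxE /= ltz_nat ltn_ord.
Qed.

(** Fernique's inequality is applied in each unit cube, and the union bound runs only over the
    cubes. Neither cost involves the order [p] of the nodes. *)
Lemma cube_tail : exists2 s0 : R, 0 < s0 & forall N p k,
  1 - #|{ffun 'I_d -> 'I_(N + N)}|%:R * 4^-1 ^+ (2 ^ k) <=
  Pr P (above (fun ab w => f (@cube_node N p ab) w) (- (2 ^+ k.+1 * s0))).
Proof.
have [s0 s00 Hs] := unit_sup_bound; exists s0 => // N p k.
set t := 2 ^+ k.+1 * s0.
pose X (ab : {ffun 'I_d -> 'I_(N + N)} * {ffun 'I_d -> 'I_(2 ^ p)}) w := f (cube_node ab) w.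
rewrite -[X in above X]/X.
have ma : measurable (above X (- t)).
  apply: measurable_forall => ab; exact: (@measurable_lt_set _ _ _ (cst (- t))).
rewrite lerBlDr -lerBlDl -PrC//.
pose Xa a b w := f (@cube_node N p (a, b)) w.
have gX a := sgf_gauss_vec sf (fun b => @cube_node N p (a, b)).
have mw a r : measurable (within (Xa a) r) by apply: measurable_within => b; exact: measurable_funP.
apply: (@le_trans _ _ (\sum_a Pr P (~` within (Xa a) t))).
  apply: Pr_union; [by move=> a; exact: measurableC|exact: measurableC|].
  move=> w /existsNP[[a b] hab]; exists a => h; apply: hab; rewrite /X.
  by have /andP[] := h b.
rewrite mulr_natl -[leRHS]sumr_const; apply: ler_sum => a _.
apply: (fernique k (gX a) s00).
apply: (le_trans (Hs p)).
have := gauss_vec_within_unique (fun=> s0) xpredT (gX a) (sgf_gauss_vec sf (@unit_node p)).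
have qE a' : quad (fun i j : {ffun 'I_d -> 'I_(2 ^ p)} => covariance_kernel f (cube_node (a, j) - cube_node (a, i))) a' =
   quad (fun i j => covariance_kernel f (unit_node j - unit_node i)) a'.
  apply: eq_bigr => i _; apply: eq_bigr => j _; congr (_ * covariance_kernel f _).
  by rewrite /cube_node /= opprD addrACA subrr add0r.
move=> /(_ qE) h; rewrite le_eqVlt; apply/orP; left; apply/eqP.
have e (X' : {ffun 'I_d -> 'I_(2 ^ p)} -> Omega -> R) : within X' s0 = [set w | forall j, xpredT j -> - s0 < X' j w < s0].
  by apply/seteqP; split => w /= hh j; [move=> _|]; exact: hh.
by rewrite !e; exact: esym h.
Qed.

Lemma above_cube_pos T : 0 < T -> \bigcap_p above (fun ab w => f (@cube_node (Num.truncn T).+1 p ab) w) 0 `<=` pos T.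
Proof.
move=> T0 w h x Bx; set N := (Num.truncn T).+1 in h.
apply: (cvgr_to_ge (@path_cvg R d _ _ f cf w _ x (@node_cvg R d x))).
exists 0%N => // p _; set z := dfloor p x.
have p0 : 0 < 2 ^+ p :> R by rewrite exprn_gt0.
have P0 : (0 < (2 ^ p)%:Z) by rewrite ltz_nat expn_gt0.
have Pn : (2 ^ p)%:Z != 0 by rewrite gt_eqF.
(* Euclidean division of the dyadic index by [2 ^ p]: the quotient selects the unit cube and the
   remainder the node inside it. *)
have [a aE] : exists a, (\row_q (z ord0 q %/ (2 ^ p)%:Z)%Z) = @shifted d N a.
  apply: shifted_surj => q; rewrite !mxE.
  have := eball_coord q (ltW T0) Bx; rewrite ler_norml => /andP[h1 h2].
  have tN : T < N%:R by exact: truncnS_gt.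
  apply/andP; split.
    rewrite lez_divRL// floor_ge_int intrM mulrNz -!pmulrn natrX mulrC ler_pM2l//.
    by apply: le_trans h1; rewrite lerN2 ltW.
  rewrite ltz_divLR// floor_lt_int intrM -!pmulrn natrX mulrC ltr_pM2r//.
  exact: le_lt_trans tN.
have hb q : (`|(z ord0 q %% (2 ^ p)%:Z)%Z|%N < 2 ^ p)%N.
  by rewrite -ltz_nat gez0_abs ?modz_ge0// ltz_pmod.
pose b : {ffun 'I_d -> 'I_(2 ^ p)} := [ffun q => Ordinal (hb q)].
have -> : node p z = @cube_node N p (a, b).
  rewrite /cube_node /= -aE; apply/rowP => q; rewrite !mxE ffunE /=.
  have := divz_eq (z ord0 q) (2 ^ p)%:Z; rewrite mxE => e.
  rewrite [in LHS]e intrD intrM mulrDr -!pmulrn natrX mulrCA mulVf ?mulr1 ?gt_eqF//.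
  by congr (_ + _ * _); rewrite natr_absz ger0_norm ?modz_ge0.
exact: ltW (h p I (a, b)).
Qed.

(** Doubling the numerators turns the nodes of order [p] into nodes of order [p.+1]. The events are
    thus nonincreasing in [p], as continuity from above requires. *)
Lemma above_cube_dec N p :
  above (fun ab w => f (@cube_node N p.+1 ab) w) 0 `<=` above (fun ab w => f (@cube_node N p ab) w) 0.
Proof.
move=> w h [a b].
have hb q : (2 * b q < 2 ^ p.+1)%N by rewrite expnS ltn_pmul2l.
have := h (a, [ffun q => Ordinal (hb q)]); rewrite (_ : cube_node _ = cube_node (a, b))//.
rewrite /cube_node /=; congr (_ + _); apply/rowP => q; rewrite !mxE ffunE /= natrM exprS invfM.
by rewrite mulrACA mulVf// mul1r.
Qed.

Variables (mu : {finite_measure set (borel 'rV[R]_d) -> \bar R}) (low : R -> \bar R) (alpha : R).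
Hypothesis covE : forall x, covariance_kernel f x = \int[mu]_l cos (2 * pi * dotp l x).
Hypothesis alpha0 : 0 <= alpha.
Hypothesis low_alpha : (lne (low r) * ((ln r)^-1)%:E)%E @[r --> 0^'+] --> alpha%:E.
Hypothesis lowE : forall r (J : finType) (x : J -> 'rV[R]_d), 0 < r ->
  (forall j, (\sum_i `|x j ord0 i|) * r <= 8^-1) ->
  (low r <= mu [set l | forall j, (2^-1 <= cos (2 * pi * dotp l (x j)))%R])%E.

(** The bound on dyadic nodes is uniform in their order [p], so it passes to the intersection of the
    events, which implies positivity on the ball. *)
Lemma continuous_lower b : alpha < b -> \forall T \near +oo, expR (- expR (b * ln T)) <= Pr P (pos T).
Proof.
move=> ab; have c0 : 0 < 2 :> R by [].
have iB (x y : 'rV[R]_d) : (id (x - y)) = id x - id y by [].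
have [eps eps0 H] := field_lower (iota := id) sf iB covE alpha0 low_alpha lowE ab c0.
have [s0 s00 Hs] := cube_tail.
have l4 : 0 < ln 4 :> R by rewrite ln_gt0// ltr1n.
pose D := 8 * s0 / ln 4.
have D0 : 0 < D by rewrite divr_gt0// mulr_gt0.
have dd0 : 0 <= D * d%:R by rewrite mulr_ge0// ltW.
have h1 := near_ln (exp_beats_lin eps0 dd0).
have h2 := near_ln (exp_beats (D * (d%:R * ln 4 + ln 4)) eps0).
have h4 := near_ln (exp_beats (2 * s0) eps0).
have h3 : \forall T \near +oo, 1 <= T :> R by exact: nbhs_pinfty_ge.
near=> T.
have T1 : 1 <= T by near: T.
have T0 : 0 < T by exact: lt_le_trans T1.
have H1 : D * d%:R * ln T <= expR (eps * ln T) by near: T.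
have H2 : D * (d%:R * ln 4 + ln 4) <= expR (eps * ln T) by near: T.
have H4 : 2 * s0 <= expR (eps * ln T) by near: T.
set N := (Num.truncn T).+1; have NT : N%:R <= 2 * T.
  have : (Num.truncn T)%:R <= T by rewrite truncn_le// ltW.
  by rewrite /N -natr1; lra.
have HH : forall (J : finType) (x : J -> 'rV[R]_d), (forall j i, `|x j ord0 i| <= 2 * T) ->
  3 / 4 <= Pr P (above (fun j w => f (x j) w) (- expR (eps * ln T))) ->
  expR (- expR (b * ln T)) <= Pr P (above (fun j w => f (x j) w) 0) by near: T.
have mA p r : measurable (above (fun ab w => f (@cube_node N p ab) w) r).
  by apply: measurable_forall => q; exact: (@measurable_lt_set _ _ _ (cst r)).
have lower p : expR (- expR (b * ln T)) <= Pr P (above (fun ab w => f (@cube_node N p ab) w) 0).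
  apply: HH => [[a b'] i|].
    have := unit_node_itv b' i; rewrite /cube_node !mxE /= => /andP[g1 g2].
    have := ltn_ord (a i) => ai; apply: le_trans NT; rewrite intrB -!pmulrn ler_norml.
    have ai' : ((a i : nat)%:R + 1 <= N%:R + N%:R :> R) by rewrite natr1 -natrD ler_nat.
    have a0 : 0 <= (a i : nat)%:R :> R by [].
    by move: g1 g2 ai' a0; set u := _^-1 * _; set A := (a i : nat)%:R; set n' := N%:R; clear;
      move=> *; apply/andP; split; lra.
  have s1 : 1 <= expR (eps * ln T) / (2 * s0) by rewrite ler_pdivlMr ?mulr_gt0// mul1r.
  (* The largest Fernique level below [T ^ eps]. Then [2 ^ k] is still of order [T ^ eps], so
     [4 ^ -(2 ^ k)] beats the number of unit cubes. *)
  have [k /andP[k1 k2]] := pow2_bracket s1.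
  have k1' : 2 ^+ k.+1 * s0 <= expR (eps * ln T).
    by move: k1; rewrite ler_pdivlMr ?mulr_gt0// exprS; lra.
  have k2' : expR (eps * ln T) <= 4 * s0 * 2 ^+ k.
    by move: k2; rewrite ltr_pdivrMr ?mulr_gt0// exprS => /ltW; lra.
  apply: (@le_trans _ _ (Pr P (above (fun ab w => f (@cube_node N p ab) w) (- (2 ^+ k.+1 * s0))))); last first.
    apply: Pr_le => // w h j; apply: le_lt_trans (h j); by rewrite lerN2.
  apply: le_trans (Hs N p k).
  suff : #|{ffun 'I_d -> 'I_(N + N)}|%:R * 4^-1 ^+ (2 ^ k) <= 4^-1 :> R by lra.
  have cJ : #|{ffun 'I_d -> 'I_(N + N)}|%:R <= expR (d%:R * (ln 4 + ln T)).
    rewrite card_ffun !card_ord natrX mulrC expRM_natr expRD !lnK ?posrE//.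
    by rewrite lerXn2r ?nnegrE ?mulr_ge0 ?(ltW T0)// natrD; lra.
  have E4 : expR (- ln 4) = 4^-1 :> R by rewrite expRN lnK ?posrE.
  apply: (@le_trans _ _ (expR (d%:R * (ln 4 + ln T)) * 4^-1 ^+ (2 ^ k))).
    by rewrite ler_wpM2r// exprn_ge0// invr_ge0.
  rewrite -E4 -expRM_natr -expRD ler_expR natrX.
  have h : D * (d%:R * (ln 4 + ln T) + ln 4) <= 2 * expR (eps * ln T) by move: H1 H2; lra.
  have h5 : D * (d%:R * (ln 4 + ln T) + ln 4) <= 8 * s0 * 2 ^+ k by move: h k2'; lra.
  have h6 : d%:R * (ln 4 + ln T) + ln 4 <= ln 4 * 2 ^+ k.
    rewrite -(ler_pM2l D0); apply: (le_trans h5); rewrite /D le_eqVlt; apply/orP; left; apply/eqP.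
    by field; rewrite gt_eqF.
  by move: h6; lra.
have mI : measurable (\bigcap_p above (fun ab w => f (@cube_node N p ab) w) 0).
  by apply: bigcapT_measurable.
apply: (@le_trans _ _ (Pr P (\bigcap_p above (fun ab w => f (@cube_node N p ab) w) 0))); last first.
  by apply: Pr_le => //; [exact: measurable_all_ge0|exact: above_cube_pos].
have cv : fine (P (above (fun ab w => f (@cube_node N p ab) w) 0)) @[p --> \oo] -->
    fine (P (\bigcap_p above (fun ab w => f (@cube_node N p ab) w) 0)).
  apply: fine_cvg; rewrite fineK ?fin_num_measure//.
  apply: (@nonincreasing_cvg_mu _ _ _ P (fun p => above (fun ab w => f (@cube_node N p ab) w) 0)) => //.
    by rewrite -ge0_fin_numE// fin_num_measure.
  apply/nonincreasing_seqP => p; apply/subsetPset; exact: above_cube_dec.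
apply: (cvgr_to_ge cv); exists 0%N => // p _; exact: lower.
Unshelve. all: end_near.
Qed.

End continuous_lower.

(** * From the torus to the fundamental domain *)

Section push.
Context d1 d2 (T1 : measurableType d1) (T2 : measurableType d2) {R : realType}.
Variables (phi : T1 -> T2).

(** The proof of measurability is an argument so that the structure of a finite measure can be
    attached to [push] itself. *)
Definition push (mu : {finite_measure set T1 -> \bar R}) (mphi : measurable_fun setT phi)
  (A : set T2) : \bar R := mu (phi @^-1` A).

Variables (mu : {finite_measure set T1 -> \bar R}) (mphi : measurable_fun setT phi).

Let push0 : push mu mphi set0 = 0%E.
Proof. by rewrite /push preimage_set0 measure0. Qed.

Let push_ge0 A : (0 <= push mu mphi A)%E.
Proof. exact: measure_ge0. Qed.

Let push_sigma_additive : semi_sigma_additive (push mu mphi).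
Proof.
move=> F mF tF mUF; rewrite /push preimage_bigcup.
apply: measure_semi_sigma_additive.
- by move=> n; rewrite -[X in measurable X]setTI; exact: mphi.
- apply/trivIsetP => /= i j _ _ ij; rewrite -preimage_setI.
  by move/trivIsetP : tF => /(_ _ _ _ _ ij) ->//; rewrite preimage_set0.
- by rewrite -preimage_bigcup -[X in measurable X]setTI; exact: mphi.
Qed.

HB.instance Definition _ := isMeasure.Build _ _ _ (push mu mphi)
  push0 push_ge0 push_sigma_additive.

Let push_finite : fin_num_fun (push mu mphi).
Proof.
move=> A mA; apply: fin_num_measure.
by rewrite -[X in measurable X]setTI; exact: mphi.
Qed.

HB.instance Definition _ := @Measure_isFinite.Build _ _ _ (push mu mphi) push_finite.

Lemma Rintegral_push (g : T2 -> R) (M : R) : measurable_fun setT g -> (forall x, `|g x| <= M) ->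
  \int[push mu mphi]_x g x = \int[mu]_x g (phi x).
Proof.
move=> mg gM; rewrite /Rintegral; congr fine.
have := @integral_pushforward _ _ _ _ _ _ mphi mu setT (EFin \o g); rewrite preimage_setT => <- //.
- exact/measurable_EFinP.
- apply: (@bounded_integrable _ _ _ _ (g \o phi) M) => [|x]; last exact: gM.
  exact: measurableT_comp.
Qed.

End push.

(** The angle is at most [pi / 4], where the square of the cosine is one half by the addition
    formula; the cosine decreases on [[0, pi]]. *)
Lemma cos_ge_half {R : realType} (t : R) : `|t| <= 8^-1 -> 2^-1 <= cos (2 * pi * t).
Proof.
move=> ht; have p0 : 0 < pi :> R by exact: pi_gt0.
have e : `|2 * pi * t| <= pi / 4.
  rewrite normrM [X in X * _]ger0_norm; last by rewrite mulr_ge0// ltW.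
  have : 2 * pi * `|t| <= 2 * pi * 8^-1 by rewrite ler_wpM2l// mulr_ge0// ltW.
  by move=> h; apply: (le_trans h); rewrite le_eqVlt; apply/orP; left; apply/eqP; field.
have c4 : 2^-1 <= cos (pi / 4) :> R.
  have c0 : 0 < cos (pi / 4) :> R by apply: cos_gt0_pihalf; apply/andP; split; lra.
  have := @cosD R (pi / 4) (pi / 4); rewrite (_ : pi / 4 + pi / 4 = pi / 2); last by lra.
  rewrite cos_pihalf -!expr2 => h.
  have h2 := cos2Dsin2 (pi / 4 : R).
  have h3 : cos (pi / 4) ^+ 2 = 2^-1 :> R by move: h h2; set u := _ ^+ 2; set v := _ ^+ 2; lra.
  by rewrite -ler_sqr ?nnegrE ?(ltW c0)// h3 expr2; lra.
apply: (le_trans c4); have -> : cos (2 * pi * t) = cos `|2 * pi * t|.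
  by case: (ler0P (2 * pi * t)) => // _; rewrite cosN.
have [->|ne] := eqVneq `|2 * pi * t| (pi / 4); first by [].
apply: ltW; rewrite ltr_cos ?in_itv/=; [by rewrite lt_neqAle ne e| |].
- by apply/andP; split; [exact: normr_ge0|apply: (le_trans e); lra].
- by apply/andP; split; lra.
Qed.

Lemma dotp_le {R : realType} d (l x : 'rV[R]_d) r : 0 <= r -> eball r l ->
  `|dotp l x| <= (\sum_i `|x ord0 i|) * r.
Proof.
move=> r0 hl; apply: (le_trans (ler_norm_sum _ _ _)); rewrite mulr_suml; apply: ler_sum => i _.
by rewrite normrM mulrC ler_wpM2l//; exact: eball_coord hl.
Qed.

Lemma decomposition_dominates {d} {S : measurableType d} {R : realType} (leb : set S -> \bar R)
    (mu mu_ac mu_d mu_sc : {finite_measure set S -> \bar R}) :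
  spectral_decomposition leb mu mu_ac mu_d mu_sc -> forall A, measurable A -> (mu_ac A <= mu A)%E.
Proof. by move=> [h _ _ _ _] A mA; rewrite h// -addeA leeDl// adde_ge0. Qed.

Section torus_transport.
Context {R : realType} (d : nat).
Local Notation E := (borel 'rV[R]_d).
Local Notation torus := (torus R d).

Definition frac (x : R) : R := x - (Num.floor x)%:~R.

Lemma frac_itv x : 0 <= frac x < 1.
Proof.
have /andP[h1 h2] := floor_itv x; rewrite intrD in h2.
by rewrite /frac; apply/andP; split; lra.
Qed.

Lemma fracDz (x y : R) : x - y \is a Num.int -> frac x = frac y.
Proof.
move=> /intrP[k hk]; have -> : x = y + k%:~R by rewrite -hk; lra.
rewrite /frac floorDrz ?intr_int// intrKfloor intrD; lra.
Qed.

(* Unlike [repr], this choice of a representative is measurable. *)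
Definition torus_rep (l : torus) : E := \row_i frac ((generic_quotient.repr l : 'rV[R]_d) ord0 i).

Lemma to_torusP (x : 'rV[R]_d) i : (x - generic_quotient.repr (to_torus x)) ord0 i \is a Num.int.
Proof.
have : (to_torus x == to_torus (generic_quotient.repr (to_torus x))) by rewrite /to_torus generic_quotient.reprK.
rewrite -Quotient.idealrBE => /forallP; exact.
Qed.

Lemma torus_rep_to (x : 'rV[R]_d) i : (torus_rep (to_torus x) : 'rV[R]_d) ord0 i = frac (x ord0 i).
Proof.
rewrite mxE; apply/esym/fracDz; have := to_torusP x i; by rewrite !mxE.
Qed.

Lemma torus_rep_repr (l : torus) i : (generic_quotient.repr l - (torus_rep l : 'rV[R]_d)) ord0 i \is a Num.int.
Proof. by rewrite !mxE /frac opprB addrCA subrr addr0 intr_int. Qed.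

Lemma cos_periodn (t : R) n : cos (2 * pi * (t + n%:R)) = cos (2 * pi * t).
Proof.
elim: n => [|n IH]; first by rewrite addr0.
rewrite -IH -[n.+1%:R]natr1 addrA mulrDr mulr1 (_ : 2 * pi = pi + pi); last by lra.
by rewrite addrA !cosDpi opprK.
Qed.

Lemma cos_int (t u : R) : t - u \is a Num.int -> cos (2 * pi * t) = cos (2 * pi * u).
Proof.
move=> /intrP[[n|n] hk].
  by rewrite (_ : t = u + n%:R) ?cos_periodn// pmulrn -hk; lra.
rewrite (_ : u = t + n.+1%:R) ?cos_periodn//; move: hk; rewrite NegzE mulrNz -pmulrn; lra.
Qed.

Lemma torus_rep_dotp (x y : 'rV[R]_d) (n : 'rV[int]_d) :
  (forall i, (x - y) ord0 i \is a Num.int) -> dotp x (of_int R n) - dotp y (of_int R n) \is a Num.int.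
Proof.
move=> h; rewrite /dotp -sumrB; apply: rpred_sum => i _.
by rewrite -mulrBl rpredM//; [have := h i; rewrite !mxE|rewrite mxE intr_int].
Qed.

(** [frac] jumps at the integers, so the value 0 has to be left out for the set to be open. *)
Lemma open_frac c : open [set t : R | 0 < frac t < c].
Proof.
rewrite (_ : [set t : R | _] = \bigcup_(n in [set: int]) `]n%:~R, n%:~R + Num.min c 1[%classic).
  by apply: bigcup_open => n _; exact: interval_open.
apply/seteqP; split => [t /= h|t [n _]].
  exists (Num.floor t) => //=; have := frac_itv t; move: h; rewrite /frac in_itv/=.
  move=> /andP[h1 h2] /andP[h3 h4]; apply/andP; split; first by lra.
  by rewrite -ltrBlDl lt_min h2.
rewrite /= in_itv/= -ltrBlDl lt_min => /andP[h1 /andP[h2 h3]].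
have -> : frac t = t - n%:~R.
  rewrite /frac (_ : Num.floor t = n)//; apply: floor_def; rewrite (ltW h1) intrD; lra.
by rewrite subr_gt0 h1.
Qed.

Lemma torus_open_rep i c : measurable [set l : borel torus | 0 < (torus_rep l : 'rV[R]_d) ord0 i < c].
Proof.
apply: sub_sigma_algebra; rewrite /open /=.
rewrite (_ : _ @^-1` _ = (fun x : 'rV[R]_d => x ord0 i) @^-1` [set t | 0 < frac t < c]); last first.
  by apply/seteqP; split => x /=; rewrite torus_rep_to.
have /continuousP : continuous (fun x : 'rV[R]_d => x ord0 i) by exact: coord_continuous.
by apply; exact: open_frac.
Qed.

(** For [0 < c], the condition that a coordinate be at least [c] is the difference of two of the
    open conditions of [torus_open_rep]; for [c <= 0] it always holds. *)
Lemma measurable_torus_rep : measurable_fun setT (torus_rep : borel torus -> E).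
Proof.
apply: measurable_rV => i; apply: (measurability _ (RGenCInfty.measurableE R)).
move=> _ [_ [c ->] <-]; rewrite setTI.
have fi (l : borel torus) : 0 <= (torus_rep l : 'rV[R]_d) ord0 i < 1 by rewrite mxE frac_itv.
have [c0|c0] := leP c 0.
  rewrite (_ : _ @^-1` _ = setT)//; apply/seteqP; split => // l _ /=.
  by rewrite in_itv/= andbT; have /andP[h _] := fi l; exact: le_trans h.
rewrite (_ : _ @^-1` _ = [set l : borel torus | 0 < (torus_rep l : 'rV[R]_d) ord0 i < 1] `\`
   [set l : borel torus | 0 < (torus_rep l : 'rV[R]_d) ord0 i < c]).
  by apply: measurableD; exact: torus_open_rep.
apply/seteqP; split => l /=; rewrite in_itv/= andbT; have /andP[h1 h2] := fi l.
  move=> h; split; first by rewrite h2 (lt_le_trans c0).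
  by move=> /andP[_]; rewrite ltNge h.
by move=> [/andP[h3 _]]; rewrite h3/= => /negP; rewrite -leNgt.
Qed.

Lemma measurable_to_torus : measurable_fun setT (@to_torus R d : E -> borel torus).
Proof.
apply: (measurability _ (erefl (@measurable _ (borel torus)))).
by move=> _ [U oU <-]; rewrite setTI; exact: borel_open.
Qed.

Lemma torus_rep_id (x : 'rV[R]_d) : (forall i, 0 <= x ord0 i < 1) -> torus_rep (to_torus x) = x.
Proof.
move=> h; apply/rowP => i; rewrite torus_rep_to /frac.
by rewrite (_ : Num.floor _ = 0) ?subr0//; apply: floor_def; rewrite add0r; exact: h.
Qed.

(** On [[0, 1) ^ d] the map [torus_rep] inverts [to_torus], so the preimage of a Lebesgue null set
    meets the fundamental domain in a null set. *)
Lemma push_torus_dominates (nu : {finite_measure set (borel torus) -> \bar R}) :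
  nu `<< @lebesgue_torus R d -> push nu measurable_torus_rep `<< @lebesgue R d.
Proof.
move=> h; apply/null_content_dominatesP => A mA A0.
have mrA : measurable (torus_rep @^-1` A : set (borel torus)).
  by rewrite -[X in measurable X]setTI; exact: measurable_torus_rep.
apply: (h (torus_rep @^-1` A)) => // B mB BA.
rewrite /lebesgue_torus.
pose Q : set E := [set x : 'rV[R]_d | forall i, 0 <= x ord0 i < 1].
have mQ : measurable Q by exact: (measurable_box (fun=> 0) (fun=> 1)).
have mp : measurable ((@to_torus R d : E -> borel torus) @^-1` B).
  by rewrite -[X in measurable X]setTI; exact: measurable_to_torus.
have mQB : measurable (Q `&` (@to_torus R d : E -> borel torus) @^-1` B) by exact: measurableI.
apply/eqP; rewrite -measure_le0 -A0.
apply: (le_measure (@lebesgue R d) (mem_set mQB) (mem_set mA)).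
by move=> x [Qx Bx]; have := BA _ Bx; rewrite /= torus_rep_id.
Qed.

(** A ball about the origin sticks out of the fundamental domain, whence the integer translates. As
    a countable union of preimages, the image under the quotient map is seen to be measurable. *)
Lemma torus_ballE (r : R) : torus_ball r =
  \bigcup_(z in [set: 'rV[int]_d]) (torus_rep @^-1` [set x | eball r (x + of_int R z)]).
Proof.
apply/seteqP; split => [_ [x bx <-]|l [z _ /= h]].
  exists (\row_i Num.floor (x ord0 i)) => //=.
  rewrite (_ : _ + _ = x)//; apply/rowP => i; rewrite mxE torus_rep_to !mxE /frac; lra.
exists (torus_rep l + of_int R z) => //.
rewrite -[RHS]generic_quotient.reprK; apply/eqP; rewrite -Quotient.idealrBE; apply/forallP => i.
have -> : (torus_rep l + of_int R z - generic_quotient.repr l) ord0 i =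
    (z ord0 i)%:~R - (generic_quotient.repr l - (torus_rep l : 'rV[R]_d)) ord0 i.
  by rewrite !mxE; lra.
by rewrite rpredB ?intr_int//; exact: torus_rep_repr.
Qed.

Lemma measurable_torus_ball (r : R) : 0 <= r -> measurable (torus_ball r : set (borel torus)).
Proof.
move=> r0; rewrite torus_ballE; apply: countable_bigcupT_measurable; first exact: countableP.
move=> z; rewrite -[X in measurable X]setTI; apply: measurable_torus_rep => //.
have := measurable_affine 1 (of_int R z) measurableT (measurable_eball r0); rewrite setTI.
by rewrite (_ : affine _ _ @^-1` _ = [set x | eball r (x + of_int R z)])//;
  apply/seteqP; split => x; rewrite /affine /= scale1r.
Qed.

End torus_transport.

(** * The two cases of the theorem *)

Section field_repulsion.
Context {R : realType} (d : nat) {disp : measure_display} {Omega : measurableType disp}.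
Variables (P : probability Omega R) (alpha delta : R).
Hypothesis alpha0 : 0 <= alpha.
Hypothesis delta0 : 0 < delta < d%:R - alpha.

Lemma euclidean_repulsion (f : 'rV[R]_d -> {RV P >-> R})
    (mu nu : {finite_measure set (borel 'rV[R]_d) -> \bar R}) :
  stationary_gaussian_field f -> (forall w, continuous (fun x => f x w)) ->
  spectral_measure f mu ->
  (lne (mu (eball r)) * ((ln r)^-1)%:E)%E @[r --> 0^'+] --> alpha%:E ->
  nu `<< @lebesgue R d -> (forall A, measurable A -> (nu A <= mu A)%E) -> nu setT <> 0%E ->
  cond_prob P
    [set w | Num.sqrt (2 * fine (nu setT) * (d%:R - alpha - delta) * ln T)
             <= (fine (lebesgue (@eball R d T)))^-1 *
                \int[@lebesgue R d]_(x in eball T) f x w]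
    [set w | forall x, eball T x -> 0 <= f x w]
    @[T --> +oo] --> (1 : R).
Proof.
move=> sf cf [_ hmu] low_alpha nuleb numu nuT.
have covE x : covariance_kernel f x = \int[mu]_l cos (2 * pi * dotp l x).
  by have [] := hmu x.
have nu0 : 0 < fine (nu setT).
  by rewrite fine_gt0// lt0e measure_ge0 andbT; apply/andP; split;
    [exact/eqP|rewrite -ge0_fin_numE// fin_num_measure].
have lowE r (J : finType) (x : J -> 'rV[R]_d) : 0 < r ->
    (forall j, (\sum_i `|x j ord0 i|) * r <= 8^-1) ->
    (mu (eball r) <= mu [set l | forall j, (2^-1 <= cos (2 * pi * dotp l (x j)))%R])%E.
  move=> r0 hx; apply: (le_measure mu (mem_set (measurable_eball (ltW r0)))).
    apply: mem_set; apply: measurable_forall => j; apply: measurable_ge_set.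
    apply: measurable_cos_comp; apply: measurable_funM => //; exact: measurable_dotp.
  move=> l hl j; apply: cos_ge_half; apply: (le_trans _ (hx j)).
  exact: dotp_le (ltW r0) hl.
have /andP[de0 deD] := delta0.
have ab : alpha < alpha + delta / 4 by rewrite ltrDl divr_gt0.
have [c [C [c0 up]]] := continuous_upper sf cf covE nuleb numu nu0 delta0.
apply: (@cond_prob_cvg1 _ _ _ _ _ _ (alpha + delta / 4) (alpha + delta / 2) c C) => //.
- by rewrite addr_ge0// divr_ge0// ltW.
- by lra.
- by move=> T T0; exact: measurable_high_ball.
- by move=> T _; exact: measurable_all_ge0.
- exact: (continuous_lower sf cf covE alpha0 low_alpha lowE ab).
Qed.

(** Two representatives of a point of the torus have pairings with an integer vector that differ by
    an integer. Carrying the spectral measure over to [[0, 1) ^ d] thus preserves the covariances,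
    and the cosines are bounded below on the whole torus ball although its representatives need not
    be small. *)
Lemma torus_repulsion (f : 'rV[int]_d -> {RV P >-> R})
    (mu nu : {finite_measure set (borel (torus R d)) -> \bar R}) :
  stationary_gaussian_field f -> torus_spectral_measure f mu ->
  (lne (mu (torus_ball r)) * ((ln r)^-1)%:E)%E @[r --> 0^'+] --> alpha%:E ->
  nu `<< @lebesgue_torus R d -> (forall A, measurable A -> (nu A <= mu A)%E) -> nu setT <> 0%E ->
  cond_prob P
    [set w | Num.sqrt (2 * fine (nu setT) * (d%:R - alpha - delta) * ln T)
             <= (fine (lebesgue (@eball R d T)))^-1 *
                \sum_(x \in lattice_ball T) f x w]
    [set w | forall x, lattice_ball T x -> 0 <= f x w]
    @[T --> +oo] --> (1 : R).
Proof.
move=> sf [_ hmu] low_alpha nuleb numu nuT.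
pose mrep := @measurable_torus_rep R d.
pose mu' : {finite_measure set (borel 'rV[R]_d) -> \bar R} := push mu mrep.
pose nu' : {finite_measure set (borel 'rV[R]_d) -> \bar R} := push nu mrep.
have mcos (y : 'rV[R]_d) : measurable_fun setT (fun l : borel 'rV[R]_d => cos (2 * pi * dotp l y)).
  by apply: measurable_cos_comp; apply: measurable_funM => //; exact: measurable_dotp.
have c1 (y l : 'rV[R]_d) : `|cos (2 * pi * dotp l y)| <= 1 by rewrite ler_norml cos_geN1 cos_le1.
have covE x : covariance_kernel f x = \int[mu']_l cos (2 * pi * dotp l (of_int R x)).
  have [-> _] := hmu x.
  rewrite (Rintegral_push _ _ (mcos (of_int R x)) (c1 _)); apply: eq_Rintegral => l _.
  by apply/cos_int/torus_rep_dotp => i; exact: torus_rep_repr.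
have nu0 : 0 < fine (nu' setT).
  rewrite /nu' /= /push preimage_setT.
  by rewrite fine_gt0// lt0e measure_ge0 andbT; apply/andP; split;
    [exact/eqP|rewrite -ge0_fin_numE// fin_num_measure].
have mpre (A : set (borel 'rV[R]_d)) : measurable A -> measurable (@torus_rep R d @^-1` A : set (borel (torus R d))).
  by move=> mA; rewrite -[X in measurable X]setTI; exact: (@measurable_torus_rep R d).
have lowE r (J : finType) (x : J -> 'rV[int]_d) : 0 < r ->
    (forall j, (\sum_i `|of_int R (x j) ord0 i|) * r <= 8^-1) ->
    (mu (torus_ball r) <= mu' [set l | forall j, (2^-1 <= cos (2 * pi * dotp l (of_int R (x j))))%R])%E.
  move=> r0 hx; set G := [set l | _].
  have mG : measurable (G : set (borel 'rV[R]_d)).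
    by apply: measurable_forall => j; exact: measurable_ge_set.
  have sub : (torus_ball r : set (borel (torus R d))) `<=` @torus_rep R d @^-1` G.
    move=> _ [y hy <-] j.
    rewrite (@cos_int _ _ (dotp y (of_int R (x j)))).
      apply: cos_ge_half; apply: (le_trans _ (hx j)); exact: dotp_le (ltW r0) hy.
    apply: torus_rep_dotp => i; rewrite mxE torus_rep_to mxE /frac.
    by rewrite addrAC subrr sub0r rpredN intr_int.
  exact: (le_measure mu (mem_set (measurable_torus_ball (ltW r0))) (mem_set (mpre _ mG)) sub).
have := lattice_repulsion sf covE alpha0 low_alpha lowE (push_torus_dominates nuleb) _ nu0 delta0.
by apply => A mA; apply: numu; exact: mpre.
Qed.

End field_repulsion.

Theorem corollary1p2 (R : realType) (d : nat) (alpha : R)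
    (alpha_ge0 : 0 <= alpha) (alpha_lt : alpha < d%:R)
    (disp : measure_display) (Omega : measurableType disp)
    (P : probability Omega R) :
  (* fields on R^d *)
  (forall (f : 'rV[R]_d -> {RV P >-> R})
      (mu mu_ac mu_d mu_sc : {finite_measure set (borel 'rV[R]_d) -> \bar R}),
    stationary_gaussian_field f ->
    (forall w, continuous (fun x => f x w)) ->
    spectral_measure f mu ->
    spectral_decomposition (@lebesgue R d) mu mu_ac mu_d mu_sc ->
    (lne (mu (eball delta)) * ((ln delta)^-1)%:E)%E @[delta --> 0^'+]
      --> alpha%:E ->
    mu_ac setT <> 0%E ->
    mu_sc setT = 0%E ->
    (forall eps : R, 0 < eps ->
      (field_capacity f (eball (T + T `^ (1 - eps))) /
       field_capacity f (eball T))%E @[T --> +oo] --> 1%E) ->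
    (exists2 c : R, 0 < c & forall delta : R, 0 < delta ->
      (mu (eball (2 * delta)) <= c%:E * mu (eball delta))%E) ->
    (exists2 c : R, 0 < c & forall delta : R, 0 < delta ->
      (ereal_sup (range (fun u : 'rV[R]_d => mu (translate u (eball delta))))
         <= c%:E * mu (eball delta))%E) ->
    forall delta : R, 0 < delta < d%:R - alpha ->
    cond_prob P
      [set w | Num.sqrt (2 * fine (mu_ac setT) * (d%:R - alpha - delta) * ln T)
               <= (fine (lebesgue (@eball R d T)))^-1 *
                  \int[@lebesgue R d]_(x in eball T) f x w]
      [set w | forall x, eball T x -> 0 <= f x w]
      @[T --> +oo] --> (1 : R))
  /\
  (* fields on Z^d *)
  (forall (f : 'rV[int]_d -> {RV P >-> R})
      (mu mu_ac mu_d mu_sc : {finite_measure set (borel (torus R d)) -> \bar R}),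
    stationary_gaussian_field f ->
    torus_spectral_measure f mu ->
    spectral_decomposition (@lebesgue_torus R d) mu mu_ac mu_d mu_sc ->
    (lne (mu (torus_ball delta)) * ((ln delta)^-1)%:E)%E @[delta --> 0^'+]
      --> alpha%:E ->
    mu_ac setT <> 0%E ->
    mu_sc setT = 0%E ->
    (forall eps : R, 0 < eps ->
      (lattice_field_capacity f (lattice_ball (T + T `^ (1 - eps))) /
       lattice_field_capacity f (lattice_ball T))%E @[T --> +oo] --> 1%E) ->
    (exists2 c : R, 0 < c & forall delta : R, 0 < delta ->
      (mu (torus_ball (2 * delta)) <= c%:E * mu (torus_ball delta))%E) ->
    (exists2 c : R, 0 < c & forall delta : R, 0 < delta ->
      (ereal_sup (range (fun u : torus R d => mu (translate u (torus_ball delta))))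
         <= c%:E * mu (torus_ball delta))%E) ->
    forall delta : R, 0 < delta < d%:R - alpha ->
    cond_prob P
      [set w | Num.sqrt (2 * fine (mu_ac setT) * (d%:R - alpha - delta) * ln T)
               <= (fine (lebesgue (@eball R d T)))^-1 *
                  \sum_(x \in lattice_ball T) f x w]
      [set w | forall x, lattice_ball T x -> 0 <= f x w]
      @[T --> +oo] --> (1 : R)).
Proof.
split=> [f mu mu_ac mu_d mu_sc sf cf smu dec low_alpha ac0 _ _ _ _ delta delta0|
  f mu mu_ac mu_d mu_sc sf smu dec low_alpha ac0 _ _ _ _ delta delta0].
  apply: (euclidean_repulsion alpha_ge0 delta0 sf cf smu low_alpha) => //; first by case: dec.
  exact: decomposition_dominates dec.
apply: (torus_repulsion alpha_ge0 delta0 sf smu low_alpha) => //; first by case: dec.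
exact: decomposition_dominates dec.
Qed.
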